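(* For any $\beta>0$ and $k\in\mathbb N$ with $k\ge\beta$, the measure $m^\beta_k$ on $\mathbb R^k$ is absolutely continuous. Its density is strictly positive and continuous on the simplex $\Sigma_k:=\{(x_1,\dots,x_k):0<x_1<\dots<x_k<1\}$ and vanishes on $\mathbb R^k\setminus\Sigma_k$. For $x\in\Sigma_k$ it is given by $$\rho^\beta_k(x_1,\dots,x_k)=\frac{\Gamma(\beta)}{\Gamma(\beta/k)^k}\int_{x_{k-1}}^{x_k}\!\!\cdots\int_{x_1}^{x_2}\prod_{i=1}^k\Big[\vartheta_{\beta/k}\Big(\frac{x_i-y_{i-1}}{y_i-y_{i-1}}\Big)(y_i-y_{i-1})^{\beta/k-2}\Big]dy_1\cdots dy_{k-1},$$ where $y_0:=0$, $y_k:=1$.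
   Context: $\mathcal G$ is the set of right continuous nondecreasing $g:[0,1]\to[0,1]$ with $g(1)=1$. $\mathbb Q^\beta$ is the Dirichlet–Ferguson process on $\mathcal G$: the unique probability measure such that for all $0=t_0<t_1<\dots<t_n=1$ (with $x_0=0,x_n=1$) $\mathbb Q^\beta(g_{t_1}\in dx_1,\dots,g_{t_{n-1}}\in dx_{n-1})=\frac{\Gamma(\beta)}{\prod_{i=1}^n\Gamma(\beta(t_i-t_{i-1}))}\prod_{i=1}^n(x_i-x_{i-1})^{\beta(t_i-t_{i-1})-1}dx_1\dots dx_{n-1}$. For $i=1,\dots,k$ let $\Phi^{(i)}_k(t)=1$ on $[0,\frac{i-1}k]$, $=i-kt$ on $[\frac{i-1}k,\frac ik]$, $=0$ on $[\frac ik,1]$, so that $\int_0^1\Phi^{(i)}_kdg=k\int_{(i-1)/k}^{i/k}g(t)\,dt$. $m^\beta_k$ is the distribution under $\mathbb Q^\beta$ of $\hat{\mathcal J}_k(g)=(\int_0^1\Phi^{(1)}_kdg,\dots,\int_0^1\Phi^{(k)}_kdg)$. For $\alpha\in(0,1]$, $\vartheta_\alpha(z)=\alpha e^\alpha\int_0^z(z-y)^{\alpha-1}y^{-\alpha y}(1-y)^{-\alpha(1-y)}[\cos(\pi\alpha y)-\frac1\pi\sin(\pi\alpha y)\log\frac y{1-y}]dy$ for $z\in[0,1]$. *)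

(* Defs.v *)
From HB Require Import structures.
From mathcomp Require Import all_boot all_order all_algebra.
From mathcomp Require Import all_classical all_reals all_analysis.
Set Implicit Arguments. Unset Strict Implicit. Unset Printing Implicit Defensive.
Import Order.TTheory GRing.Theory Num.Def Num.Theory.
Import numFieldNormedType.Exports.
Local Open Scope classical_set_scope.
Local Open Scope ring_scope.

Section DF.
Variable R : realType.

Notation leb := (@lebesgue_measure R).

(** Iterated Lebesgue integral on R^n = n.-tuple R.  The LAST coordinate is
    the outermost integration variable:
      iter_int n f = \int dx_n ... \int dx_1 f(x_1,...,x_n). *)
Fixpoint iter_int (n : nat) : (n.-tuple R -> \bar R) -> \bar R :=
  match n return (n.-tuple R -> \bar R) -> \bar R with
  | 0 => fun f => f [tuple]
  | n'.+1 => fun f =>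
      (\int[leb]_x iter_int (fun t : n'.-tuple R => f [tuple of rcons t x]))%E
  end.

Definition Gamma (s : R) : R :=
  Rintegral leb `]0, +oo[ (fun u => u `^ (s - 1) * expR (- u)).

Definition ext (s : seq R) (i : nat) : R :=
  if i == 0%N then 0 else if (size s < i)%N then 1 else nth 0 s i.-1.

Definition simplex (m : nat) (x : m.-tuple R) : bool :=
  [forall i : 'I_m.+1, ext x i < ext x i.+1].

(** The set 𝒢: right continuous nondecreasing g : [0,1] -> [0,1], g(1) = 1
    (functions are taken on R; only their restriction to [0,1] matters). *)
Definition inG (g : R -> R) : Prop :=
  [/\ (forall s t, 0 <= s -> s <= t -> t <= 1 -> g s <= g t),
      (forall t, 0 <= t <= 1 -> 0 <= g t <= 1),
      (forall t, 0 <= t < 1 -> g x @[x --> t^'+] --> g t)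
    & g 1 = 1].

(** Dirichlet density of (g_{t_1},...,g_{t_m}) for 0 = t_0 < ... < t_{m+1} = 1,
    supported on the open simplex. *)
Definition dirichlet_dens (beta : R) (m : nat) (t : nat -> R)
    (x : m.-tuple R) : R :=
  if simplex x then
    Gamma beta / (\prod_(i < m.+1) Gamma (beta * (t i.+1 - t i)))
    * \prod_(i < m.+1) (ext x i.+1 - ext x i) `^ (beta * (t i.+1 - t i) - 1)
  else 0.

(** Finite-dimensional distributions of the Dirichlet–Ferguson process:
    the process X (with paths in 𝒢) on the probability space (Omega, P) has
    law Q^beta. *)
Definition DF_process (beta : R) (d : measure_display) (Omega : measurableType d)
    (P : probability Omega R) (X : Omega -> R -> R) : Prop :=
  [/\ (forall w, inG (X w)),
      (forall t, measurable_fun setT (fun w => X w t))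
    & (forall (m : nat) (t : nat -> R),
        t 0%N = 0 -> t m.+1 = 1 -> (forall i, (i <= m)%N -> t i < t i.+1) ->
        forall A : set (m.-tuple R), measurable A ->
        P ((fun w => [tuple X w (t (val i).+1) | i < m]) @^-1` A) =
        iter_int (fun x => (\1_A x * dirichlet_dens beta t x)%:E))].

(** Ĵ_k(g) = (∫Φ^(1)_k dg, ..., ∫Φ^(k)_k dg)
           = (k ∫_{(i-1)/k}^{i/k} g(t) dt)_{i=1..k}. *)
Definition Jhat (k : nat) (g : R -> R) : k.-tuple R :=
  [tuple k%:R * Rintegral leb `[(val i)%:R / k%:R, (val i).+1%:R / k%:R] g
   | i < k].

Definition theta (alpha z : R) : R :=
  alpha * expR alpha *
  Rintegral leb `]0, z[ (fun y =>
    (z - y) `^ (alpha - 1) * y `^ (- (alpha * y))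
    * (1 - y) `^ (- (alpha * (1 - y)))
    * (cos (pi * alpha * y) - pi^-1 * sin (pi * alpha * y) * ln (y / (1 - y)))).

Definition rho_integrand (beta : R) (k : nat) (x : k.-tuple R)
    (y : k.-1.-tuple R) : R :=
  if [forall i : 'I_k.-1, (ext x i.+1 < ext y i.+1) && (ext y i.+1 < ext x i.+2)]
  then \prod_(i < k)
         (theta (beta / k%:R)
                ((ext x i.+1 - ext y i) / (ext y i.+1 - ext y i))
          * (ext y i.+1 - ext y i) `^ (beta / k%:R - 2))
  else 0.

Definition rho (beta : R) (k : nat) (x : k.-tuple R) : R :=
  if simplex x then
    Gamma beta / (Gamma (beta / k%:R)) ^+ k
    * fine (iter_int (fun y => (rho_integrand beta x y)%:E))
  else 0.

End DF.

(* Main.v *)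
(** Write [alpha = beta / k], so that [0 < alpha <= 1].  Multiplying a random
    vector by an independent Gamma([beta]) variable turns its generalized
    Stieltjes transform [c |-> E (s + <c, x>)^(- beta)] into a Laplace
    transform; hence the transform determines a law on the positive orthant, and
    it is enough to compute it for [Jhat k] and for the density [rho].

    Under the Dirichlet-Ferguson law increments are Dirichlet distributed, and
    the transform of a linear functional of a Dirichlet vector is a product of
    powers (Markov-Krein, again by the Gamma mixture).  Applied to the Riemann
    sums of the path, this gives in the limit
    [exp (- alpha * \sum_i L (A_i) (c_i))], where [A_i = s + \sum_(j > i) c_j]
    and [L A c] is the mean of [ln] over the interval from [A] to [A + c].

    On the other side, [theta alpha] is the density on the unit interval of the
    mean of a Dirichlet process with parameter [alpha] and uniform base measure,
    i.e. [\int (A + c z)^(- alpha) theta z dz = exp (- alpha L A c)].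
    The Abel kernel is removed by a Moebius substitution, the remaining phase of
    [theta] has the elementary primitive
    [sin (pi alpha x) x^(- alpha x) (1 - x)^(- alpha (1 - x)) / (pi alpha)],
    and the logistic substitution [x = 1 / (1 + e^u)] produces the imaginary
    part, on the line [Im = pi], of a function holomorphic in a strip and real
    on the real line.  Given [y], the points [x_i] are then independent, and the
    product formula for the Dirichlet vector of the gaps of [y] gives the
    transform of [rho].

    Positivity of [theta] is visible on ]0, 1/2] and extends by the symmetry
    [z |-> 1 - z], which follows from uniqueness of the transform.  Positivity
    and continuity of [rho] follow by dominated convergence after the
    substitution [y_i = x_i + s_i (x_(i+1) - x_i)]. *)

Require Import Defs.
From HB Require Import structures.
From mathcomp Require Import all_boot all_order all_algebra.
From mathcomp Require Import all_classical all_reals all_analysis.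
From mathcomp Require Import measurable_realfun.
From mathcomp Require Import ring lra.
Set Implicit Arguments. Unset Strict Implicit. Unset Printing Implicit Defensive.
Import Order.TTheory GRing.Theory Num.Def Num.Theory.
Import numFieldNormedType.Exports.
Local Open Scope classical_set_scope.
Local Open Scope ring_scope.

(** The exponent of the transform has to equal the total mass [beta]: a Dirichlet vector times an
    independent Gamma variable of that parameter has independent coordinates, so all integrals
    factor over the blocks. Everything then rests on one scalar identity for [theta alpha]. The
    obstacle is that the integrand defining [theta] changes sign and has a logarithmic singularity
    at 1, so that neither the sign of [theta] nor the use of Fubini is immediate. The condition
    [beta <= k], that is [alpha <= 1], keeps the phase [pi * alpha * y] in [[0, pi]], where the sine
    is nonnegative. Half of the exponent [alpha] is spent on the logarithm, and later half of
    [alpha - 2] on each neighbour of a gap; this is the origin of the many [alpha / 2]. The scalar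
    identity is proved for all [s > - 1], because [z |-> 1 - z] replaces [s] by [- s / (1 + s)], and
    the symmetry has to be known before [theta] may serve as a density. In the contour argument the
    denominator vanishes on the boundary of the strip; instead of indenting the contour, an
    elementary function with the same value at that point is subtracted. *)

Ltac mcomp F f := refine (@measurableT_comp _ _ _ _ _ _ F _ f _ _).

(** Recursion on the outermost operation of the function. A leaf that no rule closes is left open
    for the caller. *)
Ltac mfun := first [by [] | exact: measurable_cst | exact: measurable_id | assumption |
  exact: measurable_powR | exact: measurable_expR | exact: measurable_ln | exact: measurable_fst |
  exact: measurable_snd |
  lazymatch goal with
  | |- measurable_fun _ (fun x => @?f x - @?g x)%R =>
      refine (@measurable_funB _ _ _ _ f g _ _); mfun
  | |- measurable_fun _ (fun x => @?f x + @?g x)%R =>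
      refine (@measurable_funD _ _ _ _ f g _ _); mfun
  | |- measurable_fun _ (fun x => @?f x * @?g x)%R =>
      refine (@measurable_funM _ _ _ _ f g _ _); mfun
  | |- measurable_fun _ (fun x => @GRing.opp ?K (@?f x)) =>
      mcomp (@GRing.opp K) f; [exact: oppr_measurable|mfun]
  | |- measurable_fun _ (fun x => @expR ?K (@?f x)) =>
      mcomp (@expR K) f; [exact: measurable_expR|mfun]
  | |- measurable_fun _ (fun x => @ln ?K (@?f x)) =>
      mcomp (@ln K) f; [exact: measurable_ln|mfun]
  | |- measurable_fun _ (fun x => @cos ?K (@?f x)) =>
      mcomp (@cos K) f; [exact: (continuous_measurable_fun (@continuous_cos _))|mfun]
  | |- measurable_fun _ (fun x => @sin ?K (@?f x)) =>
      mcomp (@sin K) f; [exact: (continuous_measurable_fun (@continuous_sin _))|mfun]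
  | |- measurable_fun _ (fun x => @normr ?K ?V (@?f x)) =>
      mcomp (@normr K V) f; [exact: normr_measurable|mfun]
  | |- measurable_fun _ (fun x => @powR ?K (@?f x) ?c) =>
      mcomp ((@powR K)^~ c) f; [exact: measurable_powR|mfun]
  | |- measurable_fun _ (fun x => (@?f x) ^+ ?n)%R =>
      refine (@measurable_funX _ _ _ _ f n _); mfun
  | |- measurable_fun _ (fun x => @?f x && @?g x) =>
      refine (@measurable_and _ _ _ f g _ _); mfun
  | |- measurable_fun _ (fun x => @?f x < @?g x)%R =>
      refine (@measurable_fun_ltr _ _ _ _ f g _ _); mfun
  | |- measurable_fun _ (fun x => @?f x <= @?g x)%R =>
      refine (@measurable_fun_ler _ _ _ _ f g _ _); mfun
  | |- measurable_fun _ (fun x => (@?f x)%:E) =>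
      apply/measurable_EFinP; cbv beta; mfun
  | |- measurable_fun _ (fun x => if _ then _ else _) =>
      apply: measurable_fun_ifT; mfun
  | _ => first [exact: measurable_fun_ltr | exact: measurable_fun_ler | exact: measurable_funTS | idtac]
  end].

(** * Density measures and Lebesgue measure on tuples *)

Section density_measure.
Local Open Scope ereal_scope.
Context d (T : measurableType d) (R : realType).
Variables (mu : {measure set T -> \bar R}) (f : T -> R).
Hypothesis mf : measurable_fun setT f.
Hypothesis f0 : forall t, (0 <= f t)%R.

(* The hypotheses are arguments so that the measure structure is inferred. *)
Definition mdens of measurable_fun setT f & (forall t, (0 <= f t)%R) :=
  fun A : set T => \int[mu]_(x in A) (f x)%:E.

Local Notation md := (mdens mf f0).

Let md0 : md set0 = 0.
Proof. by rewrite /mdens integral_set0. Qed.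

Let md_ge0 A : 0 <= md A.
Proof. by apply: integral_ge0 => x _; rewrite lee_fin. Qed.

Let md_sigma : semi_sigma_additive md.
Proof.
move=> F mF tF mUF; rewrite /mdens ge0_integral_bigcup//=; last 2 first.
- by apply/measurable_EFinP; exact: measurable_funTS.
- by move=> x _; rewrite lee_fin.
apply: is_cvg_ereal_nneg_natsum => n _.
by apply: integral_ge0 => x _; rewrite lee_fin.
Qed.

HB.instance Definition _ := isMeasure.Build _ _ _ md md0 md_ge0 md_sigma.

Import HBNNSimple.

(** Both sides are monotone limits along simple approximations of [g]; on an indicator the claim is
    the definition of [mdens]. *)
Lemma integral_mdens (g : T -> R) : measurable_fun setT g ->
  (forall t, (0 <= g t)%R) ->
  \int[md]_x (g x)%:E = \int[mu]_x (g x * f x)%:E.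
Proof.
move=> mg g0.
have mgE : measurable_fun setT (EFin \o g) by exact/measurable_EFinP.
pose h := nnsfun_approx measurableT mgE.
have hg x : (h n x)%:E @[n --> \oo] --> (g x)%:E.
  by apply: cvg_nnsfun_approx => //= t _; rewrite lee_fin.
have ndh x : {homo (fun n => h n x) : m n / (m <= n)%N >-> (m <= n)%R}.
  by move=> m n mn; exact/(lefP _ _ (nd_nnsfun_approx measurableT mgE mn)).
transitivity (limn (fun n => \int[md]_x (h n x)%:E)).
  rewrite -monotone_convergence//=.
  - by apply: eq_integral => x _; apply/esym/cvg_lim => //; exact: hg.
  - by move=> n; exact/measurable_EFinP.
  - by move=> n x _; rewrite lee_fin.
  - by move=> x _ m n mn; rewrite lee_fin; exact: ndh.
transitivity (limn (fun n => \int[mu]_x (h n x * f x)%:E)); last first.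
  rewrite -monotone_convergence//=.
  - apply: eq_integral => x _; apply/cvg_lim => //.
    under eq_fun do rewrite EFinM.
    rewrite EFinM; apply: cvgeM; [by []|exact: hg|exact: cvg_cst].
  - by move=> n; apply/measurable_EFinP/measurable_funM.
  - by move=> n x _; rewrite lee_fin mulr_ge0.
  - by move=> x _ m n mn; rewrite lee_fin ler_wpM2r// ndh.
congr (limn _); apply/funext => n.
transitivity (\sum_(k \in range (h n)) k%:E * md (h n @^-1` [set k])).
  by rewrite integralT_nnsfun sintegralE.
have EFinf x : (h n x * f x)%:E =
  \sum_(k \in range (h n)) k%:E * (\1_(h n @^-1` [set k]) x * f x)%:E.
  rewrite [in LHS](fimfunE (h n)) EFinM -fsumEFin//=.
  rewrite ge0_mule_fsuml.
    by apply: eq_fsbigr => r _; rewrite !EFinM muleA.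
  by move=> r; exact: nnfun_muleindic_ge0.
under [RHS]eq_integral do rewrite EFinf.
rewrite ge0_integral_fsum//; last 2 first.
- move=> r; under eq_fun do rewrite -EFinM; apply/measurable_EFinP/measurable_funM => //.
  by apply: measurable_funM => //; exact: measurable_indic.
- move=> r x _; rewrite EFinM muleA; apply: mule_ge0; last by rewrite lee_fin.
  exact: nnfun_muleindic_ge0.
apply: eq_fsbigr => r /[!inE] -[t _ <-{r}].
rewrite ge0_integralZl//; last 3 first.
- apply/measurable_EFinP/measurable_funM => //; exact: measurable_indic.
- by move=> x _; rewrite lee_fin mulr_ge0.
- by rewrite lee_fin.
congr (_ * _); rewrite /mdens integral_mkcond; apply: eq_integral => x _.
rewrite patchE indicE; case: ifPn => _; first by rewrite mul1r.
by rewrite mul0r.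
Qed.

End density_measure.

Section tuple_measurability.
Context d (T : measurableType d).

Lemma measurable_rcons n :
  measurable_fun setT (fun p : n.-tuple T * T => [tuple of rcons p.1 p.2]).
Proof.
apply/measurable_fun_tnthP => i; rewrite /comp/=.
have [ni|ni] := ltnP i n.
  rewrite (_ : (fun _ => _) = (fun p : n.-tuple T * T => tnth p.1 (Ordinal ni))).
    apply: (@measurableT_comp _ _ _ _ _ _ (fun t : n.-tuple T => tnth t (Ordinal ni))) => //.
    exact: measurable_tnth.
  apply/funext => -[t x]/=; rewrite !(tnth_nth x)/=.
  by rewrite nth_rcons size_tuple ni.
rewrite (_ : (fun _ => _) = snd); first exact: measurable_snd.
apply/funext => -[t x]/=; rewrite (tnth_nth x)/=.
have -> : i = n :> nat by apply/eqP; rewrite eqn_leq ni -ltnS ltn_ord.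
by rewrite nth_rcons size_tuple ltnn eqxx.
Qed.

Lemma measurable_rcons_comp n d' (S : measurableType d')
    (f : S -> n.-tuple T) (g : S -> T) : measurable_fun setT f ->
  measurable_fun setT g ->
  measurable_fun setT (fun s => [tuple of rcons (f s) (g s)]).
Proof.
move=> mf mg; apply: (@measurableT_comp _ _ _ _ _ _
  (fun p : n.-tuple T * T => [tuple of rcons p.1 p.2]) _ (fun s => (f s, g s))).
  exact: measurable_rcons.
exact/measurable_fun_pair.
Qed.

End tuple_measurability.

Section lebn.
Context (R : realType).
Notation leb := (@lebesgue_measure R).
Notation mR := (measurableTypeR R).
Local Open Scope ereal_scope.

Section step.
Variable n : nat.
Variable mu : {sigma_finite_measure set (n.-tuple R) -> \bar R}.

Definition rcons_pair (p : n.-tuple R * mR) : n.+1.-tuple R :=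
  [tuple of rcons p.1 p.2].

Definition unrcons_pair (t : n.+1.-tuple R) : n.-tuple R * mR :=
  ([tuple tnth t (widen_ord (leqnSn n) i) | i < n], tnth t ord_max).

Lemma rcons_pairK : cancel rcons_pair unrcons_pair.
Proof.
move=> [t x]; rewrite /unrcons_pair /rcons_pair/=; congr (_, _).
  apply: eq_from_tnth => i; rewrite tnth_mktuple !(tnth_nth x)/=.
  by rewrite nth_rcons size_tuple ltn_ord.
by rewrite (tnth_nth x)/= nth_rcons size_tuple ltnn eqxx.
Qed.

Lemma measurable_rcons_pair : measurable_fun setT rcons_pair.
Proof. exact: measurable_rcons. Qed.

Lemma measurable_unrcons_pair : measurable_fun setT unrcons_pair.
Proof.
apply/measurable_fun_pair; last exact: measurable_tnth.
apply/measurable_fun_tnthP => i; rewrite (_ : _ \o _ =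
  (fun t : n.+1.-tuple R => tnth t (widen_ord (leqnSn n) i))); last first.
  by apply/funext => t /=; rewrite tnth_mktuple.
exact: measurable_tnth.
Qed.

(** The image of the product measure under [rcons]: the new coordinate is the last one, as in
    [iter_int], where the last variable is integrated outermost. *)
Definition lebS (A : set (n.+1.-tuple R)) : \bar R :=
  (mu \x leb) (rcons_pair @^-1` A).

Let lebS0 : lebS set0 = 0.
Proof. by rewrite /lebS preimage_set0 measure0. Qed.

Let lebS_ge0 A : 0 <= lebS A.
Proof. exact: measure_ge0. Qed.

Let lebS_sigma : semi_sigma_additive lebS.
Proof.
move=> F mF tF mUF; rewrite /lebS preimage_bigcup.
have mp A : measurable A -> measurable (rcons_pair @^-1` A).
  by move=> mA; rewrite -[X in measurable X]setTI; exact: measurable_rcons_pair.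
apply: measure_semi_sigma_additive.
- by move=> k; exact: mp.
- apply/trivIsetP => /= i j _ _ ij; rewrite -preimage_setI.
  by move/trivIsetP : tF => /(_ _ _ _ _ ij) ->//; rewrite preimage_set0.
- by rewrite -preimage_bigcup; exact: mp.
Qed.

HB.instance Definition _ := isMeasure.Build _ _ _ lebS lebS0 lebS_ge0 lebS_sigma.

Let lebS_sigma_finite : sigma_finite setT lebS.
Proof.
have /sigma_finiteP[F [TF ndF Foo]] := sigma_finiteT mu.
have /sigma_finiteP[G [TG ndG Goo]] := sigma_finiteT leb.
exists (fun k => unrcons_pair @^-1` (F k `*` G k)).
  rewrite -preimage_bigcup -(preimage_setT unrcons_pair); congr (_ @^-1` _).
  apply/esym/seteqP; split=> // -[x y] _.
  have [k _ Fx] : (\bigcup_i F i) x by rewrite -TF.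
  have [l _ Gy] : (\bigcup_i G i) y by rewrite -TG.
  exists (maxn k l) => //; split => /=.
  - by move: x Fx; exact/subsetPset/ndF/leq_maxl.
  - by move: y Gy; exact/subsetPset/ndG/leq_maxr.
move=> k; have [mF Fk] := Foo k; have [mG Gk] := Goo k; split.
  rewrite -[X in measurable X]setTI; apply: measurable_unrcons_pair => //.
  exact: measurableX.
rewrite /lebS -comp_preimage (_ : _ \o _ = id); last first.
  by apply/funext => p /=; rewrite rcons_pairK.
by rewrite preimage_id product_measure1E// lte_mul_pinfty// ge0_fin_numE.
Qed.

HB.instance Definition _ := Measure_isSigmaFinite.Build _ _ _ lebS lebS_sigma_finite.

Definition lebS_measure : {sigma_finite_measure set (n.+1.-tuple R) -> \bar R} :=
  lebS.

Lemma integral_lebS (f : n.+1.-tuple R -> \bar R) : measurable_fun setT f ->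
  (forall t, 0 <= f t) ->
  \int[lebS]_t f t = \int[mu \x leb]_p f (rcons_pair p).
Proof.
move=> mf f0.
have H : {in [set: n.+1.-tuple R], forall y, 0 <= f y} by move=> y _.
have := ge0_integral_pushforward measurable_rcons_pair (mu \x leb) measurableT mf H.
rewrite preimage_setT /=.
by move=> <-.
Qed.

End step.

(** A sigma-finite measure behind [iter_int], so that Tonelli and the convergence theorems apply to
    it. In dimension 0 it is the unit mass on the empty tuple. *)
Fixpoint lebn n : {sigma_finite_measure set (n.-tuple R) -> \bar R} :=
  match n with
  | 0 => @dirac _ (0.-tuple R) [tuple] R
  | n'.+1 => lebS_measure (lebn n')
  end.

Lemma integral_lebnS_in n (f : n.+1.-tuple R -> \bar R) : measurable_fun setT f ->
  (forall t, 0 <= f t) ->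
  \int[lebn n.+1]_t f t = \int[leb]_x \int[lebn n]_t f [tuple of rcons t x].
Proof.
move=> mf f0 /=; rewrite integral_lebS// fubini_tonelli2//.
by apply: measurableT_comp => //; exact: measurable_rcons_pair.
Qed.

Lemma integral_lebnS n (f : n.+1.-tuple R -> \bar R) : measurable_fun setT f ->
  (forall t, 0 <= f t) ->
  \int[lebn n.+1]_t f t = \int[lebn n]_t \int[leb]_x f [tuple of rcons t x].
Proof.
move=> mf f0 /=; rewrite integral_lebS// fubini_tonelli1//.
by apply: measurableT_comp => //; exact: measurable_rcons_pair.
Qed.

Lemma iter_intE n (f : n.-tuple R -> \bar R) : measurable_fun setT f ->
  (forall t, 0 <= f t) -> iter_int f = \int[lebn n]_t f t.
Proof.
elim: n f => [|n IH] f mf f0.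
  by rewrite integral_dirac// diracT mul1e.
rewrite integral_lebnS_in//=; apply: eq_integral => x _; apply: IH => //.
by apply: measurableT_comp => //; exact: measurable_rcons_comp.
Qed.

Lemma lebn_prod n (f : 'I_n -> R -> R) :
  (forall i, measurable_fun setT (f i)) -> (forall i x, (0 <= f i x)%R) ->
  \int[lebn n]_t (\prod_(i < n) f i (tnth t i))%:E =
  \prod_(i < n) \int[leb]_x (f i x)%:E.
Proof.
elim: n f => [|n IH] f mf f0.
  under eq_integral do rewrite big_ord0.
  by rewrite big_ord0 integral_dirac// diracT mul1e.
have mprod m (g : 'I_m -> R -> R) : (forall i, measurable_fun setT (g i)) ->
    measurable_fun setT (fun t : m.-tuple R => (\prod_(i < m) g i (tnth t i))%R).
  move=> mg; apply: measurable_prod => i _; apply: measurableT_comp => //.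
  exact: measurable_tnth.
rewrite integral_lebnS; last 2 first.
- by apply/measurable_EFinP; exact: mprod.
- by move=> t; rewrite lee_fin; apply: prodr_ge0.
have tE (t : n.-tuple R) x (i : 'I_n) :
    tnth [tuple of rcons t x] (widen_ord (leqnSn n) i) = tnth t i.
  by rewrite !(tnth_nth x)/= nth_rcons size_tuple ltn_ord.
have tM (t : n.-tuple R) x : tnth [tuple of rcons t x] ord_max = x.
  by rewrite (tnth_nth x)/= nth_rcons size_tuple ltnn eqxx.
transitivity (\int[lebn n]_t ((\int[leb]_x (f ord_max x)%:E) *
    (\prod_(i < n) f (widen_ord (leqnSn n) i) (tnth t i))%:E)).
  apply: eq_integral => t _.
  rewrite muleC -ge0_integralZl//; last 3 first.
  - by apply/measurable_EFinP; exact: mf.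
  - by move=> x _; rewrite lee_fin.
  - by rewrite lee_fin; apply: prodr_ge0.
  apply: eq_integral => x _; rewrite big_ord_recr/= tM -EFinM.
  by under eq_bigr do rewrite tE.
rewrite ge0_integralZl//; last 3 first.
- by apply/measurable_EFinP; apply: (mprod _ (fun i => f (widen_ord (leqnSn n) i))).
- by move=> t _; rewrite lee_fin; apply: prodr_ge0.
- by apply: integral_ge0 => x _; rewrite lee_fin.
by rewrite (IH (fun i => f (widen_ord (leqnSn n) i)))// big_ord_recr/= muleC.
Qed.

Lemma lebesgue_integral_affine (a b : R) (f : R -> \bar R) : (0 < a)%R ->
  measurable_fun setT f -> (forall x, 0 <= f x) ->
  \int[leb]_x f x = a%:E * \int[leb]_x f (b + a * x)%R.
Proof.
move=> a0 mf f0; pose phi : mR -> mR := fun x => (b + a * x)%R.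
have mphi : measurable_fun setT phi.
  by apply: measurable_funD => //; exact: measurable_funM.
pose m := mscale (NngNum (ltW a0))
  (measure_function_pushforward__canonical__measure_function_Measure leb mphi).
transitivity (\int[m]_x f x).
  (* The rescaled image measure agrees with Lebesgue measure on the intervals []c, e]], which
     determine it. *)
  apply: eq_measure_integral => A mA _; apply: lebesgue_measure_unique => //.
  move=> _ [[c e] _ <-].
  transitivity (a%:E * leb (phi @^-1` `]c, e]%classic)); last by [].
  rewrite (_ : phi @^-1` _ = `](a^-1 * (c - b))%R, (a^-1 * (e - b))%R]%classic).
    rewrite !lebesgue_measure_itv/= !lte_fin ltr_pM2l ?invr_gt0// ltrD2r.
    case: ifPn => _; last by rewrite mule0.
    by rewrite -!EFinD -EFinM; congr (_%:E); field; rewrite gt_eqF.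
  apply/seteqP; split => x; rewrite /phi/= !in_itv/= => /andP[cx xe].
    by rewrite ltr_pdivrMl// ler_pdivlMl// ltrBlDl lerBrDl cx xe.
  by move: cx xe; rewrite ltr_pdivrMl// ler_pdivlMl// ltrBlDl lerBrDl => -> ->.
rewrite ge0_integral_mscale//; congr (_ * _).
exact: (ge0_integral_pushforward mphi leb measurableT mf).
Qed.

Lemma measurable_tuple_nth n (x0 : R) i :
  measurable_fun setT (fun t : n.-tuple R => nth x0 t i).
Proof.
have [ni|ni] := ltnP i n.
  rewrite (_ : (fun _ => _) = (fun t : n.-tuple R => tnth t (Ordinal ni))).
    exact: measurable_tnth.
  by apply/funext => t; rewrite (tnth_nth x0).
rewrite (_ : (fun _ => _) = cst x0)//.
by apply/funext => t; rewrite nth_default// size_tuple.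
Qed.

Lemma lebn_affine n (a b : 'I_n -> R) (f : n.-tuple R -> \bar R) :
  (forall i, (0 < a i)%R) -> measurable_fun setT f -> (forall t, 0 <= f t) ->
  \int[lebn n]_t f t = (\prod_(i < n) a i)%:E *
    \int[lebn n]_s f [tuple (b i + a i * tnth s i)%R | i < n].
Proof.
have mtup m (c e : 'I_m -> R) : measurable_fun setT
    (fun s : m.-tuple R => [tuple (c i + e i * tnth s i)%R | i < m]).
  apply/measurable_fun_tnthP => i; rewrite (_ : _ \o _ =
    (fun s : m.-tuple R => (c i + e i * tnth s i)%R)).
    apply: measurable_funD => //; apply: measurable_funM => //.
    exact: measurable_tnth.
  by apply/funext => s /=; rewrite tnth_mktuple.
elim: n a b f => [|n IH] a b f a0 mf f0.
  rewrite big_ord0 mul1e; apply: eq_integral => t _; congr f.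
  by apply: eq_from_tnth => -[].
pose w := widen_ord (leqnSn n).
rewrite integral_lebnS//.
have -> : \int[lebn n]_t \int[leb]_x f [tuple of rcons t x] =
  (a ord_max)%:E * \int[lebn n]_t
    \int[leb]_x f [tuple of rcons t (b ord_max + a ord_max * x)%R].
  rewrite -ge0_integralZl//; last 3 first.
  - apply: (@measurable_fun_fubini_tonelli_F _ _ _ _ _ leb (fun p : n.-tuple R * mR =>
      f [tuple of rcons p.1 (b ord_max + a ord_max * p.2)%R])) => //.
    apply: measurableT_comp => //; apply: measurable_rcons_comp => //.
    by apply: measurable_funD => //; exact: measurable_funM.
  - by move=> t _; exact: integral_ge0.
  - by rewrite lee_fin ltW.
  apply: eq_integral => t _.
  rewrite (@lebesgue_integral_affine (a ord_max) (b ord_max))//.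
  by apply: measurableT_comp => //; exact: measurable_rcons_comp.
rewrite (IH (a \o w) (b \o w)); last 3 first.
- by move=> i; exact: a0.
- apply: (@measurable_fun_fubini_tonelli_F _ _ _ _ _ leb (fun p : n.-tuple R * mR =>
      f [tuple of rcons p.1 (b ord_max + a ord_max * p.2)%R])) => //.
  apply: measurableT_comp => //; apply: measurable_rcons_comp => //.
  by apply: measurable_funD => //; exact: measurable_funM.
- by move=> t; exact: integral_ge0.
rewrite muleA -EFinM mulrC big_ord_recr/=; congr (_ * _).
rewrite integral_lebnS//; last first.
  by apply: measurableT_comp => //; exact: mtup.
apply: eq_integral => t _; apply: eq_integral => x _; congr f.
apply: eq_from_tnth => i; rewrite tnth_mktuple !(tnth_nth x)/=.
rewrite !nth_rcons !size_tuple ?card_ord.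
have [ni|ni] := ltnP i n.
  have iw : i = w (Ordinal ni) by apply: val_inj.
  by rewrite (nth_mktuple _ x (Ordinal ni)) (tnth_nth x)/= -iw.
have -> : i = ord_max.
  by apply: val_inj; apply/eqP; rewrite eqn_leq ni -ltnS ltn_ord.
by rewrite eqxx.
Qed.

End lebn.

Arguments lebn {R} n.

(** * Integrals in the increments of a tuple *)

Section increments.
Context (R : realType).
Notation leb := (@lebesgue_measure R).
Definition increment (s : seq R) i : R := (nth (0 : R) (0 :: s) i.+1 - nth (0 : R) (0 :: s) i)%R.

Lemma increment_rcons s x i :
  increment (rcons s x) i = if (i < size s)%N then increment s i else
    if i == size s then (x - nth (0 : R) (0 :: s) i)%R else
    if i == (size s).+1 then (- x)%R else 0%R.
Proof.
rewrite /increment/= nth_rcons.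
have E : nth (0 : R) (0 :: rcons s x) i = if (i <= size s)%N then nth (0 : R) (0 :: s) i else
    if i == (size s).+1 then x else 0%R.
  case: i => [|i]/=; first by [].
  by rewrite nth_rcons eqSS.
rewrite E; case: (ltngtP i (size s)) => is_ //.
by case: ifP => _; rewrite sub0r ?oppr0.
Qed.

Local Open Scope ereal_scope.

Lemma measurable_increment n i :
  measurable_fun setT (fun t : n.-tuple R => increment t i).
Proof.
apply: measurable_funB; first exact: measurable_tuple_nth.
by case: i => [|i]//=; exact: measurable_tuple_nth.
Qed.

(** The map from a tuple to its increments is triangular with unit diagonal: for fixed earlier
    coordinates the last increment is a translate of the last coordinate. *)
Lemma lebn_increments n (f : 'I_n -> R -> R) :
  (forall i, measurable_fun setT (f i)) -> (forall i x, (0 <= f i x)%R) ->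
  \int[lebn n]_t (\prod_(i < n) f i (increment t i))%:E =
  \prod_(i < n) \int[leb]_x (f i x)%:E.
Proof.
elim: n f => [|n IH] f mf f0.
  under eq_integral do rewrite big_ord0.
  by rewrite big_ord0 integral_dirac// diracT mul1e.
have mprod m (g : 'I_m -> R -> R) : (forall i, measurable_fun setT (g i)) ->
    measurable_fun setT (fun t : m.-tuple R => (\prod_(i < m) g i (increment t i))%R).
  move=> mg; apply: measurable_prod => i _.
  by apply: (measurableT_comp (mg i)); exact: measurable_increment.
rewrite integral_lebnS; last 2 first.
- by apply/measurable_EFinP; exact: mprod.
- by move=> t; rewrite lee_fin; apply: prodr_ge0.
transitivity (\int[lebn n]_t ((\int[leb]_x (f ord_max x)%:E) *
    (\prod_(i < n) f (widen_ord (leqnSn n) i) (increment t i))%:E)).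
  apply: eq_integral => t _.
  rewrite [X in _ = X * _](@lebesgue_integral_affine R 1 (- nth (0 : R) (0 :: t) n)%R); last 3 first.
  - by [].
  - by apply/measurable_EFinP; exact: mf.
  - by move=> x; rewrite lee_fin.
  rewrite mul1e muleC -ge0_integralZl//; last 3 first.
  - apply/measurable_EFinP.
    have mc : measurable_fun setT (fun x : R => - nth (0 : R) (0 :: t) n + 1 * x)%R.
      by apply: measurable_funD => //; exact: measurable_funM.
    exact: (measurableT_comp (mf ord_max) mc).
  - by move=> x _; rewrite lee_fin.
  - by rewrite lee_fin; apply: prodr_ge0.
  apply: eq_integral => x _; rewrite big_ord_recr/= EFinM.
  rewrite increment_rcons size_tuple ltnn eqxx mul1r addrC; congr (_%:E * _).
  by apply: eq_bigr => i _; rewrite increment_rcons size_tuple ltn_ord.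
rewrite ge0_integralZl//; last 3 first.
- by apply/measurable_EFinP; apply: (mprod _ (fun i => f (widen_ord (leqnSn n) i))).
- by move=> t _; rewrite lee_fin; apply: prodr_ge0.
- by apply: integral_ge0 => x _; rewrite lee_fin.
by rewrite (IH (fun i => f (widen_ord (leqnSn n) i)))// big_ord_recr/= muleC.
Qed.

End increments.

(** * Improper integrals by exhaustion with segments *)

Section improper_integrals.
Context (R : realType).
Notation leb := (@lebesgue_measure R).

Lemma derivable_segment (F f : R -> R) (a b : R) :
  (forall x, x \in `[a, b] -> is_derive x 1 F (f x)) ->
  a < b -> derivable_oo_LRcontinuous F a b.
Proof.
move=> dF ab.
have cF x : x \in `[a, b] -> {for x, continuous F}.
  move=> xab; apply: differentiable_continuous; apply/derivable1_diffP.
  by case: (dF _ xab).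
split=> [x xab||].
- have : x \in `[a, b] by apply: subset_itv_oo_cc xab.
  by move=> /dF[].
- by apply: cvg_at_right_filter; apply: cF; rewrite in_itv/= lexx ltW.
- by apply: cvg_at_left_filter; apply: cF; rewrite in_itv/= lexx ltW.
Qed.

Lemma continuous_segment (f : R -> R) (a b : R) : a < b ->
  (forall x, x \in `[a, b] -> {for x, continuous f}) ->
  {within `[a, b], continuous f}.
Proof.
move=> ab cf; apply/continuous_within_itvP => //; split.
- by move=> x xab; apply: cf; apply: subset_itv_oo_cc xab.
- by apply: cvg_at_right_filter; apply: cf; rewrite in_itv/= lexx ltW.
- by apply: cvg_at_left_filter; apply: cf; rewrite in_itv/= lexx ltW.
Qed.

Lemma measurable_itv_bigcup (a_ b_ : nat -> R) (D : set R) (f : R -> R) :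
  D = \bigcup_n `[a_ n, b_ n]%classic -> (forall n, a_ n < b_ n) ->
  (forall x, D x -> {for x, continuous f}) ->
  forall n, measurable_fun `[a_ n, b_ n] (EFin \o f).
Proof.
move=> DE ab cf n; apply/measurable_EFinP.
apply: subspace_continuous_measurable_fun => //.
apply: continuous_segment => // x xab; apply: cf; rewrite DE; exists n => //.
Qed.

Lemma nondecreasing_segments (a_ b_ : nat -> R) :
  nonincreasing_seq a_ -> nondecreasing_seq b_ ->
  nondecreasing_seq (fun n => `[a_ n, b_ n]%classic).
Proof.
move=> na nb m n mn; apply/subsetPset => x /=; rewrite !in_itv/= => /andP[ax xb].
by rewrite (le_trans (na _ _ mn) ax) (le_trans xb (nb _ _ mn)).
Qed.

(** Nonnegativity gives monotone convergence along the segments; finiteness of the integral is an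
    output, read off from the limits of [F] at the two ends. *)
Lemma ge0_FTC_exhaustion (f F : R -> R) (a_ b_ : nat -> R) (D : set R) (la lb : R) :
  (forall n, a_ n < b_ n) -> nonincreasing_seq a_ -> nondecreasing_seq b_ ->
  D = \bigcup_n `[a_ n, b_ n]%classic ->
  (forall x, D x -> 0 <= f x) -> (forall x, D x -> {for x, continuous f}) ->
  (forall x, D x -> is_derive x 1 F (f x)) ->
  F (a_ n) @[n --> \oo] --> la -> F (b_ n) @[n --> \oo] --> lb ->
  (\int[leb]_(x in D) (f x)%:E = (lb - la)%:E)%E.
Proof.
move=> ab na nb DE f0 cf dF Fa Fb.
have sD n x : x \in `[a_ n, b_ n] -> D x by move=> xab; rewrite DE; exists n.
have H : (\int[leb]_(x in `[a_ n, b_ n]) (f x)%:E)%E @[n --> \oo] -->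
    (\int[leb]_(x in D) (f x)%:E)%E.
  rewrite DE.
  apply: (@ge0_nondecreasing_set_cvg_integral _ (measurableTypeR R) R
    (fun n => `[a_ n, b_ n]%classic) (EFin \o f) leb) => //.
  - exact: nondecreasing_segments.
  - exact: (measurable_itv_bigcup DE ab cf).
  - by move=> n x /sD Dx; rewrite lee_fin f0.
have {}H : (F (b_ n) - F (a_ n))%:E @[n --> \oo] --> (\int[leb]_(x in D) (f x)%:E)%E.
  apply: cvg_trans H; apply: near_eq_cvg; apply: nearW => n.
  rewrite EFinB; apply: continuous_FTC2 => //.
  - by apply: continuous_segment => // x /sD; exact: cf.
  - by apply: derivable_segment => // x /sD; exact: dF.
  - by move=> x /subset_itv_oo_cc/sD/dF[_ <-]; rewrite derive1E.
apply: (cvg_unique _ H) => //; apply: cvg_EFin; first exact: nearW.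
exact: cvgB.
Qed.

(** Stated for decreasing [phi], the case of the Moebius, logistic and reflection substitutions
    below. Both integrals are monotone limits over matching segments, so they agree even when
    infinite. *)
Lemma ge0_substitution_exhaustion (phi phi' G : R -> R) (a_ b_ : nat -> R)
    (D E : set R) :
  (forall n, a_ n < b_ n) -> nonincreasing_seq a_ -> nondecreasing_seq b_ ->
  D = \bigcup_n `[a_ n, b_ n]%classic -> open D ->
  E = \bigcup_n `[phi (b_ n), phi (a_ n)]%classic ->
  (forall x y, D x -> D y -> x < y -> phi y < phi x) ->
  (forall x, D x -> is_derive x 1 phi (phi' x)) ->
  (forall x, D x -> {for x, continuous phi'}) -> (forall x, D x -> phi' x <= 0) ->
  (forall x, E x -> 0 <= G x) -> (forall x, E x -> {for x, continuous G}) ->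
  (\int[leb]_(x in E) (G x)%:E =
   \int[leb]_(x in D) (G (phi x) * - phi' x)%:E)%E.
Proof.
move=> ab na nb DE oD EE dphi dF cphi' phi'_le0 G0 cG.
have sD n x : x \in `[a_ n, b_ n] -> D x by move=> xab; rewrite DE; exists n.
have sE n x : x \in `[phi (b_ n), phi (a_ n)] -> E x.
  by move=> xab; rewrite EE; exists n.
have aD n : D (a_ n) by apply: (sD n); rewrite in_itv/= lexx ltW.
have bD n : D (b_ n) by apply: (sD n); rewrite in_itv/= lexx ltW.
have phile x y : D x -> D y -> x <= y -> phi y <= phi x.
  by move=> Dx Dy; rewrite le_eqVlt => /predU1P[->//|/(dphi _ _ Dx Dy)/ltW].
have pab n : phi (b_ n) < phi (a_ n) by exact: dphi.
have DphiE x : D x -> E (phi x).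
  rewrite {1}DE => -[n _ xab]; apply: (sE n); have Dx := sD _ _ xab.
  by move: xab; rewrite /= !in_itv/= => /andP[ax xb]; rewrite !phile.
have cphi x : D x -> {for x, continuous phi}.
  move=> Dx; apply: differentiable_continuous; apply/derivable1_diffP.
  by case: (dF _ Dx).
have cH x : D x -> {for x, continuous (fun x => G (phi x) * - phi' x)}.
  move=> Dx; apply: cvgM; last by apply: cvgN; exact: cphi'.
  by apply: continuous_comp; [exact: cphi|apply: cG; exact: DphiE].
have H1 : (\int[leb]_(x in `[a_ n, b_ n]) (G (phi x) * - phi' x)%:E)%E @[n --> \oo] -->
    (\int[leb]_(x in D) (G (phi x) * - phi' x)%:E)%E.
  rewrite DE.
  apply: (@ge0_nondecreasing_set_cvg_integral _ (measurableTypeR R) R (fun n => `[a_ n, b_ n]%classic)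
    (fun x => (G (phi x) * - phi' x)%:E) leb) => //.
  - exact: nondecreasing_segments.
  - exact: (measurable_itv_bigcup DE ab cH).
  move=> n x /sD Dx; rewrite lee_fin mulr_ge0 ?oppr_ge0 ?phi'_le0//.
  by apply: G0; exact: DphiE.
have H2 : (\int[leb]_(x in `[phi (b_ n), phi (a_ n)]) (G x)%:E)%E @[n --> \oo] -->
    (\int[leb]_(x in E) (G x)%:E)%E.
  rewrite EE.
  apply: (@ge0_nondecreasing_set_cvg_integral _ (measurableTypeR R) R
    (fun n => `[phi (b_ n), phi (a_ n)]%classic) (EFin \o G) leb) => //.
  - apply: (@nondecreasing_segments (phi \o b_) (phi \o a_)).
    by move=> m n mn /=; apply: phile => //; exact: nb.
    by move=> m n mn /=; apply: phile => //; exact: na.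
  - exact: (measurable_itv_bigcup EE pab cG).
  - by move=> n x /sE Ex; rewrite lee_fin G0.
suff : (\int[leb]_(x in `[phi (b_ n), phi (a_ n)]) (G x)%:E)%E @[n --> \oo] -->
    (\int[leb]_(x in D) (G (phi x) * - phi' x)%:E)%E by move/(cvg_unique _ H2); exact.
apply: cvg_trans H1; apply: near_eq_cvg; apply: nearW => n; apply/esym.
have D'phi x : D x -> derive1 phi x = phi' x.
  by move=> /dF[_ <-]; rewrite derive1E.
have nD x : D x -> \forall y \near x, D y by move=> Dx; exact: open_nbhs_nbhs.
rewrite integration_by_substitution_decreasing//.
- by apply: eq_integral => x /[!inE] /sD Dx /=; rewrite !fctE D'phi.
- exact: ltW.
- by move=> x y /sD Dx /sD Dy; exact: dphi.
- move=> x /subset_itv_oo_cc/sD Dx; rewrite /continuous_at (D'phi _ Dx).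
  apply: cvg_trans (cphi' _ Dx); apply: near_eq_cvg.
  by apply: filterS (nD _ Dx) => y Dy; exact/esym/D'phi.
- apply/cvg_ex; exists (phi' (a_ n)); apply: cvg_at_right_filter.
  apply: cvg_trans (cphi' _ (aD n)); apply: near_eq_cvg.
  by apply: filterS (nD _ (aD n)) => y Dy; exact/esym/D'phi.
- apply/cvg_ex; exists (phi' (b_ n)); apply: cvg_at_left_filter.
  apply: cvg_trans (cphi' _ (bD n)); apply: near_eq_cvg.
  by apply: filterS (nD _ (bD n)) => y Dy; exact/esym/D'phi.
- by apply: derivable_segment => // x /sD; exact: dF.
- by apply: continuous_segment => // x /sE; exact: cG.
Qed.

End improper_integrals.

Section positive_integral.
Local Open Scope ereal_scope.
Context d (T : measurableType d) (R : realType).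
Variable mu : {measure set T -> \bar R}.

Lemma integral_gt0 (D : set T) (f : T -> \bar R) : measurable D ->
  measurable_fun D f -> 0 < mu D -> (forall x, D x -> 0 < f x) ->
  0 < \int[mu]_(x in D) f x.
Proof.
move=> mD mf muD f0; rewrite lt0e integral_ge0 ?andbT; last first.
  by move=> x /f0/ltW.
apply/eqP => intf0.
have : \int[mu]_(x in D) `|f x| = 0.
  by rewrite -intf0; apply: eq_integral => x /[!inE] /f0 fx0; rewrite gee0_abs// ltW.
move/(ae_eq_integral_abs mu mD mf) => [N [mN N0 DN]].
have : mu D <= mu N.
  rewrite le_measure ?inE// => x Dx; apply: DN => /= /(_ Dx) fx0.
  by have := f0 _ Dx; rewrite fx0 ltxx.
by rewrite N0 leNgt muD.
Qed.

End positive_integral.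

(** * The Gamma integral *)

Section gamma_function.
Context (R : realType).
Notation leb := (@lebesgue_measure R).

Lemma itv0y_exhaustion : `]0, +oo[%classic =
  \bigcup_n `[(n.+2%:R : R)^-1, n.+2%:R]%classic.
Proof.
apply/seteqP; split => x /=.
  rewrite in_itv/= andbT => x0.
  have [n xn] := ltr_add_invr (x0 : 0 < x).
  exists (maxn n (truncn x)) => //=; rewrite in_itv/=; apply/andP; split.
    rewrite add0r in xn; apply: le_trans (ltW xn).
    by rewrite lef_pV2 ?posrE// ler_nat -addn2 -addn1 leq_add// leq_maxl.
  apply: (le_trans (ltW (truncnS_gt x))); rewrite ler_nat.
  by rewrite -addn1 -addn2 leq_add// leq_maxr.
move=> [n _]; rewrite /= !in_itv/= andbT => /andP[nx _].
by apply: lt_le_trans nx; rewrite invr_gt0.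
Qed.

(** This is [ln v <= v - 1] at [v = u / (2 s)]: half of the exponential decay is spent on the
    power. *)
Lemma powR_le_exp (s u : R) : 0 < s -> 0 < u ->
  u `^ s <= (s *+ 2) `^ s * expR (u / 2).
Proof.
move=> s0 u0; rewrite /powR !gt_eqF ?mulrn_wgt0// -expRD ler_expR.
have s20 : 0 < s *+ 2 by rewrite mulrn_wgt0.
have -> : ln u = ln (u / (s *+ 2)) + ln (s *+ 2).
  by rewrite ln_div ?posrE// subrK.
have : ln (u / (s *+ 2)) <= u / (s *+ 2) - 1.
  have := @le_ln1Dx R (u / (s *+ 2) - 1); rewrite [1 + _]addrC subrK; apply.
  by rewrite ltrBrDr addrC subrr divr_gt0.
have : u / 2 = s * (u / (s *+ 2)).
  by rewrite -mulr_natr; field; rewrite gt_eqF.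
nra.
Qed.

(** The unnormalized Gamma([s]) density with rate [a], extended by 0 so that it can be integrated
    over the whole line. *)
Definition gamma_fun (s a x : R) : R :=
  if 0 < x then x `^ (s - 1) * expR (- (a * x)) else 0.

Lemma gamma_fun_ge0 s a x : 0 <= gamma_fun s a x.
Proof.
by rewrite /gamma_fun; case: ifP => // _; rewrite mulr_ge0 ?powR_ge0 ?expR_ge0.
Qed.

Lemma measurable_gamma_fun s a : measurable_fun setT (gamma_fun s a).
Proof.
apply: measurable_fun_ifT => //.
  exact: measurable_fun_ltr.
apply: measurable_funM; first exact: measurable_powR.
apply: measurableT_comp; first exact: measurable_expR.
by apply: measurableT_comp => //; exact: measurable_funM.
Qed.

Lemma measurable_gamma_integrand s :
  measurable_fun setT (fun x : R => x `^ (s - 1) * expR (- x)).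
Proof.
mfun.
Qed.

Lemma gamma_funE1 s : (\int[leb]_x (gamma_fun s 1 x)%:E =
  \int[leb]_(x in `]0%R, +oo[) (x `^ (s - 1) * expR (- x))%:E)%E.
Proof.
rewrite [RHS]integral_mkcond; apply: eq_integral => x _.
rewrite patchE /gamma_fun mul1r; case: ifPn => x0; case: ifPn => //.
  by rewrite notin_setE/= in_itv/= andbT x0.
by rewrite inE/= in_itv/= andbT => x0'; rewrite x0' in x0.
Qed.

Let bump (s x : R) : R := x `^ s / (1 + x `^ s).

(** Comparison with [h], the derivative of [bump s], which takes values in [[0, 1]]: from
    [1 + x^s <= (1 + K) e^(x/2)] the factor [e^(- x)] is at most [(1 + K)^2 / (1 + x^s)^2]. This
    treats the singularity at 0 and the decay at infinity together. *)
Lemma integral_gamma_fun1_lty s : 0 < s ->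
  (\int[leb]_x (gamma_fun s 1 x)%:E < +oo)%E.
Proof.
move=> s0; pose K := (s *+ 2) `^ s.
pose h x := s * x `^ (s - 1) / (1 + x `^ s) ^+ 2.
have K0 : 0 < K by rewrite powR_gt0// mulrn_wgt0.
have le_h (x : R) : 0 < x -> gamma_fun s 1 x <= (1 + K) ^+ 2 / s * h x.
  move=> x0; rewrite /gamma_fun x0 /h mul1r.
  have p0 : 0 < x `^ s by exact: powR_gt0.
  have -> : (1 + K) ^+ 2 / s * (s * x `^ (s - 1) / (1 + x `^ s) ^+ 2) =
      x `^ (s - 1) * ((1 + K) ^+ 2 / (1 + x `^ s) ^+ 2).
    by field; rewrite !gt_eqF// addr_gt0.
  rewrite ler_wpM2l ?powR_ge0// ler_pdivlMr ?exprn_gt0 ?addr_gt0//.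
  have -> : expR (- x) = (expR (- (x / 2))) ^+ 2.
    by rewrite expr2 -expRD; congr expR; field.
  have e0 : 0 < expR (- (x / 2)) by exact: expR_gt0.
  rewrite -exprMn ler_pXn2r ?nnegrE//; [|by nra|by lra].
  have := powR_le_exp s0 x0; rewrite -/K => xK.
  rewrite expRN mulrC ler_pdivrMr ?expR_gt0//.
  rewrite -/K in xK; have : 1 <= expR (x / 2) by rewrite -expR0 ler_expR divr_ge0// ltW.
  nra.
have h0 (x : R) : 0 < x -> 0 <= h x.
  move=> x0; rewrite /h; apply: divr_ge0; last exact: sqr_ge0.
  by apply: mulr_ge0; [exact: ltW|exact: powR_ge0].
have dbump (x : R) : 0 < x -> is_derive x 1 (bump s) (h x).
  move=> x0; rewrite /bump /h.
  have p0 : 0 < x `^ s by exact: powR_gt0.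
  have d1 := is_derive1_powR s x0.
  have n0 : 1 + x `^ s != 0 by rewrite gt_eqF// addr_gt0.
  have d2 := @is_deriveV R (cst 1 + (@powR R)^~ s) x _ 1 n0 (is_deriveD (is_derive_cst _ _ _) d1).
  apply: (is_derive_eq (is_deriveM d1 d2)).
  rewrite /= !fctE /= /GRing.scale/=; field.
  by [].
have cbump (x : R) : 0 < x -> {for x, continuous h}.
  move=> x0; have p0 : 0 < x `^ s by exact: powR_gt0.
  have cp r : {for x, continuous ((@powR R)^~ r)}.
    apply: differentiable_continuous; apply/derivable1_diffP.
    by case: (is_derive1_powR r x0).
  apply: cvgM; first by apply: cvgM; [exact: cvg_cst|exact: cp].
  apply: cvgV; first by rewrite gt_eqF// exprn_gt0// addr_gt0.
  by apply: cvgM; apply: cvgD; (exact: cvg_cst || exact: cp).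
have ndb : {in [set x | 0 < x] &, {homo bump s : x y / x <= y}}.
  move=> x y /[!inE]/= x0 y0 xy; rewrite /bump.
  have px : 0 < x `^ s by exact: powR_gt0.
  have py : 0 < y `^ s by exact: powR_gt0.
  have pxy : x `^ s <= y `^ s by rewrite ge0_ler_powR// ?nnegrE ltW.
  by rewrite ler_pdivrMr ?addr_gt0// mulrAC ler_pdivlMr ?addr_gt0//; nra.
have b01 (x : R) : 0 < x -> 0 <= bump s x <= 1.
  move=> x0; have px : 0 < x `^ s by exact: powR_gt0.
  apply/andP; split; first by rewrite /bump divr_ge0//; lra.
  by rewrite /bump ler_pdivrMr; lra.
have i0 n : 0 < n.+2%:R :> R by [].
have in0 n : 0 < n.+2%:R^-1 :> R by rewrite invr_gt0.
have [la bla] : exists la : R, bump s (n.+2%:R^-1) @[n --> \oo] --> la.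
  exists (limn (fun n => bump s (n.+2%:R^-1))); apply: nonincreasing_is_cvgn.
    move=> m n mn; apply: ndb; rewrite ?inE/= ?invr_gt0//.
    by rewrite lef_pV2 ?posrE// ler_nat !ltnS.
  by exists 0 => _ [n _ <-]; have /andP[] := b01 n.+2%:R^-1 (in0 n).
have [lb blb] : exists lb : R, bump s n.+2%:R @[n --> \oo] --> lb.
  exists (limn (fun n => bump s n.+2%:R)); apply: nondecreasing_is_cvgn.
    by move=> m n mn; apply: ndb; rewrite ?inE//= ler_nat !ltnS.
  by exists 1 => _ [n _ <-]; have /andP[] := b01 n.+2%:R (i0 n).
have Ih := @ge0_FTC_exhaustion R h (bump s) (fun n => n.+2%:R^-1) (fun n => n.+2%:R)
  `]0, +oo[%classic la lb.
have {}Ih : (\int[leb]_(x in `]0%R, +oo[) (h x)%:E = (lb - la)%:E)%E.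
  apply: Ih => //.
  - move=> n; rewrite (@lt_trans _ _ 1)// ?invf_lt1// ltr1n//.
  - by move=> m n mn; rewrite lef_pV2 ?posrE// ler_nat !ltnS.
  - by move=> m n mn; rewrite ler_nat !ltnS.
  - exact: itv0y_exhaustion.
  - by move=> x /=; rewrite in_itv/= andbT; exact: h0.
  - by move=> x /=; rewrite in_itv/= andbT; exact: cbump.
  - by move=> x /=; rewrite in_itv/= andbT; exact: dbump.
have mh : measurable_fun (`]0%R, +oo[%classic : set R) h.
  apply: open_continuous_measurable_fun; first exact: interval_open.
  by move=> x; rewrite inE/= in_itv/= andbT; exact: cbump.
rewrite gamma_funE1.
apply: (@le_lt_trans _ _ (\int[leb]_(x in `]0%R, +oo[) ((1 + K) ^+ 2 / s * h x)%:E)%E).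
  apply: ge0_le_integral => //.
  - by move=> x _; rewrite lee_fin mulr_ge0 ?powR_ge0 ?expR_ge0.
  - by apply/measurable_EFinP; apply: measurable_funTS; exact: measurable_gamma_integrand.
  - by apply/measurable_EFinP; apply: measurable_funM.
  - by move=> x /=; rewrite in_itv/= andbT lee_fin => x0; have := le_h _ x0; rewrite /gamma_fun x0 mul1r.
under eq_integral do rewrite EFinM.
rewrite ge0_integralZl//.
- by rewrite Ih -EFinM ltry.
- exact/measurable_EFinP.
- by move=> x /=; rewrite in_itv/= andbT lee_fin => /h0.
- by rewrite lee_fin divr_ge0 ?sqr_ge0 ?ltW.
Qed.

Lemma integral_gamma_fun s a : 0 < s -> 0 < a ->
  (\int[leb]_x (gamma_fun s a x)%:E = (Gamma s * a `^ (- s))%:E)%E.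
Proof.
move=> s0 a0.
have I1 : (\int[leb]_x (gamma_fun s 1 x)%:E = (Gamma s)%:E)%E.
  rewrite /Gamma /Rintegral fineK; last first.
    rewrite ge0_fin_numE; last by apply: integral_ge0 => x _; rewrite lee_fin mulr_ge0 ?powR_ge0 ?expR_ge0.
    by rewrite -gamma_funE1; exact: integral_gamma_fun1_lty.
  exact: gamma_funE1.
rewrite (@lebesgue_integral_affine R a^-1 0); last 3 first.
- by rewrite invr_gt0.
- by apply/measurable_EFinP; exact: measurable_gamma_fun.
- by move=> x; rewrite lee_fin gamma_fun_ge0.
have E x : gamma_fun s a (0 + a^-1 * x) = a `^ (1 - s) * gamma_fun s 1 x.
  rewrite add0r /gamma_fun pmulr_rgt0 ?invr_gt0//; case: ifP => x0; last by rewrite mulr0.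
  have -> : a * (a^-1 * x) = 1 * x by field; rewrite gt_eqF.
  rewrite powRM ?invr_ge0 ?ltW// -(powR_inv1 (ltW a0)) -powRrM mulN1r opprB.
  by rewrite !mulrA.
under eq_integral do rewrite E EFinM.
rewrite ge0_integralZl//; last 3 first.
- by apply/measurable_EFinP; exact: measurable_gamma_fun.
- by move=> x _; rewrite lee_fin gamma_fun_ge0.
- by rewrite lee_fin powR_ge0.
rewrite I1 -!EFinM; congr (_%:E); rewrite mulrA mulrC; congr (_ * _).
rewrite -(powR_inv1 (ltW a0)) -powRD; last by rewrite (gt_eqF a0) implybT.
by congr (_ `^ _); ring.
Qed.

Lemma Gamma_gt0 s : 0 < s -> 0 < Gamma s :> R.
Proof.
move=> s0; rewrite -lte_fin; have := integral_gamma_fun s0 ltr01.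
rewrite powR1 mulr1 gamma_funE1 => <-; apply: integral_gt0 => //.
- by apply/measurable_EFinP; apply: measurable_funTS; exact: measurable_gamma_integrand.
- have : (0 < leb `]0%R, +oo[%classic)%E by rewrite lebesgue_measure_itv/= ltry sube0 ltry.
  by [].
- by move=> x /=; rewrite in_itv/= andbT lte_fin => x0; rewrite mulr_gt0 ?powR_gt0 ?expR_gt0.
Qed.

End gamma_function.

(** * Gamma mixtures over the simplex *)

Section simplex_mixture.
Context (R : realType).
Notation leb := (@lebesgue_measure R).

Lemma ext_rcons (s : seq R) i : (i <= (size s).+1)%N ->
  ext s i = nth 0 (0 :: rcons s 1) i.
Proof.
rewrite /ext; case: i => //= i; rewrite ltnS => is_.
rewrite nth_rcons ltnS; by case: ltngtP is_.
Qed.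

Lemma nth0_map (a : R) (s : seq R) i : nth 0 [seq a * x | x <- s] i = a * nth 0 s i.
Proof.
have [is_|is_] := ltnP i (size s); first by rewrite (nth_map 0).
by rewrite !nth_default ?mulr0// size_map.
Qed.

Lemma increment_scale (a : R) (s : seq R) i :
  increment (rcons [seq a * x | x <- s] a) i = a * increment (rcons s 1) i.
Proof.
have -> : rcons [seq a * x | x <- s] a = [seq a * x | x <- rcons s 1].
  by rewrite map_rcons mulr1.
rewrite /increment -[0 :: [seq a * x | x <- _]]/(nil ++ _).
have -> : 0 :: [seq a * x | x <- rcons s 1] = [seq a * x | x <- 0 :: rcons s 1].
  by rewrite /= mulr0.
by rewrite cat0s !nth0_map mulrBr.
Qed.

Lemma increment_ext (s : seq R) i : (i <= size s)%N ->
  increment (rcons s 1) i = ext s i.+1 - ext s i.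
Proof. by move=> is_; rewrite /increment !ext_rcons// ltnW. Qed.

Lemma sum_increment (s : seq R) n : \sum_(i < n) increment s i = nth 0 (0 :: s) n.
Proof.
rewrite -(big_mkord xpredT (increment s)).
by rewrite telescope_sumr//= subr0.
Qed.

Local Open Scope ereal_scope.

(** The source of independence in the Gamma mixture: [m + 1] positive variables are described by
    their sum [r] and their normalized partial sums [y], with Jacobian [r ^ m]. *)
Lemma simplex_mixture m (f : 'I_m.+1 -> R -> R) :
  (forall i, measurable_fun setT (f i)) -> (forall i x, 0 <= f i x)%R ->
  (forall i x, (x <= 0)%R -> f i x = 0%R) ->
  \int[leb]_r ((if 0 < r then r ^+ m else 0)%R%:E * \int[lebn m]_y
     (\prod_(i < m.+1) f i (r * (ext y i.+1 - ext y i)))%R%:E) =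
  \prod_(i < m.+1) \int[leb]_x (f i x)%:E.
Proof.
move=> mf f0 fN.
have mprod : measurable_fun setT
    (fun t : m.+1.-tuple R => (\prod_(i < m.+1) f i (increment t i))%:E).
  apply/measurable_EFinP; apply: measurable_prod => i _.
  by apply: (measurableT_comp (mf i)); exact: measurable_increment.
rewrite -lebn_increments// integral_lebnS_in//; last first.
  by move=> t; rewrite lee_fin; apply: prodr_ge0.
(* The last coordinate is the total [r], integrated outermost; the partial sums before it are
   rescaled by [r]. *)
apply: eq_integral => r _; case: ifPn => [r0|].
  rewrite [RHS](@lebn_affine R m (fun=> r) (fun=> 0%R))//; last 2 first.
  - by apply: measurableT_comp mprod _; exact: measurable_rcons_comp.
  - by move=> t; rewrite lee_fin; apply: prodr_ge0.
  rewrite prodr_const card_ord; congr (_ * _).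
  apply: eq_integral => y _; congr (_%:E); apply: eq_bigr => i _; congr (f i _).
  have iy : (i <= size y)%N by rewrite size_tuple -ltnS.
  rewrite -(increment_ext iy) -increment_scale /=.
  congr (increment (rcons _ _) _).
  apply: (@eq_from_nth _ 0%R); first by rewrite size_map size_tuple size_map size_enum_ord.
  move=> j; rewrite size_map size_tuple => jm.
  by rewrite (nth_map 0%R) ?size_tuple// (nth_mktuple _ _ (Ordinal jm)) add0r (tnth_nth 0%R).
rewrite -leNgt => r0; rewrite mul0e; apply/esym/integral0_eq => t _.
(* The increments sum to [r <= 0], so one of them is nonpositive and its factor vanishes. *)
suff [i it] : exists i : 'I_m.+1, (increment (rcons t r) i <= 0)%R.
  by rewrite (bigD1 i)//= fN// mul0r.
apply/not_existsP => H.
have : (0 < \sum_(i < m.+1) increment (rcons t r) i)%R.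
  rewrite big_ord_recl ltr_wpDr//.
    by apply: sumr_ge0 => i _; rewrite ltW// ltNge; apply/negP; exact: H.
  by rewrite ltNge; apply/negP; exact: (H ord0).
by rewrite sum_increment/= nth_rcons size_tuple ltnn eqxx ltNge r0.
Qed.

End simplex_mixture.

(** * Uniqueness of Laplace and Stieltjes transforms *)

Lemma integrable_unit_bounded d (T : measurableType d) (R : realType)
    (n : {measure set T -> \bar R}) (g : T -> R) : (n setT < +oo)%E ->
  measurable_fun setT g -> (forall t, 0 <= g t <= 1) ->
  n.-integrable setT (EFin \o g).
Proof.
move=> noo mg g01; apply: measurable_bounded_integrable => //.
exists 1; split => // M M1 x _ /=; have /andP[g0 g1] := g01 x.
by rewrite ger0_norm// (le_trans g1)// ltW.
Qed.

Section laplace_uniqueness.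
Context (R : realType).

(** The quadratic term of the exponential gives [e^t >= t^2 / 2], whence the bound [2 / (d^2 n)]. *)
Lemma cvg_nexpN (d : R) : 0 < d -> n%:R * expR (- (n%:R * d)) @[n --> \oo] --> (0 : R).
Proof.
move=> d0; apply: (@squeeze_cvgr _ _ _ _ (cst 0) (fun n => 2 / d ^+ 2 * harmonic n.-1)).
- near=> n; have n0 : (0 < n)%N by near: n; exact: nbhs_infty_gt.
  rewrite mulr_ge0 ?expR_ge0//= /harmonic prednK// expRN.
  have nd0 : 0 < n%:R * d by rewrite mulr_gt0 ?ltr0n.
  rewrite ler_pdivrMr ?expR_gt0//.
  have n0R : 0 < n%:R :> R by rewrite ltr0n.
  have /= := expR_ge1Dxn 1 (ltW nd0) => h.
  apply: (@le_trans _ _ (2 / d ^+ 2 * n%:R^-1 * ((n%:R * d) ^+ 2 / 2))); last first.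
    rewrite ler_wpM2l ?mulr_ge0 ?invr_ge0 ?sqr_ge0 ?ler0n//.
    by apply: le_trans h; rewrite lerDr.
  by rewrite le_eqVlt; apply/orP; left; apply/eqP; field; rewrite !gt_eqF.
- exact: cvg_cst.
- rewrite -(mulr0 (2 / d ^+ 2)); apply: cvgMr; rewrite -(cvg_shiftS _).
  exact: cvg_harmonic.
Unshelve. all: end_near. Qed.

(* [(1 - exp (- n x)) ^ threshold_exponent b n], a linear combination of
   exponentials in [x], tends to the indicator of [x > b]. *)
Definition threshold_exponent (b : R) n : nat := truncn (n%:R * expR (n%:R * b)).

(** With [M] close to [n e^(n b)], the quantity [M e^(- n x)] is about [n e^(n (b - x))]: it tends
    to 0 for [x > b] and to infinity for [x <= b], and the power behaves like [exp (- M e^(- n x))].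
    The extra factor [n] settles the boundary case [x = b]. *)
Lemma cvg_threshold (b x : R) : 0 <= b -> 0 <= x ->
  (1 - expR (- (n%:R * x))) ^+ threshold_exponent b n @[n --> \oo] -->
  ((b < x)%R%:R : R).
Proof.
move=> b0 x0.
have e01 n : 0 <= expR (- (n%:R * x)) <= 1.
  by rewrite expR_ge0/= -expR0 ler_expR oppr_le0 mulr_ge0.
have f01 n : 0 <= 1 - expR (- (n%:R * x)) <= 1 by have := e01 n; lra.
have M0 n : 0 <= n%:R * expR (n%:R * b) by rewrite mulr_ge0 ?expR_ge0.
have [bx|xb] := ltP b x.
- apply: (@squeeze_cvgr _ _ _ _ (fun n => 1 - n%:R * expR (- (n%:R * (x - b)))) (cst 1)).
  + near=> n; apply/andP; split; last by rewrite exprn_ile1//; have /andP[] := f01 n.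
    (* Bernoulli's inequality. *)
    have bern m : 1 - m%:R * expR (- (n%:R * x)) <= (1 - expR (- (n%:R * x))) ^+ m.
      elim: m => [|m IH]; first by rewrite mul0r subr0 expr0.
      rewrite exprS mulrSr; have := e01 n; have := f01 n.
      have : 0 <= m%:R :> R by [].
      have := IH; set e := expR _; set z := (_ ^+ _); nra.
    apply: le_trans (bern _); rewrite lerD2l lerN2.
    apply: (@le_trans _ _ (n%:R * expR (n%:R * b) * expR (- (n%:R * x)))).
      by rewrite ler_wpM2r ?expR_ge0// truncn_le.
    by rewrite -mulrA -expRD mulrBr opprB addrC.
  + rewrite -[X in _ --> X](subr0 1); apply: cvgB; first exact: cvg_cst.
    by apply: cvg_nexpN; rewrite subr_gt0.
  + exact: cvg_cst.
(* The factor [expR 1] pays for the truncation in the exponent: [M >= n e^(n b) - 1] and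
   [e^(- n x) <= 1]. *)
- apply: (@squeeze_cvgr _ _ _ _ (cst 0) (fun n => expR 1 * expR (- n%:R))).
  + near=> n; rewrite exprn_ge0/=; last by have /andP[] := f01 n.
    apply: (@le_trans _ _ (expR (- expR (- (n%:R * x))) ^+ threshold_exponent b n)).
      rewrite lerXn2r ?nnegrE ?expR_ge0//; first by have /andP[] := f01 n.
      exact: expR_ge1Dx.
    rewrite -expRM_natl -expRD ler_expR.
    have h : n%:R * expR (n%:R * b) - 1 <= (threshold_exponent b n)%:R.
      by have := truncnS_gt (n%:R * expR (n%:R * b)); rewrite -/(threshold_exponent _ _) -natr1; lra.
    have h2 : n%:R <= n%:R * expR (n%:R * b) * expR (- (n%:R * x)).
      rewrite -mulrA -expRD ler_peMr// -expR0 ler_expR -mulrBr.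
      by rewrite mulr_ge0// subr_ge0.
    have := e01 n; move: h h2; set e := expR (- _); set z := _ * expR _; set w := _%:R.
    nra.
  + exact: cvg_cst.
  + rewrite (_ : false%:R = expR 1 * 0 :> R); last by rewrite mulr0.
    apply: cvgMr.
    have -> : (fun n => expR (- n%:R)) = (fun n => expR (-1) ^+ n) :> (nat -> R).
      by apply/funext => n; rewrite -expRM_natl mulrN1.
    by apply: cvg_expr; rewrite ger0_norm ?expR_ge0// -expR0 ltr_expR oppr_lt0.
Unshelve. all: end_near. Qed.

Lemma measurable_tupleP N (B : set (N.-tuple R)) : measurable B ->
  <<s [set [set y : N.-tuple R | forall i, b i < tnth y i] | b in [set: 'I_N -> R]] >> B.
Proof.
set G := (X in <<s X >>) => mB.
pose GT := g_sigma_algebraType G.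
have mid : measurable_fun [set: GT] (fun y : GT => (y : N.-tuple R)).
  apply/measurable_fun_tnthP => i; apply: (measurability _ (RGenOInfty.measurableE R)).
  move=> _ [_ [a ->] <-]; rewrite setTI.
  (* A half-space in one coordinate is a countable union of orthants whose other bounds go to minus
     infinity. *)
  have -> : (@tnth N R ^~ i \o (fun y : GT => (y : N.-tuple R))) @^-1` `]a, +oo[%classic =
    \bigcup_n [set y : N.-tuple R | forall j, (if j == i then a else - n%:R) < tnth y j].
    apply/seteqP; split => y /=; rewrite in_itv/= andbT.
      move=> ay; exists (truncn (\sum_j `|tnth y j|)).+1 => //= j; case: eqP => [->//|_].
      rewrite ltrNl (le_lt_trans _ (truncnS_gt _))// (bigD1 j)//=.
      rewrite -[leLHS]addr0 lerD// ?sumr_ge0//.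
      by rewrite (le_trans (ler_norm _)) ?normrN.
    by move=> [n _ /= /(_ i)]; rewrite eqxx.
  apply: bigcupT_measurable => n; apply: sub_sigma_algebra.
  by exists (fun j => if j == i then a else - n%:R).
by have := mid measurableT _ mB; rewrite setTI.
Qed.

(** Integer exponents are closed under products, by [expsumD], and they are exactly what the powers
    in [cvg_threshold] expand into. *)
Definition expsum N (c : 'I_N -> nat) (y : N.-tuple R) : R :=
  expR (- \sum_(i < N) (c i)%:R * tnth y i).

Lemma measurable_expsum N (c : 'I_N -> nat) : measurable_fun setT (expsum c).
Proof.
apply: measurableT_comp => //; apply: measurableT_comp => //.
by apply: measurable_sum => i; apply: measurable_funM => //; exact: measurable_tnth.
Qed.

Lemma expsum0 N (y : N.-tuple R) : expsum (fun=> 0%N) y = 1.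
Proof. by rewrite /expsum big1 ?oppr0 ?expR0// => i _; rewrite mul0r. Qed.

Lemma expsum_le1 N (c : 'I_N -> nat) y : (forall i, 0 <= tnth y i) -> expsum c y <= 1.
Proof.
move=> y0; rewrite /expsum -expR0 ler_expR oppr_le0; apply: sumr_ge0 => i _.
by rewrite mulr_ge0.
Qed.

Lemma expsumD N (c e : 'I_N -> nat) y :
  expsum (fun i => (c i + e i)%N) y = expsum c y * expsum e y.
Proof.
rewrite /expsum -expRD -opprD -big_split/=; congr (expR (- _)).
by apply: eq_bigr => i _; rewrite natrD mulrDl.
Qed.

Variables (d1 d2 : measure_display) (T1 : measurableType d1) (T2 : measurableType d2).

Local Open Scope ereal_scope.

Variables (n1 : {measure set T1 -> \bar R}) (n2 : {measure set T2 -> \bar R}).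
Hypothesis n1oo : n1 setT < +oo.
Hypothesis n2oo : n2 setT < +oo.
Variables (N : nat) (Y1 : T1 -> N.-tuple R) (Y2 : T2 -> N.-tuple R).
Hypotheses (mY1 : measurable_fun setT Y1) (mY2 : measurable_fun setT Y2).
Hypothesis Y1_ge0 : forall t i, (0 <= tnth (Y1 t) i)%R.
Hypothesis Y2_ge0 : forall t i, (0 <= tnth (Y2 t) i)%R.

(** The weights that preserve equality of the two Laplace transforms. The class contains 1 and is
    closed under multiplication by [1 - clip c] and under the limits of [cvg_threshold]; hence it
    contains the indicators of orthants. *)
Definition same_transform (w : N.-tuple R -> R) :=
  [/\ measurable_fun setT w, (forall y, 0 <= w y <= 1)%R & forall c,
    \int[n1]_t (w (Y1 t) * expsum c (Y1 t))%:E =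
    \int[n2]_t (w (Y2 t) * expsum c (Y2 t))%:E].

Let w01 (w p : R) : (0 <= w <= 1 -> 0 <= p <= 1 -> 0 <= w * p <= 1)%R.
Proof. by move=> /andP[w0 w1] /andP[p0 p1]; rewrite mulr_ge0//= mulr_ile1. Qed.

(** Truncation keeps the weight in [[0, 1]] at every tuple, also where some coordinate is negative;
    it is invisible on the values of [Y1] and [Y2]. *)
Let clip (c : 'I_N -> nat) (y : N.-tuple R) : R := (Num.min 1 (expsum c y))%R.

Let clipE c y : (forall i, 0 <= tnth y i)%R -> clip c y = expsum c y.
Proof. by move=> y0; rewrite /clip min_r// expsum_le1. Qed.

Let clip01 c y : (0 <= clip c y <= 1)%R.
Proof. by rewrite /clip le_min ler01 expR_ge0/= ge_min lexx. Qed.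

Let measurable_clip c : measurable_fun setT (clip c).
Proof. by apply: measurable_minr => //; exact: measurable_expsum. Qed.

Let same_transform_onem w c : same_transform w ->
  same_transform (fun y => w y * (1 - clip c y))%R.
Proof.
move=> [mw w_01 sw]; split.
- by apply: measurable_funM => //; apply: measurable_funB => //; exact: measurable_clip.
- by move=> y; apply: w01 => //; have := clip01 c y; lra.
have split_int d (T : measurableType d) (n : {measure set T -> \bar R})
    (Y : T -> N.-tuple R) e : n setT < +oo -> measurable_fun setT Y ->
    (forall t i, (0 <= tnth (Y t) i)%R) ->
    \int[n]_t (w (Y t) * (1 - clip c (Y t)) * expsum e (Y t))%:E =
    \int[n]_t (w (Y t) * expsum e (Y t))%:E -
    \int[n]_t (w (Y t) * expsum (fun i => (c i + e i)%N) (Y t))%:E.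
  move=> noo mY Y0.
  have ew e' : n.-integrable setT (fun t => (w (Y t) * expsum e' (Y t))%:E).
    apply: integrable_unit_bounded => //.
      apply: measurable_funM; first exact: (measurableT_comp mw).
      by apply: measurableT_comp => //; exact: measurable_expsum.
    by move=> t; apply: w01 => //; rewrite expR_ge0 expsum_le1.
  transitivity (\int[n]_t ((w (Y t) * expsum e (Y t))%:E -
      (w (Y t) * expsum (fun i => (c i + e i)%N) (Y t))%:E)); last first.
    exact: (integralB_EFin measurableT (ew e) (ew _)).
  apply: eq_integral => t _; rewrite -EFinB; congr (_%:E).
  by rewrite clipE// expsumD; ring.
by move=> e; rewrite !split_int// !sw.
Qed.

Let same_transform_iter w c M : same_transform w ->
  same_transform (fun y => w y * (1 - clip c y) ^+ M)%R.
Proof.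
move=> sw; elim: M => [|M IH].
  by rewrite (_ : (fun _ => _) = w)//; apply/funext => y; rewrite mulr1.
have := same_transform_onem c IH.
by congr same_transform; apply/funext => y; rewrite exprSr mulrA.
Qed.

Let same_transform_threshold w j b : same_transform w ->
  same_transform (fun y => w y * (b < tnth y j)%R%:R)%R.
Proof.
move=> sw; have [mw w_01 sw'] := sw.
have mlt : measurable_fun setT (fun y : N.-tuple R => (b < tnth y j)%R%:R : R).
  rewrite (_ : (fun _ => _) = (fun y => if (b < tnth y j)%R then 1%R else 0%R)).
    apply: measurable_fun_ifT => //; apply: measurable_fun_ltr => //.
    exact: measurable_tnth.
  by apply/funext => y; case: ifP.
split.
- by apply: measurable_funM.
- by move=> y; apply: w01 => //; case: ltP; rewrite ?lexx ?ler01.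
(* [cvg_threshold] asks for [b >= 0]; for negative [b] the indicator is 1 on the nonnegative
   orthant. *)
have [b0|b0] := ltP b 0%R.
  move=> c; transitivity (\int[n1]_t (w (Y1 t) * expsum c (Y1 t))%:E).
    by apply: eq_integral => t _; rewrite (lt_le_trans b0 (Y1_ge0 _ _)) mulr1.
  rewrite sw'; apply: eq_integral => t _.
  by rewrite (lt_le_trans b0 (Y2_ge0 _ _)) mulr1.
pose e n : 'I_N -> nat := fun i => if i == j then n else 0%N.
have eE n y : (forall i, 0 <= tnth y i)%R -> clip (e n) y = expR (- (n%:R * tnth y j)).
  move=> y0; rewrite clipE// /expsum (bigD1 j)//= /e eqxx big1 ?addr0//.
  by move=> i /negbTE ->; rewrite mul0r.
pose u n y := (w y * (1 - clip (e n) y) ^+ threshold_exponent b n)%R.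
have su n : same_transform (u n) by exact: same_transform_iter.
have lim_int d (T : measurableType d) (n : {measure set T -> \bar R})
    (Y : T -> N.-tuple R) c : n setT < +oo -> measurable_fun setT Y ->
    (forall t i, (0 <= tnth (Y t) i)%R) ->
    \int[n]_t (u k (Y t) * expsum c (Y t))%:E @[k --> \oo] -->
    \int[n]_t (w (Y t) * (b < tnth (Y t) j)%R%:R * expsum c (Y t))%:E.
  move=> noo mY Y0; apply: (@dominated_cvg _ _ _ _ _ _ _ _ (cst 1)) => //.
  - move=> k; apply/measurable_EFinP; have [mu _ _] := su k.
    apply: measurable_funM; first exact: (measurableT_comp mu).
    by apply: measurableT_comp => //; exact: measurable_expsum.
  - move=> t _; apply: cvg_EFin; first exact: nearW.
    apply: cvgMl; apply: cvgMr; under eq_fun do rewrite eE//.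
    exact: cvg_threshold.
  - by apply: (@integrable_unit_bounded _ _ _ _ (cst 1%R)) => // y; rewrite /= ler01 lexx.
  - move=> k t _; rewrite /= lee_fin.
    have /andP[h0 h1] : (0 <= u k (Y t) * expsum c (Y t) <= 1)%R.
      apply: w01; first by have [_ + _] := su k; exact.
      by rewrite expR_ge0 expsum_le1.
    by rewrite ger0_norm.
move=> c; apply: (cvg_unique _ (lim_int _ _ n1 Y1 c n1oo mY1 Y1_ge0)) => //.
apply: cvg_trans (lim_int _ _ n2 Y2 c n2oo mY2 Y2_ge0).
by apply: near_eq_cvg; apply: nearW => k; have [_ _ ->] := su k.
Qed.

(** The orthants form a generating family closed under intersection, so it suffices that their
    indicators belong to [same_transform], tested at exponent 0. *)
Lemma laplace_uniqueness :
  (forall c, \int[n1]_t (expsum c (Y1 t))%:E = \int[n2]_t (expsum c (Y2 t))%:E) ->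
  forall A, measurable A -> n1 (Y1 @^-1` A) = n2 (Y2 @^-1` A).
Proof.
move=> hc A mA.
pose m1 := measure_function_pushforward__canonical__measure_function_Measure n1 mY1.
pose m2 := measure_function_pushforward__canonical__measure_function_Measure n2 mY2.
have s1 : same_transform (cst 1%R).
  split => //; first by move=> y; rewrite /= ler01 lexx.
  by move=> c; under eq_integral do rewrite mul1r; rewrite hc; under [RHS]eq_integral do rewrite mul1r.
have sG b : same_transform (fun y => \prod_(i < N) (b i < tnth y i)%R%:R)%R.
  have : same_transform (fun y => \prod_(i <- index_enum 'I_N) (b i < tnth y i)%R%:R)%R.
    elim: (index_enum _) => [|i l IH].
      by rewrite (_ : (fun _ => _) = cst 1%R)//; apply/funext => y; rewrite big_nil.
    have := same_transform_threshold i (b i) IH.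
    by congr same_transform; apply/funext => y; rewrite big_cons mulrC.
  by [].
pose G := [set [set y : N.-tuple R | forall i, (b i < tnth y i)%R] | b in [set: 'I_N -> R]].
have mG : G `<=` measurable.
  move=> _ [b _ <-]; rewrite (_ : mkset _ = \bigcap_(i in [set: 'I_N]) (fun y => tnth y i) @^-1` `]b i, +oo[%classic).
    apply: fin_bigcap_measurable => // i _; rewrite -[X in measurable X]setTI.
    exact: measurable_tnth.
  apply/seteqP; split => y /= h i; first by move=> _ /=; rewrite in_itv/= h.
  by have := h i Logic.I; rewrite /= in_itv/= andbT.
apply: (@g_sigma_algebra_measure_unique _ R _ G mG
  (fun k => [set y : N.-tuple R | forall i, (- k%:R < tnth y i)%R]) _ _ m1 m2).
- by move=> k; exists (fun=> (- k%:R)%R).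
- apply/seteqP; split => // y _; exists (truncn (\sum_j `|tnth y j|)%R).+1 => //= i.
  rewrite ltrNl (le_lt_trans _ (truncnS_gt _))// (bigD1 i)//=.
  rewrite -[leLHS]addr0 lerD// ?sumr_ge0//.
  by rewrite (le_trans (ler_norm _)) ?normrN.
- move=> _ _ [b _ <-] [e _ <-]; exists (fun i => Num.max (b i) (e i)) => //.
  apply/seteqP; split => y /=.
    by move=> h; split => i; have := h i; rewrite gt_max => /andP[].
  by move=> [hb he] i; rewrite gt_max hb he.
- move=> _ [b _ <-].
  have [_ _ /(_ (fun=> 0%N))] := sG b.
  have E d (T : measurableType d) (n : {measure set T -> \bar R}) (Y : T -> N.-tuple R) :
      measurable_fun setT Y ->
      \int[n]_t (\prod_(i < N) (b i < tnth (Y t) i)%R%:R * expsum (fun=> 0%N) (Y t))%:E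
      = n (Y @^-1` [set y | forall i, (b i < tnth y i)%R]).
    move=> mY; rewrite -[X in n X]setIT -integral_indic//; last first.
      by rewrite -[X in measurable X]setTI; apply: mY => //; apply: mG; exists b.
    apply: eq_integral => t _; rewrite expsum0 mulr1.
    rewrite indicE; congr (_%:E); case: (boolP (t \in _)).
      by rewrite inE/= => h; rewrite big1// => i _; rewrite h.
    rewrite notin_setE/= => /existsNP[i /negP/negbTE h].
    by rewrite (bigD1 i)//= h mul0r.
  by rewrite !E.
- by move=> k; apply: le_lt_trans n1oo; rewrite /= /pushforward le_measure ?inE//;
    rewrite -[X in measurable X]setTI; apply: mY1 => //; apply: mG; exists (fun=> (- k%:R)%R).
- exact: measurable_tupleP.
Qed.

End laplace_uniqueness.

(** * From Laplace to generalized Stieltjes transforms *)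

Section stieltjes_uniqueness.
Context (R : realType).
Notation leb := (@lebesgue_measure R).
Notation mR := (measurableTypeR R).
Local Open Scope ereal_scope.
Variables (b : R) (k : nat).
Hypothesis b0 : (0 < b)%R.

(** Recovers [X] from [(r, r X)]. The power [- 1] serves as a measurable inverse, correct when the
    first coordinate is positive. *)
Definition unscale (y : k.+1.-tuple R) : k.-tuple R :=
  [tuple (tnth y (lift ord0 i) * tnth y ord0 `^ (- 1))%R | i < k].

Lemma measurable_unscale (A : set (k.-tuple R)) : measurable A ->
  measurable (unscale @^-1` A).
Proof.
move=> mA; rewrite -[X in measurable X]setTI.
have : measurable_fun setT unscale; last exact.
apply/measurable_fun_tnthP => i.
rewrite (_ : _ \o _ = (fun y => tnth y (lift ord0 i) * tnth y ord0 `^ (- 1))%R); last first.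
  by apply/funext => p /=; rewrite tnth_mktuple.
apply: measurable_funM; first exact: measurable_tnth.
by apply: (measurableT_comp (measurable_powR _)); exact: measurable_tnth.
Qed.

Section randomization.
Context d (T : measurableType d) (m : {finite_measure set T -> \bar R}).
Let g (p : T * mR) : R := gamma_fun b 1 p.2.

Let mg : measurable_fun setT g.
Proof. by apply: (measurableT_comp (measurable_gamma_fun b 1)); exact: measurable_snd. Qed.

Let g0 p : (0 <= g p)%R.
Proof. exact: gamma_fun_ge0. Qed.

(* The joint law of [T] and an independent Gamma([b]) variable, up to the factor
   [Gamma b]. *)
Definition randomized := mdens (m \x leb) mg g0.

HB.instance Definition _ := Measure.on randomized.

Variable X : T -> k.-tuple R.
Hypothesis mX : measurable_fun setT X.
Hypothesis X_ge0 : forall t i, (0 <= tnth (X t) i)%R.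

(** The absolute value makes every coordinate nonnegative, as [laplace_uniqueness] demands; under
    [randomized] the scale is positive almost everywhere. *)
Definition scaled (p : T * mR) : k.+1.-tuple R :=
  [tuple of `|p.2|%R :: [tuple (`|p.2| * tnth (X p.1) i)%R | i < k]].

Lemma measurable_scaled : measurable_fun setT scaled.
Proof.
have mn : measurable_fun setT (fun p : T * mR => `|p.2|%R : R).
  by apply: measurableT_comp => //; exact: measurable_snd.
apply: measurable_cons => //; apply/measurable_fun_tnthP => i.
rewrite (_ : _ \o _ = (fun p : T * mR => (`|p.2| * tnth (X p.1) i)%R)); last first.
  by apply/funext => p /=; rewrite tnth_mktuple.
apply: measurable_funM => //.
apply: (measurableT_comp (measurable_tnth i)).
by apply: measurableT_comp => //; exact: measurable_fst.
Qed.

Lemma scaled_ge0 p i : (0 <= tnth (scaled p) i)%R.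
Proof.
case: (unliftP ord0 i) => [j|] -> /=; last by rewrite normr_ge0.
by rewrite tnthS tnth_mktuple mulr_ge0.
Qed.

Lemma integral_randomized (f : T * mR -> R) : measurable_fun setT f ->
  (forall p, (0 <= f p)%R) ->
  \int[randomized]_p (f p)%:E =
  \int[m]_t \int[leb]_r (f (t, r) * gamma_fun b 1 r)%:E.
Proof.
move=> mf f0; rewrite integral_mdens// fubini_tonelli1//.
- by apply/measurable_EFinP; apply: measurable_funM => //; exact: mg.
- by move=> p; rewrite lee_fin mulr_ge0//; exact: g0.
Qed.

Lemma randomized_fin : randomized setT < +oo.
Proof.
rewrite /randomized /mdens fubini_tonelli1//; last first.
  by apply/measurable_EFinP; exact: mg.
under eq_integral => t _.
  rewrite /fubini_F /g /= integral_gamma_fun//.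
  over.
rewrite integral_cst// lte_mul_pinfty// ?lee_fin ?powR1 ?mulr1 ?ltW ?Gamma_gt0//.
by rewrite -ge0_fin_numE// fin_num_measure.
Qed.

(** Integrating out the scale is a Gamma integral. The summand 1 comes from the factor [e^(- r)] of
    the Gamma density, which is why transforms are compared for [s >= 1]. *)
Lemma integral_randomized_expsum (c : 'I_k.+1 -> nat) :
  \int[randomized]_p (expsum c (scaled p))%:E = (Gamma b)%:E *
  \int[m]_t ((1 + (c ord0)%:R + \sum_(i < k) (c (lift ord0 i))%:R * tnth (X t) i)
    `^ (- b))%R%:E.
Proof.
pose s t : R := (1 + (c ord0)%:R + \sum_(i < k) (c (lift ord0 i))%:R * tnth (X t) i)%R.
have s0 t : (0 < s t)%R.
  rewrite /s -addrA ltr_wpDr// addr_ge0//; apply: sumr_ge0 => i _.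
  by rewrite mulr_ge0.
rewrite (integral_randomized (f := fun p => expsum c (scaled p))); last 2 first.
- exact: (measurableT_comp (measurable_expsum c) measurable_scaled).
- by move=> p; exact: expR_ge0.
rewrite -ge0_integralZl//; last 3 first.
- apply/measurable_EFinP; mfun; apply: measurable_sum => i.
  by apply: measurable_funM => //; exact: (measurableT_comp (measurable_tnth i)).
- by move=> t _; rewrite lee_fin powR_ge0.
- by rewrite lee_fin ltW// Gamma_gt0.
apply: eq_integral => t _; rewrite -EFinM -(integral_gamma_fun b0 (s0 t)).
apply: eq_integral => r _; rewrite /gamma_fun; case: ifPn => r0; last by rewrite mulr0.
rewrite mulrCA; congr ((_ * _)%:E); rewrite /expsum -expRD; congr expR.
rewrite big_ord_recl [tnth _ ord0](tnth_nth 0%R)/= gtr0_norm// -opprD; congr (- _)%R.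
have -> : (\sum_(i < k) (c (lift ord0 i))%:R * tnth (scaled (t, r)) (lift ord0 i) =
    r * \sum_(i < k) (c (lift ord0 i))%:R * tnth (X t) i)%R.
  rewrite mulr_sumr; apply: eq_bigr => i _.
  by rewrite tnthS tnth_mktuple/= gtr0_norm//; ring.
by rewrite /s; ring.
Qed.

Lemma randomized_preimage (A : set (k.-tuple R)) : measurable A ->
  randomized (scaled @^-1` (unscale @^-1` A)) = (Gamma b)%:E * m (X @^-1` A).
Proof.
move=> mA; have mB := measurable_unscale mA; pose u := unscale.
have mXA : measurable (X @^-1` A) by rewrite -[X in measurable X]setTI; exact: mX.
have mSB : measurable (scaled @^-1` (u @^-1` A)).
  by rewrite -[X in measurable X]setTI; exact: measurable_scaled.
transitivity (\int[randomized]_p (\1_(scaled @^-1` (u @^-1` A)) p)%:E).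
  by rewrite integral_indic// setIT.
rewrite (integral_randomized (f := \1_(scaled @^-1` (u @^-1` A)))); last 2 first.
- exact: measurable_indic.
- by [].
have uK t r : (0 < r)%R -> u (scaled (t, r)) = X t.
  move=> r0; apply: eq_from_tnth => i; rewrite tnth_mktuple tnthS tnth_mktuple.
  rewrite [tnth _ ord0](tnth_nth 0%R)/= gtr0_norm// powR_inv1 ?ltW// mulrAC.
  by rewrite mulfV ?mul1r// gt_eqF.
transitivity (\int[m]_t ((Gamma b)%:E * (\1_(X @^-1` A) t)%:E)).
  apply: eq_integral => t _.
  transitivity (\int[leb]_r ((\1_(X @^-1` A) t)%:E * (gamma_fun b 1 r)%:E)).
    apply: eq_integral => r _; rewrite /gamma_fun -EFinM; case: ifPn => r0; last first.
      by rewrite !mulr0.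
    congr ((_ * _)%:E); rewrite !indicE; congr ((nat_of_bool _)%:R).
    by apply/idP/idP; rewrite !inE/= uK.
  rewrite ge0_integralZl//; last 2 first.
  - by apply/measurable_EFinP; exact: measurable_gamma_fun.
  - by move=> r _; rewrite lee_fin gamma_fun_ge0.
  by rewrite integral_gamma_fun// powR1 mulr1 muleC.
rewrite ge0_integralZl//; last 2 first.
- by apply/measurable_EFinP; exact: measurable_indic.
- by rewrite lee_fin ltW// Gamma_gt0.
by rewrite integral_indic// setIT.
Qed.

End randomization.

(** The Laplace transforms of [(r, r X1)] and [(r, r X2)] agree, hence so do their laws; [unscale]
    returns to [X1] and [X2] up to the common factor [Gamma b]. *)
Lemma stieltjes_uniqueness d1 (T1 : measurableType d1)
    (m1 : {finite_measure set T1 -> \bar R}) d2 (T2 : measurableType d2)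
    (m2 : {finite_measure set T2 -> \bar R})
    (X1 : T1 -> k.-tuple R) (X2 : T2 -> k.-tuple R) :
  measurable_fun setT X1 -> measurable_fun setT X2 ->
  (forall t i, 0 <= tnth (X1 t) i)%R -> (forall t i, 0 <= tnth (X2 t) i)%R ->
  (forall (s : R) (c : 'I_k -> R), (1 <= s)%R -> (forall i, 0 <= c i)%R ->
    \int[m1]_t ((s + \sum_(i < k) c i * tnth (X1 t) i) `^ (- b))%R%:E =
    \int[m2]_t ((s + \sum_(i < k) c i * tnth (X2 t) i) `^ (- b))%R%:E) ->
  forall A, measurable A -> m1 (X1 @^-1` A) = m2 (X2 @^-1` A).
Proof.
move=> mX1 mX2 X10 X20 h A mA.
have hc c : \int[randomized m1]_t (expsum c (scaled X1 t))%:E =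
    \int[randomized m2]_t (expsum c (scaled X2 t))%:E.
  by rewrite !integral_randomized_expsum//; congr (_ * _); apply: h => //; rewrite lerDl.
have H : randomized m1 (scaled X1 @^-1` (unscale @^-1` A)) =
    randomized m2 (scaled X2 @^-1` (unscale @^-1` A)).
  by apply: laplace_uniqueness; first [exact: randomized_fin|exact: measurable_scaled|
    exact: scaled_ge0|exact: measurable_unscale|exact: hc].
have G0 := Gamma_gt0 b0.
rewrite !randomized_preimage// in H.
have mXA1 : measurable (X1 @^-1` A) by rewrite -[X in measurable X]setTI; exact: mX1.
have mXA2 : measurable (X2 @^-1` A) by rewrite -[X in measurable X]setTI; exact: mX2.
have f1 := fin_num_measure m1 _ mXA1; have f2 := fin_num_measure m2 _ mXA2.
move: H; rewrite -(fineK f1) -(fineK f2) -!EFinM => -[] /mulfI -> //.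
by rewrite gt_eqF.
Qed.

End stieltjes_uniqueness.

(** * A contour integral *)

Section cauchy_riemann.
Context (R : realType).
Implicit Types (F G : R * R -> R * R) (z : R * R).

Definition cmul (a b : R * R) : R * R := (a.1 * b.1 - a.2 * b.2, a.1 * b.2 + a.2 * b.1).
Definition csub (a b : R * R) : R * R := (a.1 - b.1, a.2 - b.2).
Definition csqn (a : R * R) : R := a.1 ^+ 2 + a.2 ^+ 2.
Definition cinv (a : R * R) : R * R := (a.1 / csqn a, - a.2 / csqn a).
Definition cexp (a : R * R) : R * R := (expR a.1 * cos a.2, expR a.1 * sin a.2).

Definition ccont F z := {for z, continuous (fun x => (F x).1)} /\
  {for z, continuous (fun x => (F x).2)}.

(* Complex numbers are pairs; [holo] is the Cauchy-Riemann system with complex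
   derivative [F' z]. *)
Definition holo F (F' : R * R -> R * R) z :=
  [/\ is_derive z.1 1 (fun x => (F (x, z.2)).1) (F' z).1,
      is_derive z.2 1 (fun y => (F (z.1, y)).2) (F' z).1,
      is_derive z.1 1 (fun x => (F (x, z.2)).2) (F' z).2
    & is_derive z.2 1 (fun y => (F (z.1, y)).1) (- (F' z).2)] /\
  ccont F z /\ ccont F' z.

Lemma ccont_cst (a : R * R) z : ccont (fun=> a) z.
Proof. by split; exact: cst_continuous. Qed.

Lemma ccont_id z : ccont id z.
Proof. by split; [exact: cvg_fst|exact: cvg_snd]. Qed.

Lemma ccont_sub F G z : ccont F z -> ccont G z -> ccont (fun x => csub (F x) (G x)) z.
Proof. by move=> [F1 F2] [G1 G2]; split; exact: cvgB. Qed.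

Lemma ccont_mul F G z : ccont F z -> ccont G z -> ccont (fun x => cmul (F x) (G x)) z.
Proof.
move=> [F1 F2] [G1 G2]; split; [apply: cvgB|apply: cvgD]; exact: cvgM.
Qed.

Lemma csqn_eq0 (a : R * R) : (csqn a == 0) = (a == (0, 0)).
Proof.
case: a => x y; rewrite /csqn paddr_eq0 ?sqr_ge0//= !sqrf_eq0.
by rewrite -pair_eqE.
Qed.

Lemma ccont_inv F z : ccont F z -> F z != (0, 0) -> ccont (fun x => cinv (F x)) z.
Proof.
move=> [F1 F2] Fz; have n0 : csqn (F z) != 0 by rewrite csqn_eq0.
have cn : {for z, continuous (fun x => (csqn (F x))^-1)}.
  by apply: cvgV => //; apply: cvgD; rewrite expr2; under eq_fun do rewrite expr2; exact: cvgM.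
by split; apply: cvgM => //; exact: cvgN.
Qed.

Lemma ccont_exp F z : ccont F z -> ccont (fun x => cexp (F x)) z.
Proof.
move=> [F1 F2]; split; apply: cvgM;
  (apply: continuous_comp; [by []|first [exact: continuous_expR|exact: continuous_cos|exact: continuous_sin]]).
Qed.

Lemma holo_cst (a : R * R) z : holo (fun=> a) (fun=> (0, 0)) z.
Proof.
split; last by split; exact: ccont_cst.
by rewrite /= oppr0; split; exact: is_derive_cst.
Qed.

Lemma holo_id z : holo id (fun=> (1, 0)) z.
Proof.
split; last by split; [exact: ccont_id|exact: ccont_cst].
by rewrite /= oppr0; split; [exact: is_derive_id|exact: is_derive_id|exact: is_derive_cst|exact: is_derive_cst].
Qed.

Lemma holo_sub F (F' : R * R -> R * R) G (G' : R * R -> R * R) z : holo F F' z -> holo G G' z ->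
  holo (fun x => csub (F x) (G x)) (fun x => csub (F' x) (G' x)) z.
Proof.
move=> [[F1 F2 F3 F4] [cF cF']] [[G1 G2 G3 G4] [cG cG']].
split; last by split; exact: ccont_sub.
split; rewrite /= ?opprB; [exact: is_deriveB|exact: is_deriveB|exact: is_deriveB|].
by apply: is_derive_eq (is_deriveB F4 G4) _; ring.
Qed.

Lemma holo_mul F (F' : R * R -> R * R) G (G' : R * R -> R * R) z : holo F F' z -> holo G G' z ->
  holo (fun x => cmul (F x) (G x))
    (fun x => (cmul (F' x) (G x) + cmul (F x) (G' x))) z.
Proof.
move=> [[F1 F2 F3 F4] [cF cF']] [[G1 G2 G3 G4] [cG cG']].
split; last first.
  split; first exact: ccont_mul.
  have [h1 h2] := ccont_mul cF' cG; have [h3 h4] := ccont_mul cF cG'.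
  by split; exact: cvgD.
case: z F1 F2 F3 F4 G1 G2 G3 G4 {cF cF' cG cG'} => u y /= F1 F2 F3 F4 G1 G2 G3 G4.
split => /=.
- apply: is_derive_eq (is_deriveB (is_deriveM F1 G1) (is_deriveM F3 G3)) _.
  by rewrite /GRing.scale/=; ring.
- apply: is_derive_eq (is_deriveD (is_deriveM F4 G2) (is_deriveM F2 G4)) _.
  by rewrite /GRing.scale/=; ring.
- apply: is_derive_eq (is_deriveD (is_deriveM F1 G3) (is_deriveM F3 G1)) _.
  by rewrite /GRing.scale/=; ring.
- apply: is_derive_eq (is_deriveB (is_deriveM F4 G4) (is_deriveM F2 G2)) _.
  by rewrite /GRing.scale/=; ring.
Qed.

Lemma holo_inv F (F' : R * R -> R * R) z : holo F F' z -> F z != (0, 0) ->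
  holo (fun x => cinv (F x))
    (fun x => cmul (- F' x) (cmul (cinv (F x)) (cinv (F x)))) z.
Proof.
move=> [[F1 F2 F3 F4] [cF cF']] n0.
have cI := ccont_inv cF n0.
split; last first.
  split; first exact: cI.
  apply: (ccont_mul (F := fun x => - F' x)); last exact: (ccont_mul cI cI).
  by case: cF' => h1 h2; split; exact: cvgN.
case: z F1 F2 F3 F4 {cF cF' cI} n0 => u y /= F1 F2 F3 F4 n0.
have s0 : csqn (F (u, y)) != 0 by rewrite csqn_eq0.
have s0' := s0; rewrite /csqn in s0'.
have dq (f g : R -> R) (x f' g' : R) : is_derive x 1 f f' -> is_derive x 1 g g' ->
    f x ^+ 2 + g x ^+ 2 != 0 ->
    is_derive x 1 (fun x => (f x ^+ 2 + g x ^+ 2)^-1)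
      (- (f x ^+ 2 + g x ^+ 2) ^- 2 * (2 * f x * f' + 2 * g x * g')).
  move=> df dg fg0; apply: is_derive_eq; rewrite /GRing.scale/=; ring.
split => /=.
- apply: is_derive_eq (is_deriveM F1 (dq _ _ _ _ _ F1 F3 s0')) _.
  by rewrite /GRing.scale/= /csqn; field.
- apply: is_derive_eq (is_deriveM (is_deriveN F2) (dq _ _ _ _ _ F4 F2 s0')) _.
  by rewrite /GRing.scale/= ?opprfctE /csqn; field.
- apply: is_derive_eq (is_deriveM (is_deriveN F3) (dq _ _ _ _ _ F1 F3 s0')) _.
  by rewrite /GRing.scale/= ?opprfctE /csqn; field.
- apply: is_derive_eq (is_deriveM F4 (dq _ _ _ _ _ F4 F2 s0')) _.
  by rewrite /GRing.scale/= /csqn; field.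
Qed.

Lemma holo_exp F (F' : R * R -> R * R) z : holo F F' z ->
  holo (fun x => cexp (F x)) (fun x => cmul (F' x) (cexp (F x))) z.
Proof.
move=> [[F1 F2 F3 F4] [cF cF']].
have cE := ccont_exp cF.
split; last by split; [exact: cE|exact: (ccont_mul cF' cE)].
case: z F1 F2 F3 F4 {cF cF' cE} => u y /= F1 F2 F3 F4.
have de (f : R -> R) (x f' : R) : is_derive x 1 f f' ->
    is_derive x 1 (fun x => expR (f x)) (expR (f x) * f').
  by move=> df; exact: (is_derive1_comp (is_derive_expR _) df).
have dc (f : R -> R) (x f' : R) : is_derive x 1 f f' ->
    is_derive x 1 (fun x => cos (f x)) (- sin (f x) * f').
  by move=> df; exact: (is_derive1_comp (is_derive_cos _) df).
have ds (f : R -> R) (x f' : R) : is_derive x 1 f f' ->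
    is_derive x 1 (fun x => sin (f x)) (cos (f x) * f').
  by move=> df; exact: (is_derive1_comp (is_derive_sin _) df).
split => /=.
- apply: is_derive_eq (is_deriveM (de _ _ _ F1) (dc _ _ _ F3)) _.
  by rewrite /GRing.scale/=; ring.
- apply: is_derive_eq (is_deriveM (de _ _ _ F4) (ds _ _ _ F2)) _.
  by rewrite /GRing.scale/=; ring.
- apply: is_derive_eq (is_deriveM (de _ _ _ F1) (ds _ _ _ F3)) _.
  by rewrite /GRing.scale/=; ring.
- apply: is_derive_eq (is_deriveM (de _ _ _ F4) (dc _ _ _ F2)) _.
  by rewrite /GRing.scale/=; ring.
Qed.

End cauchy_riemann.

(** * Cauchy's theorem on a horizontal strip *)

Section strip.
Context (R : realType).
Notation leb := (@lebesgue_measure R).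
Notation mR := (measurableTypeR R).

Lemma compact_rectangle_bound (f : R * R -> R) (a b c e : R) :
  (forall x y, x \in `[a, b] -> y \in `[c, e] -> {for (x, y), continuous f}) ->
  exists2 M : R, 0 < M & forall x y, x \in `[a, b] -> y \in `[c, e] -> `|f (x, y)| <= M.
Proof.
move=> cf; pose A := (`[a, b]%classic `*` `[c, e]%classic : set (R * R)).
have cA : compact A by apply: compact_setX; exact: segment_compact.
have cfA : {within A, continuous f}.
  apply/continuous_in_subspaceT => -[x y]; rewrite inE => -[/= xab yce].
  exact: cf.
have /ex_strict_bound_gt0[M M0 hM] : bounded_set (f @` A).
  exact/compact_bounded/continuous_compact.
exists M => // x y xab yce; apply/ltW/hM.
by exists (x, y).
Qed.

Lemma holo_continuous1 F (F' : R * R -> R * R) (x y : R) : holo F F' (x, y) ->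
  {for x, continuous (fun x => (F (x, y)).1)} /\ {for x, continuous (fun x => (F (x, y)).2)}.
Proof.
move=> [[[/= d1 _] _ [d2 _] _] _].
by split; apply: differentiable_continuous; apply/derivable1_diffP.
Qed.

Variables F F' : R * R -> R * R.
Hypothesis Fh : forall u y, 0 < y < 2 * pi -> holo F F' (u, y).

Let ccontF' u y : 0 < y < 2 * pi -> {for (u, y), continuous (fun z => (F' z).1)}.
Proof. by move=> /(Fh u)[_ [_ []]]. Qed.

Lemma pair_continuous (y u : R) : {for u, continuous (fun u => (u, y))}.
Proof.
exact: (@cvg_pair R R R (nbhs u) (nbhs u) (nbhs y) _ _ _ id (fun=> y) cvg_id (cvg_cst y)).
Qed.

(** Cauchy's theorem on a rectangle in real form. By the Cauchy-Riemann equations the [y]-derivative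
    of the integral of [Im F] is the integral of the [u]-derivative of [Re F], that is
    [Re F (L, y) - Re F (- L, y)]; the mean value theorem concludes. *)
Lemma strip_segment (L y1 y2 C : R) : 0 < L -> 0 < y1 -> y1 < y2 -> y2 < 2 * pi ->
  (forall y, y \in `[y1, y2] -> `|(F (L, y)).1| + `|(F (- L, y)).1| <= C) ->
  `|\int[leb]_(u in `[- L, L]) (F (u, y2)).2 - \int[leb]_(u in `[- L, L]) (F (u, y1)).2|
  <= C * (y2 - y1).
Proof.
move=> L0 y10 y12 y22 hC.
have LL : - L < L by rewrite gtrN.
(* An open interval around [[y1, y2]] inside the strip, so that differentiation under the integral
   is available at the end points too. *)
pose v1 := y1 / 2; pose v2 := (y2 + 2 * pi) / 2.
have v10 : 0 < v1 by rewrite /v1 divr_gt0.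
have v1y : v1 < y1 by rewrite /v1; lra.
have v2y : y2 < v2 by rewrite /v2; lra.
have v2p : v2 < 2 * pi by rewrite /v2; lra.
have inv y : y \in `[v1, v2] -> 0 < y < 2 * pi.
  by rewrite in_itv/= => /andP[h1 h2]; apply/andP; split; lra.
have [M M0 hM] : exists2 M : R, 0 < M & forall x y, x \in `[- L, L] -> y \in `[v1, v2] ->
    `|(F' (x, y)).1| <= M.
  apply: (@compact_rectangle_bound (fun z => (F' z).1)) => x y _ /inv; exact: ccontF'.
pose G y := \int[leb]_(u in `[- L, L]) (F (u, y)).2.
pose dG y := (F (L, y)).1 - (F (- L, y)).1.
have dF2 (u y : R) : 0 < y < 2 * pi -> is_derive y 1 (fun y => (F (u, y)).2) (F' (u, y)).1.
  by move=> /(Fh u)[[]].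
have dF1 (u y : R) : 0 < y < 2 * pi -> is_derive u 1 (fun u => (F (u, y)).1) (F' (u, y)).1.
  by move=> /(Fh u)[[]].
have d12 y u : 0 < y < 2 * pi ->
    partial1of2 (fun y u => (F (u, y)).2) y u = (F' (u, y)).1.
  by move=> hy; rewrite partial1of2E; case: (dF2 u y hy).
have intf y : 0 < y < 2 * pi ->
    leb.-integrable `[- L, L] (EFin \o (fun u => (F (u, y)).2)).
  move=> hy; apply: continuous_compact_integrable; first exact: segment_compact.
  apply: (continuous_segment LL) => u _.
  by have [] := holo_continuous1 (Fh u hy).
have dGP y : y \in `[y1, y2] -> is_derive y 1 G (dG y).
  rewrite in_itv/= => /andP[yy1 yy2].
  have hy : 0 < y < 2 * pi by apply/andP; split; lra.
  have yI : `]v1, v2[%classic y by rewrite /= in_itv/=; apply/andP; split; lra.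
  have sub x : `]v1, v2[%classic x -> 0 < x < 2 * pi.
    by move=> xv; apply: inv; apply: subset_itv_oo_cc xv.
  have intM : leb.-integrable `[- L, L] (EFin \o (fun=> M)).
    apply: continuous_compact_integrable; first exact: segment_compact.
    by apply: (continuous_segment LL) => u _; exact: cst_continuous.
  have hder x u : `]v1, v2[%classic x -> `[- L, L]%classic u ->
      derivable (fun y => (F (u, y)).2) x 1.
    by move=> /sub xv _; case: (dF2 u x xv).
  have hbd x u : `]v1, v2[%classic x -> `[- L, L]%classic u ->
      `|partial1of2 (fun y u => (F (u, y)).2) x u| <= M.
    move=> xv uL; rewrite d12; last exact: sub.
    by apply: hM => //; apply: subset_itv_oo_cc xv.
  have hint x : `]v1, v2[%classic x -> 
      leb.-integrable `[- L, L] (EFin \o (fun u => (F (u, x)).2)).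
    by move=> /sub; exact: intf.
  have mL : measurable (`[- L, L]%classic : set mR) by [].
  split.
    apply: (@derivable_under_integral R _ mR leb (fun y u => (F (u, y)).2) _ mL y v1 v2 yI
      hint hder (fun=> M) (fun=> ltW M0) intM hbd).
  rewrite -derive1E.
  rewrite (@differentiation_under_integral R _ mR leb (fun y u => (F (u, y)).2) _ mL y v1 v2 yI
      hint hder (fun=> M) (fun=> ltW M0) intM hbd).
  under eq_Rintegral do rewrite d12//.
  rewrite /Rintegral (@continuous_FTC2 _ (fun u => (F' (u, y)).1) (fun u => (F (u, y)).1))//.
  - apply: (continuous_segment LL) => u _.
    apply: (@continuous_comp _ _ _ (fun u => (u, y)) (fun z => (F' z).1)).
      exact: pair_continuous.
    exact: ccontF'.
  - by apply: derivable_segment LL => u _; exact: dF1.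
  - by move=> u _; rewrite derive1E; case: (dF1 u y hy).
have cG : {within `[y1, y2], continuous G}.
  by apply: derivable_within_continuous => y /dGP[].
have [c cy ->] := MVT y12 (fun y hy => dGP y (subset_itv_oo_cc hy)) cG.
rewrite normrM (gtr0_norm (_ : 0 < y2 - y1)) ?subr_gt0// ler_wpM2r//; first by rewrite subr_ge0 ltW.
by apply: le_trans (ler_normB _ _) _; apply: hC; apply: subset_itv_oo_cc cy.
Qed.

Variable k : R -> R.
Hypothesis ik : leb.-integrable setT (EFin \o k).
Hypothesis bF : forall u y, 0 < y <= pi -> `|(F (u, y)).1| <= k u /\ `|(F (u, y)).2| <= k u.

Lemma measurable_strip y : 0 < y < 2 * pi -> measurable_fun setT (fun u : mR => (F (u, y)).2).
Proof.
move=> hy; apply: continuous_measurable_fun => u.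
by have [] := holo_continuous1 (Fh u hy).
Qed.

Lemma cvg_integral_segments (f : R -> R) : leb.-integrable setT (EFin \o f) ->
  (\int[leb]_(u in `[(- n.+1%:R)%R, (n.+1%:R)%R]) (f u)%:E)%E @[n --> \oo] --> (\int[leb]_u (f u)%:E)%E.
Proof.
move=> intf.
under eq_fun do rewrite integral_mkcond/=.
have mf := measurable_int _ intf.
apply: (@dominated_cvg _ mR _ leb setT measurableT _ (EFin \o f) (fun u => `|(f u)%:E|%E)) => //.
- move=> n; have /= h := @measurable_restrictT _ _ mR _ `[(- n.+1%:R), n.+1%:R]%classic (EFin \o f).
  by apply/h => //; exact: measurable_funTS.
- move=> u _; apply: cvg_near_cst; near=> n.
  rewrite patchE mem_set//= in_itv/= -ler_norml.
  by rewrite (le_trans (ltW (truncnS_gt _)))// ler_nat ltnS; near: n; exact: nbhs_infty_ge.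
- exact: integrable_abse.
- move=> n u _; rewrite patchE; case: ifPn => // _.
  by rewrite abse0.
Unshelve. all: end_near. Qed.

Hypothesis k_cvg : (k n.+1%:R + k (- n.+1%:R)) @[n --> \oo] --> 0.
Hypothesis F_bottom : {ae leb, forall u, (F (u, m.+1%:R^-1)).2 @[m --> \oo] --> 0}.

(** The line at height [pi] is compared with the one at height [1 / (m + 1)], whose contribution
    tends to 0, while the vertical sides vanish by [k_cvg]. Holomorphy up to height [2 * pi] makes
    the line at height [pi] interior. *)
Lemma strip_integral0 : leb.-integrable setT (fun u => ((F (u, pi)).2)%:E) /\
  (\int[leb]_u ((F (u, pi)).2)%:E = 0)%E.
Proof.
have pi0 := pi_gt0 R; have pi2 := pi_ge2 R.
have pi_in : 0 < (pi : R) < 2 * pi by apply/andP; split; lra.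
have int_y y : 0 < y <= pi -> leb.-integrable setT (EFin \o (fun u => (F (u, y)).2)).
  move=> hy; apply: le_integrable ik => //.
    by apply/measurable_EFinP; apply: measurable_strip; move/andP: hy => [h1 h2]; lra.
  move=> u _ /=; rewrite lee_fin (le_trans _ (ler_norm _))//.
  by have [] := bF u hy.
have ipi := int_y pi ltac:(lra); split; first exact: ipi.
have y_in m : 0 < (m.+1%:R^-1 : R) <= pi.
  rewrite invr_gt0 ltr0n/= (@le_trans _ _ 1)//; first by rewrite invf_le1 ?ltr0n// ler1n.
  by lra.
pose I n (y : R) := \int[leb]_(u in `[(- n.+1%:R), n.+1%:R]) (F (u, y)).2.
(* On a fixed segment the lower height goes to 0 first; only then does the segment grow. *)
have bn n : `|I n pi| <= (k n.+1%:R + k (- n.+1%:R)) * pi.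
  have cv : I n m.+1%:R^-1 @[m --> \oo] --> 0.
    apply: fine_cvg => /=.
    have -> : 0%:E = (\int[leb]_(u in `[(- n.+1%:R)%R, (n.+1%:R)%R]) 0)%E :> \bar R.
      by rewrite integral0.
    have mI : measurable (`[(- n.+1%:R), n.+1%:R]%classic : set mR) by [].
    suff [] : [/\ leb.-integrable `[(- n.+1%:R), n.+1%:R] (fun=> 0%E : \bar R),
        [sequence \int[leb]_(u in `[(- n.+1%:R)%R, (n.+1%:R)%R])
          `|((F (u, m.+1%:R^-1)).2)%:E - 0|]_m%E @ \oo --> 0%E &
        [sequence \int[leb]_(u in `[(- n.+1%:R)%R, (n.+1%:R)%R])
          ((F (u, m.+1%:R^-1)).2)%:E]_m%E @ \oo -->
         (\int[leb]_(u in `[(- n.+1%:R)%R, (n.+1%:R)%R]) (0 : \bar R))%E] by [].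
    apply: (@dominated_convergence _ mR _ leb _ mI _ _ (EFin \o k)).
    - move=> m; apply/measurable_EFinP/measurable_funTS; apply: measurable_strip.
      by have /andP[-> h2] := y_in m; rewrite (le_lt_trans h2)//; lra.
    - exact: measurable_cst.
    - case: F_bottom => N [mN N0 sN]; exists N; split => //; apply: subset_trans sN.
      apply: subsetC => u h _; apply: cvg_EFin; first exact: nearW.
      exact: h.
    - by apply: integrableS ik.
    - apply: aeW => u m _; rewrite lee_fin.
      by have [] := bF u (y_in m).
  have : `|I n pi - I n m.+1%:R^-1| @[m --> \oo] --> `|I n pi - 0|.
    by apply: cvg_norm; apply: cvgB => //; exact: cvg_cst.
  rewrite subr0 => cv'.
  apply: (closed_cvg (fun x => x <= _) (@closed_le R _) _ _ cv').
  near=> m; have /andP[y0 ypi] := y_in m.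
  have ylt : (m.+1%:R^-1 : R) < pi.
    by apply: (@le_lt_trans _ _ 1); [rewrite invf_le1 ?ltr0n// ler1n|lra].
  apply: (le_trans (@strip_segment n.+1%:R _ _ (k n.+1%:R + k (- n.+1%:R)) _ y0 ylt _ _)).
  - by rewrite ltr0n.
  - by lra.
  - move=> y; rewrite in_itv/= => /andP[h1 h2].
    have hy : 0 < y <= pi by rewrite h2 (lt_le_trans y0 h1).
    by apply: lerD; [have [] := bF n.+1%:R hy|have [] := bF (- n.+1%:R) hy].
  - rewrite ler_wpM2l//; last by rewrite gerBl ltW.
    have h : 0 < (pi : R) <= pi by lra.
    by rewrite addr_ge0//; [have [/(le_trans (normr_ge0 _))] := bF n.+1%:R h|
       have [/(le_trans (normr_ge0 _))] := bF (- n.+1%:R) h].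
have cI : I n pi @[n --> \oo] --> fine (\int[leb]_u ((F (u, pi)).2)%:E)%E.
  apply: fine_cvg; rewrite fineK; last exact: integrable_fin_num.
  exact: (cvg_integral_segments ipi).
have cI0 : I n pi @[n --> \oo] --> 0.
  apply: norm_cvg0; apply: (@squeeze_cvgr _ _ _ _ (cst 0) (fun n => (k n.+1%:R + k (- n.+1%:R)) * pi)).
  - by near=> n; rewrite normr_ge0 bn.
  - exact: cvg_cst.
  - by rewrite -(mul0r pi); apply: cvgMl.
rewrite -[LHS]fineK; last exact: integrable_fin_num.
by congr EFin; exact: cvg_unique cI cI0.
Unshelve. all: end_near. Qed.

End strip.

(** * The contour integrand and its bounds *)

Section contour.
Context (R : realType).
Notation leb := (@lebesgue_measure R).
Notation mR := (measurableTypeR R).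
Implicit Types (z w : R * R) (u y : R).

Lemma csqn_mul z w : csqn (cmul z w) = csqn z * csqn w.
Proof. by rewrite /csqn /cmul/=; ring. Qed.

Lemma csqn_inv z : z != (0, 0) -> csqn (cinv z) = (csqn z)^-1.
Proof.
move=> z0; have s0 : csqn z != 0 by rewrite csqn_eq0.
by rewrite {1}/csqn /cinv/=; move: s0; rewrite /csqn => s0; field.
Qed.

Lemma csqn_exp z : csqn (cexp z) = expR z.1 ^+ 2.
Proof. by rewrite /csqn /cexp/= !exprMn -mulrDr cos2Dsin2 mulr1. Qed.

Lemma csqn_sub_le z w : csqn (csub z w) <= 2 * csqn z + 2 * csqn w.
Proof.
rewrite /csqn /csub/=.
have := sqr_ge0 (z.1 + w.1); have := sqr_ge0 (z.2 + w.2); nra.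
Qed.

Lemma csqn_components z (K : R) : 0 <= K -> csqn z <= K ^+ 2 -> `|z.1| <= K /\ `|z.2| <= K.
Proof.
move=> K0 h; have := sqr_ge0 z.1; have := sqr_ge0 z.2; move: h; rewrite /csqn => h h2 h1.
by split; rewrite -(ger0_norm K0) -ler_sqr ?nnegrE ?normr_ge0// -!normrX !ger0_norm ?sqr_ge0//; lra.
Qed.

(** The equation [e^z = b > 0] forces [sin y = 0] and [cos y > 0], which leaves only [y = 0] below
    [2 * pi]. *)
Lemma csub_cexp_neq0 (b u y : R) : 0 < b -> 0 <= y < 2 * pi -> y != 0 \/ u != ln b ->
  csub (b, 0) (cexp (u, y)) != (0, 0).
Proof.
move=> b0 /andP[y0 y2] h; apply/eqP => -[/= h1 h2].
have e0 := expR_gt0 u.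
have s0 : sin y = 0.
  by move/eqP: h2; rewrite sub0r oppr_eq0 mulf_eq0 gt_eqF//= => /eqP.
have c0 : 0 < cos y by rewrite -(pmulr_rgt0 _ e0); move: h1; lra.
have [yE|yn] := eqVneq y 0.
  case: h => [|/eqP]; first by rewrite yE eqxx.
  by apply; move: h1; rewrite yE cos0 mulr1 => /eqP; rewrite subr_eq0 => /eqP ->; rewrite expRK.
have yp : 0 < y by rewrite lt_neqAle eq_sym yn.
have [ylt|ygt|yeq] := ltgtP y pi.
- by have := sin_gt0_pi (_ : 0 < y < pi); rewrite yp ylt s0 ltxx => /(_ isT).
- have : 0 < sin (y - pi) by apply: sin_gt0_pi; apply/andP; split; lra.
  by rewrite sinB s0 sinpi mul0r mulr0 subr0 ltxx.
- by move: c0; rewrite yeq cospi; lra.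
Qed.

(** The function [z / (1 - e^z)]. Its singularity at 0 is removable, but the formula takes the
    default value 0 there, so the point 0 is excluded from the holomorphy statements. *)
Definition cW z : R * R := cmul z (cinv (csub (1, 0) (cexp z))).

Lemma cW_re u y : (cW (u, y)).1 =
  (u * (1 - expR u * cos y) - y * (expR u * sin y)) /
  csqn (csub (1, 0) (cexp (u, y))).
Proof. by rewrite /cW /cmul/=; ring. Qed.

Lemma csqn_1subexp u y : csqn (csub (1, 0) (cexp (u, y))) =
  1 - 2 * expR u * cos y + expR u ^+ 2.
Proof.
transitivity (1 - 2 * expR u * cos y + expR u ^+ 2 * (cos y ^+ 2 + sin y ^+ 2)).
  by rewrite /csqn /csub /cexp/=; ring.
by rewrite cos2Dsin2 mulr1.
Qed.

Lemma cos_bounds y : - 1 <= cos y <= 1.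
Proof. by rewrite cos_geN1 cos_le1. Qed.

Lemma cW_re_le1 u y : 0 < u -> 0 < y <= pi -> (cW (u, y)).1 <= 1.
Proof.
move=> u0 /andP[y0 yp].
have s0 : 0 <= sin y by apply: sin_ge0_pi; rewrite ltW.
have /andP[c1 c2] := cos_bounds y.
have e1 : 1 < expR u by rewrite expR_gt1.
have eu : 1 + u <= expR u := expR_ge1Dx u.
have q0 : csqn (csub (1, 0) (cexp (u, y))) != 0.
  rewrite csqn_eq0; apply: csub_cexp_neq0 => //; first by apply/andP; split; lra.
  by left; rewrite gt_eqF.
have q0' : 0 < csqn (csub (1, 0) (cexp (u, y))).
  by rewrite lt_neqAle eq_sym q0/= addr_ge0// sqr_ge0.
rewrite cW_re ler_pdivrMr// mul1r csqn_1subexp.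
have ys : 0 <= y * (expR u * sin y) by rewrite !mulr_ge0// ?ltW// expR_gt0.
suff : u * (1 - expR u * cos y) <= 1 - 2 * expR u * cos y + expR u ^+ 2 by lra.
set e := expR u in e1 eu *; set c := cos y in c1 c2 *.
(* The difference of the two sides is affine in [c = cos y]; [h1] and [h2] are its values at [c = 1]
   and [c = - 1] with the weights [1 + c] and [1 - c]. *)
have h1 : 0 <= (1 + c) * ((e - 1) ^+ 2 + u * (e - 1)).
  apply: mulr_ge0; first lra.
  by apply: addr_ge0; [exact: sqr_ge0|apply: mulr_ge0; lra].
have h2 : 0 <= (1 - c) * ((1 + e) * (1 + e - u)) by rewrite !mulr_ge0//; lra.
lra.
Qed.

(** The decay as [u] goes to minus infinity. For [u <= - 1] the numerator is at most [u / 2] and the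
    squared modulus of [1 - e^z] at most 4; for [- 1 < u <= 0] the left side is nonpositive and the
    right side positive. *)
Lemma cW_re_le u y : u <= 0 -> 0 < y <= pi -> (cW (u, y)).1 <= u / 8 + 8^-1.
Proof.
move=> u0 /andP[y0 yp].
have s0 : 0 <= sin y by apply: sin_ge0_pi; rewrite ltW.
have /andP[c1 c2] := cos_bounds y.
have e1 : expR u <= 1 by rewrite -expR0 ler_expR.
have e0 := expR_gt0 u.
have q0 : csqn (csub (1, 0) (cexp (u, y))) != 0.
  rewrite csqn_eq0; apply: csub_cexp_neq0 => //; first by apply/andP; split; lra.
  by left; rewrite gt_eqF.
have q0' : 0 < csqn (csub (1, 0) (cexp (u, y))).
  by rewrite lt_neqAle eq_sym q0/= addr_ge0// sqr_ge0.
rewrite cW_re ler_pdivrMr//.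
have ys : 0 <= y * (expR u * sin y) by rewrite !mulr_ge0// ?ltW// expR_gt0.
have [um|um] := leP u (- 1); last first.
  suff : u * (1 - expR u * cos y) <= 0.
    have : 0 <= (u / 8 + 8^-1) * csqn (csub (1, 0) (cexp (u, y))).
      by rewrite mulr_ge0// ?ltW//; lra.
    by lra.
  by rewrite mulr_le0_ge0//; nra.
have em : expR u <= 2^-1.
  rewrite -[u]opprK expRN lef_pV2 ?posrE ?expR_gt0//.
  by apply: le_trans (expR_ge1Dx (- u)); lra.
have q4 : csqn (csub (1, 0) (cexp (u, y))) <= 4 by rewrite csqn_1subexp; nra.
have : 4 * (1 - expR u * cos y) >= 2 by nra.
by nra.
Qed.

Variables (al a : R).
Hypothesis al01 : 0 < al <= 1.
Hypothesis a0 : 0 < a.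
Hypothesis a1 : a != 1.

Let u0 := ln a.
Let h0 := expR (al * (u0 / (1 - a))).

Definition cH z : R * R := cexp (cmul (al, 0) (cW z)).
(** Equal to 1 at [z = ln a] and of modulus [e^((u - ln a) / 2)], so that its quotient by [a - e^z]
    decays at both ends; on the line [Im z = pi] it is purely imaginary. *)
Definition cE z : R * R := cexp (cmul (2^-1, 0) (csub z (ln a, 0))).
Definition cN z : R * R :=
  csub (cH z) (cmul (expR (al * (ln a / (1 - a))), 0) (cE z)).

(* The multiple of [cE] in [cN] cancels the zero of [a - e^z] at [z = ln a], so
   that [cF] stays bounded on the strip [0 < Im z <= pi]; the integral of [cE]
   along [Im z = pi] is elementary. *)
Definition cF z : R * R := cmul (cN z) (cinv (csub (a, 0) (cexp z))).

Let u0_neq0 : u0 != 0.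
Proof. by rewrite /u0 ln_eq0// a1. Qed.

Lemma holo_cN : exists N' : R * R -> R * R,
  forall z, csub (1, 0) (cexp z) != (0, 0) -> holo cN N' z.
Proof.
eexists => z h; rewrite /cN /cH /cW /cE.
apply: holo_sub; first apply: holo_exp.
  apply: holo_mul; first exact: holo_cst.
  apply: holo_mul; first exact: holo_id.
  apply: holo_inv; last exact: h.
  apply: holo_sub; first exact: holo_cst.
  by apply: holo_exp; exact: holo_id.
apply: holo_mul; first exact: holo_cst.
apply: holo_exp; apply: holo_mul; first exact: holo_cst.
by apply: holo_sub; [exact: holo_id|exact: holo_cst].
Qed.

Lemma holo_cF : exists F' : R * R -> R * R,
  forall z, csub (1, 0) (cexp z) != (0, 0) -> csub (a, 0) (cexp z) != (0, 0) ->
  holo cF F' z.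
Proof.
have [N' hN] := holo_cN.
eexists => z h1 ha; apply: holo_mul; first exact: hN.
apply: holo_inv; last exact: ha.
apply: holo_sub; first exact: holo_cst.
by apply: holo_exp; exact: holo_id.
Qed.

(** With [x = e^(u - u0)] this separates the distance to the zero in the real direction,
    [(1 - x)^2], from the one in the imaginary direction, [2 x (1 - cos y)]. *)
Lemma csqn_denominator u y : csqn (csub (a, 0) (cexp (u, y))) =
  a ^+ 2 * ((1 - expR (u - u0)) ^+ 2 + 2 * expR (u - u0) * (1 - cos y)).
Proof.
rewrite /csqn /csub /cexp/=.
have -> : expR u = a * expR (u - u0) by rewrite expRB lnK ?posrE// mulrC divfK// gt_eqF.
have /eqP := cos2Dsin2 y; rewrite -subr_eq0 => /eqP h.
apply/eqP; rewrite -subr_eq0; apply/eqP.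
set x := expR _; transitivity (a ^+ 2 * x ^+ 2 * (cos y ^+ 2 + sin y ^+ 2 - 1)); first by ring.
by rewrite h mulr0.
Qed.

Lemma csqn_cN_le u y : csqn (cN (u, y)) <=
  2 * expR (al * (cW (u, y)).1) ^+ 2 + 2 * (h0 ^+ 2 * expR (u - u0)).
Proof.
apply: le_trans (csqn_sub_le _ _) _.
rewrite /cH /cE csqn_mul !csqn_exp /=.
rewrite !mul0r !subr0 {3}/csqn/= expr0n/= addr0.
have -> : expR (2^-1 * (u - ln a)) ^+ 2 = expR (u - u0).
  by rewrite -expRM_natl; congr expR; rewrite mulrA divff ?mul1r// pnatr_eq0.
by [].
Qed.

Let c := al / 8.

(** The dominating function on horizontal lines. Its rate [al / 8] is the decay of [exp (al * W)]
    given by [cW_re_le], and it has the explicit primitive [- 1 / (c (1 + e^(c u)))]. *)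
Definition logistic (u : R) : R := expR (c * u) / (1 + expR (c * u)) ^+ 2.

Let t u := expR (c * u).

Lemma logistic_gt0 u : 0 < logistic u.
Proof. by rewrite divr_gt0 ?expR_gt0// exprn_gt0// addr_gt0// expR_gt0. Qed.

Lemma logistic_near0 u : u <= 0 -> t u <= 4 * logistic u.
Proof.
move=> h; have t0 : 0 < t u := expR_gt0 _.
have t1 : t u <= 1.
  by rewrite /t -expR0 ler_expR /c mulr_ge0_le0// divr_ge0//; case/andP: al01 => /ltW.
rewrite /logistic -/(t u) mulrA ler_pdivlMr ?exprn_gt0 ?addr_gt0//; nra.
Qed.

Lemma logistic_far u : 0 <= u -> 1 <= 4 * (t u * logistic u).
Proof.
move=> h; have t0 : 0 < t u := expR_gt0 _.
have t1 : 1 <= t u.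
  by rewrite /t -expR0 ler_expR /c mulr_ge0// divr_ge0//; case/andP: al01 => /ltW.
rewrite /logistic -/(t u) !mulrA ler_pdivlMr ?exprn_gt0 ?addr_gt0//; nra.
Qed.

Let b := expR (u0 / 2).
Let E u := expR ((u - u0) / 2).

Let EE u : E u ^+ 2 = expR (u - u0).
Proof. by rewrite /E -expRM_natl; congr expR; rewrite mulrC divfK. Qed.

Let tE u : 0 <= u -> t u <= b * E u.
Proof.
move=> h; rewrite /t /b /E -expRD ler_expR /c.
have /andP[_ al1] := al01; have : al * u <= u by rewrite ler_piMl.
by lra.
Qed.

Let Et u : u <= 0 -> E u <= b^-1 * t u.
Proof.
move=> h; rewrite /t /b /E -expRN -expRD ler_expR /c.
have /andP[al0 al1] := al01; have : al * u >= u by nra.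
by lra.
Qed.

Let e1 : R := expR 1.

Lemma expW_bound u y : 0 < y <= pi ->
  expR (al * (cW (u, y)).1) <= e1 * Num.min 1 (t u).
Proof.
move=> hy; have /andP[al0 al1] := al01.
have [h|h] := ltP 0 u.
  have t1 : 1 <= t u by rewrite /t -expR0 ler_expR /c; apply: mulr_ge0; lra.
  rewrite min_l// mulr1 ler_expR; have := cW_re_le1 h hy; nra.
have t1 : t u <= 1 by rewrite /t -expR0 ler_expR /c; apply: mulr_ge0_le0; lra.
rewrite min_r// /e1 /t -expRD ler_expR /c; have := cW_re_le h hy; nra.
Qed.

Let C1 := 4 * (e1 + e1 * b).
Let C2 := 4 * (b^-1 + b).

(** The factor [1 + E u ^+ 2 = 1 + e^(u - u0)] is, up to a constant, the size of [a - e^z] away from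
    its zero; once it is divided out, [logistic] remains. *)
Lemma numerator_bounds u y : 0 < y <= pi ->
  expR (al * (cW (u, y)).1) <= C1 * (1 + E u ^+ 2) * logistic u /\
  E u <= C2 * (1 + E u ^+ 2) * logistic u.
Proof.
move=> hy; have hW := expW_bound u hy.
have E0 : 0 < E u := expR_gt0 _; have b0 : 0 < b := expR_gt0 _.
have e10 : 0 < e1 := expR_gt0 _; have l0 := logistic_gt0 u.
have t0 : 0 < t u := expR_gt0 _; have bi0 : 0 < b^-1 by rewrite invr_gt0.
have E2 : E u <= 1 + E u ^+ 2 by nra.
have E1 : 1 <= 1 + E u ^+ 2 by nra.
have [h|h] := leP 0 u.
- have tl := logistic_far h; have tb := tE h.
  have hl : 1 <= 4 * (b * E u * logistic u).
    by apply: le_trans tl _; rewrite ler_pM2l// ler_pM2r.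
  have hl2 : 1 <= 4 * (b * (1 + E u ^+ 2) * logistic u).
    by apply: le_trans hl _; rewrite ler_pM2l// ler_pM2r// ler_pM2l.
  have eb : 0 <= e1 * ((1 + E u ^+ 2) * logistic u) by rewrite !mulr_ge0//; lra.
  have m1 : e1 * Num.min 1 (t u) <= e1.
    by rewrite -[leRHS]mulr1 ler_pM2l// ge_min lexx.
  split; first by rewrite /C1; have := ler_wpM2l (ltW e10) hl2; lra.
  have : E u <= 4 * (b * E u ^+ 2 * logistic u).
    by have := ler_wpM2l (ltW E0) hl; lra.
  have : 0 <= b^-1 * ((1 + E u ^+ 2) * logistic u) by rewrite !mulr_ge0//; lra.
  have : 0 <= b * logistic u by rewrite mulr_ge0// ltW.
  by rewrite /C2; lra.
- have tl := logistic_near0 (ltW h); have bt := Et (ltW h).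
  have l1 : logistic u <= (1 + E u ^+ 2) * logistic u by rewrite ler_peMl// ltW.
  have m1 : e1 * Num.min 1 (t u) <= e1 * t u by rewrite ler_pM2l// ge_min lexx orbT.
  have x0 : 0 < (1 + E u ^+ 2) * logistic u by rewrite mulr_gt0//; lra.
  split.
    have h1 : e1 * t u <= 4 * (e1 * ((1 + E u ^+ 2) * logistic u)).
      by rewrite mulrCA ler_pM2l//; lra.
    have : 0 <= e1 * b * ((1 + E u ^+ 2) * logistic u) by rewrite !mulr_ge0//; lra.
    by rewrite /C1; lra.
  have h1 : b^-1 * t u <= 4 * (b^-1 * ((1 + E u ^+ 2) * logistic u)).
    by rewrite mulrCA ler_pM2l//; lra.
  have : 0 <= b * ((1 + E u ^+ 2) * logistic u) by rewrite !mulr_ge0//; lra.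
  by rewrite /C2; lra.
Qed.

Lemma csqn_cN_bound u y : 0 < y <= pi ->
  csqn (cN (u, y)) <= (2 * (C1 ^+ 2 + h0 ^+ 2 * C2 ^+ 2)) *
    ((1 + E u ^+ 2) * logistic u) ^+ 2.
Proof.
move=> hy; have [h1 h2] := numerator_bounds u hy.
apply: le_trans (csqn_cN_le _ _) _; rewrite -EE.
set P := _ * logistic u.
have sq (x x' : R) : 0 <= x -> x <= x' -> x ^+ 2 <= x' ^+ 2 by move=> ? ?; nra.
have g1 : expR (al * (cW (u, y)).1) ^+ 2 <= (C1 * P) ^+ 2.
  by apply: sq; [exact: expR_ge0|rewrite /P mulrA].
have g2 : E u ^+ 2 <= (C2 * P) ^+ 2.
  by apply: sq; [exact: expR_ge0|rewrite /P mulrA].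
have := ler_wpM2l (sqr_ge0 h0) g2.
by rewrite !exprMn in g1 *; lra.
Qed.

Lemma far_bound (d : R) : 0 < d <= 1 -> exists2 K : R, 0 < K & forall u y, 0 < y <= pi ->
  d <= `|u - u0| \/ d <= y -> K * (1 + E u ^+ 2) ^+ 2 <= csqn (csub (a, 0) (cexp (u, y))).
Proof.
move=> /andP[d0 d1]; have pi2 := pi_ge2 R.
have cd : cos d < 1.
  by rewrite -cos0 ltr_cos// in_itv/=; lra.
have ed : 1 < expR d by rewrite expR_gt1.
(* [k2] covers [|u - u0| >= d], where [|x - 1| / (x + 1)] is at least [r = tanh (d / 2)]; [k1]
   covers [y >= d], through [(1 - x)^2 + 4 k1 x = k1 (1 + x)^2 + (1 - k1) (1 - x)^2]. *)
pose k1 := (1 - cos d) / 2; pose r := (expR d - 1) / (expR d + 1); pose k2 := r ^+ 2.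
have r0 : 0 < r by rewrite /r divr_gt0//; lra.
have k10 : 0 < k1 by rewrite /k1; lra.
have k20 : 0 < k2 by rewrite exprn_gt0.
have k11 : k1 <= 1 by rewrite /k1; have := cos_geN1 d; lra.
exists (a ^+ 2 * Num.min k1 k2).
  by rewrite mulr_gt0 ?exprn_gt0// lt_min k10 k20.
move=> u y /andP[y0 yp] far; rewrite csqn_denominator -mulrA -EE ler_pM2l ?exprn_gt0//.
set x := E u ^+ 2.
have x0 : 0 <= x by exact: sqr_ge0.
have cy : cos y <= 1 := cos_le1 y.
have x1 : 0 <= (1 + x) ^+ 2 := sqr_ge0 _.
case: far => far.
- apply: (@le_trans _ _ (k2 * (1 + x) ^+ 2)); first by rewrite ler_wpM2r// ge_min lexx orbT.
  suff : k2 * (1 + x) ^+ 2 <= (1 - x) ^+ 2.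
    move=> h; apply: le_trans h _; rewrite lerDl; apply: mulr_ge0; lra.
  have rE : r * (expR d + 1) = expR d - 1 by rewrite /r divfK//; lra.
  rewrite /k2 -exprMn.
  have [h|h] := leP 0 (u - u0).
    have hx : expR d <= x by rewrite /x EE ler_expR; rewrite ger0_norm in far.
    have : r * (1 + x) <= x - 1.
      rewrite /r mulrAC ler_pdivrMr; last lra.
      by nra.
    have : 0 <= r * (1 + x) by rewrite mulr_ge0//; lra.
    by nra.
  have hx : x * expR d <= 1.
    rewrite ltr0_norm// in far.
    by rewrite /x EE -expRD -expR0 ler_expR; lra.
  have : r * (1 + x) <= 1 - x.
    rewrite /r mulrAC ler_pdivrMr; last lra.
    by nra.
  have : 0 <= r * (1 + x) by rewrite mulr_ge0//; lra.
  by nra.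
- apply: (@le_trans _ _ (k1 * (1 + x) ^+ 2)); first by rewrite ler_wpM2r// ge_min lexx.
  have cyd : cos y <= cos d.
    have [->//|yn] := eqVneq y d.
    apply/ltW; rewrite ltr_cos ?in_itv/=; [|lra|lra].
    by rewrite lt_neqAle eq_sym yn.
  have h1 : 2 * k1 <= 1 - cos y by rewrite /k1; lra.
  have h2 : 0 <= (1 - k1) * (1 - x) ^+ 2 by rewrite mulr_ge0 ?sqr_ge0//; lra.
  have h3 : 0 <= x * (1 - cos y - 2 * k1) by rewrite mulr_ge0//; lra.
  by lra.
Qed.

Lemma cN_root : cN (u0, 0) = (0, 0).
Proof.
have a1' : 1 - a != 0 by rewrite subr_eq0 eq_sym.
have W0 : cW (u0, 0) = (u0 / (1 - a), 0).
  rewrite /cW /cmul /cinv /csqn /csub /cexp/= cos0 sin0 lnK ?posrE// !(mulr0, mulr1, subr0, mul0r, oppr0, addr0).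
  by rewrite expr0n/= addr0; congr pair; field.
rewrite /cN /cH /cE W0 /csub /cmul /cexp/= !(mulr0, mulr1, subr0, mul0r, oppr0, addr0, subrr).
by rewrite expR0 cos0 sin0 !(mulr0, mulr1, subr0, mul0r, oppr0, addr0, subrr).
Qed.

(** [cN] vanishes at [(u0, 0)] and has a bounded derivative on a rectangle; the path to [(u, y)]
    runs first horizontally, then vertically. The condition [d < |u0|] keeps the rectangle away from
    [z = 0]. *)
Lemma cN_lipschitz (d : R) : 0 < d -> d < `|u0| -> d <= 1 -> exists2 M : R, 0 < M &
  forall u y, `|u - u0| <= d -> 0 <= y <= d ->
    csqn (cN (u, y)) <= M * (`|u - u0| ^+ 2 + y ^+ 2).
Proof.
move=> d0 du d1; have pi2 := pi_ge2 R; have [N' hN] := holo_cN.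
have hin u y : u \in `[u0 - d, u0 + d] -> y \in `[0, d] -> holo cN N' (u, y).
  rewrite !in_itv/= => /andP[h1 h2] /andP[h3 h4]; apply: hN.
  apply: csub_cexp_neq0 => //; first by apply/andP; split; lra.
  right; rewrite ln1; apply: contraTneq du => uE; rewrite -leNgt ler_norml; lra.
have [M1 M10 hM1] := @compact_rectangle_bound _ (fun z => (N' z).1) _ _ _ _
  (fun u y hu hy => (hin u y hu hy).2.2.1).
have [M2 M20 hM2] := @compact_rectangle_bound _ (fun z => (N' z).2) _ _ _ _
  (fun u y hu hy => (hin u y hu hy).2.2.2).
pose M := M1 + M2; have M0 : 0 < M by rewrite addr_gt0.
have u0in : u0 \in `[u0 - d, u0 + d] by rewrite in_itv/=; lra.
have step (f df : R -> R) (v w : R) : 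
    (forall x, x \in `[Num.min v w, Num.max v w] -> is_derive x 1 f (df x)) ->
    (forall x, x \in `[Num.min v w, Num.max v w] -> `|df x| <= M) ->
    `|f w - f v| <= M * `|w - v|.
  wlog vw : v w / v <= w.
    move=> H; case/orP: (le_total v w) => [vw|wv]; first exact: (H v w vw).
    by rewrite minC maxC distrC (distrC w v); exact: (H w v wv).
  rewrite min_l// max_r// => h1 h2.
  have cf : {within `[v, w], continuous f}.
    by apply: derivable_within_continuous => x /h1[].
  have [x xvw ->] := MVT_segment vw (fun x hx => h1 x (subset_itv_oo_cc hx)) cf.
  by rewrite normrM ler_wpM2r//; exact: h2.
(* Each component is at most [M (|u - u0| + y)]; squaring the sum costs a factor 2, the two
   components another 2. *)
exists (4 * M ^+ 2); first by rewrite mulr_gt0// exprn_gt0.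
move=> u y; rewrite ler_norml => /andP[h1 h2] /andP[y0 yd].
have uin : u \in `[u0 - d, u0 + d] by rewrite in_itv/=; lra.
have uI x : x \in `[Num.min u0 u, Num.max u0 u] -> x \in `[u0 - d, u0 + d].
  rewrite !in_itv/= => /andP[]; rewrite ge_min le_max => /orP[] ? /orP[] ?; lra.
have yI x : x \in `[Num.min 0 y, Num.max 0 y] -> x \in `[0, d].
  by rewrite min_l// max_r// !in_itv/=; lra.
have zin : (0 : R) \in `[0, d] by rewrite in_itv/= lexx ltW.
have b1 : `|(cN (u, y)).1| <= M * (`|u - u0| + `|y - 0|).
  have -> : (cN (u, y)).1 = ((cN (u, 0)).1 - (cN (u0, 0)).1) + ((cN (u, y)).1 - (cN (u, 0)).1).
    by rewrite cN_root/=; ring.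
  apply: le_trans (ler_normD _ _) _; rewrite mulrDr; apply: lerD.
    apply: (step (fun x => (cN (x, 0)).1) (fun x => (N' (x, 0)).1)) => x /uI hx.
      by have [[]] := hin _ _ hx zin.
    by apply: le_trans (hM1 _ _ hx zin) _; rewrite /M; lra.
  apply: (step (fun x => (cN (u, x)).1) (fun x => - (N' (u, x)).2)) => x /yI hx.
    by have [[]] := hin _ _ uin hx.
  by rewrite normrN; apply: le_trans (hM2 _ _ uin hx) _; rewrite /M; lra.
have b2 : `|(cN (u, y)).2| <= M * (`|u - u0| + `|y - 0|).
  have -> : (cN (u, y)).2 = ((cN (u, 0)).2 - (cN (u0, 0)).2) + ((cN (u, y)).2 - (cN (u, 0)).2).
    by rewrite cN_root/=; ring.
  apply: le_trans (ler_normD _ _) _; rewrite mulrDr; apply: lerD.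
    apply: (step (fun x => (cN (x, 0)).2) (fun x => (N' (x, 0)).2)) => x /uI hx.
      by have [[]] := hin _ _ hx zin.
    by apply: le_trans (hM2 _ _ hx zin) _; rewrite /M; lra.
  apply: (step (fun x => (cN (u, x)).2) (fun x => (N' (u, x)).1)) => x /yI hx.
    by have [[]] := hin _ _ uin hx.
  by apply: le_trans (hM1 _ _ uin hx) _; rewrite /M; lra.
rewrite subr0 (ger0_norm y0) in b1 b2.
set P := M * _ in b1 b2.
have sq (x x' : R) : `|x| <= x' -> x ^+ 2 <= x' ^+ 2.
  move=> hx; have x0 := normr_ge0 x.
  by rewrite -(ger0_norm (sqr_ge0 x)) normrX; nra.
have {}b1 := sq _ _ b1; have {}b2 := sq _ _ b2.
have : P ^+ 2 <= M ^+ 2 * (2 * (`|u - u0| ^+ 2 + y ^+ 2)).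
  by rewrite /P exprMn ler_pM2l ?exprn_gt0//; have := sqr_ge0 (`|u - u0| - y); lra.
by rewrite /csqn; lra.
Qed.

(** Near its zero the denominator is at least a multiple of the squared distance, from
    [|1 - e^v| >= e^(- 1) |v|] and [2 (1 - cos y) >= (sin y)^2 >= (r y)^2] with
    [r = cos (1 / 2)]. *)
Lemma denominator_near (d : R) : 0 < d <= 2^-1 -> exists2 K : R, 0 < K &
  forall u y, `|u - u0| <= d -> 0 <= y <= d ->
    K * (`|u - u0| ^+ 2 + y ^+ 2) <= csqn (csub (a, 0) (cexp (u, y))).
Proof.
move=> /andP[d0 d2]; have pi2 := pi_ge2 R.
pose r : R := cos 2^-1; have r0 : 0 < r by apply: cos_gt0_pihalf; lra.
pose e : R := expR (- 1); have e0 : 0 < e := expR_gt0 _.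
have sinl y : 0 <= y <= d -> r * y <= sin y.
  move=> /andP[y0 yd]; have cs : {within `[0, y], continuous (@sin R)}.
    by apply: continuous_subspaceT; exact: continuous_sin.
  have [x xy] := MVT_segment y0 (fun x _ => is_derive_sin x) cs.
  rewrite sin0 !subr0 => ->; rewrite ler_wpM2r//.
  move: xy; rewrite in_itv/= => /andP[x0 xy].
  have [->//|xn] := eqVneq x 2^-1.
  apply/ltW; rewrite /r ltr_cos ?in_itv/=; [|lra|lra].
  by rewrite lt_neqAle xn/=; lra.
exists (a ^+ 2 * Num.min (e ^+ 2) (e * r ^+ 2)).
  by rewrite mulr_gt0 ?exprn_gt0// lt_min exprn_gt0//= mulr_gt0// exprn_gt0.
move=> u y hu hy; rewrite csqn_denominator -mulrA ler_pM2l ?exprn_gt0//.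
set v := u - u0 in hu *; set x := expR v; set m := Num.min _ _.
have y2 := sqr_ge0 y; have v2 := sqr_ge0 `|v|.
have hx : e <= x by rewrite ler_expR; move: hu; rewrite ler_norml; lra.
have h1 : e ^+ 2 * `|v| ^+ 2 <= (1 - x) ^+ 2.
  have e1' : e <= 1 by rewrite /e -[leRHS]expR0 ler_expR; lra.
  have : e * `|v| <= `|1 - x|.
    have [h|h] := leP 0 v.
      rewrite (distrC 1 x) (ger0_norm h).
      have := expR_ge1Dx v; rewrite -/x => hv.
      apply: (@le_trans _ _ (x - 1)); last exact: ler_norm.
      by nra.
    rewrite (ltr0_norm h); apply: le_trans (ler_norm _).
    have := expR_ge1Dx (- v); rewrite expRN -/x => hv.
    have x0 : 0 < x := expR_gt0 v.
    have : x * (1 - v) <= 1 by rewrite -ler_pdivlMl// mulr1.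
    by nra.
  have n2 := normr_ge0 v; have n1 := normr_ge0 (1 - x) => h.
  rewrite -(ger0_norm (sqr_ge0 (1 - x))) normrX -exprMn.
  by rewrite ler_sqr ?nnegrE// mulr_ge0// ltW.
have h2 : r ^+ 2 * y ^+ 2 <= 2 * (1 - cos y).
  have s := sinl _ hy; have := cos2Dsin2 y; have := cos_geN1 y; have := cos_le1 y.
  have : 0 <= r * y by rewrite mulr_ge0//; lra.
  by rewrite -exprMn; nra.
have m1 : m <= e ^+ 2 by rewrite ge_min lexx.
have m2 : m <= e * r ^+ 2 by rewrite ge_min lexx orbT.
have h3 : e * (r ^+ 2 * y ^+ 2) <= x * (2 * (1 - cos y)).
  apply: ler_pM => //; first exact: ltW.
  by rewrite -exprMn sqr_ge0.
have h4 : m * `|v| ^+ 2 <= e ^+ 2 * `|v| ^+ 2 by rewrite ler_wpM2r.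
have h5 : m * y ^+ 2 <= e * r ^+ 2 * y ^+ 2 by rewrite ler_wpM2r.
by lra.
Qed.

(** Away from the zero of the denominator, [csqn_cN_bound] is divided by [far_bound]. Near it, the
    quotient of two quantities of the order of the squared distance is bounded, and [logistic] is at
    least [m] on that bounded interval. *)
Lemma cF_bound : exists2 K : R, 0 <= K & forall u y, 0 < y <= pi ->
  `|(cF (u, y)).1| <= K * logistic u /\ `|(cF (u, y)).2| <= K * logistic u.
Proof.
have pi2 := pi_ge2 R.
suff [K K0 hK] : exists2 K : R, 0 <= K & forall u y, 0 < y <= pi ->
    csqn (cF (u, y)) <= K * logistic u ^+ 2.
  exists (1 + K); first lra.
  move=> u y hy; have l0 := logistic_gt0 u; apply: csqn_components.
    by rewrite mulr_ge0//; lra.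
  apply: le_trans (hK _ _ hy) _; rewrite [leRHS]exprMn.
  have l2 := sqr_ge0 (logistic u); set l := logistic u ^+ 2 in l2 *.
  by apply: ler_wpM2r => //; nra.
have nu0 : 0 < `|u0| by rewrite normr_gt0 u0_neq0.
pose d := Num.min (`|u0| / 2) 2^-1.
have d0 : 0 < d by rewrite lt_min; apply/andP; split; lra.
have du : d < `|u0|.
  by apply: (@le_lt_trans _ _ (`|u0| / 2)); [rewrite ge_min lexx|lra].
have d2 : d <= 2^-1 by rewrite ge_min lexx orbT.
have [K1 K10 far] := @far_bound d ltac:(apply/andP; split; lra).
have [M M0 lipN] := @cN_lipschitz d d0 du ltac:(lra).
have [K2 K20 near] := @denominator_near d ltac:(apply/andP; split; lra).
pose KN := 2 * (C1 ^+ 2 + h0 ^+ 2 * C2 ^+ 2).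
have KN0 : 0 <= KN by apply: mulr_ge0 => //; apply: addr_ge0; [exact: sqr_ge0|apply: mulr_ge0; exact: sqr_ge0].
pose m := expR (c * (u0 - d)) / (1 + expR (c * (u0 + d))) ^+ 2.
have m0 : 0 < m by rewrite divr_gt0 ?expR_gt0// exprn_gt0// addr_gt0// expR_gt0.
have c0 : 0 < c by rewrite /c divr_gt0//; case/andP: al01.
have K3 : 0 <= M / K2 / m ^+ 2 by rewrite !divr_ge0 ?sqr_ge0// ltW.
have K4 : 0 <= KN / K1 by rewrite divr_ge0// ltW.
exists (KN / K1 + M / K2 / m ^+ 2); first lra.
move=> u y hy; have /andP[y0 yp] := hy; have l0 := logistic_gt0 u.
have l2 : 0 < logistic u ^+ 2 by rewrite exprn_gt0.
have D0 : csub (a, 0) (cexp (u, y)) != (0, 0).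
  by apply: csub_cexp_neq0 => //; [apply/andP; split; lra|left; rewrite gt_eqF].
have D0' : 0 < csqn (csub (a, 0) (cexp (u, y))).
  by rewrite lt_neqAle eq_sym csqn_eq0 D0/= addr_ge0// sqr_ge0.
rewrite /cF csqn_mul csqn_inv// ler_pdivrMr//.
have [isfar|isnear] := boolP ((d <= `|u - u0|) || (d <= y)).
  have {}far := far u y hy ltac:(by case/orP: isfar => ?; [left|right]).
  apply: le_trans (csqn_cN_bound u hy) _; rewrite -/KN exprMn.
  apply: (@le_trans _ _ (KN / K1 * (K1 * (1 + E u ^+ 2) ^+ 2) * logistic u ^+ 2)).
    by rewrite !mulrA divfK// gt_eqF.
  rewrite [leRHS]mulrAC ler_wpM2r ?(ltW l2)//.
  apply: (@le_trans _ _ (KN / K1 * csqn (csub (a, 0) (cexp (u, y))))).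
    by rewrite ler_wpM2l.
  by rewrite ler_wpM2r ?(ltW D0')//; lra.
move: isnear; rewrite negb_or -!ltNge => /andP[uu yd].
have hyd : 0 <= y <= d by rewrite !ltW.
have {}near := near u y (ltW uu) hyd; have {}lipN := lipN u y (ltW uu) hyd.
have ml : m <= logistic u.
  move: uu; rewrite ltr_norml => /andP[uu1 uu2].
  have t0 : 0 < expR (c * u) := expR_gt0 _.
  rewrite /m /logistic ler_pM ?expR_ge0 ?invr_ge0 ?sqr_ge0//.
    by rewrite ler_expR ler_wpM2l ?(ltW c0)//; lra.
  rewrite lef_pV2 ?posrE ?exprn_gt0 ?addr_gt0 ?expR_gt0// ler_sqr ?nnegrE ?addr_ge0 ?expR_ge0//.
  by rewrite lerD2l ler_expR ler_wpM2l ?(ltW c0)//; lra.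
have ml2 : m ^+ 2 <= logistic u ^+ 2 by rewrite ler_sqr ?nnegrE ?(ltW m0) ?(ltW l0).
apply: le_trans lipN _.
apply: (@le_trans _ _ (M / K2 * (K2 * (`|u - u0| ^+ 2 + y ^+ 2)))).
  by rewrite !mulrA divfK// gt_eqF.
apply: (@le_trans _ _ (M / K2 * csqn (csub (a, 0) (cexp (u, y))))).
  by rewrite ler_wpM2l// divr_ge0// ltW.
rewrite ler_wpM2r ?(ltW D0')//.
apply: (@le_trans _ _ (M / K2 / m ^+ 2 * logistic u ^+ 2)).
  by rewrite -mulrA ler_peMr ?divr_ge0 ?(ltW M0) ?(ltW K20)// mulrC ler_pdivlMr ?mul1r// exprn_gt0.
by rewrite ler_wpM2r ?(ltW l2)//; lra.
Qed.

Lemma setT_segments : setT = \bigcup_n `[- n.+1%:R, n.+1%:R]%classic :> set R.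
Proof.
rewrite eqEsubset; split=> // x _; exists (truncn `|x|) => //=.
by rewrite in_itv/= -ler_norml ltW// truncnS_gt.
Qed.

Let c_gt0 : 0 < c.
Proof. by rewrite /c divr_gt0//; case/andP: al01. Qed.

Lemma logistic_cvg0 : logistic n.+1%:R + logistic (- n.+1%:R) @[n --> \oo] --> 0.
Proof.
apply: (@squeeze_cvgr _ _ _ _ (cst 0) (fun n => 2 / c * harmonic n)).
- near=> n; rewrite addr_ge0 ?(ltW (logistic_gt0 _))//= /harmonic.
  set x : R := n.+1%:R; have x0 : 0 < x by rewrite ltr0n.
  have cx : 0 < c * x by apply: mulr_gt0; [exact: c_gt0|exact: x0].
  have ht : 1 + c * x <= t x := expR_ge1Dx _.
  have hl : logistic x <= (t x)^-1.
    rewrite /logistic -/(t x) ler_pdivrMr ?exprn_gt0 ?addr_gt0//; last lra.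
    by rewrite mulrC ler_pdivlMr; [nra|lra].
  have hr : logistic (- x) <= (t x)^-1.
    rewrite /logistic mulrN -expRN -/(t x); set w := (t x)^-1.
    have w0 : 0 < w by rewrite invr_gt0; lra.
    by rewrite expRN -/(t x) -/w ler_pdivrMr ?exprn_gt0 ?addr_gt0//; nra.
  have : (t x)^-1 <= c^-1 * x^-1.
    by rewrite -invfM lef_pV2 ?posrE//; lra.
  have -> : 2 / c / x = c^-1 / x + c^-1 / x by rewrite -mulrA mulr_natl mulr2n.
  by move=> hw; apply: lerD; [exact: le_trans hl hw|exact: le_trans hr hw].
- exact: cvg_cst.
- by rewrite -(mulr0 (2 / c)); apply: cvgMr; exact: cvg_harmonic.
Unshelve. all: end_near. Qed.

Lemma cvg_expR_natl (r : R) : 0 < r -> expR (- (r * n.+1%:R)) @[n --> \oo] --> (0 : R).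
Proof.
move=> r0; apply: (@squeeze_cvgr _ _ _ _ (cst 0) (fun n => r^-1 * harmonic n)).
- near=> n; rewrite expR_ge0/= /harmonic expRN -invfM lef_pV2 ?posrE ?expR_gt0 ?mulr_gt0//.
  by have := expR_ge1Dx (r * n.+1%:R); lra.
- exact: cvg_cst.
- by rewrite -(mulr0 r^-1); apply: cvgMr; exact: cvg_harmonic.
Unshelve. all: end_near. Qed.

Lemma integrable_logistic : leb.-integrable setT (EFin \o logistic).
Proof.
have cl : continuous logistic.
  move=> u; rewrite /logistic; apply: cvgM; last apply: cvgV.
  - apply: continuous_comp; last exact: continuous_expR.
    by apply: cvgM; [exact: cvg_cst|exact: cvg_id].
  - by rewrite expf_neq0// gt_eqF// addr_gt0// expR_gt0.
  - have h : expR (c * x) @[x --> u] --> expR (c * u).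
      apply: continuous_comp; last exact: continuous_expR.
      by apply: cvgM; [exact: cvg_cst|exact: cvg_id].
    by rewrite expr2; under eq_fun do rewrite expr2; apply: cvgM; apply: cvgD => //; exact: cvg_cst.
apply/integrableP; split.
  by apply/measurable_EFinP; exact: continuous_measurable_fun.
under eq_integral => u _ do rewrite /= ger0_norm ?ltW ?logistic_gt0//.
pose G u := - (c * (1 + t u))^-1.
have Gn0 u : c * (1 + t u) != 0.
  by rewrite gt_eqF//; apply: mulr_gt0; [exact: c_gt0|apply: addr_gt0 => //; exact: expR_gt0].
have dt (u : R) : is_derive u 1 t (t u * c).
  apply: (@is_derive1_comp R expR (fun x => c * x)).
  rewrite -[c in is_derive _ _ _ c]mulr1; exact: is_deriveZ.
rewrite setT_segments.
suff -> : (\int[leb]_(u in \bigcup_n `[(- n.+1%:R)%R, (n.+1%:R)%R]%classic) (logistic u)%:E =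
    (0 - - c^-1)%:E)%E by rewrite ltry.
apply: (@ge0_FTC_exhaustion _ logistic G (fun n => - n.+1%:R) (fun n => n.+1%:R)).
- by move=> n; rewrite gtrN// ltr0n.
- by move=> m n mn; rewrite lerN2 ler_nat ltnS.
- by move=> m n mn; rewrite ler_nat ltnS.
- by [].
- by move=> u _; rewrite ltW ?logistic_gt0.
- by move=> u _; exact: cl.
- move=> u _; rewrite /G.
  have d1 : is_derive u 1 (fun x => c * (1 + t x)) (c * (t u * c)).
    apply: is_deriveZ; rewrite -[X in is_derive _ _ _ X]add0r; exact: is_deriveD.
  apply: is_derive_eq (is_deriveN (is_deriveV _ d1)) _ => //.
  rewrite /GRing.scale/= /logistic -/(t u); field.
  by rewrite -negb_or orbC -mulf_eq0 Gn0.
- have h : t (- n.+1%:R) @[n --> \oo] --> 0.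
    rewrite /t; under eq_fun do rewrite mulrN.
    exact: cvg_expR_natl c_gt0.
  rewrite /G; apply: cvgN; have -> : c^-1 = (c * (1 + 0))^-1 by rewrite addr0 mulr1.
  apply: cvgV; first by rewrite addr0 mulr1 (gt_eqF c_gt0).
  by apply: cvgM; [exact: cvg_cst|apply: cvgD => //; exact: cvg_cst].
- rewrite /G -oppr0; apply: cvgN.
  apply: (@squeeze_cvgr _ _ _ _ (cst 0) (fun n => c^-1 * expR (- (c * n.+1%:R)))).
  + near=> n; rewrite invr_ge0 mulr_ge0 ?(ltW c_gt0) ?addr_ge0 ?expR_ge0//= invfM.
    rewrite ler_pM2l ?invr_gt0 ?c_gt0// expRN lef_pV2 ?posrE ?addr_gt0 ?expR_gt0//.
    by rewrite /t; lra.
  + exact: cvg_cst.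
  + by rewrite -(mulr0 c^-1); apply: cvgMr; exact: cvg_expR_natl c_gt0.
Unshelve. all: end_near. Qed.

(** Since [a + e^u = a (1 + E^2)] and [E' = E / 2], a primitive is [2 / a * atan E]. *)
Lemma integral_atan : (\int[leb]_u (E u / (a + expR u))%:E = (pi / a)%:E)%E.
Proof.
have EE' u : expR u = a * E u ^+ 2.
  by rewrite EE expRB lnK ?posrE// mulrC divfK// gt_eqF.
have E0 u : 0 < E u := expR_gt0 _.
have dE (u : R) : is_derive u 1 E (E u / 2).
  rewrite /E; apply: (@is_derive1_comp R expR (fun x => (x - u0) / 2)).
  apply: is_derive_eq; rewrite /GRing.scale/=; lra.
have cE u : {for u, continuous E}.
  by apply: differentiable_continuous; apply/derivable1_diffP; case: (dE u).
have hE0 u : a + a * E u ^+ 2 != 0.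
  by rewrite gt_eqF// addr_gt0// mulr_gt0// exprn_gt0.
rewrite setT_segments.
under eq_integral => u _ do rewrite EE'.
rewrite -[pi / a]subr0.
apply: (@ge0_FTC_exhaustion _ (fun u => E u / (a + a * E u ^+ 2)) (fun u => 2 / a * atan (E u))
  (fun n => - n.+1%:R) (fun n => n.+1%:R)).
- by move=> n; rewrite gtrN// ltr0n.
- by move=> m n mn; rewrite lerN2 ler_nat ltnS.
- by move=> m n mn; rewrite ler_nat ltnS.
- by [].
- by move=> u _; rewrite divr_ge0 ?ltW// addr_gt0// mulr_gt0// exprn_gt0.
- move=> u _; apply: cvgM; first exact: cE.
  apply: cvgV; first exact: hE0.
  apply: cvgD; first exact: cvg_cst.
  apply: cvgM; first exact: cvg_cst.
  by rewrite expr2; under eq_fun do rewrite expr2; apply: cvgM; exact: cE.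
- move=> u _; have d1 := is_derive1_comp (is_derive1_atan (E u)) (dE u).
  apply: is_derive_eq (is_deriveZ (2 / a) d1) _.
  rewrite /GRing.scale/=; field.
  have h1 : 1 + E u ^+ 2 != 0 by rewrite gt_eqF// addr_gt0// exprn_gt0.
  by apply/and3P; split; [exact: hE0|exact: h1|rewrite gt_eqF].
- have h : E (- n.+1%:R) @[n --> \oo] --> 0.
    rewrite -(mulr0 (expR (- u0 / 2))).
    under eq_fun => n.
      rewrite /E (_ : (- n.+1%:R - u0) / 2 = - u0 / 2 + - (2^-1 * n.+1%:R)); last by lra.
      rewrite expRD.
      over.
    by apply: cvgMr; apply: cvg_expR_natl; rewrite invr_gt0.
  rewrite -(mulr0 (2 / a)) -(@atan0 R); apply: cvgMr.
  by apply: continuous_cvg => //; exact: continuous_atan.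
- have -> : pi / a = 2 / a * (pi / 2) by field; rewrite gt_eqF.
  apply: cvgMr; apply: (cvg_comp _ _ _ (@cvgy_atan R)).
  apply/cvgryPge => A; near=> n.
  apply: (@le_trans _ _ ((n.+1%:R - u0) / 2)); last first.
    by rewrite /E; have := expR_ge1Dx ((n.+1%:R - u0) / 2); lra.
  suff : 2 * A + u0 <= n.+1%:R by lra.
  apply: le_trans (ltW (truncnS_gt _)) _; rewrite ler_nat ltnS.
  near: n; exact: nbhs_infty_ge.
Unshelve. all: end_near. Qed.

Lemma cE_pi u : cE (u, pi) = (0, E u).
Proof.
rewrite /cE /cexp /cmul /csub/= !(mul0r, subr0, addr0).
rewrite (_ : 2^-1 * pi = pi / 2); last by rewrite mulrC.
by rewrite cos_pihalf sin_pihalf mulr0 mulr1 mulrC.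
Qed.

Lemma cW_pi u : cW (u, pi) = (u / (1 + expR u), pi / (1 + expR u)).
Proof.
have e0 : 1 + expR u != 0 by rewrite gt_eqF// addr_gt0// expR_gt0.
rewrite /cW /cmul /cinv /csqn /csub /cexp/= cospi sinpi !(mulr0, subr0, mulrN1, opprK, oppr0, mul0r, addr0, add0r).
by rewrite expr0n/= addr0; congr pair; field.
Qed.

Lemma cF_pi u : (cF (u, pi)).2 =
  (expR (al * (u / (1 + expR u))) * sin (al * (pi / (1 + expR u))) - h0 * E u) / (a + expR u).
Proof.
have e0 : a + expR u != 0 by rewrite gt_eqF// addr_gt0// expR_gt0.
rewrite /cF /cN /cH cE_pi cW_pi /cmul /cinv /csqn /csub /cexp/= cospi sinpi.
rewrite !(mulr0, subr0, mulrN1, opprK, oppr0, mul0r, addr0, add0r, expr0n)/= ?addr0.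
by rewrite -/h0; field.
Qed.

Lemma cF_real u : (cF (u, 0)).2 = 0.
Proof.
rewrite /cF /cN /cH /cE /cW /cmul /cinv /csqn /csub /cexp/= cos0 sin0.
by rewrite !(mulr0, subr0, mulr1, oppr0, mul0r, addr0, add0r, sin0).
Qed.

(** The integral of [Im cF] along [Im z = pi] is 0; it is the wanted integral minus [h0] times the
    elementary one of [integral_atan]. *)
Lemma contour_integral :
  (\int[leb]_u (expR (al * (u / (1 + expR u))) * sin (al * (pi / (1 + expR u)))
     / (a + expR u))%:E = (h0 * (pi / a))%:E)%E.
Proof.
have pi0 := pi_gt0 R; have pi2 := pi_ge2 R.
have [F' hF'] := holo_cF.
have hF u y : 0 < y < 2 * pi -> holo cF F' (u, y).
  move=> hy; have y0 : 0 <= y < 2 * pi by case/andP: hy => /ltW -> ->.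
  have yn : y != 0 by case/andP: hy => /gt_eqF ->.
  by apply: hF'; apply: csub_cexp_neq0 => //; left.
have [K K0 bK] := cF_bound.
have iK : leb.-integrable setT (EFin \o (fun u => K * logistic u)).
  have -> : EFin \o (fun u => K * logistic u) = (fun u => K%:E * (EFin \o logistic) u)%E by [].
  by apply: integrableZl => //; exact: integrable_logistic.
have cK : K * logistic n.+1%:R + K * logistic (- n.+1%:R) @[n --> \oo] --> 0.
  under eq_fun do rewrite -mulrDr.
  by rewrite -(mulr0 K); apply: cvgMr; exact: logistic_cvg0.
have bottom : {ae leb, forall u, (cF (u, m.+1%:R^-1)).2 @[m --> \oo] --> 0}.
  (* The two real points where the formula for [cF] divides by zero; at the other real points [cF]
     is continuous with real value. *)
  exists [set 0; u0]; split.
  - by apply: measurableU.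
  - by apply: countable_lebesgue_measure0; apply: finite_set_countable.
  - move=> u nu; apply: contrapT => /not_orP[u1 u2]; apply: nu.
    have hol : holo cF F' (u, 0).
      apply: hF'; apply: csub_cexp_neq0 => //; rewrite ?lexx ?mulr_gt0//; right; last exact/eqP.
      by rewrite ln1; exact/eqP.
    have [_ [[_ c2] _]] := hol.
    have hp : ((u, m.+1%:R^-1) : R * R) @[m --> \oo] --> ((u, 0) : R * R).
      exact: (@cvg_pair nat R R \oo (nbhs u) (nbhs (0 : R)) _ _ _ (fun=> u) _ (cvg_cst u) (@cvg_harmonic R)).
    have := cvg_comp (fun m => (u, m.+1%:R^-1) : R * R) (fun z => (cF z).2) hp c2.
    by rewrite cF_real.
have [i0 I0] := strip_integral0 hF iK bK cK bottom.
have h0' : 0 < h0 := expR_gt0 _.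
have mE : measurable_fun setT (fun u : mR => E u / (a + expR u)).
  apply: measurable_funM; first by rewrite /E; mfun.
  have -> : (fun u => (a + expR u)^-1) = (fun u => (a + expR u) `^ (-1)).
    by apply/funext => u; rewrite powR_inv1// addr_ge0 ?expR_ge0// ltW.
  by mfun.
have iE : leb.-integrable setT (fun u => (h0 * (E u / (a + expR u)))%:E).
  apply/integrableP; split; first by apply/measurable_EFinP; exact: measurable_funM.
  under eq_integral => u _.
    rewrite gee0_abs; last first.
      by rewrite lee_fin mulr_ge0 ?divr_ge0 ?addr_ge0 ?expR_ge0 ?ltW.
    rewrite EFinM.
    over.
  rewrite ge0_integralZl//; first by rewrite integral_atan -EFinM ltry.
  - exact/measurable_EFinP.
  - by move=> u _; rewrite lee_fin divr_ge0 ?addr_ge0 ?expR_ge0 ?ltW.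
  - by rewrite lee_fin ltW.
transitivity (\int[leb]_u (((cF (u, pi)).2)%:E + (h0 * (E u / (a + expR u)))%:E))%E.
  by apply: eq_integral => u _; rewrite cF_pi -EFinD; congr EFin; ring.
rewrite integralD// I0 add0e.
under eq_integral do rewrite EFinM.
rewrite ge0_integralZl//; first by rewrite integral_atan.
- exact/measurable_EFinP.
- by move=> u _; rewrite lee_fin divr_ge0 ?addr_ge0 ?expR_ge0 ?ltW.
- by rewrite lee_fin ltW.
Qed.

End contour.

(** * The function theta and its transform *)

Section theta_basics.
Context (R : realType).
Notation leb := (@lebesgue_measure R).
Notation mR := (measurableTypeR R).

Lemma is_derive_affine (a b x : R) : is_derive x 1 (fun x => a + b * x) b.
Proof.
apply: is_derive_eq (is_deriveD (is_derive_cst a x 1) (is_deriveZ b (is_derive_id x 1))) _.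
by rewrite /GRing.scale/= mulr1 add0r.
Qed.

Lemma is_derive_powR_affine (g a b x : R) : 0 < a + b * x ->
  is_derive x 1 (fun x => (a + b * x) `^ g) (g * (a + b * x) `^ (g - 1) * b).
Proof.
move=> h; have d := is_derive_affine a b x.
exact: (@is_derive1_comp R (fun y => y `^ g) (fun x => a + b * x) _ _ _ (is_derive1_powR g h) d).
Qed.

Lemma continuous_powR_affine (g a b x : R) : 0 < a + b * x ->
  {for x, continuous (fun x => (a + b * x) `^ g)}.
Proof.
move=> h; apply: differentiable_continuous; apply/derivable1_diffP.
by case: (is_derive_powR_affine g h).
Qed.

(** The shift by 3 keeps already the first segment nondegenerate: [z / 3 < z - z / 3]. *)
Lemma itv0_exhaustion (z : R) : 0 < z -> `]0, z[%classic =
  \bigcup_n `[z * n.+3%:R^-1, z - z * n.+3%:R^-1]%classic.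
Proof.
move=> z0; rewrite predeqE => x /=; split.
  rewrite in_itv/= => /andP[x0 xz].
  pose e : R := Num.min x (z - x).
  have e0 : 0 < e / z by rewrite divr_gt0// lt_min x0 subr_gt0.
  have [n] := ltr_add_invr e0; rewrite add0r => ne; exists n => //=.
  have h : z * n.+3%:R^-1 <= e.
    rewrite mulrC -ler_pdivlMr//; apply: le_trans (ltW ne).
    by rewrite lef_pV2 ?posrE// ler_nat; exact: leqW (leqnSn _).
  have [h1 h2] : e <= x /\ e <= z - x by rewrite !ge_min !lexx orbT.
  by rewrite in_itv/= (le_trans h h1)/= lerBrDr -lerBrDl (le_trans h h2).
move=> [n _]; rewrite /= !in_itv/= => /andP[nx xz].
have h : 0 < z * n.+3%:R^-1 by rewrite mulr_gt0// invr_gt0.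
by rewrite (lt_le_trans h nx)/= (le_lt_trans xz)// gtrBl.
Qed.

Lemma cvg_invS3 (z : R) : z * n.+3%:R^-1 @[n --> \oo] --> 0.
Proof.
rewrite -(mulr0 z); apply: cvgMr.
have := @cvg_harmonic R; rewrite -(cvg_shiftn 2).
by under eq_fun do rewrite /harmonic addn2.
Qed.

Lemma itv0_exhaustion_lt (z : R) n : 0 < z -> z * n.+3%:R^-1 < z - z * n.+3%:R^-1.
Proof.
move=> z0; have : z * n.+3%:R^-1 <= z * 3^-1.
  by rewrite ler_pM2l// lef_pV2 ?posrE// ler_nat.
move: (z * n.+3%:R^-1) => w; lra.
Qed.

Lemma itv0_exhaustion_mono (z : R) : 0 < z ->
  nonincreasing_seq (fun n => z * n.+3%:R^-1) /\
  nondecreasing_seq (fun n => z - z * n.+3%:R^-1).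
Proof.
move=> z0; have h : nonincreasing_seq (fun n => z * n.+3%:R^-1).
  by move=> m n mn; rewrite ler_pM2l// lef_pV2 ?posrE// ler_nat !ltnS.
by split=> // m n mn; rewrite lerD2l lerN2; exact: h.
Qed.

Lemma integral_powR_itv (g z : R) : 0 < g -> 0 < z ->
  (\int[leb]_(y in `]0%R, z[) ((z - y) `^ (g - 1))%:E = (z `^ g / g)%:E)%E.
Proof.
move=> g0 z0; rewrite -[z `^ g / g]opprK -[- - _]add0r.
have [na nb] := itv0_exhaustion_mono z0.
have aff (y : R) : z - y = z + (-1) * y by rewrite mulN1r.
have inD (y : R) : `]0, z[%classic y -> 0 < z + (-1) * y.
  by rewrite /= in_itv/= mulN1r subr_gt0 => /andP[].
under eq_integral do rewrite aff.
apply: (@ge0_FTC_exhaustion _ (fun y => (z + (-1) * y) `^ (g - 1))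
  (fun y => - ((z + (-1) * y) `^ g / g)) _ _ _ _ _ (fun n => itv0_exhaustion_lt n z0) na nb
  (itv0_exhaustion z0)).
- by move=> y _; exact: powR_ge0.
- by move=> y /inD; exact: continuous_powR_affine.
- move=> y /inD h.
  apply: is_derive_eq (is_deriveN (is_deriveM (is_derive_powR_affine g h) (is_derive_cst g^-1 y 1))) _.
  by rewrite /GRing.scale/=; field; rewrite gt_eqF.
- apply: cvgN; apply: cvgMl.
  have h : z + -1 * 0 = z by rewrite mulr0 addr0.
  rewrite -[X in _ --> X `^ g]h.
  apply: (@continuous_cvg _ _ _ _ _ (fun n => z * n.+3%:R^-1) (fun y => (z + (-1) * y) `^ g)).
    by apply: continuous_powR_affine; rewrite h.
  exact: cvg_invS3.
- rewrite -oppr0; apply: cvgN; rewrite -(mul0r g^-1); apply: cvgMl.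
  have -> : (fun n => (z + -1 * (z - z * n.+3%:R^-1)) `^ g) = (fun n => (z * n.+3%:R^-1) `^ g).
    by apply/funext => n; congr (_ `^ _); ring.
  have /cvg_at_rightP := powR_cvg0 g0; apply; split; last exact: cvg_invS3.
  by move=> n; rewrite mulr_gt0// invr_gt0.
Qed.

Lemma ler_lnB1 (x : R) : 0 < x -> ln x <= x - 1.
Proof. by move=> x0; have := expR_ge1Dx (ln x); rewrite lnK ?posrE//; lra. Qed.

Lemma mulr_ln_ge (x : R) : 0 < x -> x - 1 <= x * ln x.
Proof.
move=> x0; have xi : 0 < x^-1 by rewrite invr_gt0.
have := ler_lnB1 xi; rewrite lnV ?posrE// => h.
have : x * - ln x <= x * (x^-1 - 1) by rewrite ler_pM2l.
by rewrite mulrN mulrBr divff ?gt_eqF//; lra.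
Qed.

Lemma ln_le_powRN (e x : R) : 0 < e -> 0 < x -> - ln x <= e^-1 * x `^ (- e).
Proof.
move=> e0 x0; rewrite ler_pdivlMl// /powR gt_eqF//.
by have := expR_ge1Dx (- e * ln x); lra.
Qed.

Lemma sin_le_id (x : R) : 0 <= x -> sin x <= x.
Proof.
move=> x0; have cs : {within `[0, x], continuous (@sin R)}.
  by apply: continuous_subspaceT; exact: continuous_sin.
have [c _] := MVT_segment x0 (fun x _ => is_derive_sin x) cs.
rewrite sin0 !subr0 => ->; have := cos_le1 c; nra.
Qed.

Variable al : R.
Hypothesis al01 : 0 < al <= 1.

Definition theta_exp (y : R) : R := expR (- al * (y * ln y + (1 - y) * ln (1 - y))).

Definition theta_phase (y : R) : R :=
  if (0 < y) && (y < 1) then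
    theta_exp y * (cos (pi * al * y) - pi^-1 * sin (pi * al * y) * (ln y - ln (1 - y)))
  else 0.

(** Dominates the logarithm of [1 - y] in [theta_phase]. The exponent [al / 2] is small enough for
    the product with the kernel [(z - y)^(al - 1)] to stay integrable, even at [z = 1]. *)
Definition theta_weight (y : R) : R :=
  if (0 < y) && (y < 1) then (1 - y) `^ (- (al / 2)) else 0.

Definition riemann_kernel (z y : R) : R := if y < z then (z - y) `^ (al - 1) else 0.

Let al0 : 0 < al. Proof. by case/andP: al01. Qed.

Lemma measurable_theta_exp : measurable_fun setT theta_exp.
Proof. by rewrite /theta_exp; mfun. Qed.

Lemma measurable_theta_phase : measurable_fun setT (theta_phase : mR -> R).
Proof. by rewrite /theta_phase /theta_exp; mfun. Qed.

Lemma measurable_theta_weight : measurable_fun setT (theta_weight : mR -> R).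
Proof. by rewrite /theta_weight; mfun. Qed.

Lemma measurable_riemann_kernel :
  measurable_fun setT (fun p : mR * mR => riemann_kernel p.1 p.2).
Proof. by rewrite /riemann_kernel; mfun. Qed.

Lemma theta_exp_bounds (y : R) : 0 < y < 1 -> 1 <= theta_exp y <= expR al.
Proof.
move=> /andP[y0 y1]; have z0 : 0 < 1 - y by lra.
have h1 := mulr_ln_ge y0; have h2 := mulr_ln_ge z0.
have l1 : y * ln y <= 0 by rewrite pmulr_rle0// ln_le0// ltW.
have l2 : (1 - y) * ln (1 - y) <= 0 by rewrite pmulr_rle0// ln_le0//; lra.
by rewrite /theta_exp -[leLHS]expR0 !ler_expR; have := al0; nra.
Qed.

Definition theta_const : R := expR al * (2 + 2 / al).

(** The factor [theta_exp] lies between 1 and [e^al]. At 0 the sine absorbs [ln y], by [sin x <= x]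
    and [- y ln y <= 1]; at 1 the logarithm is at most [(2 / al) (1 - y)^(- al / 2)]. The summand 2
    of the constant collects the cosine and the term at 0. *)
Lemma theta_phase_bound (y : R) : `|theta_phase y| <= theta_const * theta_weight y.
Proof.
rewrite /theta_phase /theta_weight; case: ifP => [y01|_]; last by rewrite normr0 mulr0.
have /andP[y0 y1] := y01; have z0 : 0 < 1 - y by lra.
have /andP[E1 E2] := theta_exp_bounds y01; have al1 : al <= 1 by case/andP: al01.
have pi0 := pi_gt0 R; have pi2 := pi_ge2 R.
rewrite normrM (ger0_norm (le_trans ler01 E1)) /theta_const -[leRHS]mulrA.
apply: ler_pM; [exact: le_trans ler01 E1|exact: normr_ge0|exact: E2|].
set W := (1 - y) `^ _.
have lny : ln y <= 0 by rewrite ln_le0// ltW.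
have lnz : ln (1 - y) <= 0 by rewrite ln_le0//; lra.
have W1 : 1 <= W.
  by rewrite /W /powR gt_eqF// -[leLHS]expR0 ler_expR; have := al0; nra.
have hW : - ln (1 - y) <= 2 / al * W.
  have a20 : 0 < al / 2 by have := al0; lra.
  by have := ln_le_powRN a20 z0; rewrite invf_div.
have x0 : 0 <= pi * al * y <= pi.
  by rewrite !mulr_ge0 ?(ltW pi0) ?(ltW al0) ?(ltW y0)//= -mulrA ler_piMr ?(ltW pi0)// mulr_ile1 ?(ltW al0) ?(ltW y0) ?(ltW y1).
have s0 := sin_ge0_pi x0; have s1 := sin_le1 (pi * al * y).
have sx : sin (pi * al * y) <= pi * al * y by apply: sin_le_id; case/andP: x0.
have p0 : 0 < (pi : R)^-1 by rewrite invr_gt0.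
have p1 : (pi : R)^-1 <= 1 by rewrite invf_le1//; lra.
set S := sin _ in s0 s1 sx *; set p := (pi : R)^-1 in p0 p1 *.
have pS1 : p * S <= 1 by rewrite mulr_ile1// ltW.
have pS0 : 0 <= p * S by rewrite mulr_ge0// ltW.
have pSy : p * S <= y.
  apply: (@le_trans _ _ (al * y)); last by rewrite ler_piMl// ltW.
  rewrite (_ : al * y = p * (pi * al * y)); first by rewrite ler_pM2l.
  by rewrite /p -[pi * al * y]mulrA mulKf// gt_eqF.
have h1 : p * S * - ln y <= 1.
  apply: (@le_trans _ _ (y * - ln y)); first by rewrite ler_wpM2r// oppr_ge0.
  by have := mulr_ln_ge y0; lra.
have h2 : p * S * - ln (1 - y) <= 2 / al * W.
  by apply: le_trans hW; rewrite ler_piMl// oppr_ge0.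
have h3 : 0 <= p * S * - ln y by rewrite mulr_ge0// oppr_ge0.
have h4 : 0 <= p * S * - ln (1 - y) by rewrite mulr_ge0// oppr_ge0.
have c1 := cos_le1 (pi * al * y); have c2 := cos_geN1 (pi * al * y).
rewrite [leRHS]mulrDl; move: h2 h4; set H := p * S * - ln (1 - y) => h2 h4; rewrite ler_norml.
have -> : p * S * (ln y - ln (1 - y)) = H - p * S * - ln y by rewrite /H; ring.
set C := cos _ in c1 c2 *; set L := p * S * - ln y in h1 h3 *; set V := 2 / al * W in h2 *.
by rewrite lerNl; apply/andP; split; lra.
Qed.

(** As [1 - y >= z - y], the two powers merge into [(z - y)^(al / 2 - 1)]. *)
Lemma kernel_weight_le (z y : R) : 0 < z <= 1 ->
  0 <= riemann_kernel z y * theta_weight y <= (if (0 < y) && (y < z) then (z - y) `^ (al / 2 - 1) else 0).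
Proof.
move=> /andP[z0 z1]; rewrite /riemann_kernel /theta_weight.
have [yz|yz] := ltP y z; last by rewrite mul0r andbF lexx.
rewrite (lt_le_trans yz z1) !andbT; case: ifP => y0; last by rewrite mulr0 lexx.
rewrite mulr_ge0 ?powR_ge0//=.
have zy : 0 < z - y by rewrite subr_gt0.
have -> : al / 2 - 1 = (al - 1) + - (al / 2) by lra.
rewrite [leRHS]powRD; last by rewrite (gt_eqF zy) implybT.
rewrite ler_wpM2l ?powR_ge0// !powRN lef_pV2 ?posrE ?powR_gt0//; last by lra.
by rewrite ge0_ler_powR// ?nnegrE; have := al0; lra.
Qed.

Lemma integral_kernel_weight (z : R) : 0 < z <= 1 ->
  (\int[leb]_y (riemann_kernel z y * theta_weight y)%:E <= (z `^ (al / 2) / (al / 2))%:E)%E.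
Proof.
move=> hz; have /andP[z0 z1] := hz; have a20 : 0 < al / 2 by have := al0; lra.
rewrite -integral_powR_itv// [leRHS]integral_mkcond.
apply: ge0_le_integral => //.
- by move=> y _; rewrite lee_fin; case/andP: (kernel_weight_le y hz).
- apply/measurable_EFinP; apply: measurable_funM; last exact: measurable_theta_weight.
  by rewrite /riemann_kernel; mfun.
- apply/(@measurable_restrictT _ _ mR _ `]0, z[%classic) => //.
  by apply/measurable_EFinP; mfun.
- move=> y _; rewrite patchE /= mem_setE in_itv/=.
  by case/andP: (kernel_weight_le y hz) => _; case: ifP => _; rewrite lee_fin.
Qed.

Lemma measurable_kernel_phase (z : R) :
  measurable_fun setT (fun y : mR => riemann_kernel z y * theta_phase y).
Proof.
apply: measurable_funM; last exact: measurable_theta_phase.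
by rewrite /riemann_kernel; mfun.
Qed.

Lemma riemann_kernel_ge0 (z y : R) : 0 <= riemann_kernel z y.
Proof. by rewrite /riemann_kernel; case: ifP => // _; exact: powR_ge0. Qed.

Lemma theta_const_ge0 : 0 <= theta_const.
Proof. by rewrite mulr_ge0 ?expR_ge0// addr_ge0// divr_ge0// (ltW al0). Qed.

Lemma integral_kernel_phase (z : R) : 0 < z <= 1 ->
  (\int[leb]_y `|(riemann_kernel z y * theta_phase y)%:E| <=
   (theta_const * (z `^ (al / 2) / (al / 2)))%:E)%E.
Proof.
move=> hz.
apply: (@le_trans _ _ (theta_const%:E * \int[leb]_y (riemann_kernel z y * theta_weight y)%:E)%E).
  rewrite -ge0_integralZl//; last 3 first.
  - apply/measurable_EFinP; apply: measurable_funM; last exact: measurable_theta_weight.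
    by rewrite /riemann_kernel; mfun.
  - by move=> y _; rewrite lee_fin; case/andP: (kernel_weight_le y hz).
  - by rewrite lee_fin theta_const_ge0.
  apply: ge0_le_integral => //.
  - by do 2 apply: measurableT_comp => //; exact: measurable_kernel_phase.
  - apply/measurable_EFinP; apply: measurable_funM => //.
    apply: measurable_funM; last exact: measurable_theta_weight.
    by rewrite /riemann_kernel; mfun.
  - move=> y _; rewrite -EFinM lee_fin normrM (ger0_norm (riemann_kernel_ge0 _ _)) mulrCA.
    by rewrite ler_wpM2l ?riemann_kernel_ge0 ?theta_phase_bound.
rewrite [leRHS]EFinM; apply: lee_wpmul2l; first by rewrite lee_fin theta_const_ge0.
exact: integral_kernel_weight.
Qed.

Lemma integrable_kernel_phase (z : R) : 0 < z <= 1 ->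
  leb.-integrable setT (fun y => (riemann_kernel z y * theta_phase y)%:E).
Proof.
move=> hz; apply/integrableP; split.
  by apply/measurable_EFinP; exact: measurable_kernel_phase.
by apply: le_lt_trans (integral_kernel_phase hz) _; rewrite ltry.
Qed.

(** With both factors cut off, [theta] is an integral over the whole line of a function jointly
    measurable in [z] and [y], the form that Fubini asks for. *)
Lemma thetaE (z : R) : 0 < z <= 1 ->
  (theta al z)%:E = ((al * expR al)%:E *
    \int[leb]_y (riemann_kernel z y * theta_phase y)%:E)%E.
Proof.
move=> hz; have /andP[z0 z1] := hz.
rewrite /theta EFinM; congr (_ * _)%E.
rewrite -(fineK (integrable_fin_num _ (integrable_kernel_phase hz)))//.
congr EFin; rewrite /Rintegral integral_mkcond; congr fine.
apply: eq_integral => y _; rewrite patchE mem_setE in_itv/= /riemann_kernel /theta_phase.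
have [yz|yz] := ltP y z; last by rewrite andbF mul0r.
rewrite (lt_le_trans yz z1) !andbT; case: ifP => y0; last by rewrite mulr0.
have y1 : 0 < 1 - y by rewrite subr_gt0 (lt_le_trans yz).
rewrite ln_div ?posrE// /theta_exp -!mulrA; congr (_ * _)%:E; rewrite !mulrA.
congr (_ * _); rewrite /powR !gt_eqF// -expRD; congr expR; ring.
Qed.

Lemma theta_bound (z : R) : 0 < z <= 1 ->
  `|theta al z| <= al * expR al * (theta_const * (z `^ (al / 2) / (al / 2))).
Proof.
move=> hz; have ac : 0 <= al * expR al by rewrite mulr_ge0 ?expR_ge0// ltW ?al0.
rewrite -lee_fin -[X in (X <= _)%E]/(`|(theta al z)%:E|)%E thetaE// abseM.
rewrite [X in (_ <= X)%E]EFinM gee0_abs ?lee_fin//; apply: lee_wpmul2l; first by rewrite lee_fin.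
apply: le_trans (integral_kernel_phase hz).
apply: le_abse_integral => //.
by apply/measurable_EFinP; exact: measurable_kernel_phase.
Qed.

(** For [y < z <= 1 / 2] the angle [pi * al * y] is below [pi / 2] and [ln (y / (1 - y))] is
    nonpositive, so the integrand is positive. *)
Lemma theta_gt0_half (z : R) : 0 < z <= 2^-1 -> 0 < theta al z.
Proof.
move=> /andP[z0 z2]; have z1 : z <= 1 by lra.
rewrite -lte_fin thetaE ?z0// mule_gt0//.
  by rewrite lte_fin mulr_gt0 ?expR_gt0// al0.
have -> : (\int[leb]_y (riemann_kernel z y * theta_phase y)%:E =
    \int[leb]_(y in `]0%R, z[) (riemann_kernel z y * theta_phase y)%:E)%E.
  rewrite [RHS]integral_mkcond; apply: eq_integral => y _.
  rewrite patchE mem_setE in_itv/= /riemann_kernel /theta_phase.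
  by case: (0 < y); case: (y < z); rewrite ?mulr0 ?mul0r.
apply: integral_gt0 => //.
- by apply/measurable_EFinP/measurable_funTS; exact: measurable_kernel_phase.
- have : (0 < leb `]0%R, z[%classic)%E by rewrite lebesgue_measure_itv/= lte_fin z0 -EFinB lte_fin subr0.
  by [].
move=> y /=; rewrite in_itv/= => /andP[y0 yz].
have y1 : 0 < 1 - y by lra.
rewrite /riemann_kernel yz /theta_phase y0 (_ : y < 1) /=; last lra.
rewrite lte_fin mulr_gt0 ?powR_gt0 ?subr_gt0//.
have pi0 := pi_gt0 R; have al1 : al <= 1 by case/andP: al01.
have ay : al * y < 2^-1 by have := al0; nra.
have ay0 : 0 < al * y by rewrite mulr_gt0 ?al0.
have x2 : pi * al * y < pi / 2 by rewrite -mulrA ltr_pM2l.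
have x0 : 0 < pi * al * y by rewrite -mulrA mulr_gt0.
apply: mulr_gt0; first exact: expR_gt0.
have c0 : 0 < cos (pi * al * y) by apply: cos_gt0_pihalf; lra.
have s0 : 0 < sin (pi * al * y) by apply: sin_gt0_pi; lra.
have l0 : ln y <= ln (1 - y) by rewrite ler_ln ?posrE//; lra.
have : 0 <= pi^-1 * sin (pi * al * y) * - (ln y - ln (1 - y)).
  by rewrite !mulr_ge0 ?invr_ge0 ?(ltW pi0) ?(ltW s0)//; lra.
lra.
Qed.

Lemma lebesgue_integral_affine_integrable (a b : R) (f : R -> \bar R) : 0 < a ->
  leb.-integrable setT f ->
  (\int[leb]_x f x = a%:E * \int[leb]_x f (b + a * x)%R)%E.
Proof.
move=> a0 intf; have mf := measurable_int _ intf.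
pose g x := f (b + a * x).
have h1 : (\int[leb]_x f^\+ x = a%:E * \int[leb]_x g^\+ x)%E.
  rewrite (lebesgue_integral_affine b a0 (measurable_funepos mf) (funepos_ge0 f)).
  by congr (_ * _)%E; apply: eq_integral => x _; rewrite !funeposE.
have h2 : (\int[leb]_x f^\- x = a%:E * \int[leb]_x g^\- x)%E.
  rewrite (lebesgue_integral_affine b a0 (measurable_funeneg mf) (funeneg_ge0 f)).
  by congr (_ * _)%E; apply: eq_integral => x _; rewrite !funenegE.
have fin : (\int[leb]_x g^\- x)%E \is a fin_num.
  have g0 : (0 <= \int[leb]_x g^\- x)%E by apply: integral_ge0.
  rewrite ge0_fin_numE// ltey; apply/eqP => E0.
  by have := integrable_neg_fin_num measurableT intf; rewrite h2 E0 gt0_muley.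
rewrite integralE [in RHS]integralE muleBr//.
  by congr (_ - _)%E; [exact: h1|exact: h2].
by apply: fin_num_adde_defl; rewrite fin_numN; exact: fin.
Qed.

Lemma continuous_theta_phase (y : R) : 0 < y < 1 -> {for y, continuous theta_phase}.
Proof.
move=> y01; have /andP[y0 y1] := y01.
pose f (y : R) := theta_exp y * (cos (pi * al * y) - pi^-1 * sin (pi * al * y) * (ln y - ln (1 - y))).
have c1 : {for y, continuous (fun y : R => 1 - y)}.
  by apply: cvgB; [exact: cvg_cst|exact: cvg_id].
have l0 : {for y, continuous (@ln R)} by exact: continuous_ln.
have l1 : {for y, continuous (fun y : R => ln (1 - y))}.
  by apply: (continuous_comp c1); apply: continuous_ln; lra.
have cx : {for y, continuous (fun y : R => pi * al * y)}.
  by apply: cvgM; [exact: cvg_cst|exact: cvg_id].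
have cf : {for y, continuous f}.
  apply: cvgM.
    rewrite /theta_exp; apply: continuous_comp; last exact: continuous_expR.
    apply: cvgM; first exact: cvg_cst.
    by apply: cvgD; apply: cvgM => //; exact: cvg_id.
  apply: cvgB; first by apply: (continuous_comp cx); exact: continuous_cos.
  apply: cvgM; last exact: cvgB.
  apply: cvgM; first exact: cvg_cst.
  by apply: (continuous_comp cx); exact: continuous_sin.
rewrite /prop_for /continuous_at (_ : theta_phase y = f y); last by rewrite /theta_phase y01.
apply: cvg_trans cf; apply: near_eq_cvg; near=> x.
rewrite /theta_phase ifT//; near: x.
have : y \in `]0, 1[ by rewrite in_itv/= y01.
by move/near_in_itvoo; apply: filterS => x; rewrite in_itv.
Unshelve. all: end_near. Qed.

(** The substitution [y = z t] fixes the domain and the singular kernel; the dependence on [z] is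
    left in [theta_phase (z * t)] alone, where dominated convergence gives continuity. *)
Let ker1 (z t : R) : R := riemann_kernel 1 t * theta_phase (z * t).

Lemma ker1_bound (z t : R) : 0 < z < 1 ->
  `|ker1 z t| <= theta_const * (riemann_kernel 1 t * theta_weight t).
Proof.
move=> /andP[z0 z1]; rewrite /ker1 normrM (ger0_norm (riemann_kernel_ge0 _ _)) mulrCA.
have [->|rn] := eqVneq (riemann_kernel 1 t) 0; first by rewrite !mul0r.
rewrite ler_wpM2l ?riemann_kernel_ge0//.
have t1 : t < 1 by move: rn; rewrite /riemann_kernel; case: ifP => //; rewrite eqxx.
have [t0|t0] := ltP 0 t; last first.
  rewrite /theta_phase (ltNge 0) pmulr_rle0// t0/= normr0.
  by rewrite mulr_ge0 ?theta_const_ge0// /theta_weight; case: ifP; rewrite ?powR_ge0.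
apply: le_trans (theta_phase_bound _) _; rewrite ler_wpM2l ?theta_const_ge0//.
have zt : z * t <= t by rewrite ler_piMl// ltW.
rewrite /theta_weight mulr_gt0// t0 t1 (le_lt_trans zt t1)/=.
rewrite !powRN lef_pV2 ?posrE ?powR_gt0 ?subr_gt0// ?(le_lt_trans zt)//.
by rewrite ge0_ler_powR// ?nnegrE; have := al0; lra.
Qed.

Lemma measurable_ker1 (z : R) : measurable_fun setT (ker1 z : mR -> R).
Proof.
apply: measurable_funM; first by rewrite /riemann_kernel; mfun.
by apply: (measurableT_comp measurable_theta_phase); mfun.
Qed.

Lemma integrable_ker1_bound :
  leb.-integrable setT (EFin \o (fun t => theta_const * (riemann_kernel 1 t * theta_weight t))).
Proof.
have h1 : 0 < (1 : R) <= 1 by rewrite ltr01 lexx.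
have -> : EFin \o (fun t => theta_const * (riemann_kernel 1 t * theta_weight t)) =
   (fun t => theta_const%:E * (riemann_kernel 1 t * theta_weight t)%:E)%E by [].
apply: integrableZl => //; apply/integrableP; split.
  apply/measurable_EFinP; apply: measurable_funM; last exact: measurable_theta_weight.
  by rewrite /riemann_kernel; mfun.
under eq_integral => t _.
  rewrite gee0_abs; last by rewrite lee_fin; case/andP: (kernel_weight_le t h1).
  over.
by apply: le_lt_trans (integral_kernel_weight h1) _; rewrite ltry.
Qed.

Lemma integrable_ker1 (z : R) : 0 < z < 1 -> leb.-integrable setT (EFin \o ker1 z).
Proof.
move=> z01; apply: le_integrable integrable_ker1_bound => //.
  by apply/measurable_EFinP; exact: measurable_ker1.
move=> t _; rewrite lee_fin; apply: le_trans (ker1_bound t z01) _; exact: ler_norm.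
Qed.

Lemma theta_scaled (z : R) : 0 < z < 1 ->
  theta al z = al * expR al * z `^ al * \int[leb]_(t in `]0, 1[) ker1 z t.
Proof.
move=> z01; have /andP[z0 z1] := z01.
have hz : 0 < z <= 1 by rewrite z0 ltW.
have -> : \int[leb]_(t in `]0, 1[) ker1 z t = \int[leb]_t ker1 z t.
  rewrite Rintegral_mkcond; apply: eq_Rintegral => t _.
  rewrite patchE mem_setE in_itv/= /ker1 /riemann_kernel /theta_phase pmulr_rgt0//.
  by case: (0 < t); case: (t < 1); rewrite ?mulr0 ?mul0r.
apply: EFin_inj; rewrite thetaE// (lebesgue_integral_affine_integrable 0 z0 (integrable_kernel_phase hz)).
have fin := integrable_fin_num measurableT (integrable_ker1 z01).
have -> : (al * expR al * z `^ al * \int[leb]_t ker1 z t)%:E =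
    ((al * expR al)%:E * ((z `^ al)%:E * \int[leb]_t (ker1 z t)%:E))%E.
  by rewrite -[in RHS](fineK fin) -!EFinM mulrA.
congr (_ * _)%E.
have -> : z `^ al = z * z `^ (al - 1) by rewrite mulr_powRB1 ?al0// ltW.
rewrite EFinM -[RHS]muleA; congr (_ * _)%E; rewrite -integralZl//; last exact: integrable_ker1.
apply: eq_integral => t _; rewrite add0r -EFinM /ker1 mulrA; congr ((_ * _)%:E).
rewrite /riemann_kernel gtr_pMr//; case: ifP => t1; last by rewrite mulr0.
by rewrite -powRM ?(ltW z0) ?subr_ge0 ?(ltW t1)// mulrBr mulr1.
Qed.

Lemma continuous_theta (z : R) : 0 < z < 1 -> {for z, continuous (theta al)}.
Proof.
move=> z01; have /andP[z0 z1] := z01.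
pose f z := al * expR al * z `^ al * \int[leb]_(t in `]0, 1[) ker1 z t.
have zI : z \in `]0, 1[%classic by rewrite inE/= in_itv/=.
have mI : measurable (`]0, 1[%classic : set mR) by [].
have cI : {in `]0, 1[%classic, continuous (fun z => \int[leb]_(t in `]0, 1[) ker1 z t)}.
  apply: (@continuity_under_integral R _ mR leb ker1 _ mI 0 1 _ _
    (fun t => theta_const * (riemann_kernel 1 t * theta_weight t))).
  - move=> x; rewrite /= in_itv/= => x01; apply: integrableS (integrable_ker1 x01) => //.
  - apply: aeW => t /=; rewrite in_itv/= => t01 x; rewrite inE/= in_itv/= => x01.
    rewrite /ker1.
    have cx : {for x, continuous (fun x : R => x * t)}.
      by apply: cvgM; [exact: cvg_id|exact: cvg_cst].
    have xt : 0 < x * t < 1.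
      have /andP[t0 t1] := t01; have /andP[x0 x1] := x01.
      by rewrite mulr_gt0//= mulr_ilt1// ltW.
    have := continuous_comp cx (continuous_theta_phase xt).
    by move=> h; apply: cvgM; [exact: cvg_cst|exact: h].
  - by apply: integrableS integrable_ker1_bound.
  - move=> x; rewrite /= in_itv/= => x01; apply: aeW => t _; exact: ker1_bound.
have cz : {for z, continuous (fun x : R => x `^ al)}.
  apply: differentiable_continuous; apply/derivable1_diffP.
  by case: (is_derive1_powR al z0).
have cf : {for z, continuous f}.
  apply: cvgM; last exact: cI.
  apply: cvgM; first exact: cvg_cst.
  exact: cz.
rewrite /prop_for /continuous_at theta_scaled//.
apply: cvg_trans cf; apply: near_eq_cvg; near=> x.
rewrite theta_scaled//; near: x.
have : z \in `]0, 1[ by rewrite in_itv/= z01.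
by move/near_in_itvoo; apply: filterS => x; rewrite in_itv.
Unshelve. all: end_near. Qed.

End theta_basics.

(** * The Stieltjes transform of theta *)

Section stieltjes_theta.
Context (R : realType).
Notation leb := (@lebesgue_measure R).
Notation mR := (measurableTypeR R).

(** The inverse [psi] and the convexity of [E] show that the images of the exhausting segments
    exhaust [E]. *)
Lemma ge0_substitution_bijection (phi psi phi' G : R -> R) (a_ b_ : nat -> R) (D E : set R) :
  (forall n, a_ n < b_ n) -> nonincreasing_seq a_ -> nondecreasing_seq b_ ->
  D = \bigcup_n `[a_ n, b_ n]%classic -> open D ->
  (forall x y z, E x -> E z -> x <= y <= z -> E y) ->
  (forall x, D x -> E (phi x)) -> (forall x, E x -> D (psi x)) ->
  (forall x, E x -> phi (psi x) = x) ->
  (forall x y, D x -> D y -> x < y -> phi y < phi x) ->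
  (forall x, D x -> is_derive x 1 phi (phi' x)) ->
  (forall x, D x -> {for x, continuous phi'}) -> (forall x, D x -> phi' x <= 0) ->
  (forall x, E x -> 0 <= G x) -> (forall x, E x -> {for x, continuous G}) ->
  (\int[leb]_(x in E) (G x)%:E = \int[leb]_(x in D) (G (phi x) * - phi' x)%:E)%E.
Proof.
move=> ab na nb DE oD cE phiE psiD phiK dphi.
have Dn n x : x \in `[a_ n, b_ n] -> D x by move=> h; rewrite DE; exists n.
apply: (ge0_substitution_exhaustion ab na nb DE oD) => //.
apply/seteqP; split => x.
- move=> Ex; have := psiD _ Ex; rewrite {1}DE => -[n _ xn]; exists n => //=.
  have Dx := psiD _ Ex; move: xn; rewrite /= !in_itv/= => /andP[h1 h2].
  have Da : D (a_ n) by apply: (Dn n); rewrite in_itv/= lexx ltW.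
  have Db : D (b_ n) by apply: (Dn n); rewrite in_itv/= lexx ltW.
  rewrite -(phiK _ Ex); apply/andP; split.
    by move: h2; rewrite le_eqVlt => /predU1P[->//|h2]; exact/ltW/dphi.
  by move: h1; rewrite le_eqVlt => /predU1P[->//|h1]; exact/ltW/dphi.
- move=> [n _ /=]; rewrite in_itv/=; apply: cE; apply: phiE; apply: (Dn n).
    by rewrite in_itv/= lexx ltW.
  by rewrite in_itv/= lexx ltW.
Qed.

Lemma itv_exhaustion (a b : R) : a < b -> `]a, b[%classic =
  \bigcup_n `[a + (b - a) * n.+3%:R^-1, b - (b - a) * n.+3%:R^-1]%classic.
Proof.
move=> ab; have z0 : 0 < b - a by rewrite subr_gt0.
have H := itv0_exhaustion z0; rewrite predeqE => x.
transitivity (`]0, b - a[%classic (x - a)).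
  by rewrite /= !in_itv/= subr_gt0 ltrD2r.
have e n : (x - a \in `[(b - a) * n.+3%:R^-1, b - a - (b - a) * n.+3%:R^-1]) =
    (x \in `[a + (b - a) * n.+3%:R^-1, b - (b - a) * n.+3%:R^-1]).
  by rewrite !in_itv/= lerBrDl lerBlDr; congr (_ && (_ <= _)); ring.
by rewrite H; split => -[n _ /= h]; exists n => //=; move: h; rewrite e.
Qed.

Lemma affine_pos (s z : R) : -1 < s -> 0 <= z <= 1 -> 0 < 1 + s * z.
Proof.
move=> s1 /andP[z0 z1]; have [->|zn] := eqVneq z 0; first by rewrite mulr0 addr0.
have zp : 0 < z by rewrite lt_neqAle eq_sym zn.
have : 0 < z * (1 + s) by rewrite mulr_gt0//; lra.
lra.
Qed.

Variables (al s : R).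
Hypothesis al01 : 0 < al <= 1.
Hypothesis s1 : -1 < s.

Let al0 : 0 < al. Proof. by case/andP: al01. Qed.

Lemma continuous_inv_affine x : 0 < 1 + s * x -> {for x, continuous (fun x => (1 + s * x)^-1)}.
Proof.
move=> h; apply: cvgV; first by rewrite gt_eqF.
apply: cvgD; first exact: cvg_cst.
by apply: cvgM; [exact: cvg_cst|exact: cvg_id].
Qed.

(** The map [phi] is a decreasing involution of []y, 1[]. It moves the dependence on [y] from the
    integrand to the domain, so that after an exchange of integrals [theta_phase] is integrated
    alone over []0, x[]. *)
Lemma moebius_substitution (y : R) : 0 < y < 1 ->
  (\int[leb]_(x in `]y, 1%R[) ((1 - x) `^ (al - 1) / (1 + s * x))%:E =
   ((1 + s) `^ (al - 1))%:E *
   \int[leb]_(z in `]y, 1%R[) ((1 + s * z) `^ (- al) * (z - y) `^ (al - 1))%:E)%E.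
Proof.
move=> /andP[y0 y1].
have pos z : y < z < 1 -> 0 < 1 + s * z.
  by move=> /andP[yz z1]; apply: affine_pos => //; rewrite (ltW z1) ltW// (lt_trans y0).
have posy : 0 < 1 + s * y by apply: affine_pos => //; rewrite !ltW.
have sp : 0 < 1 + s by rewrite -ltrBlDl sub0r.
pose phi z : R := (1 + y * (1 + s) + (-1) * z) / (1 + s * z).
pose phi' z : R := - ((1 + s) * (1 + s * y)) / (1 + s * z) ^+ 2.
have w0 : 0 < 1 - y by lra.
have [na nb] := itv0_exhaustion_mono w0.
have phiD z : y < z < 1 -> y < phi z < 1.
  move=> hz; have /andP[yz z1] := hz; have pz := pos _ hz.
  rewrite /phi ltr_pdivlMr// ltr_pdivrMr// mul1r; apply/andP; split.
    have : 0 < (1 - z) * (1 + s * y) by rewrite mulr_gt0//; lra.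
    by lra.
  have : (1 + s) * y < (1 + s) * z by rewrite ltr_pM2l.
  by lra.
have phiK z : y < z < 1 -> phi (phi z) = z.
  move=> hz; have pz := pos _ hz; have pz' := pos _ (phiD _ hz).
  have e1 : phi z * (1 + s * z) = 1 + y * (1 + s) + (-1) * z by rewrite divfK// gt_eqF.
  have e2 : phi (phi z) * (1 + s * phi z) = 1 + y * (1 + s) + (-1) * phi z by rewrite divfK// gt_eqF.
  have n0 : 1 + s * phi z != 0 by rewrite gt_eqF.
  by apply: (mulIf n0); rewrite e2; move: e1; move: (phi z) => w; lra.
rewrite -ge0_integralZl//; last 3 first.
- apply/measurable_EFinP/measurable_funTS; mfun.
- by move=> z _; rewrite lee_fin mulr_ge0 ?powR_ge0.
- by rewrite lee_fin powR_ge0.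
pose G x : R := (1 - x) `^ (al - 1) / (1 + s * x).
transitivity (\int[leb]_(z in `]y, 1%R[) (G (phi z) * - phi' z)%:E)%E; last first.
  apply: eq_integral => z; rewrite inE/= in_itv/= => hz; rewrite -EFinM; congr EFin; rewrite /G.
  have /andP[yz z1] := hz; have pz := pos _ hz.
  have zy : 0 < z - y by rewrite subr_gt0.
  have -> : 1 - phi z = (1 + s) * (z - y) * (1 + s * z)^-1.
    by rewrite /phi; field; rewrite gt_eqF.
  have -> : 1 + s * phi z = (1 + s) * (1 + s * y) / (1 + s * z).
    by rewrite /phi; field; rewrite gt_eqF.
  rewrite !powRM ?mulr_ge0 ?invr_ge0 ?(ltW sp) ?(ltW zy) ?(ltW pz)//.
  have -> : (1 + s * z)^-1 `^ (al - 1) = (1 + s * z) * (1 + s * z) `^ (- al).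
    rewrite -powR_inv1 ?(ltW pz)// -powRrM (_ : -1 * (al - 1) = 1 + - al); last by ring.
    by rewrite powRD ?(gt_eqF pz) ?implybT// powRr1 ?(ltW pz).
  rewrite /phi'; field.
  by rewrite !gt_eqF ?powR_gt0.
apply: (@ge0_substitution_bijection phi phi phi' G _ _ `]y, 1[%classic `]y, 1[%classic _ _ _ (itv_exhaustion y1)).
- by move=> n; have := itv0_exhaustion_lt n w0; move: ((1 - y) * n.+3%:R^-1) => w; lra.
- by move=> m n mn; rewrite lerD2l; exact: na.
- by move=> m n mn; rewrite lerD2l lerN2; exact: na.
- exact: interval_open.
- by move=> x1 x2 x3; rewrite /= !in_itv/= => /andP[h1 h2] /andP[h3 h4] /andP[h5 h6]; apply/andP; split; lra.
- by move=> z; rewrite /= !in_itv/=; exact: phiD.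
- by move=> z; rewrite /= !in_itv/=; exact: phiD.
- by move=> z; rewrite /= in_itv/=; exact: phiK.
- move=> z1 z2; rewrite /= !in_itv/= => /[dup] h1 /pos p1 /[dup] h2 /pos p2 z12.
  rewrite /phi ltr_pdivrMr// mulrAC ltr_pdivlMr//.
  have : 0 < (1 + s) * (1 + s * y) * (z2 - z1) by rewrite !mulr_gt0// subr_gt0.
  lra.
- move=> z; rewrite /= in_itv/= => hz; have pz := pos _ hz.
  have d1 := is_derive_affine (1 + y * (1 + s)) (-1) z.
  have d2 := is_derive_affine 1 s z.
  have n0 : 1 + s * z != 0 by rewrite gt_eqF.
  have d3 : is_derive z 1 (fun z => (1 + s * z)^-1) (- (1 + s * z) ^- 2 *: s).
    exact: (@is_deriveV R (fun z => 1 + s * z) z _ _ n0 d2).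
  apply: is_derive_eq (is_deriveM d1 d3) _.
  by rewrite /GRing.scale/= /phi'; field.
- move=> z; rewrite /= in_itv/= => hz; have pz := pos _ hz.
  have c := continuous_inv_affine pz.
  apply: cvgM; first exact: cvg_cst.
  have -> : (fun x => ((1 + s * x) ^+ 2)^-1) = (fun x => (1 + s * x)^-1 * (1 + s * x)^-1).
    by apply/funext => x; rewrite -expr2 exprVn.
  by rewrite -exprVn expr2; exact: cvgM.
- move=> z; rewrite /= in_itv/= => hz; have pz := pos _ hz.
  by rewrite /phi' mulNr oppr_le0 divr_ge0 ?sqr_ge0// mulr_ge0 ?ltW.
- move=> x; rewrite /= in_itv/= => hx; have px := pos _ hx.
  by rewrite divr_ge0 ?powR_ge0 ?ltW.
- move=> x; rewrite /= in_itv/= => hx; have px := pos _ hx.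
  have -> : G = (fun x => (1 + (-1) * x) `^ (al - 1) * (1 + s * x)^-1).
    by apply/funext => t; rewrite /G mulN1r.
  apply: cvgM; last exact: continuous_inv_affine.
  by apply: continuous_powR_affine; rewrite mulN1r subr_gt0; case/andP: hx.
Qed.

Definition theta_primitive (y : R) : R := sin (pi * al * y) * theta_exp al y.

(** In [theta_phase] the cosine comes from differentiating the sine, the logarithm from
    differentiating the entropy in [theta_exp]. *)
Lemma is_derive_theta_primitive (y : R) : 0 < y < 1 ->
  is_derive y 1 theta_primitive (pi * al * theta_phase al y).
Proof.
move=> y01; have /andP[y0 y1] := y01; have z0 : 0 < 1 - y by lra.
have dm : is_derive y 1 (fun y => 1 + (-1) * y) (-1) := is_derive_affine 1 (-1) y.
have dl : is_derive y 1 (fun y => ln (1 + (-1) * y)) ((1 + (-1) * y)^-1 * -1).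
  apply: (@is_derive1_comp R (@ln R) (fun y => 1 + (-1) * y) _ _ _ _ dm).
  by apply: is_derive1_ln; lra.
have dln := is_derive1_ln y0.
have did := is_derive_id y (1 : R).
have di := is_deriveD (is_deriveM did dln) (is_deriveM dm dl).
have de := is_derive1_comp (is_derive_expR _) (is_deriveZ (- al) di).
have dx : is_derive y 1 (fun y => pi * al * y) (pi * al).
  by apply: is_derive_eq (is_deriveZ (pi * al) did) _; rewrite /GRing.scale/= mulr1.
have ds := is_derive1_comp (is_derive_sin _) dx.
have -> : theta_primitive = (@sin R \o (fun y => pi * al * y)) *
   (expR \o (- al *: (id * @ln R + (fun y => 1 + (-1) * y) * (fun y => ln (1 + (-1) * y))))).
  by apply/funext => x; rewrite /theta_primitive /theta_exp /GRing.scale/= !fctE/= mulN1r.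
apply: is_derive_eq (is_deriveM ds de) _.
rewrite /theta_phase y01 /theta_exp !fctE/= /GRing.scale/= !mulN1r.
have pi0 : (pi : R) != 0 by rewrite gt_eqF// pi_gt0.
have n1 : y != 0 by rewrite gt_eqF.
have n2 : 1 - y != 0 by rewrite gt_eqF.
set X := expR _; set C := cos _; set S := sin _; set l1 := ln y; set l2 := ln (1 - y).
move: X C S l1 l2 (pi : R) pi0 => X C S l1 l2 p p0.
by field; rewrite n2 n1 p0.
Qed.

Lemma integrable_theta_phase : leb.-integrable setT (EFin \o theta_phase al).
Proof.
apply: le_integrable (integrable_ker1_bound al01) => //.
  by apply/measurable_EFinP; exact: measurable_theta_phase.
move=> y _; rewrite lee_fin; apply: le_trans (theta_phase_bound al01 y) _.
apply: le_trans (ler_norm _); rewrite ler_wpM2l ?theta_const_ge0//.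
rewrite /riemann_kernel /theta_weight; case: ifP => [/andP[y0 y1]|_]; last by rewrite mulr0.
rewrite y1 ler_peMl ?powR_ge0// /powR gt_eqF ?subr_gt0// -[leLHS]expR0 ler_expR.
have : ln (1 - y) <= 0 by rewrite ln_le0//; lra.
have /andP[_ al1] := al01; nra.
Qed.

(** Since [theta_phase] may change sign, the exhaustion by segments goes through dominated
    convergence. *)
Lemma integral_theta_phase (x : R) : 0 < x < 1 ->
  (\int[leb]_(y in `]0%R, x[) (theta_phase al y)%:E = (theta_primitive x / (pi * al))%:E)%E.
Proof.
move=> /andP[x0 x1].
have [na nb] := itv0_exhaustion_mono x0.
have D n : `[x * n.+3%:R^-1, x - x * n.+3%:R^-1]%classic `<=` `]0, x[%classic.
  by rewrite (itv0_exhaustion x0) => y hy; exists n.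
have cc : (\int[leb]_(y in `[(x * n.+3%:R^-1)%R, (x - x * n.+3%:R^-1)%R]) (theta_phase al y)%:E)%E
    @[n --> \oo] --> (\int[leb]_(y in `]0%R, x[) (theta_phase al y)%:E)%E.
  rewrite integral_mkcond; under eq_fun do rewrite integral_mkcond.
  apply: (@dominated_cvg _ mR _ leb setT measurableT _ _ (fun y => `|(theta_phase al y)%:E|%E)) => //.
  - move=> n; have /= h := @measurable_restrictT _ _ mR _ `[(x * n.+3%:R^-1), (x - x * n.+3%:R^-1)]%classic (EFin \o theta_phase al).
    apply/h => //; apply: measurable_funTS; apply/measurable_EFinP; exact: measurable_theta_phase.
  - move=> y _; apply: cvg_near_cst.
    have [yx|yx] := boolP (y \in `]0, x[%classic); last first.
      apply: nearW => n; rewrite !patchE (negbTE yx) ifN//.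
      by apply: contra yx; rewrite !inE; exact: D.
    have [N _ yN] : (\bigcup_n `[x * n.+3%:R^-1, x - x * n.+3%:R^-1]%classic) y.
      by rewrite -itv0_exhaustion//; move: yx; rewrite inE.
    near=> n.
    rewrite !patchE yx mem_set//.
    have Nn : (N <= n)%N by near: n; exact: nbhs_infty_ge.
    by have /subsetPset := nondecreasing_segments na nb Nn; exact.
  - exact: integrable_abse integrable_theta_phase.
  - by move=> n y _; rewrite patchE; case: ifP => // _; rewrite abse0.
have cE n : (\int[leb]_(y in `[(x * n.+3%:R^-1)%R, (x - x * n.+3%:R^-1)%R]) (theta_phase al y)%:E =
    ((theta_primitive (x - x * n.+3%:R^-1) - theta_primitive (x * n.+3%:R^-1)) / (pi * al))%:E)%E.
  have ab := itv0_exhaustion_lt n x0.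
  have in01 y : y \in `[x * n.+3%:R^-1, x - x * n.+3%:R^-1] -> 0 < y < 1.
    move=> hy; have := D n y hy; rewrite /= in_itv/= => /andP[-> h]; exact: lt_trans h x1.
  have dP y : y \in `[x * n.+3%:R^-1, x - x * n.+3%:R^-1] ->
      is_derive y 1 (fun y => (pi * al)^-1 * theta_primitive y) (theta_phase al y).
    move=> /in01 /is_derive_theta_primitive d; apply: is_derive_eq (is_deriveZ (pi * al)^-1 d) _.
    by rewrite /GRing.scale/= mulKf// mulf_neq0 ?gt_eqF ?pi_gt0 ?al0.
  rewrite (@continuous_FTC2 _ (theta_phase al) (fun y => (pi * al)^-1 * theta_primitive y))//.
  - by rewrite -EFinB; congr EFin; rewrite mulrBl ![_ / _]mulrC.
  - apply: (continuous_segment ab) => y /in01; exact: continuous_theta_phase.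
  - exact: derivable_segment dP ab.
  - move=> y hy; rewrite derive1E.
    by case: (dP y (subset_itv_oo_cc hy)).
have cP : {for x, continuous theta_primitive}.
  apply: differentiable_continuous; apply/derivable1_diffP.
  by case: (@is_derive_theta_primitive x ltac:(by rewrite x0)).
have h1 : theta_primitive (x - x * n.+3%:R^-1) @[n --> \oo] --> theta_primitive x.
  apply: (@continuous_cvg _ _ _ _ _ (fun n => x - x * n.+3%:R^-1) theta_primitive x cP).
  by rewrite -[X in _ --> X]subr0; apply: cvgB; [exact: cvg_cst|exact: cvg_invS3].
have h2 : theta_primitive (x * n.+3%:R^-1) @[n --> \oo] --> 0.
  apply: norm_cvg0.
  apply: (@squeeze_cvgr _ _ _ _ (cst 0) (fun n => (pi * al * expR al) * (x * n.+3%:R^-1))).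
  - near=> n; rewrite normr_ge0/=.
    have hy : 0 < x * n.+3%:R^-1 < 1.
      rewrite mulr_gt0 ?invr_gt0//=; apply: le_lt_trans x1; rewrite ler_piMr ?(ltW x0)//.
      by rewrite invf_le1// ler1n.
    have /andP[y0 y1] := hy; move: (x * n.+3%:R^-1) hy y0 y1 => y hy y0 y1.
    have /andP[E1 E2] := theta_exp_bounds al01 hy.
    have pi0 := pi_gt0 R; have /andP[_ al1] := al01.
    have p0 : 0 <= pi * al * y by rewrite !mulr_ge0 ?(ltW pi0) ?(ltW al0) ?(ltW y0).
    have s0 : 0 <= sin (pi * al * y).
      apply: sin_ge0_pi; rewrite p0/= -mulrA ler_piMr ?(ltW pi0)//.
      by rewrite mulr_ile1 ?(ltW al0) ?(ltW y0) ?(ltW y1).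
    rewrite /theta_primitive ger0_norm ?mulr_ge0 ?expR_ge0// [leRHS]mulrAC.
    by apply: ler_pM => //; [exact: expR_ge0|exact: sin_le_id].
  - exact: cvg_cst.
  - by rewrite -(mulr0 (pi * al * expR al)); apply: cvgMr; exact: cvg_invS3.
have E : (fun n => \int[leb]_(y in `[(x * n.+3%:R^-1)%R, (x - x * n.+3%:R^-1)%R]) (theta_phase al y)%:E)%E =
    (fun n => ((theta_primitive (x - x * n.+3%:R^-1) - theta_primitive (x * n.+3%:R^-1)) / (pi * al))%:E).
  by apply/funext => n; exact: cE.
rewrite E in cc; apply: (cvg_unique _ cc) => //.
apply: cvg_EFin; first exact: nearW.
by apply: cvgMl; rewrite -[X in _ --> X]subr0; exact: cvgB.
Unshelve. all: end_near. Qed.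

(** Under [x = 1 / (1 + e^u)] one has [1 - x = e^u x]; the entropy and the power of [1 - x] combine
    into [e^(al u / (1 + e^u))], the modulus of [exp (al * W)] on the line [Im z = pi], and the
    angle of the sine is its argument. *)
Lemma logistic_substitution : s != 0 ->
  (\int[leb]_(x in `]0%R, 1%R[) ((1 - x) `^ (al - 1) / (1 + s * x) * theta_primitive x)%:E =
   \int[leb]_u (expR (al * (u / (1 + expR u))) * sin (al * (pi / (1 + expR u))) / (1 + s + expR u))%:E)%E.
Proof.
move=> s0; have sp : 0 < 1 + s by rewrite -ltrBlDl sub0r.
have e0 (u : R) : 0 < 1 + expR u by rewrite addr_gt0// expR_gt0.
pose phi (u : R) : R := (1 + expR u)^-1; pose psi (x : R) : R := ln (x^-1 - 1).
pose phi' (u : R) : R := - (1 + expR u) ^- 2 * expR u.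
pose G x : R := (1 - x) `^ (al - 1) / (1 + s * x) * theta_primitive x.
have phi01 u : 0 < phi u < 1.
  by rewrite /phi invr_gt0 e0 invf_lt1// ltrDl expR_gt0.
have pos x : 0 < x < 1 -> 0 < 1 + s * x.
  by move=> /andP[x0 x1]; apply: affine_pos => //; rewrite !ltW.
transitivity (\int[leb]_u (G (phi u) * - phi' u)%:E)%E; last first.
  apply: eq_integral => u _; congr EFin; rewrite /G /theta_primitive /theta_exp.
  have eu := expR_gt0 u; have n0 : 1 + expR u != 0 by rewrite gt_eqF.
  have h1 : 1 - phi u = expR u / (1 + expR u) by rewrite /phi; field.
  have l1 : ln (phi u) = - ln (1 + expR u) by rewrite /phi lnV ?posrE.
  have l2 : ln (1 - phi u) = u - ln (1 + expR u) by rewrite h1 ln_div ?posrE// expRK.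
  have p1 : (1 - phi u) `^ (al - 1) = expR ((al - 1) * (u - ln (1 + expR u))).
    by rewrite /powR gt_eqF ?l2// subr_gt0; case/andP: (phi01 u).
  have n1 : 1 + s + expR u != 0 by rewrite gt_eqF// addr_gt0.
  have h2 : 1 + s * phi u = (1 + s + expR u) / (1 + expR u) by rewrite /phi; field.
  rewrite p1 l1 l2 h2 (_ : al * (pi / (1 + expR u)) = pi * al * phi u); last by rewrite /phi mulrCA mulrA.
  set S := sin _.
  have -> : expR (al * (u / (1 + expR u))) = expR ((al - 1) * (u - ln (1 + expR u))) *
     expR (- al * (phi u * - ln (1 + expR u) + (1 - phi u) * (u - ln (1 + expR u)))) *
     (expR u / (1 + expR u)).
    rewrite -[X in expR u / X](lnK (e0 u : (1 + expR u) \is Num.pos)) -expRN -!expRD; congr expR.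
    by rewrite /phi; set L := ln _; field.
  by rewrite /phi'; set X := expR (_ * _); set Y := expR (_ * _); field; rewrite n0 n1.
apply: (@ge0_substitution_bijection phi psi phi' G (fun n => - n.+1%:R) (fun n => n.+1%:R)
  setT `]0, 1[%classic).
- by move=> n; rewrite gtrN// ltr0n.
- by move=> m n mn; rewrite lerN2 ler_nat ltnS.
- by move=> m n mn; rewrite ler_nat ltnS.
- exact: setT_segments.
- exact: openT.
- by move=> x1 x2 x3; rewrite /= !in_itv/= => /andP[h1 h2] /andP[h3 h4] /andP[h5 h6]; apply/andP; split; lra.
- by move=> u _; rewrite /= in_itv/=; exact: phi01.
- by [].
- move=> x; rewrite /= in_itv/= => /andP[x0 x1]; rewrite /phi /psi lnK.
    by rewrite addrC subrK invrK.
  by rewrite posrE subr_gt0 invf_gt1.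
- by move=> u v _ _ uv; rewrite /phi ltf_pV2 ?posrE// ltrD2l ltr_expR.
- move=> u _; have d1 : is_derive u 1 (fun u => 1 + expR u) (expR u).
    by have := is_deriveD (is_derive_cst (1 : R) u (1 : R)) (is_derive_expR u); rewrite add0r.
  apply: (@is_deriveV R (fun u => 1 + expR u) u _ _ _ d1).
  by rewrite gt_eqF.
- move=> u _; apply: cvgM; last exact: continuous_expR.
  apply: cvgN; apply: cvgV; first by rewrite gt_eqF// exprn_gt0.
  have h : {for u, continuous (fun u : R => 1 + expR u)}.
    by apply: cvgD; [exact: cvg_cst|exact: continuous_expR].
  by rewrite expr2; under eq_fun do rewrite expr2; exact: cvgM.
- move=> u _; rewrite /phi' mulNr oppr_le0 mulr_ge0 ?expR_ge0// invr_ge0 sqr_ge0//.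
- move=> x; rewrite /= in_itv/= => hx; have px := pos _ hx; have /andP[x0 x1] := hx.
  rewrite /G mulr_ge0 ?divr_ge0 ?powR_ge0 ?(ltW px)// /theta_primitive mulr_ge0 ?expR_ge0//.
  have pi0 := pi_gt0 R; have /andP[_ al1] := al01.
  apply: sin_ge0_pi; rewrite -mulrA !mulr_ge0 ?(ltW pi0) ?(ltW al0) ?(ltW x0)//=.
  by rewrite ler_piMr ?(ltW pi0)// mulr_ile1 ?(ltW al0) ?(ltW x0) ?(ltW x1).
- move=> x; rewrite /= in_itv/= => hx; have px := pos _ hx.
  have -> : G = (fun x => (1 + (-1) * x) `^ (al - 1) * (1 + s * x)^-1 * theta_primitive x).
    by apply/funext => t; rewrite /G mulN1r.
  apply: cvgM; last first.
    apply: differentiable_continuous; apply/derivable1_diffP.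
    by case: (is_derive_theta_primitive hx).
  apply: cvgM; last exact: continuous_inv_affine.
  by apply: continuous_powR_affine; rewrite mulN1r subr_gt0; case/andP: hx.
Qed.

(** Used at fixed [y] with the factor [theta_phase], which has either sign; the integrals are
    extended reals, hence the two cases. *)
Lemma eq_integral_scale (r : R) (A B : mR -> R) :
  measurable_fun setT A -> measurable_fun setT B ->
  (forall x, 0 <= A x) -> (forall x, 0 <= B x) ->
  (\int[leb]_x (A x)%:E = \int[leb]_x (B x)%:E)%E ->
  (\int[leb]_x (r * A x)%:E = \int[leb]_x (r * B x)%:E)%E.
Proof.
move=> mA mB A0 B0 AB.
have pos c (D : mR -> R) : 0 <= c -> measurable_fun setT D -> (forall x, 0 <= D x) ->
    (\int[leb]_x (c * D x)%:E = c%:E * \int[leb]_x (D x)%:E)%E.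
  move=> c0 mD D0; under eq_integral do rewrite EFinM.
  rewrite ge0_integralZl//; first exact/measurable_EFinP.
  by move=> x _; rewrite lee_fin.
have neg c (D : mR -> R) : c <= 0 -> measurable_fun setT D -> (forall x, 0 <= D x) ->
    (\int[leb]_x (c * D x)%:E = - ((- c)%:E * \int[leb]_x (D x)%:E))%E.
  move=> c0 mD D0; rewrite -pos// ?oppr_ge0//.
  rewrite -integral_ge0N; last by move=> x _; rewrite lee_fin mulr_ge0// oppr_ge0.
  by apply: eq_integral => x _; rewrite -EFinN mulNr opprK.
have [r0|r0] := leP 0 r; first by rewrite !pos// AB.
by rewrite !neg ?AB// ltW.
Qed.

Let m := Num.min 1 (1 + s).

Let m0 : 0 < m.
Proof. by rewrite /m lt_min ltr01/= -ltrBlDl sub0r. Qed.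

Let mle x : 0 <= x <= 1 -> m <= 1 + s * x.
Proof.
move=> /andP[x0 x1]; have [s0|s0] := leP 0 s.
  by apply: (@le_trans _ _ 1); [rewrite ge_min lexx|rewrite lerDl mulr_ge0].
apply: (@le_trans _ _ (1 + s)); [by rewrite ge_min lexx orbT|].
by rewrite lerD2l ler_niMr// ltW.
Qed.

Let K (z : R) : R := if (0 < z) && (z < 1) then (1 + s * z) `^ (- al) else 0.
Let g (x : R) : R := if (0 < x) && (x < 1) then (1 - x) `^ (al - 1) * (1 + s * x) `^ (-1) else 0.
Let C := al * expR al * (1 + s) `^ (1 - al).
(** For each [y] the kernels [A] and [B] have the same integral, by [moebius_substitution]. Weighted
    with [C * theta_phase] and integrated in the other order, [A] yields the transform of [theta]
    and [B] a single integral of [theta_primitive]. *)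
Let A (z y : R) : R := (1 + s) `^ (al - 1) * (K z * riemann_kernel al z y).
Let B (x y : R) : R := if y < x then g x else 0.

Let K_bound z : 0 <= K z <= m `^ (- al).
Proof.
rewrite /K; case: ifP => [/andP[z0 z1]|_]; last by rewrite lexx powR_ge0.
rewrite powR_ge0 !powRN lef_pV2 ?posrE ?powR_gt0 ?m0//.
  by rewrite ge0_ler_powR ?nnegrE ?(ltW al0) ?(ltW m0) ?mle// ?ltW// affine_pos// !ltW.
by rewrite affine_pos// !ltW.
Qed.

Let mK : measurable_fun setT (K : mR -> R).
Proof. by rewrite /K; mfun. Qed.

Let mg : measurable_fun setT (g : mR -> R).
Proof. by rewrite /g; mfun. Qed.

Let mrk : measurable_fun setT (fun p : mR * mR => riemann_kernel al p.1 p.2).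
Proof. exact: measurable_riemann_kernel. Qed.

Let mtp : measurable_fun setT (fun p : mR * mR => theta_phase al p.2).
Proof. by apply: (measurableT_comp (measurable_theta_phase al)); mfun. Qed.

Let mA : measurable_fun setT (fun p : mR * mR => A p.1 p.2).
Proof.
apply: measurable_funM => //; apply: measurable_funM; last exact: mrk.
by apply: (measurableT_comp mK); mfun.
Qed.

Let mB : measurable_fun setT (fun p : mR * mR => B p.1 p.2).
Proof.
rewrite /B; apply: measurable_fun_ifT; [by mfun| |by []].
by apply: (measurableT_comp mg); mfun.
Qed.

Let A_ge0 z y : 0 <= A z y.
Proof. by rewrite mulr_ge0 ?powR_ge0// mulr_ge0 ?riemann_kernel_ge0//; case/andP: (K_bound z). Qed.

Let g_ge0 x : 0 <= g x.
Proof. by rewrite /g; case: ifP => // _; rewrite mulr_ge0 ?powR_ge0. Qed.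

Let B_ge0 x y : 0 <= B x y.
Proof. by rewrite /B; case: ifP => // _; exact: g_ge0. Qed.

Let slice1 (f : mR * mR -> R) y : measurable_fun setT f -> measurable_fun setT (fun x : mR => f (x, y)).
Proof. by move=> mf; apply: (measurableT_comp mf). Qed.

Let AB y : 0 < y < 1 -> (\int[leb]_z (A z y)%:E = \int[leb]_x (B x y)%:E)%E.
Proof.
move=> hy; have /andP[y0 y1] := hy; have := moebius_substitution hy.
have -> : (\int[leb]_(x in `]y, 1%R[) ((1 - x) `^ (al - 1) / (1 + s * x))%:E = \int[leb]_x (B x y)%:E)%E.
  rewrite integral_mkcond; apply: eq_integral => x _; rewrite patchE mem_setE in_itv/= /B /g.
  have [yx|yx] := ltP y x; last by rewrite /=.
  rewrite (lt_trans y0 yx)/=; case: ifP => // x1; rewrite powR_inv1//.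
  by rewrite ltW// affine_pos// !ltW// (lt_trans y0).
move=> ->; rewrite -ge0_integralZl//.
- rewrite [RHS]integral_mkcond; apply: eq_integral => z _.
  rewrite patchE mem_setE in_itv/= /A /K /riemann_kernel.
  have [yz|yz] := ltP y z; last by rewrite !mulr0.
  by rewrite (lt_trans y0 yz)/=; case: ifP => _; rewrite ?mul0r ?mulr0 ?EFinM.
- by apply/measurable_funTS/measurable_EFinP; mfun.
- by move=> z _; rewrite lee_fin mulr_ge0 ?powR_ge0.
- by rewrite lee_fin powR_ge0.
Qed.

Let sp : 0 < 1 + s. Proof. by rewrite -ltrBlDl sub0r. Qed.

Let CA z y : C * theta_phase al y * A z y = al * expR al * (K z * (riemann_kernel al z y * theta_phase al y)).
Proof.
have h : (1 + s) `^ (1 - al) * (1 + s) `^ (al - 1) = 1.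
  by rewrite -powRD ?(gt_eqF sp) ?implybT// (_ : 1 - al + (al - 1) = 0) ?powRr0//; ring.
rewrite /C /A; transitivity (((1 + s) `^ (1 - al) * (1 + s) `^ (al - 1)) *
  (al * expR al * (K z * (riemann_kernel al z y * theta_phase al y)))); first by ring.
by rewrite h mul1r.
Qed.

Let fA (p : mR * mR) : \bar R := (C * theta_phase al p.2 * A p.1 p.2)%:E.
Let fB (p : mR * mR) : \bar R := (C * theta_phase al p.2 * B p.1 p.2)%:E.

Let mfA : measurable_fun setT fA.
Proof.
apply/measurable_EFinP; apply: measurable_funM; last exact: mA.
by apply: measurable_funM; [exact: measurable_cst|exact: mtp].
Qed.

Let mfB : measurable_fun setT fB.
Proof.
apply/measurable_EFinP; apply: measurable_funM; last exact: mB.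
by apply: measurable_funM; [exact: measurable_cst|exact: mtp].
Qed.

Let C0 : 0 <= C.
Proof. by rewrite mulr_ge0 ?powR_ge0// mulr_ge0 ?expR_ge0// ltW ?al0. Qed.

Let ac0 : 0 <= al * expR al. Proof. by rewrite mulr_ge0 ?expR_ge0// ltW ?al0. Qed.

Let sliceA z : (\int[leb]_y fA (z, y) = (K z * theta al z)%:E)%E.
Proof.
have [z01|z01] := boolP ((0 < z) && (z < 1)); last first.
  rewrite /fA integral0_eq; first by rewrite /K (negbTE z01) mul0r.
  by move=> y _ /=; rewrite CA /K (negbTE z01) mul0r mulr0.
have hz : 0 < z <= 1 by have /andP[-> /ltW] := z01.
rewrite EFinM thetaE// -integralZl//; last exact: integrable_kernel_phase.
rewrite -integralZl//; last by apply: integrableZl => //; exact: integrable_kernel_phase.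
by apply: eq_integral => y _; rewrite /fA /= CA -!EFinM; congr EFin; ring.
Qed.

Let intA : (leb \x leb)%E.-integrable setT fA.
Proof.
apply/integrable12ltyP; first exact: mfA.
pose M := al * expR al * (m `^ (- al) * (theta_const al * (1 / (al / 2)))).
apply: (@le_lt_trans _ _ (\int[leb]_(z in `]0%R, 1%R[) M%:E)%E); last first.
  rewrite integral_cst//; apply: lte_mul_pinfty; rewrite ?lee_fin//.
    have a2 : 0 <= 1 / (al / 2) by rewrite divr_ge0// divr_ge0// ltW ?al0.
    by rewrite mulr_ge0 ?ac0// mulr_ge0 ?powR_ge0// mulr_ge0// theta_const_ge0.
  have : (leb `]0%R, 1%R[%classic < +oo)%E by rewrite lebesgue_measure_itv/= lte_fin ltr01 -EFinB ltry.
  by [].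
rewrite [leRHS]integral_mkcond; apply: ge0_le_integral => //.
- by move=> z _; apply: integral_ge0.
- apply: (measurable_fun_fubini_tonelli_F (m2 := leb) (fun p => `|fA p|%E)) => //.
  by apply: measurableT_comp => //; exact: mfA.
- have /= h := @measurable_restrictT _ _ mR _ `]0, 1[%classic (fun=> M%:E).
  by apply/h.
move=> z _; rewrite patchE mem_setE in_itv/=.
have [z01|z01] := boolP ((0 < z) && (z < 1)); last first.
  rewrite integral0_eq// => y _; rewrite /fA CA /K (negbTE z01) mul0r mulr0.
  by rewrite /= normr0.
have hz : 0 < z <= 1 by have /andP[-> /ltW] := z01.
have /andP[K0 K1] := K_bound z.
have -> : (\int[leb]_y `|fA (z, y)| = (al * expR al * K z)%:E *
    \int[leb]_y `|(riemann_kernel al z y * theta_phase al y)%:E|)%E.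
  rewrite -ge0_integralZl//.
  - apply: eq_integral => y _; rewrite /fA CA mulrA EFinM abseM gee0_abs//.
    by rewrite lee_fin mulr_ge0// ac0.
  - by do 2 apply: measurableT_comp => //; exact: measurable_kernel_phase.
  - by rewrite lee_fin mulr_ge0// ac0.
apply: (@le_trans _ _ ((al * expR al * K z)%:E * (theta_const al * (z `^ (al / 2) / (al / 2)))%:E)%E).
  by apply: lee_wpmul2l; [rewrite lee_fin mulr_ge0// ac0|exact: integral_kernel_phase].
rewrite -EFinM lee_fin /M -[leLHS]mulrA; apply: ler_wpM2l; first exact: ac0.
have za : z `^ (al / 2) <= 1.
  have /andP[z0 z1] := z01; apply: (@le_trans _ _ (1 `^ (al / 2))); last by rewrite powR1.
  by apply: ge0_ler_powR; rewrite ?nnegrE// ?ltW// divr_gt0// al0.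
have a2 : 0 <= (al / 2)^-1 by rewrite invr_ge0 divr_ge0// ltW ?al0.
apply: ler_pM => //; first by rewrite mulr_ge0 ?theta_const_ge0// mulr_ge0 ?powR_ge0.
by rewrite ler_wpM2l ?theta_const_ge0// ler_wpM2r.
Qed.

Let integral_g : (\int[leb]_x (g x)%:E <= ((al * m)^-1)%:E)%E.
Proof.
have -> : (al * m)^-1 = m^-1 * (1 `^ al / al) by rewrite powR1 mul1r invfM mulrC.
rewrite EFinM -(integral_powR_itv al0 ltr01) -ge0_integralZl//; last 3 first.
- by apply/measurable_funTS/measurable_EFinP; mfun.
- by move=> x _; rewrite lee_fin powR_ge0.
- by rewrite lee_fin invr_ge0 ltW ?m0.
rewrite [leRHS]integral_mkcond; apply: ge0_le_integral => //.
- by move=> x _; rewrite lee_fin g_ge0.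
- by apply/measurable_EFinP; exact: mg.
- have /= h := @measurable_restrictT _ _ mR _ `]0, 1[%classic
    (fun x => (m^-1)%:E * ((1 - x) `^ (al - 1))%:E)%E.
  apply/h => //; apply/measurable_funTS/measurable_EFinP; mfun.
move=> x _; rewrite patchE mem_setE in_itv/= /g; case: ifP => // /andP[x0 x1].
have mx : m <= 1 + s * x by apply: mle; rewrite !ltW.
have px : 0 < 1 + s * x by apply: lt_le_trans mx; exact: m0.
rewrite -EFinM lee_fin mulrC powR_inv1 ?(ltW px)// ler_wpM2r ?powR_ge0//.
by rewrite lef_pV2 ?posrE ?m0.
Qed.

(** Here [x] is integrated first, because for fixed [y] the kernel [B] is at most [g], whose
    integral is bounded; in [intA] it is [y] that comes first, with the bound
    [integral_kernel_phase] for fixed [z]. *)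
Let intB : (leb \x leb)%E.-integrable setT fB.
Proof.
apply/integrable21ltyP; first exact: mfB.
have [M M0 hM] : exists2 M : R, 0 <= M & (\int[leb]_y `|(theta_phase al y)%:E| <= M%:E)%E.
  have /integrableP[_ h] := integrable_theta_phase.
  exists (fine (\int[leb]_y `|(theta_phase al y)%:E|)%E); first by rewrite fine_ge0// integral_ge0.
  by rewrite fineK// ge0_fin_numE// integral_ge0.
have am : 0 <= (al * m)^-1 by rewrite invr_ge0 mulr_ge0// ltW ?al0 ?m0.
apply: (@le_lt_trans _ _ (\int[leb]_y ((C * (al * m)^-1)%:E * `|(theta_phase al y)%:E|))%E); last first.
  rewrite ge0_integralZl//; last 2 first.
  - by do 2 apply: measurableT_comp => //; exact: measurable_theta_phase.
  - by rewrite lee_fin mulr_ge0// C0.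
  apply: (@le_lt_trans _ _ ((C * (al * m)^-1)%:E * M%:E)%E); last by rewrite -EFinM ltry.
  by apply: lee_wpmul2l => //; rewrite lee_fin mulr_ge0// C0.
apply: ge0_le_integral => //.
- by move=> y _; apply: integral_ge0.
- apply: (measurable_fun_fubini_tonelli_G (m1 := leb) (fun p => `|fB p|%E)) => //.
  by apply: measurableT_comp => //; exact: mfB.
- apply: measurable_funeM; do 2 apply: measurableT_comp => //; exact: measurable_theta_phase.
move=> y _.
have -> : (\int[leb]_x `|fB (x, y)| = (C * `|theta_phase al y|)%:E * \int[leb]_x (B x y)%:E)%E.
  rewrite -ge0_integralZl//.
  - apply: eq_integral => x _; rewrite /fB /= normrM (ger0_norm (B_ge0 _ _)) normrM (ger0_norm C0).
    by rewrite EFinM.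
  - by apply/measurable_EFinP; exact: (slice1 (f := fun p => B p.1 p.2) y mB).
  - by move=> x _; rewrite lee_fin B_ge0.
  - by rewrite lee_fin mulr_ge0// C0.
rewrite [leRHS](_ : _ = (C * `|theta_phase al y|)%:E * ((al * m)^-1)%:E)%E; last first.
  by rewrite abse_EFin -!EFinM; congr EFin; ring.
apply: lee_wpmul2l; first by rewrite lee_fin mulr_ge0// C0.
apply: le_trans integral_g; apply: ge0_le_integral => //.
- by move=> x _; rewrite lee_fin B_ge0.
- by apply/measurable_EFinP; exact: (slice1 (f := fun p => B p.1 p.2) y mB).
- by apply/measurable_EFinP; exact: mg.
- by move=> x _; rewrite lee_fin /B; case: ifP => // _; exact: g_ge0.
Qed.

Let sliceB x : (\int[leb]_y fB (x, y) = (C / (pi * al) * (g x * theta_primitive x))%:E)%E.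
Proof.
have [x01|x01] := boolP ((0 < x) && (x < 1)); last first.
  have g0 : g x = 0 by rewrite /g (negbTE x01).
  rewrite g0 mul0r mulr0 integral0_eq// => y _.
  by rewrite /fB /B g0 if_same mulr0.
transitivity ((C * g x)%:E * \int[leb]_(y in `]0%R, x[) (theta_phase al y)%:E)%E; last first.
  by rewrite (integral_theta_phase x01) -EFinM; congr EFin; ring.
rewrite -integralZl//; last by apply: integrableS integrable_theta_phase.
rewrite [RHS]integral_mkcond; apply: eq_integral => y _.
rewrite patchE mem_setE in_itv/= /fB /B /=; case: (ltP y x) => yx; last by rewrite andbF mulr0.
rewrite andbT; case: ifP => y0; first by rewrite -EFinM; congr EFin; ring.
by rewrite /theta_phase y0 mulr0 mul0r.
Qed.

Lemma theta_stieltjes : s != 0 ->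
  (\int[leb]_(z in `]0%R, 1%R[) ((1 + s * z) `^ (- al) * theta al z)%:E =
   (expR (al * (1 - (1 + s) * ln (1 + s) / s)))%:E)%E.
Proof.
move=> s0; have pi0 := pi_gt0 R.
have -> : (\int[leb]_(z in `]0%R, 1%R[) ((1 + s * z) `^ (- al) * theta al z)%:E =
    \int[leb]_z \int[leb]_y fA (z, y))%E.
  rewrite integral_mkcond; apply: eq_integral => z _; rewrite patchE mem_setE in_itv/= sliceA /K.
  by case: ifP => // _; rewrite mul0r.
rewrite (Fubini intA).
have -> : (\int[leb]_y \int[leb]_z fA (z, y) = \int[leb]_y \int[leb]_x fB (x, y))%E.
  apply: eq_integral => y _; rewrite /fA /fB /=.
  have [y01|y01] := boolP ((0 < y) && (y < 1)); last first.
    by rewrite !integral0_eq// => x _; rewrite /theta_phase (negbTE y01) mulr0 mul0r.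
  apply: eq_integral_scale.
  - exact: (slice1 (f := fun p => A p.1 p.2) y mA).
  - exact: (slice1 (f := fun p => B p.1 p.2) y mB).
  - by move=> x; exact: A_ge0.
  - by move=> x; exact: B_ge0.
  - exact: AB.
rewrite -(Fubini intB).
under eq_integral do rewrite sliceB EFinM.
have gp x : 0 <= g x * theta_primitive x.
  rewrite /g; case: ifP => [/andP[x0 x1]|_]; last by rewrite mul0r.
  have /andP[_ al1] := al01.
  rewrite !mulr_ge0 ?powR_ge0 ?expR_ge0//.
  apply: sin_ge0_pi; rewrite -mulrA !mulr_ge0 ?(ltW pi0) ?(ltW al0) ?(ltW x0)//=.
  by rewrite ler_piMr ?(ltW pi0)// mulr_ile1 ?(ltW al0) ?(ltW x0) ?(ltW x1).
rewrite ge0_integralZl//; last 3 first.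
- apply/measurable_EFinP; apply: measurable_funM; first exact: mg.
  by apply: measurable_funM; [mfun|exact: measurable_theta_exp].
- by move=> x _; rewrite lee_fin gp.
- by rewrite lee_fin divr_ge0 ?C0// mulr_ge0 ?(ltW pi0)// ltW ?al0.
have -> : (\int[leb]_x (g x * theta_primitive x)%:E =
    \int[leb]_(x in `]0%R, 1%R[) ((1 - x) `^ (al - 1) / (1 + s * x) * theta_primitive x)%:E)%E.
  rewrite [RHS]integral_mkcond; apply: eq_integral => x _; rewrite patchE mem_setE in_itv/= /g.
  case: ifP => [/andP[x0 x1]|_]; last by rewrite mul0r.
  by rewrite powR_inv1// ltW// affine_pos// !ltW.
(* The contour integral is taken at [a = 1 + s]; the hypothesis [s != 0] separates the zero [ln a]
   of the denominator from the point 0. *)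
have a1 : 1 + s != 1 by rewrite -subr_eq0 addrC addKr.
rewrite (logistic_substitution s0) (contour_integral al01 sp a1) -EFinM; congr EFin.
have pn : (pi : R) != 0 by rewrite gt_eqF.
have sn : 1 + s != 0 by rewrite gt_eqF// sp.
have -> : C = al * (expR al * expR ((1 - al) * ln (1 + s))).
  by rewrite /C /powR (negbTE sn) mulrA.
have -> : pi / (1 + s) = pi * expR (- ln (1 + s)) by rewrite expRN lnK// posrE sp.
set X := expR (al * _); set Y := expR al; set Z := expR ((1 - al) * _); set W := expR (- _).
have -> : al * (Y * Z) / (pi * al) * (X * (pi * W)) = Y * Z * X * W.
  have an : al != 0 by rewrite gt_eqF// al0.
  by move: (pi : R) pn => p pn; field; rewrite pn an.
rewrite /X /Y /Z /W -!expRD; congr expR; rewrite opprD addNKr.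
by set L := ln _; field; rewrite s0.
Qed.

End stieltjes_theta.

Section finite_density.
Context d (T : measurableType d) (R : realType).
Variables (mu : {measure set T -> \bar R}) (f : T -> R).
Hypothesis mf : measurable_fun setT f.
Hypothesis f0 : forall t, (0 <= f t)%R.
Hypothesis foo : (\int[mu]_t (f t)%:E < +oo)%E.

Definition mdens_fin of (\int[mu]_t (f t)%:E < +oo)%E := mdens mu mf f0.

HB.instance Definition _ := Measure.on (mdens_fin foo).

Let mdens_fin_num : fin_num_fun (mdens_fin foo).
Proof. by apply: lty_fin_num_fun; exact: foo. Qed.

HB.instance Definition _ := Measure_isFinite.Build _ _ _ (mdens_fin foo) mdens_fin_num.

End finite_density.

(** * Uniqueness of continuous densities on the unit interval *)

Section density_uniqueness.
Context (R : realType).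
Notation leb := (@lebesgue_measure R).
Notation mR := (measurableTypeR R).

Lemma reflection_substitution (G : R -> R) :
  (forall x, 0 < x < 1 -> 0 <= G x) -> (forall x, 0 < x < 1 -> {for x, continuous G}) ->
  (\int[leb]_(x in `]0%R, 1%R[) (G x)%:E = \int[leb]_(x in `]0%R, 1%R[) (G (1 - x))%:E)%E.
Proof.
move=> G0 cG; have w1 : 0 < (1 : R) by [].
have [na nb] := itv0_exhaustion_mono w1.
have -> : (\int[leb]_(x in `]0%R, 1%R[) (G (1 - x))%:E =
    \int[leb]_(x in `]0%R, 1%R[) (G (1 + (-1) * x) * - (-1))%:E)%E.
  by apply: eq_integral => x _; rewrite opprK mulr1 mulN1r.
apply: (@ge0_substitution_bijection R (fun x => 1 + (-1) * x) (fun x => 1 + (-1) * x) (fun=> -1) G _ _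
   `]0, 1[%classic `]0, 1[%classic (fun n => itv0_exhaustion_lt n w1) na nb (itv0_exhaustion w1)).
- exact: interval_open.
- by move=> x1 x2 x3; rewrite /= !in_itv/= => /andP[h1 h2] /andP[h3 h4] /andP[h5 h6]; apply/andP; split; lra.
- by move=> x; rewrite /= !in_itv/= => /andP[h1 h2]; apply/andP; split; lra.
- by move=> x; rewrite /= !in_itv/= => /andP[h1 h2]; apply/andP; split; lra.
- by move=> x _; ring.
- by move=> x y _ _ xy; lra.
- by move=> x _; exact: is_derive_affine.
- by move=> x _; exact: cst_continuous.
- by move=> x _; rewrite oppr_le0.
- by move=> x; rewrite /= in_itv/=; exact: G0.
- by move=> x; rewrite /= in_itv/=; exact: cG.
Qed.

Lemma measurable_unit_restrict (f : R -> R) :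
  measurable_fun (`](0 : R), 1[%classic : set mR) (f : mR -> R) ->
  measurable_fun setT (fun z : mR => if (0 < z) && (z < 1) then f z else 0).
Proof.
move=> mf; have /= h := @measurable_restrictT _ _ mR _ `]0, 1[%classic f.
have -> : (fun z : mR => if (0 < z) && (z < 1) then f z else 0) = f \_ `]0, 1[.
  by apply/funext => z; rewrite patchE mem_setE in_itv.
by apply/h.
Qed.

Lemma measurable_continuous_unit (f : R -> R) : (forall z, 0 < z < 1 -> {for z, continuous f}) ->
  measurable_fun (`](0 : R), 1[%classic : set mR) (f : mR -> R).
Proof.
move=> cf; apply: open_continuous_measurable_fun; first exact: interval_open.
by move=> z; rewrite inE/= in_itv/=; exact: cf.
Qed.

Lemma unit_bounded_fin (M : R) (F : mR -> R) : 0 <= M ->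
  measurable_fun setT F -> (forall z, 0 <= F z) ->
  (forall z, F z <= if (0 < z) && (z < 1) then M else 0) ->
  (\int[leb]_z (F z)%:E < +oo)%E.
Proof.
move=> M0 mFF F0 FM.
apply: (@le_lt_trans _ _ (\int[leb]_(z in `]0%R, 1%R[) M%:E)%E); last first.
  rewrite integral_cst//; apply: lte_mul_pinfty; rewrite ?lee_fin//.
  have : (leb `]0%R, 1%R[%classic < +oo)%E by rewrite lebesgue_measure_itv/= lte_fin ltr01 -EFinB ltry.
  by [].
rewrite [leRHS]integral_mkcond; apply: ge0_le_integral => //.
- by move=> z _; rewrite lee_fin.
- exact/measurable_EFinP.
- have /= h := @measurable_restrictT _ _ mR _ `]0, 1[%classic (fun=> M%:E).
  by apply/h.
- by move=> z _; rewrite patchE mem_setE in_itv/=; have := FM z; case: ifP => _; rewrite -lee_fin.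
Qed.

Variables (b M : R).
Hypothesis b0 : 0 < b.

Let X (z : mR) : 1.-tuple R := [tuple `|z|].

Let mX : measurable_fun setT X.
Proof.
apply/measurable_fun_tnthP => i.
rewrite (_ : _ \o _ = (fun z : mR => `|z|)); first exact: measurableT_comp.
by apply/funext => z /=; rewrite (tnth_nth 0)/= ord1.
Qed.

Let X_ge0 z i : 0 <= tnth (X z) i.
Proof. by rewrite (tnth_nth 0)/= ord1/= normr_ge0. Qed.

Let unit_transform (f : R -> R) (s c : R) (F := fun z : mR => if (0 < z) && (z < 1) then f z else 0)
    (mFF : measurable_fun setT F) (F0 : forall z, 0 <= F z) (Foo : (\int[leb]_z (F z)%:E < +oo)%E) :
  measurable_fun (`](0 : R), 1[%classic : set mR) (f : mR -> R) -> 1 <= s -> 0 <= c ->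
  (\int[mdens_fin mFF F0 Foo]_z ((s + c * `|z|) `^ (- b))%:E =
   (s `^ (- b))%:E * \int[leb]_(z in `]0%R, 1%R[) ((1 + c / s * z) `^ (- b) * f z)%:E)%E.
Proof.
move=> mf s1 c0; have s0 : 0 < s by lra.
rewrite [LHS](integral_mdens leb mFF F0); last 2 first.
- by mfun.
- by move=> z; rewrite powR_ge0.
have f0 z : `]0, 1[%classic z -> 0 <= f z.
  by rewrite /= in_itv/= => h; have := F0 z; rewrite /F h.
have mpf : measurable_fun (`](0 : R), 1[%classic : set mR)
    (fun z : mR => ((1 + c / s * z) `^ (- b) * f z)%:E).
  by apply/measurable_EFinP; apply: measurable_funM => //; apply: measurable_funTS; mfun.
rewrite -ge0_integralZl//; last 2 first.
- by move=> z hz; rewrite lee_fin mulr_ge0 ?powR_ge0 ?f0.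
- by rewrite lee_fin powR_ge0.
rewrite [RHS]integral_mkcond; apply: eq_integral => z _; rewrite patchE mem_setE in_itv/= /F.
case: ifP => [/andP[z0 z1]|_]; last by rewrite mulr0.
rewrite -EFinM mulrA; congr ((_ * _)%:E); rewrite gtr0_norm//.
have cs : 0 <= c / s * z by rewrite !mulr_ge0 ?invr_ge0 ?(ltW s0) ?(ltW z0).
rewrite -powRM ?(ltW s0) ?addr_ge0//.
by congr (_ `^ _); field; rewrite gt_eqF.
Qed.

Section comparison.
Variables f g : R -> R.
Hypothesis f0M : forall z, 0 < z < 1 -> 0 <= f z <= M.
Hypothesis g0M : forall z, 0 < z < 1 -> 0 <= g z <= M.
Hypothesis cf : forall z, 0 < z < 1 -> {for z, continuous f}.
Hypothesis cg : forall z, 0 < z < 1 -> {for z, continuous g}.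
Hypothesis fg : forall s, 0 <= s ->
  (\int[leb]_(z in `]0%R, 1%R[) ((1 + s * z) `^ (- b) * f z)%:E =
   \int[leb]_(z in `]0%R, 1%R[) ((1 + s * z) `^ (- b) * g z)%:E)%E.

Let F (h : R -> R) (z : mR) : R := if (0 < z) && (z < 1) then h z else 0.

Let mF (h : R -> R) : (forall z, 0 < z < 1 -> {for z, continuous h}) -> measurable_fun setT (F h).
Proof. by move=> ch; apply: measurable_unit_restrict; exact: measurable_continuous_unit. Qed.

Let F_ge0 (h : R -> R) : (forall z, 0 < z < 1 -> 0 <= h z <= M) -> forall z, 0 <= F h z.
Proof. by move=> h0 z; rewrite /F; case: ifP => // /h0/andP[]. Qed.

Let M0 : 0 <= M.
Proof.
have h : 0 < (2^-1 : R) < 1 by apply/andP; split; lra.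
by have /andP[h1 h2] := f0M h; exact: le_trans h1 h2.
Qed.

Let F_fin (h : R -> R) : (forall z, 0 < z < 1 -> 0 <= h z <= M) ->
  (forall z, 0 < z < 1 -> {for z, continuous h}) -> (\int[leb]_z (F h z)%:E < +oo)%E.
Proof.
move=> h0 ch; apply: (unit_bounded_fin M0); [exact: mF|exact: F_ge0|move=> z].
by rewrite /F; case: ifP => // /h0/andP[].
Qed.

Let law_eq (A : set mR) : measurable A -> A `<=` `]0, 1[ ->
  (\int[leb]_(z in A) (F f z)%:E = \int[leb]_(z in A) (F g z)%:E)%E.
Proof.
move=> mA sA.
pose B : set (1.-tuple R) := (fun t => tnth t ord0) @^-1` A.
have mB : measurable B.
  by rewrite -[X in measurable X]setTI; exact: (@measurable_tnth _ _ 1 ord0).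
have H := @stieltjes_uniqueness R b 1 b0 _ mR (mdens_fin (mF cf) (F_ge0 f0M) (F_fin f0M cf))
  _ mR (mdens_fin (mF cg) (F_ge0 g0M) (F_fin g0M cg)) X X mX mX X_ge0 X_ge0.
have eA h : (\int[leb]_(z in A) (F h z)%:E = \int[leb]_(z in X @^-1` B) (F h z)%:E)%E.
  rewrite integral_mkcond [RHS]integral_mkcond; apply: eq_integral => z _.
  rewrite !patchE; have [z01|/negbTE z01] := boolP ((0 < z) && (z < 1)); last first.
    by rewrite /F z01 !if_same.
  have -> : (z \in X @^-1` B) = (z \in A); last by [].
  by apply/idP/idP; rewrite !inE /B /= (tnth_nth 0)/= gtr0_norm//; case/andP: z01.
rewrite !eA; apply: H mB => s c s1 c0.
under eq_integral do rewrite big_ord1 (tnth_nth 0)/=.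
under [RHS]eq_integral do rewrite big_ord1 (tnth_nth 0)/=.
rewrite (unit_transform _ _ _ (measurable_continuous_unit cf))//.
rewrite (unit_transform _ _ _ (measurable_continuous_unit cg))//.
by rewrite fg// divr_ge0//; lra.
Qed.

(** The transforms determine the law, so [f] and [g] have equal mass on every measurable part of
    []0, 1[]; by continuity [f z > g z] would give [f] more mass on a small interval. *)
Lemma continuous_stieltjes_le (z : R) : 0 < z < 1 -> f z <= g z.
Proof.
move=> z01; rewrite leNgt; apply/negP => zlt.
pose h (x : R) := f x - g x.
have ch : {for z, continuous h} by apply: cvgB; [exact: cf|exact: cg].
have hz : 0 < h z by rewrite /h subr_gt0.
have /near_in_itvoo[e2 /= e20 h2] : z \in `]0, 1[ by rewrite in_itv/= z01.
have /cvgr_gt -/(_ _ hz)[e1 /= e10 h1] := ch.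
pose e := Num.min e1 e2.
have e0 : 0 < e by rewrite lt_min e10 e20.
pose A : set mR := `]z - e, z + e[%classic.
have inA x : A x -> (0 < x < 1) /\ 0 < h x.
  rewrite /A /= in_itv/= -ltr_distlC => xe.
  have hd : `|z - x| < e1 /\ `|z - x| < e2.
    by move: xe; rewrite lt_min => /andP[].
  split; last by apply: h1; case: hd.
  by have := h2 x; rewrite /= in_itv/=; apply; case: hd.
have mA : measurable A by exact: measurable_itv.
have sA : A `<=` `]0, 1[ by move=> x /inA[]; rewrite /= in_itv/=.
have := law_eq mA sA.
have iF (k : R -> R) : (forall z, 0 < z < 1 -> 0 <= k z <= M) ->
    (forall z, 0 < z < 1 -> {for z, continuous k}) -> leb.-integrable A (EFin \o F k).
  move=> k0 ck; apply: (@integrableS _ _ _ leb setT) => //; apply/integrableP; split.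
    by apply/measurable_EFinP; exact: mF.
  under eq_integral => x _ do rewrite /= ger0_norm ?F_ge0//.
  exact: F_fin.
have i1 := iF _ f0M cf; have i2 := iF _ g0M cg.
move=> E; have : (\int[leb]_(x in A) (F f x - F g x)%:E = 0)%E.
  rewrite integralB_EFin// E subee//; exact: integrable_fin_num.
apply/eqP; rewrite gt_eqF//; apply: integral_gt0 => //.
- by apply/measurable_EFinP/measurable_funTS; apply: measurable_funB; exact: mF.
- have : (0 < leb `](z - e)%R, (z + e)%R[%classic)%E.
    have d0 : 0 < z + e - (z - e) by rewrite (_ : _ - _ = e + e); [exact: addr_gt0|ring].
    by rewrite lebesgue_measure_itv/= lte_fin -subr_gt0 d0 -EFinB lte_fin.
  by [].
- by move=> x /inA[x01 gx]; rewrite lte_fin /F x01.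
Qed.

End comparison.
End density_uniqueness.

(** * Symmetry and positivity of theta *)

Section theta_symmetry.
Context (R : realType).
Notation leb := (@lebesgue_measure R).
Notation mR := (measurableTypeR R).
Variable al : R.
Hypothesis al01 : 0 < al <= 1.

Let al0 : 0 < al. Proof. by case/andP: al01. Qed.

Definition theta_max : R := al * expR al * (theta_const al / (al / 2)).

Lemma theta_le_max (z : R) : 0 < z <= 1 -> `|theta al z| <= theta_max.
Proof.
move=> hz; have /andP[z0 z1] := hz; apply: le_trans (theta_bound al01 hz) _.
have a2 : 0 < al / 2 by rewrite divr_gt0// al0.
rewrite /theta_max ler_wpM2l ?mulr_ge0 ?expR_ge0 ?(ltW al0)//.
rewrite ler_wpM2l ?theta_const_ge0// ler_piMl ?invr_ge0 ?(ltW a2)//.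
apply: (@le_trans _ _ (1 `^ (al / 2))); last by rewrite powR1.
by apply: ge0_ler_powR; rewrite ?nnegrE// ltW.
Qed.

Lemma theta_max_ge0 : 0 <= theta_max.
Proof.
have h : 0 < (1 : R) <= 1 by rewrite ltr01 lexx.
exact: le_trans (normr_ge0 _) (theta_le_max h).
Qed.

Lemma measurable_theta_itv : measurable_fun (`](0 : R), 1[%classic : set mR) (theta al : mR -> R).
Proof.
apply: open_continuous_measurable_fun; first exact: interval_open.
by move=> z; rewrite inE/= in_itv/= => z01; exact: continuous_theta.
Qed.

Lemma integrable_bounded01 (f : mR -> R) (M : R) : measurable_fun (`](0 : R), 1[%classic : set mR) f ->
  (forall z, 0 < z < 1 -> `|f z| <= M) -> leb.-integrable (`](0 : R), 1[%classic : set mR) (EFin \o f).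
Proof.
move=> mf fM; apply: measurable_bounded_integrable => //.
  have : (leb `]0%R, 1%R[%classic < +oo)%E by rewrite lebesgue_measure_itv/= lte_fin ltr01 -EFinB ltry.
  by [].
exists M; split; first exact: num_real.
by move=> N MN z /=; rewrite in_itv/= => /fM h; exact: le_trans h (ltW MN).
Qed.

Let M := theta_max.
(* The sign of [theta] is not known yet; adding [M] makes both functions
   densities. *)
Let f1 (z : R) := theta al z + M.
Let f2 (z : R) := theta al (1 - z) + M.

Let f1_ge0 z : 0 < z < 1 -> 0 <= f1 z.
Proof.
move=> /andP[z0 z1]; have hz : 0 < z <= 1 by rewrite z0 ltW.
by have := theta_le_max hz; rewrite ler_norml /f1 /M => /andP[h _]; lra.
Qed.

Let in01 (z : R) : 0 < z < 1 -> 0 < 1 - z < 1.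
Proof. by move=> /andP[h1 h2]; apply/andP; split; lra. Qed.

Let cf1 z : 0 < z < 1 -> {for z, continuous f1}.
Proof. by move=> hz; apply: cvgD; [exact: continuous_theta|exact: cvg_cst]. Qed.

Let cf2 z : 0 < z < 1 -> {for z, continuous f2}.
Proof.
move=> hz; have h : {for z, continuous (fun z : R => 1 - z)}.
  by apply: cvgB; [exact: cvg_cst|exact: cvg_id].
exact: (continuous_comp h (cf1 (in01 hz))).
Qed.

Let powk (s z : R) := (1 + s * z) `^ (- al).

Let cpow (s z : R) : -1 < s -> 0 < z < 1 -> {for z, continuous (powk s)}.
Proof.
move=> s1 /andP[z0 z1]; apply: continuous_powR_affine.
by apply: affine_pos => //; rewrite !ltW.
Qed.

Let powk_bound (s z : R) : -1 < s -> 0 < z < 1 -> `|powk s z| <= (Num.min 1 (1 + s)) `^ (- al).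
Proof.
move=> s1 /andP[z0 z1]; have sp : 0 < 1 + s by rewrite -ltrBlDl sub0r.
have m0 : 0 < Num.min 1 (1 + s) by rewrite lt_min ltr01.
have p0 : 0 < 1 + s * z by apply: affine_pos => //; rewrite !ltW.
rewrite /powk ger0_norm ?powR_ge0// !powRN lef_pV2 ?posrE ?powR_gt0//.
apply: ge0_ler_powR; rewrite ?nnegrE ?(ltW al0) ?(ltW m0) ?(ltW p0)//.
have [s0|s0] := leP 0 s.
  by apply: (@le_trans _ _ 1); [rewrite ge_min lexx|rewrite lerDl mulr_ge0// ltW].
apply: (@le_trans _ _ (1 + s)); [by rewrite ge_min lexx orbT|].
by rewrite lerD2l ler_niMr// ltW.
Qed.

Let mpowk s : measurable_fun (`](0 : R), 1[%classic : set mR) (powk s : mR -> R).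
Proof. by apply: measurable_funTS; rewrite /powk; mfun. Qed.

Let split_f1 (s : R) : -1 < s ->
  (\int[leb]_(z in `]0%R, 1%R[) (powk s z * f1 z)%:E =
   \int[leb]_(z in `]0%R, 1%R[) (powk s z * theta al z)%:E +
   \int[leb]_(z in `]0%R, 1%R[) (powk s z * M)%:E)%E.
Proof.
move=> s1; under eq_integral do rewrite /f1 mulrDr EFinD.
apply: integralD => //.
- apply: (integrable_bounded01 (M := (Num.min 1 (1 + s)) `^ (- al) * M)).
    by apply: measurable_funM; [exact: mpowk|exact: measurable_theta_itv].
  move=> z z01; have hz : 0 < z <= 1 by case/andP: z01 => -> /ltW.
  by rewrite normrM ler_pM ?normr_ge0 ?powk_bound ?theta_le_max.
- apply: (integrable_bounded01 (M := (Num.min 1 (1 + s)) `^ (- al) * M)).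
    by apply: measurable_funM; [exact: mpowk|exact: measurable_cst].
  move=> z z01.
  by rewrite normrM ler_pM ?normr_ge0 ?powk_bound// ger0_norm ?theta_max_ge0.
Qed.

(** Defined by [1 + s (1 - z) = (1 + s) (1 + conj s * z)]: reflection sends positive [s] into []- 1,
    0[]. *)
Let conj (s : R) : R := - s / (1 + s).

Let conj_gt s : -1 < s -> -1 < conj s.
Proof.
move=> s1; have sp : 0 < 1 + s by rewrite -ltrBlDl sub0r.
by rewrite /conj ltr_pdivlMr//; lra.
Qed.

Let powk_conj s z : -1 < s -> 0 < z < 1 -> powk s (1 - z) = (1 + s) `^ (- al) * powk (conj s) z.
Proof.
move=> s1 /andP[z0 z1]; have sp : 0 < 1 + s by rewrite -ltrBlDl sub0r.
have p0 : 0 < 1 + conj s * z by apply: affine_pos; rewrite ?conj_gt// !ltW.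
rewrite /powk -powRM ?ltW//; congr (_ `^ _); rewrite /conj; field.
by rewrite gt_eqF.
Qed.

Let reflect_powk (s : R) (f : R -> R) : -1 < s ->
  (forall x, 0 < x < 1 -> 0 <= f x) -> (forall x, 0 < x < 1 -> {for x, continuous f}) ->
  measurable_fun (`](0 : R), 1[%classic : set mR) (f : mR -> R) ->
  (\int[leb]_(z in `]0%R, 1%R[) (powk s z * f (1 - z)%R)%:E =
   ((1 + s) `^ (- al))%:E * \int[leb]_(z in `]0%R, 1%R[) (powk (conj s) z * f z)%:E)%E.
Proof.
move=> s1 f0 cf mf; rewrite -ge0_integralZl//; last 3 first.
- by apply/measurable_EFinP; apply: measurable_funM => //; exact: mpowk.
- by move=> z; rewrite /= in_itv/= => /f0 h; rewrite lee_fin mulr_ge0 ?powR_ge0.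
- by rewrite lee_fin powR_ge0.
rewrite (reflection_substitution (G := fun z => powk s z * f (1 - z))).
- apply: eq_integral => z; rewrite inE/= in_itv/= => z01.
  by rewrite powk_conj// -EFinM mulrA subKr.
- by move=> x /in01/f0 h; rewrite mulr_ge0 ?powR_ge0.
- move=> x x01; apply: cvgM; first exact: cpow.
  have h : {for x, continuous (fun z : R => 1 - z)}.
    by apply: cvgB; [exact: cvg_cst|exact: cvg_id].
  exact: (continuous_comp h (cf _ (in01 x01))).
Qed.

Let mf1 : measurable_fun (`](0 : R), 1[%classic : set mR) (f1 : mR -> R).
Proof. by apply: measurable_funD; [exact: measurable_theta_itv|exact: measurable_cst]. Qed.

(** For [theta] the two closed forms agree; the added constant [M] is handled by reflecting the
    constant function itself. *)
Let transform_eq (s : R) : 0 < s ->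
  (\int[leb]_(z in `]0%R, 1%R[) (powk s z * f1 z)%:E =
   \int[leb]_(z in `]0%R, 1%R[) (powk s z * f1 (1 - z)%R)%:E)%E.
Proof.
move=> s0; have s1 : -1 < s by lra.
have sp : 0 < 1 + s by lra.
have sn : s != 0 by rewrite gt_eqF.
have sn1 : 1 + s != 0 by rewrite gt_eqF.
have cn : conj s != 0 by rewrite mulf_neq0 ?oppr_eq0 ?invr_eq0.
apply: etrans (esym (reflect_powk s1 f1_ge0 cf1 mf1)).
rewrite (split_f1 s1) (split_f1 (conj_gt s1)).
rewrite muleDr//; last first.
  by rewrite (theta_stieltjes al01 (conj_gt s1) cn).
rewrite (theta_stieltjes al01 s1 sn) (theta_stieltjes al01 (conj_gt s1) cn).
have -> : (\int[leb]_(z in `]0%R, 1%R[) (powk s z * M)%:E =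
    ((1 + s) `^ (- al))%:E * \int[leb]_(z in `]0%R, 1%R[) (powk (conj s) z * M)%:E)%E.
  rewrite -(reflect_powk (f := fun=> M) s1)//.
  - by move=> x _; exact: theta_max_ge0.
  - by move=> x _; exact: cst_continuous.
congr (_ + _)%E; rewrite -EFinM; congr EFin.
rewrite /powR (negbTE sn1) -expRD; congr expR.
have -> : 1 + conj s = (1 + s)^-1 by rewrite /conj; field.
by rewrite lnV ?posrE// /conj; set L := ln _; field; rewrite sn sn1.
Qed.

Let f_bounds z : 0 < z < 1 -> 0 <= f1 z <= M + M.
Proof.
move=> z01; have hz : 0 < z <= 1 by case/andP: z01 => -> /ltW.
by rewrite f1_ge0//= /f1 lerD2r; exact: le_trans (ler_norm _) (theta_le_max hz).
Qed.

Let transform_eq0 (s : R) : 0 <= s ->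
  (\int[leb]_(z in `]0%R, 1%R[) ((1 + s * z) `^ (- al) * f1 z)%:E =
   \int[leb]_(z in `]0%R, 1%R[) ((1 + s * z) `^ (- al) * f2 z)%:E)%E.
Proof.
(* At [s = 0], which [theta_stieltjes] excludes, both sides are total masses and are exchanged by
   the reflection. *)
rewrite le_eqVlt => /predU1P[<-|s0]; last exact: transform_eq.
have E (h : R -> R) : (\int[leb]_(z in `]0%R, 1%R[) ((1 + 0 * z) `^ (- al) * h z)%:E =
    \int[leb]_(z in `]0%R, 1%R[) (h z)%:E)%E.
  by apply: eq_integral => z _; rewrite mul0r addr0 powR1 mul1r.
apply: etrans (E f1) (etrans _ (esym (E f2))); exact: (reflection_substitution f1_ge0 cf1).
Qed.

Lemma theta_reflect (z : R) : 0 < z < 1 -> theta al (1 - z) = theta al z.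
Proof.
move=> z01.
have f2_bounds x : 0 < x < 1 -> 0 <= f2 x <= M + M by move=> /in01/f_bounds.
have h x : 0 < x < 1 -> theta al x <= theta al (1 - x).
  move=> x01; rewrite -(lerD2r M).
  exact: (continuous_stieltjes_le al0 f_bounds f2_bounds cf1 cf2 transform_eq0).
apply: le_anti; apply/andP; split; last exact: h.
by have := h _ (in01 z01); rewrite subKr.
Qed.

Lemma theta_gt0 (z : R) : 0 < z < 1 -> 0 < theta al z.
Proof.
move=> z01; have /andP[z0 z1] := z01; have [z2|z2] := leP z 2^-1.
  by apply: (theta_gt0_half al01); rewrite z0.
rewrite -(theta_reflect z01); apply: (theta_gt0_half al01).
by apply/andP; split; lra.
Qed.

End theta_symmetry.

(** * The transform of theta as a probability density *)

Section theta_transform.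
Context {R : realType}.
Notation leb := (@lebesgue_measure R).
Notation mR := (measurableTypeR R).

(** Obtained from the primitive [x ln x - x] of [ln]; the value at [c = 0] is the limit of the
    quotient. *)
Definition mean_log (A c : R) : R :=
  if c == 0 then ln A else ((A + c) * ln (A + c) - A * ln A) / c - 1.

Let ln_ratio_bounds (w : R) : 0 < w -> 1 <= (1 + w) * ln (1 + w) / w <= 1 + w.
Proof.
move=> w0; have w1 : 0 < 1 + w by rewrite addr_gt0.
have h1 := mulr_ln_ge w1; have h2 := ler_lnB1 w1.
have E : 1 + w - 1 = w by rewrite addrC addKr.
rewrite E in h1 h2.
by rewrite ler_pdivlMr// ler_pdivrMr// mul1r h1/= ler_pM2l.
Qed.

Variable al : R.
Hypothesis al01 : 0 < al <= 1.

Let al0 : 0 < al. Proof. by case/andP: al01. Qed.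

Definition theta01 (z : mR) : R := if (0 < z) && (z < 1) then theta al z else 0.

Lemma measurable_theta01 : measurable_fun setT theta01.
Proof. by apply: measurable_unit_restrict; exact: (measurable_theta_itv al01). Qed.

Lemma theta01_ge0 z : 0 <= theta01 z.
Proof. by rewrite /theta01; case: ifP => // h; rewrite ltW// (theta_gt0 al01). Qed.

Lemma theta01_le_max z : theta01 z <= theta_max al.
Proof.
rewrite /theta01; case: ifP => [/andP[z0 z1]|_]; last exact: (theta_max_ge0 al01).
by apply: le_trans (ler_norm _) _; apply: (theta_le_max al01); rewrite z0 ltW.
Qed.

Lemma integrable_theta01 : leb.-integrable (setT : set mR) (EFin \o theta01).
Proof.
have mt := measurable_theta_itv al01.
have h : leb.-integrable (`](0 : R), 1[%classic : set mR) (EFin \o theta al).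
  apply: (@integrable_bounded01 _ _ (theta_max al)) => // z /andP[z0 z1].
  by apply: (theta_le_max al01); rewrite z0 ltW.
have -> : EFin \o theta01 = (EFin \o theta al) \_ (`](0 : R), 1[%classic : set mR).
  by apply/funext => z; rewrite /= /theta01 patchE mem_setE in_itv/=; case: ifP.
by apply/integrable_restrict => //; rewrite setTI.
Qed.

(** The closed form has [s] in a denominator, so the mass is the limit of the transforms at
    [s = 1 / (n + 1)], where [(1 + s) ln (1 + s) / s] tends to 1. *)
Lemma integral_theta01 : (\int[leb]_z (theta01 z)%:E = 1)%E.
Proof.
pose s (n : nat) : R := n.+1%:R^-1.
have s0 n : 0 < s n by rewrite invr_gt0.
pose f (n : nat) (z : mR) := ((1 + s n * z) `^ (- al) * theta01 z)%:E.
have fE n : (\int[leb]_z f n z = (expR (al * (1 - (1 + s n) * ln (1 + s n) / s n)))%:E)%E.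
  have sn : -1 < s n by have := s0 n; lra.
  rewrite -(theta_stieltjes al01 sn) ?gt_eqF// [RHS]integral_mkcond; apply: eq_integral => z _.
  by rewrite patchE mem_setE in_itv/= /f /theta01; case: ifP => //; rewrite mulr0.
have c1 : (\int[leb]_z f n z)%E @[n --> \oo] --> (\int[leb]_z (theta01 z)%:E)%E.
  apply: (@dominated_cvg _ mR _ leb setT measurableT _ _ (EFin \o theta01)) => //.
  - move=> n; rewrite /f; apply/measurable_EFinP; apply: measurable_funM; last exact: measurable_theta01.
    by mfun.
  - move=> z _; rewrite /f; apply: cvg_EFin; first by apply: nearW => n.
    rewrite -[X in _ --> X]mul1r; apply: cvgM; last exact: cvg_cst.
    under eq_fun do rewrite [s _ * z]mulrC.
    have h1 : 1 + z * 0 = 1 :> R by rewrite mulr0 addr0.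
    suff : (1 + z * s n) `^ (- al) @[n --> \oo] --> (1 + z * 0) `^ (- al) by rewrite h1 powR1.
    apply: (@continuous_cvg _ _ _ _ _ s (fun y => (1 + z * y) `^ (- al))); last exact: cvg_harmonic.
    by apply: continuous_powR_affine; rewrite h1.
  - exact: integrable_theta01.
  - move=> n z _; rewrite /f /= lee_fin ger0_norm ?mulr_ge0 ?powR_ge0 ?theta01_ge0//.
    rewrite /theta01; case: ifP => [/andP[z0 z1]|_]; last by rewrite mulr0.
    rewrite ler_piMl ?(ltW (theta_gt0 al01 _)) ?z0//.
    rewrite powRN invf_le1 ?powR_gt0 ?ltr_wpDr ?mulr_ge0 ?(ltW (s0 n)) ?(ltW z0)//.
    have {1}<- : 1 `^ al = 1 :> R by rewrite powR1.
    by rewrite ge0_ler_powR ?nnegrE ?(ltW al0)// ?lerDl ?addr_ge0 ?mulr_ge0 ?(ltW (s0 n)) ?(ltW z0).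
have c2 : (\int[leb]_z f n z)%E @[n --> \oo] --> (1 : \bar R)%E.
  under eq_fun do rewrite fE.
  apply: cvg_EFin; first by apply: nearW.
  have cs : (expR (- (al * s n)) : R) @[n --> \oo] --> (1 : R).
    rewrite -[X in _ --> X]expR0; apply: continuous_cvg; first exact: continuous_expR.
    rewrite -oppr0 -[X in _ --> - X](mulr0 al); apply: cvgN; apply: cvgM; first exact: cvg_cst.
    exact: cvg_harmonic.
  have c1s : (1 : R) @[_ --> \oo] --> (1 : R) by exact: cvg_cst.
  apply: (squeeze_cvgr _ cs c1s).
  apply: nearW => n; have /andP[] := ln_ratio_bounds (s0 n).
  rewrite /=; set q := _ / s n => q1 q2.
  have h3 : - s n <= 1 - q by rewrite lerBrDr addrC lerBlDr.
  apply/andP; split; first by rewrite ler_expR -mulrN (ler_pM2l al0).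
  by rewrite -[leRHS]expR0 ler_expR (pmulr_rle0 _ al0) subr_le0.
exact: cvg_unique c1 c2.
Qed.

Lemma theta_transform (A c : R) : 0 < A -> 0 <= c ->
  (\int[leb]_z ((A + c * z) `^ (- al) * theta01 z)%:E = (expR (- al * mean_log A c))%:E)%E.
Proof.
move=> A0; rewrite le_eqVlt => /predU1P[<-|c0].
  rewrite /mean_log eqxx /powR; under eq_integral do rewrite mul0r addr0 EFinM.
  rewrite ge0_integralZl//; last 3 first.
  - by apply/measurable_EFinP; exact: measurable_theta01.
  - by move=> z _; rewrite lee_fin theta01_ge0.
  - by rewrite lee_fin; case: ifP => // _; exact: expR_ge0.
  by rewrite integral_theta01 mule1 gt_eqF.
rewrite /mean_log gt_eqF//.
have sp : 0 < c / A by rewrite divr_gt0.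
have sn : -1 < c / A by move: sp; set w := c / A; lra.
have L1 : ln (1 + c / A) = ln (A + c) - ln A.
  rewrite -ln_div ?posrE ?addr_gt0//; congr ln; rewrite mulrDl divff ?gt_eqF//.
have pA (z : R) : 0 < z < 1 -> (A + c * z) `^ (- al) = A `^ (- al) * (1 + c / A * z) `^ (- al).
  move=> /andP[z0 z1]; rewrite -powRM ?(ltW A0) ?addr_ge0 ?mulr_ge0 ?invr_ge0 ?(ltW A0) ?(ltW c0) ?(ltW z0)//.
  by congr (_ `^ _); field; rewrite gt_eqF.
transitivity (\int[leb]_z ((A `^ (- al))%:E * ((1 + c / A * z) `^ (- al) * theta01 z)%:E))%E.
  apply: eq_integral => z _; rewrite -EFinM /theta01; case: ifP => [/pA ->|_].
    exact: (congr1 EFin (esym (mulrA _ _ _))).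
  by rewrite !mulr0.
rewrite ge0_integralZl//; last 3 first.
- apply/measurable_EFinP; apply: measurable_funM; last exact: measurable_theta01.
  by mfun.
- by move=> z _; rewrite lee_fin mulr_ge0 ?powR_ge0 ?theta01_ge0.
- by rewrite lee_fin powR_ge0.
have -> : (\int[leb]_z ((1 + c / A * z) `^ (- al) * theta01 z)%:E =
    \int[leb]_(z in `]0%R, 1%R[) ((1 + c / A * z) `^ (- al) * theta al z)%:E)%E.
  rewrite [RHS]integral_mkcond; apply: eq_integral => z _.
  by rewrite patchE mem_setE in_itv/= /theta01; case: ifP => //; rewrite mulr0.
rewrite (theta_stieltjes al01 sn) ?gt_eqF// -EFinM; congr EFin.
rewrite /powR gt_eqF// -expRD; congr expR; rewrite L1.
move: (ln (A + c)) (ln A) => x y; field.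
by rewrite !gt_eqF.
Qed.

End theta_transform.

(** * Riemann sums of the logarithm *)

Section riemann_log.
Context {R : realType}.

Let F (x : R) := x * ln x - x.

Let F_bounds (a b : R) : 0 < a -> a <= b ->
  (b - a) * ln a <= F b - F a <= (b - a) * ln b.
Proof.
move=> a0 ab; have b0 : 0 < b by exact: lt_le_trans ab.
have ba : 0 < b / a by rewrite divr_gt0.
have ia : 0 < a / b by rewrite divr_gt0.
have h1 := ler_lnB1 ba; have h2 := ler_lnB1 ia.
move: h1 h2; rewrite !ln_div ?posrE// => h1 h2.
have e1 : a * (ln b - ln a) <= a * (b / a - 1) by rewrite ler_pM2l.
have e2 : b * (ln a - ln b) <= b * (a / b - 1) by rewrite ler_pM2l.
have E1 : a * (b / a - 1) = b - a by field; rewrite gt_eqF.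
have E2 : b * (a / b - 1) = a - b by field; rewrite gt_eqF.
rewrite /F; move: (ln a) (ln b) e1 e2; rewrite E1 E2 => x y e1 e2.
by apply/andP; split; lra.
Qed.

(** A right-end Riemann sum of an increasing function: its excess over the mean lies between 0 and
    its difference from the left-end sum, which telescopes. *)
Lemma mean_log_riemann (A c : R) (n : nat) : 0 < A -> 0 <= c -> (0 < n)%N ->
  0 <= n%:R^-1 * \sum_(l < n) ln (A + c * (l.+1%:R / n%:R)) - mean_log A c <=
  n%:R^-1 * (ln (A + c) - ln A).
Proof.
move=> A0 c0 n0; have nR : 0 < n%:R :> R by rewrite ltr0n.
have [->|cn] := eqVneq c 0.
  under eq_bigr do rewrite mul0r addr0.
  rewrite /mean_log eqxx sumr_const card_ord addr0 subrr mulr0 -[X in _ * X]mulr_natl mulrA mulVf ?gt_eqF// mul1r.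
  by rewrite subrr lexx.
have cp : 0 < c by rewrite lt0r cn.
pose x (l : nat) : R := A + c * (l%:R / n%:R).
have x0 l : 0 < x l by rewrite ltr_wpDr ?mulr_ge0 ?divr_ge0.
have xS l : x l.+1 - x l = c / n%:R.
  rewrite /x -[l.+1]addn1 natrD; move: (l%:R : R) (n%:R : R) nR => u v v0; field.
  by rewrite gt_eqF.
have xle l : x l <= x l.+1 by rewrite -subr_ge0 xS divr_ge0 ?ltW.
have x_0 : x 0%N = A by rewrite /x mul0r mulr0 addr0.
have x_n : x n = A + c by rewrite /x divff ?mulr1 ?gt_eqF.
have ML : mean_log A c = (F (x n) - F (x 0%N)) / c.
  rewrite /mean_log (negbTE cn) x_0 x_n /F; move: (ln _) (ln _) => u v; field.
  by rewrite cn.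
have T1 : \sum_(l < n) (F (x l.+1) - F (x l)) = F (x n) - F (x 0%N).
  by rewrite -(big_mkord xpredT (fun l => F (x l.+1) - F (x l))) telescope_sumr.
have T2 : \sum_(l < n) (ln (x l.+1) - ln (x l)) = ln (x n) - ln (x 0%N).
  by rewrite -(big_mkord xpredT (fun l => ln (x l.+1) - ln (x l))) telescope_sumr.
have up : F (x n) - F (x 0%N) <= c / n%:R * \sum_(l < n) ln (x l.+1).
  rewrite -T1 mulr_sumr; apply: ler_sum => l _.
  by have /andP[_] := F_bounds (x0 l) (xle l); rewrite xS.
have lo : c / n%:R * \sum_(l < n) ln (x l) <= F (x n) - F (x 0%N).
  rewrite -T1 mulr_sumr; apply: ler_sum => l _.
  by have /andP[+ _] := F_bounds (x0 l) (xle l); rewrite xS.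
have S : \sum_(l < n) ln (x l.+1) = \sum_(l < n) ln (x l) + (ln (A + c) - ln A).
  by rewrite -x_n -[in ln A]x_0 -T2 -big_split/=; apply: eq_bigr => l _; rewrite addrC subrK.
rewrite ML; move: up lo; rewrite -[\sum_(l < n) ln (A + _)]/(\sum_(l < n) ln (x l.+1)) S.
move: (\sum_(l < n) ln (x l)) (ln (A + c) - ln A) (F (x n) - F (x 0%N)) => u v w up lo.
have E : n%:R^-1 * (u + v) = c / n%:R * (u + v) / c by field; rewrite cn gt_eqF.
have E' : n%:R^-1 * u = c / n%:R * u / c by field; rewrite cn gt_eqF.
rewrite subr_ge0 E ler_pdivrMr// divfK// up/=.
have lo' : n%:R^-1 * u <= w / c by rewrite E' ler_pM2r ?invr_gt0.
by rewrite -E mulrDr lerBlDr addrC lerD2l.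
Qed.

Lemma cvg_mean_log (A c : R) : 0 < A -> 0 <= c ->
  (n.+1%:R^-1 * \sum_(l < n.+1) ln (A + c * (l.+1%:R / n.+1%:R)) : R) @[n --> \oo] --> mean_log A c.
Proof.
move=> A0 c0; apply/subr_cvg0.
have c1 : (0 : R) @[_ --> \oo] --> (0 : R) by exact: cvg_cst.
have c2 : (n.+1%:R^-1 * (ln (A + c) - ln A) : R) @[n --> \oo] --> (0 : R).
  rewrite -[X in _ --> X](mul0r (ln (A + c) - ln A)).
  by apply: cvgM; [exact: cvg_harmonic|exact: cvg_cst].
by apply: (squeeze_cvgr _ c1 c2); apply: nearW => n; exact: mean_log_riemann.
Qed.

End riemann_log.

(** * The transform of the averaged Dirichlet-Ferguson path *)

Section dirichlet_stieltjes.
Context {R : realType}.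
Notation leb := (@lebesgue_measure R).
Notation mR := (measurableTypeR R).

Lemma measurable_forall d (T : measurableType d) n (P : 'I_n -> T -> bool) :
  (forall i, measurable_fun setT (P i)) -> measurable_fun setT (fun t => [forall i, P i t]).
Proof.
move=> mP; rewrite (_ : (fun t => _) = (fun t => \big[andb/true]_(i < n) P i t)); last first.
  by apply/funext => t; rewrite big_andE.
elim: (index_enum _) => [|i r IH].
  by rewrite (_ : (fun t => _) = cst true)//; apply/funext => t; rewrite big_nil.
rewrite (_ : (fun t => _) = (fun t => P i t && \big[andb/true]_(j <- r) P j t)).
  by apply: measurable_and => //; exact: mP.
by apply/funext => t; rewrite big_cons.
Qed.

Lemma measurable_ext m i : measurable_fun setT (fun y : m.-tuple R => ext y i : R).
Proof.
rewrite (_ : (fun y => _) = if i == 0%N then cst 0 else if (m < i)%N then cst 1 else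
    (fun y : m.-tuple R => nth 0 y i.-1)).
  by case: ifP => // _; case: ifP => // _; exact: measurable_tuple_nth.
by apply/funext => y; rewrite /ext size_tuple; case: ifP => // _; case: ifP.
Qed.

Lemma measurable_simplex m : measurable_fun setT (fun y : m.-tuple R => simplex y).
Proof.
by apply: measurable_forall => i; apply: measurable_fun_ltr; exact: measurable_ext.
Qed.

Lemma simplex_ext_lt m (y : m.-tuple R) i : simplex y -> (i <= m)%N -> ext y i < ext y i.+1.
Proof. by move=> /forallP h im; exact: (h (Ordinal (im : (i < m.+1)%N))). Qed.

Variables (m : nat) (g b : 'I_m.+1 -> R).
Hypothesis g0 : forall i, 0 < g i.
Hypothesis b0 : forall i, 0 < b i.

Let D (y : m.-tuple R) (i : 'I_m.+1) : R := ext y i.+1 - ext y i.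
Let S (y : m.-tuple R) : R := \sum_(i < m.+1) b i * D y i.
Let be : R := \sum_(i < m.+1) g i.
Let W (y : m.-tuple R) : R := if simplex y then \prod_(i < m.+1) D y i `^ (g i - 1) else 0.

Let be0 : 0 < be.
Proof. by rewrite /be big_ord_recl ltr_wpDr ?sumr_ge0// => i _; rewrite ltW. Qed.

Let D_gt0 y i : simplex y -> 0 < D y i.
Proof. by move=> /forallP/(_ i); rewrite -subr_gt0. Qed.

Let S_gt0 y : simplex y -> 0 < S y.
Proof.
move=> sy; rewrite /S big_ord_recl ltr_wpDr ?mulr_gt0 ?D_gt0//.
by apply: sumr_ge0 => i _; rewrite mulr_ge0 ?ltW ?D_gt0.
Qed.

Let mD i : measurable_fun setT (D ^~ i).
Proof. by apply: measurable_funB; exact: measurable_ext. Qed.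

Let mS : measurable_fun setT S.
Proof. by apply: measurable_sum => i; apply: measurable_funM => //; exact: mD. Qed.

Let mW : measurable_fun setT W.
Proof.
apply: measurable_fun_ifT => //; first exact: measurable_simplex.
by apply: measurable_prod => i _; apply: (measurableT_comp (measurable_powR _)); exact: mD.
Qed.

Let W_ge0 y : 0 <= W y.
Proof. by rewrite /W; case: ifP => // _; apply: prodr_ge0 => i _; exact: powR_ge0. Qed.

Let K (p : (m.-tuple R * mR)%type) : R :=
  W p.1 * (if 0 < p.2 then p.2 `^ (be - 1) * expR (- (S p.1 * p.2)) else 0).

Let mK : measurable_fun setT K.
Proof.
have mS1 : measurable_fun setT (fun p : (m.-tuple R * mR)%type => S p.1).
  by apply: (measurableT_comp mS); exact: measurable_fst.
have m2 : measurable_fun setT (fun p : (m.-tuple R * mR)%type => p.2 : R) by exact: measurable_snd.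
apply: measurable_funM; first by apply: (measurableT_comp mW); exact: measurable_fst.
by mfun.
Qed.

Let K_ge0 p : 0 <= K p.
Proof.
rewrite /K mulr_ge0 ?W_ge0//; case: ifP => // _.
by rewrite mulr_ge0 ?powR_ge0 ?expR_ge0.
Qed.

(** Homogeneity: the total degree is [m + (be - (m + 1)) = be - 1]. *)
Let prod_powR_scale (r : R) (y : m.-tuple R) : 0 < r -> simplex y ->
  r ^+ m * \prod_(i < m.+1) (r * D y i) `^ (g i - 1) =
  r `^ (be - 1) * \prod_(i < m.+1) D y i `^ (g i - 1).
Proof.
move=> r0 sy; under eq_bigr => i _ do rewrite powRM ?(ltW r0) ?(ltW (D_gt0 i sy))//.
rewrite big_split/= mulrA; congr (_ * _).
have -> : \prod_(i < m.+1) r `^ (g i - 1) = r `^ (\sum_(i < m.+1) (g i - 1)).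
  rewrite [in RHS]/powR gt_eqF// mulr_suml expR_sum.
  by apply: eq_bigr => i _; rewrite /powR gt_eqF.
rewrite -powR_mulrn ?(ltW r0)// -powRD ?(gt_eqF r0) ?implybT//.
congr (_ `^ _); rewrite sumrB sumr_const card_ord -/be.
by rewrite -[m.+1]addn1 natrD; move: (m%:R : R) be => u v; ring.
Qed.

(** [Gamma be * S^(- be)] is written as a Gamma integral in [r]. After Tonelli the power
    [r^(be - 1)] is exactly the weight under which the increments [r * D y i] become independent
    Gamma variables with rates [b i]. *)
Lemma dirichlet_stieltjes :
  (\int[lebn m]_y (W y * S y `^ (- be))%:E * (Gamma be)%:E =
   (\prod_(i < m.+1) (Gamma (g i) * b i `^ (- g i)))%:E)%E.
Proof.
rewrite muleC -ge0_integralZl//; last 3 first.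
- apply/measurable_EFinP; apply: measurable_funM; first exact: mW.
  by apply: (measurableT_comp (measurable_powR _)); exact: mS.
- by move=> y _; rewrite lee_fin mulr_ge0 ?W_ge0 ?powR_ge0.
- by rewrite lee_fin ltW// Gamma_gt0// be0.
transitivity (\int[lebn m]_y \int[leb]_r (K (y, r))%:E)%E.
  apply: eq_integral => y _; rewrite /K /=.
  have [sy|sy] := boolP (simplex y); last first.
    rewrite /W (negbTE sy) integral0_eq ?mul0r ?mule0// => r _.
    by rewrite mul0r.
  under eq_integral do rewrite EFinM.
  rewrite ge0_integralZl//; last 3 first.
  - apply/measurable_EFinP; exact: (measurable_gamma_fun be (S y)).
  - by move=> r _; rewrite lee_fin; exact: (gamma_fun_ge0 be (S y) r).
  - by rewrite lee_fin W_ge0.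
  transitivity ((W y)%:E * (Gamma be * S y `^ (- be))%:E)%E.
    by rewrite -!EFinM mulrCA.
  by congr (_ * _)%E; rewrite -(integral_gamma_fun be0 (S_gt0 sy)).
have mKE : measurable_fun setT (EFin \o K) by apply/measurable_EFinP; exact: mK.
have KE0 p : (0 <= (EFin \o K) p)%E by rewrite lee_fin K_ge0.
rewrite (@fubini_tonelli _ _ _ _ R (lebn m) leb _ mKE KE0).
have -> : (\prod_(i < m.+1) (Gamma (g i) * b i `^ (- g i)))%:E =
    (\prod_(i < m.+1) \int[leb]_x (gamma_fun (g i) (b i) x)%:E)%E.
  by rewrite -prodEFin; apply: eq_bigr => i _; rewrite integral_gamma_fun.
rewrite -simplex_mixture; last 3 first.
- by move=> i; exact: measurable_gamma_fun.
- by move=> i x; exact: gamma_fun_ge0.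
- by move=> i x x0; rewrite /gamma_fun ltNge x0.
apply: eq_integral => r _ /=; case: ifPn => r0; last first.
  by rewrite mul0e integral0_eq// => y _; rewrite /K /= (negbTE r0) mulr0.
rewrite -ge0_integralZl//; last 3 first.
- apply/measurable_EFinP; apply: measurable_prod => i _.
  by apply: (measurableT_comp (measurable_gamma_fun _ _)); apply: measurable_funM => //; exact: mD.
- by move=> y _; rewrite lee_fin prodr_ge0// => i _; exact: gamma_fun_ge0.
- by rewrite lee_fin exprn_ge0 ?ltW.
apply: eq_integral => y _; rewrite /K /= r0 -EFinM; congr EFin.
have [sy|sy] := boolP (simplex y); last first.
  rewrite /W (negbTE sy) mul0r.
  move: sy; rewrite /simplex => /forallPn/=[i]; rewrite -leNgt -subr_le0 => hi.
  by rewrite (bigD1 i)//= /gamma_fun ltNge mulr_ge0_le0 ?(ltW r0)//= mul0r mulr0.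
have -> : \prod_(i < m.+1) gamma_fun (g i) (b i) (r * (ext y i.+1 - ext y i)) =
   \prod_(i < m.+1) (r * D y i) `^ (g i - 1) * \prod_(i < m.+1) expR (- (b i * (r * D y i))).
  rewrite -big_split/=; apply: eq_bigr => i _.
  by rewrite /gamma_fun mulr_gt0// (D_gt0 i sy).
rewrite [RHS]mulrA (prod_powR_scale r0 sy) /W sy -expR_sum mulrCA mulrA; congr (_ * expR _).
rewrite sumrN; congr (- _); rewrite /S mulr_suml; apply: eq_bigr => i _.
by rewrite -mulrA [D y i * r]mulrC.
Qed.

End dirichlet_stieltjes.

(** * Laws given by densities, and summation by parts *)

Section law_density.
Context {R : realType}.
Notation leb := (@lebesgue_measure R).

Lemma integral_density_law d (T : measurableType d) (P : {measure set T -> \bar R}) m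
    (V : T -> m.-tuple R) (D : m.-tuple R -> R) (f : m.-tuple R -> R) :
  measurable_fun setT V -> measurable_fun setT D -> (forall y, 0 <= D y) ->
  (forall A, measurable A -> P (V @^-1` A) = iter_int (fun x => (\1_A x * D x)%:E)) ->
  measurable_fun setT f -> (forall y, 0 <= f y) ->
  (\int[P]_w (f (V w))%:E = \int[lebn m]_y (f y * D y)%:E)%E.
Proof.
move=> mV mD D0 law mf f0.
rewrite -(@integral_mdens _ _ _ (lebn m) D mD D0 f mf f0).
have mfE : measurable_fun setT (EFin \o f) by apply/measurable_EFinP.
have H : {in [set: m.-tuple R], forall y, (0 <= (EFin \o f) y)%E} by move=> y _; rewrite lee_fin.
have <- := ge0_integral_pushforward mV P measurableT mfE H.
apply: (@eq_measure_integral _ _ _ setT (mdens (lebn m) mD D0)) => A mA _.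
rewrite [LHS](law A mA) iter_intE; last 2 first.
- by apply/measurable_EFinP; apply: measurable_funM => //; exact: measurable_indic.
- by move=> y; rewrite lee_fin mulr_ge0.
rewrite /mdens/= [RHS]integral_mkcond; apply: eq_integral => y _.
by rewrite patchE indicE; case: ifP => _; rewrite ?mul1r ?mul0r.
Qed.

Lemma sum_mul_ord (V : nmodType) k n (F : nat -> V) :
  \sum_(j < k * n) F j = \sum_(i < k) \sum_(l < n) F (i * n + l)%N.
Proof.
rewrite -(big_mkord xpredT F) big_nat_mul big_mkord; apply: eq_bigr => i _.
by rewrite mulSn addnC -{1}[(i * n)%N]add0n big_addn addKn big_mkord; apply: eq_bigr => l _; rewrite addnC.
Qed.

Lemma ext_telescope (s : seq R) i : ext s i = \sum_(j < i) (ext s j.+1 - ext s j).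
Proof.
rewrite -(big_mkord xpredT (fun j => ext s j.+1 - ext s j)) telescope_sumr//.
by rewrite /ext/= subr0.
Qed.

Lemma ext_last m (y : m.-tuple R) : ext y m.+1 = 1.
Proof. by rewrite /ext/= size_tuple ltnSn. Qed.

(** Summation by parts; [s] joins every tail sum because the increments add up to 1. *)
Lemma abel_ext m (y : m.-tuple R) (w : nat -> R) (s : R) :
  s + \sum_(j < m.+1) w j * ext y j.+1 =
  \sum_(i < m.+1) (s + \sum_(j < m.+1 | (i <= j)%N) w j) * (ext y i.+1 - ext y i).
Proof.
under [in RHS]eq_bigr do rewrite mulrDl.
rewrite big_split/= -mulr_sumr -ext_telescope ext_last mulr1; congr (_ + _).
under eq_bigr => j _.
  rewrite ext_telescope (big_ord_widen m.+1 (fun i => ext y i.+1 - ext y i))// mulr_sumr.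
  over.
rewrite (exchange_big_dep xpredT)//=; apply: eq_bigr => i _.
by rewrite mulr_suml; apply: eq_bigl => j; rewrite ltnS.
Qed.

(** From position [l] of block [i] on, the tail consists of the later blocks in full and of [n - l]
    of the [n] steps of block [i]. *)
Lemma block_tail_sum k n (c : nat -> R) i l : (0 < n)%N -> (i < k)%N -> (l < n)%N ->
  \sum_(j < k * n | (i * n + l <= j)%N) c (j %/ n)%N / n%:R =
  \sum_(i' < k | (i < i')%N) c i' + c i * ((n - l)%:R / n%:R).
Proof.
move=> n0 ik ln; have nR : n%:R != 0 :> R by rewrite pnatr_eq0 -lt0n.
rewrite big_mkcond (@sum_mul_ord _ k n (fun j => if (i * n + l <= j)%N then c (j %/ n)%N / n%:R else 0)).
have E (i' : 'I_k) : \sum_(l' < n) (if (i * n + l <= i' * n + l')%N then c ((i' * n + l') %/ n)%N / n%:R else 0)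
   = if (i < i')%N then c i' else if i' == i :> nat then c i * ((n - l)%:R / n%:R) else 0.
  under eq_bigr => l' _ do rewrite divnMDl// divn_small// addn0.
  case: ltngtP => ii'.
  - rewrite (eq_bigr (fun=> c i' / n%:R)); last first.
      move=> l' _; rewrite ifT//; apply: leq_trans (_ : i.+1 * n <= _)%N.
        by rewrite mulSn addnC leq_add2r ltnW.
      by apply: leq_trans (leq_addr _ _); rewrite leq_mul2r ii' orbT.
    by rewrite sumr_const card_ord -[X in X = _]mulr_natr divfK.
  - rewrite big1// => l' _; rewrite ifF//; apply/negbTE; rewrite -ltnNge.
    apply: leq_trans (_ : i'.+1 * n <= _)%N; first by rewrite mulSn addnC ltn_add2r.
    by apply: leq_trans (leq_addr _ _); rewrite leq_mul2r ii' orbT.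
  - rewrite -ii'; under eq_bigr => l' _ do rewrite leq_add2l.
    rewrite -big_mkcond sumr_const -[X in X = _]mulr_natr mulrAC -mulrA; congr (_ * (_%:R / _)).
    rewrite -sum1_card -(big_mkord (fun l' => l <= l')%N (fun=> 1%N)).
    have := big_nat_widenl l 0 n xpredT (fun=> 1%N) (leq0n _) => /= <-.
    by rewrite sum_nat_const_nat muln1.
under eq_bigr do rewrite E.
rewrite (bigD1 (Ordinal ik))//= ltnn eqxx addrC; congr (_ + _).
rewrite [RHS]big_mkcond [LHS]big_mkcond; apply: eq_bigr => i' _ /=.
have [->|ni] /= := eqVneq i' (Ordinal ik); first by rewrite ltnn.
by case: ifP => // _; rewrite ifF//; apply: contraNF ni => /eqP h; apply/eqP/val_inj.
Qed.

End law_density.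

(** * The transform of the discretized path *)

Section df_side.
Context {R : realType}.
Notation leb := (@lebesgue_measure R).
Notation mR := (measurableTypeR R).

Variables (beta : R) (k : nat) (d : measure_display) (Omega : measurableType d).
Variables (P : probability Omega R) (X : Omega -> R -> R).
Hypothesis b0 : 0 < beta.
Hypothesis k0 : (0 < k)%N.
Hypothesis DF : DF_process beta P X.

(** The right-end Riemann sum for [k] times the integral of the path over the [i]-th block, on the
    grid of mesh [1 / (k n)]. *)
Definition block_mean n (i : nat) (w : Omega) : R :=
  n%:R^-1 * \sum_(l < n) X w ((i * n + l).+1%:R / (k * n)%:R).

Section discretized.
Variables (n : nat) (c : nat -> R) (s : R).
Hypothesis n0 : (0 < n)%N.
Hypothesis c0 : forall i, 0 <= c i.
Hypothesis s0 : 0 < s.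

Let N := (k * n)%N.
(** The grid has [N] positive times, but the value at time 1 is fixed; the Dirichlet density lives
    in dimension [N - 1], and [ext] restores the last value. *)
Let m := N.-1.
Let wt (j : nat) : R := c (j %/ n)%N / n%:R.
Let t (j : nat) : R := j%:R / N%:R.

Let N0 : (0 < N)%N. Proof. by rewrite muln_gt0 k0 n0. Qed.
Let mN : m.+1 = N. Proof. by rewrite prednK// N0. Qed.
Let NR : 0 < N%:R :> R. Proof. by rewrite ltr0n N0. Qed.

Let t0 : t 0%N = 0. Proof. by rewrite /t mul0r. Qed.
Let t1 : t m.+1 = 1. Proof. by rewrite /t mN divff// gt_eqF// NR. Qed.
Let tB j : t j.+1 - t j = N%:R^-1.
Proof. by rewrite /t -mulrBl -[j.+1]addn1 natrD addrAC subrr add0r mul1r. Qed.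

Let tS j : t j < t j.+1. Proof. by rewrite -subr_gt0 tB invr_gt0 NR. Qed.

Let V (w : Omega) : m.-tuple R := [tuple X w (t (val i).+1) | i < m].

Let mV : measurable_fun setT V.
Proof.
apply/measurable_fun_tnthP => i; case: DF => _ mX _.
rewrite (_ : _ \o _ = (fun w => X w (t (val i).+1))); first exact: mX.
by apply/funext => w /=; rewrite tnth_mktuple.
Qed.

Let wt0 j : 0 <= wt j. Proof. by rewrite /wt divr_ge0. Qed.

Let ext_V w j : (j < N)%N -> ext (V w) j.+1 = X w (t j.+1).
Proof.
move=> jN; rewrite /ext size_tuple; case: ltnP => [mj|jm].
  have -> : j = m by apply/eqP; rewrite eqn_leq -ltnS mN jN -ltnS.
  by rewrite t1; case: DF => /(_ w)[_ _ _ ->].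
by rewrite /= (nth_mktuple _ _ (Ordinal jm)).
Qed.

Let f (y : m.-tuple R) : R := (s + \sum_(j < m.+1) wt j * ext y j.+1) `^ (- beta).

Let mf : measurable_fun setT f.
Proof.
apply: (measurableT_comp (measurable_powR _)); apply: measurable_funD => //.
by apply: measurable_sum => j; apply: measurable_funM => //; exact: measurable_ext.
Qed.

Let f0 y : 0 <= f y. Proof. exact: powR_ge0. Qed.

Let fV w : (s + \sum_(i < k) c i * block_mean n i w) `^ (- beta) = f (V w).
Proof.
rewrite /f; congr ((s + _) `^ _); rewrite mN.
under [RHS]eq_bigr => j _ do rewrite ext_V//.
rewrite (@sum_mul_ord R k n (fun j => wt j * X w (t j.+1))).
apply: eq_bigr => i _; rewrite /block_mean mulrA mulr_sumr; apply: eq_bigr => l _.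
by rewrite /wt divnMDl// divn_small// addn0.
Qed.

Let dens := dirichlet_dens beta t : m.-tuple R -> R.

Let gE (i : 'I_m.+1) : beta * (t i.+1 - t i) = beta / N%:R.
Proof. by rewrite tB. Qed.

Let g0 : 0 < beta / N%:R. Proof. by rewrite divr_gt0// NR. Qed.

Let mdensity : measurable_fun setT dens.
Proof.
apply: measurable_fun_ifT => //; first exact: measurable_simplex.
apply: measurable_funM => //; apply: measurable_prod => i _.
apply: (measurableT_comp (measurable_powR _)).
by apply: measurable_funB; exact: measurable_ext.
Qed.

Let dens0 y : 0 <= dens y.
Proof.
rewrite /dens /dirichlet_dens; case: ifP => // _.
apply: mulr_ge0; last by apply: prodr_ge0 => i _; exact: powR_ge0.
apply: divr_ge0; first exact: ltW (Gamma_gt0 b0).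
by apply: prodr_ge0 => i _; rewrite gE ltW// Gamma_gt0// g0.
Qed.

(** All increments of the path over the grid have the same parameter [beta / N], so
    [dirichlet_stieltjes] applies with the tail sums of the weights as coefficients. *)
Lemma discretized_stieltjes :
  (\int[P]_w ((s + \sum_(i < k) c i * block_mean n i w) `^ (- beta))%:E =
   (\prod_(j < k * n) (s + \sum_(j' < k * n | (j <= j')%N) c (j' %/ n)%N / n%:R) `^
      (- (beta / (k * n)%:R)))%:E)%E.
Proof.
under eq_integral => w _ do rewrite fV.
have law A : measurable A -> P (V @^-1` A) = iter_int (fun x => (\1_A x * dens x)%:E).
  by move=> mA; case: DF => _ _ /(_ m t t0 t1 (fun i _ => tS i) A mA).
rewrite (integral_density_law mV mdensity dens0 law mf f0).
pose b (i : 'I_m.+1) := s + \sum_(j < m.+1 | (i <= j)%N) wt j.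
have bp i : 0 < b i by rewrite ltr_wpDr// sumr_ge0// => j _; exact: wt0.
have := dirichlet_stieltjes (fun=> g0) bp; cbv zeta.
have -> : \sum_(i < m.+1) beta / N%:R = beta.
  by rewrite sumr_const card_ord mN -[LHS]mulr_natr divfK// gt_eqF// NR.
set I1 := (X in (X * _)%E = _); set I2 := (\int[_]_y _)%E => E.
have G0 := Gamma_gt0 g0; have GB := Gamma_gt0 b0.
have -> : I2 = ((Gamma beta / \prod_(i < m.+1) Gamma (beta / N%:R))%:E * I1)%E.
  rewrite /I1 -ge0_integralZl//; last 3 first.
  - apply/measurable_EFinP; apply: measurable_funM.
      apply: measurable_fun_ifT => //; first exact: measurable_simplex.
      apply: measurable_prod => i _; apply: (measurableT_comp (measurable_powR _)).
      by apply: measurable_funB; exact: measurable_ext.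
    apply: (measurableT_comp (measurable_powR _)); apply: measurable_sum => i.
    by apply: measurable_funM => //; apply: measurable_funB; exact: measurable_ext.
  - move=> y _; rewrite lee_fin mulr_ge0 ?powR_ge0//; case: ifP => // _.
    by apply: prodr_ge0 => i _; exact: powR_ge0.
  - by rewrite lee_fin divr_ge0 ?(ltW GB)//; apply: prodr_ge0 => i _; exact: ltW.
  apply: eq_integral => y _; rewrite /f abel_ext -EFinM; congr EFin.
  rewrite /dens /dirichlet_dens; case: ifP => _; last by rewrite !(mulr0, mul0r).
  have -> : \prod_(i < m.+1) Gamma (beta * (t i.+1 - t i)) = \prod_(i < m.+1) Gamma (beta / N%:R).
    by apply: eq_bigr => i _; rewrite gE.
  have -> : \prod_(i < m.+1) (ext y i.+1 - ext y i) `^ (beta * (t i.+1 - t i) - 1) =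
      \prod_(i < m.+1) (ext y i.+1 - ext y i) `^ (beta / N%:R - 1).
    by apply: eq_bigr => i _; rewrite gE.
  by rewrite mulrC mulrA.
have pG : 0 < \prod_(i < m.+1) Gamma (beta / N%:R) :> R by apply: prodr_gt0 => i _.
have I1E : I1 = ((\prod_(i < m.+1) (Gamma (beta / N%:R) * b i `^ (- (beta / N%:R)))) / Gamma beta)%:E.
  by rewrite EFinM -E -muleA -EFinM divff ?gt_eqF// mule1.
rewrite I1E -EFinM; congr EFin; rewrite big_split/=.
transitivity (\prod_(i < m.+1) b i `^ (- (beta / N%:R))); last by rewrite /b mN.
move: (\prod_(i < m.+1) b i `^ _) (Gamma beta) GB (\prod_(i < m.+1) Gamma _) pG => B G hG Q hQ.
by field; rewrite !gt_eqF.
Qed.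

Definition tail_weight (i : nat) : R := s + \sum_(i' < k | (i < i')%N) c i'.

Lemma tail_weight_gt0 i : 0 < tail_weight i.
Proof. by rewrite ltr_wpDr// sumr_ge0. Qed.

Lemma discretized_stieltjes_exp :
  (\int[P]_w ((s + \sum_(i < k) c i * block_mean n i w) `^ (- beta))%:E =
   (expR (- (beta / k%:R) * \sum_(i < k)
      (n%:R^-1 * \sum_(l < n) ln (tail_weight i + c i * (l.+1%:R / n%:R)))))%:E)%E.
Proof.
rewrite discretized_stieltjes; congr EFin.
pose x (j : nat) := s + \sum_(j' < k * n | (j <= j')%N) c (j' %/ n)%N / n%:R.
have xp j : 0 < x j by rewrite ltr_wpDr// sumr_ge0// => j' _; exact: wt0.
transitivity (expR (- (beta / (k * n)%:R) * \sum_(j < k * n) ln (x j))).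
  rewrite mulr_sumr expR_sum; apply: eq_bigr => j _.
  by rewrite {1}/powR gt_eqF// xp.
congr expR; rewrite (@sum_mul_ord R k n (fun j => ln (x j))).
rewrite natrM invfM mulrA -mulNr -mulrA; congr (_ * _).
rewrite mulr_sumr; apply: eq_bigr => i _; congr (_ * _).
(* Reversing the order inside the block turns the fraction [(n - l) / n] into [(l + 1) / n]. *)
rewrite (reindex_inj rev_ord_inj)/=; apply: eq_bigr => l _; congr ln.
have nl : (n - l.+1 < n)%N by rewrite ltn_subrL n0.
by rewrite /x block_tail_sum// subKn ?addrA.
Qed.

End discretized.
End df_side.

(** * Riemann sums of monotone paths *)

Section monotone_riemann.
Context {R : realType}.
Notation leb := (@lebesgue_measure R).
Notation mR := (measurableTypeR R).

Lemma monotone_integrable (g : R -> R) (a b : R) : nondecreasing_fun g ->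
  leb.-integrable (`[a, b]%classic : set mR) (EFin \o g).
Proof.
move=> ng; apply: measurable_bounded_integrable => //.
- change (leb `[a, b]%classic < +oo)%E; rewrite lebesgue_measure_itv/=.
  by case: ifP => // _; rewrite -EFinD ltry.
- exact: nondecreasing_measurable.
exists (`|g a| + `|g b|); split; first exact: num_real.
move=> M hM x /=; rewrite in_itv/= => /andP[ax xb]; apply: le_trans (ltW hM).
have h1 := ng _ _ ax; have h2 := ng _ _ xb.
have h3 := ler_norm (g b); have h4 := lerNnormlW (lexx `|g a|).
have h5 := normr_ge0 (g a); have h6 := normr_ge0 (g b).
rewrite ler_norml; apply/andP; split.
  apply: le_trans h1; apply: le_trans h4; rewrite lerN2.
  by rewrite lerDl.
by apply: le_trans h2 _; apply: le_trans h3 _; rewrite lerDr.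
Qed.

Lemma monotone_riemann (g : R -> R) (a h : R) n : nondecreasing_fun g -> 0 < h ->
  h * \sum_(l < n) g (a + l%:R * h) <= Rintegral leb `[a, a + n%:R * h] g <=
  h * \sum_(l < n) g (a + l.+1%:R * h).
Proof.
move=> ng h0; elim: n => [|n IH].
  rewrite !big_ord0 mul0r addr0 !mulr0.
  by rewrite set_itv1 Rintegral_set1 lexx.
have ab : a + n%:R * h < a + n.+1%:R * h by rewrite ltrD2l ltr_pM2r// ltr_nat.
have i1 := monotone_integrable a (a + n.+1%:R * h) ng.
have i2 : leb.-integrable (`]a + n%:R * h, a + n.+1%:R * h]%classic : set mR) (EFin \o g).
  apply: integrableS (monotone_integrable (a + n%:R * h) (a + n.+1%:R * h) ng) => //.
  exact: subset_itv_oc_cc.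
have := @Rintegral_itvB R g (BLeft a) (BRight (a + n.+1%:R * h)) (a + n%:R * h) i1.
rewrite !bnd_simp lerDl mulr_ge0 ?(ltW h0)// (ltW ab) => /(_ isT isT) E.
have ml v : Rintegral leb `]a + n%:R * h, a + n.+1%:R * h] (cst v) = h * v.
  rewrite Rintegral_cst//.
  rewrite [X in _ * fine X](_ : _ = (h)%:E); last first.
    transitivity (leb `]a + n%:R * h, a + n.+1%:R * h]%classic); first by [].
    rewrite lebesgue_measure_itv/= lte_fin ab -EFinD; congr EFin.
    by rewrite -[n.+1]addn1 natrD; move: (n%:R : R) => u; ring.
  by rewrite mulrC.
have ic v : leb.-integrable (`]a + n%:R * h, a + n.+1%:R * h]%classic : set mR) (EFin \o cst v).
  have hh := monotone_integrable (a + n%:R * h) (a + n.+1%:R * h) (fun x y (_ : x <= y) => lexx v).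
  by apply: integrableS hh => //; exact: subset_itv_oc_cc.
have lo : h * g (a + n%:R * h) <= Rintegral leb `]a + n%:R * h, a + n.+1%:R * h] g.
  rewrite -ml; apply: (le_Rintegral _ (ic _) i2) => //.
  by move=> x /=; rewrite in_itv/= => /andP[xa _]; apply: ng; exact: ltW.
have up : Rintegral leb `]a + n%:R * h, a + n.+1%:R * h] g <= h * g (a + n.+1%:R * h).
  rewrite -ml; apply: (le_Rintegral _ i2 (ic _)) => //.
  by move=> x /=; rewrite in_itv/= => /andP[_ xb]; apply: ng.
have -> : Rintegral leb `[a, a + n.+1%:R * h] g = Rintegral leb `[a, a + n%:R * h] g +
    Rintegral leb `]a + n%:R * h, a + n.+1%:R * h] g by rewrite -E [RHS]addrC subrK.
by rewrite !big_ord_recr/= !mulrDr; have /andP[j1 j2] := IH; apply/andP; split; apply: lerD.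
Qed.

Lemma monotone_riemann_error (g : R -> R) (a h : R) n : nondecreasing_fun g -> 0 < h ->
  `|h * (\sum_(l < n) g (a + l.+1%:R * h)) - Rintegral leb `[a, a + n%:R * h] g| <=
  h * (g (a + n%:R * h) - g a).
Proof.
move=> ng h0; have /andP[j1 j2] := @monotone_riemann g a h n ng h0.
rewrite ger0_norm ?subr_ge0//.
have T : \sum_(l < n) (g (a + l.+1%:R * h) - g (a + l%:R * h)) = g (a + n%:R * h) - g a.
  rewrite -(big_mkord xpredT (fun l => g (a + l.+1%:R * h) - g (a + l%:R * h))) telescope_sumr//.
  by rewrite mul0r addr0.
rewrite -T sumrB mulrBr lerD2l lerN2.
exact: j1.
Qed.

End monotone_riemann.

Section block_means.
Context {R : realType}.
Notation leb := (@lebesgue_measure R).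

(** [inG] speaks of the path on [[0, 1]] only, while [nondecreasing_fun] is a global property. *)
Let clamp (x : R) : R := Num.max 0 (Num.min x 1).

Let clamp01 x : 0 <= clamp x <= 1.
Proof.
rewrite /clamp le_max lexx/= ge_max ler01/= ge_min lexx orbT//.
Qed.

Let clampE x : 0 <= x <= 1 -> clamp x = x.
Proof. by move=> /andP[x0 x1]; rewrite /clamp (min_idPl x1) (max_idPr x0). Qed.

Let clamp_mono x y : x <= y -> clamp x <= clamp y.
Proof.
move=> xy; rewrite /clamp ge_max le_max lexx/= le_max; apply/orP; right.
by rewrite le_min ge_min xy/= ge_min lexx orbT.
Qed.

(** The error of the Riemann sum is at most the mesh times the oscillation, which is at most 1; the
    factor [k] turns the mesh [1 / (k n)] into [1 / n]. *)
Lemma inG_riemann (g : R -> R) k n i : inG g -> (i < k)%N -> (0 < n)%N ->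
  `|n%:R^-1 * (\sum_(l < n) g ((i * n + l).+1%:R / (k * n)%:R)) -
    k%:R * Rintegral leb `[i%:R / k%:R, i.+1%:R / k%:R] g| <= n%:R^-1.
Proof.
move=> [gm g01 _ _] ik n0.
have k0 : (0 < k)%N by exact: leq_ltn_trans ik.
have kR : 0 < k%:R :> R by rewrite ltr0n.
have nR : 0 < n%:R :> R by rewrite ltr0n.
pose f x := g (clamp x).
have nf : nondecreasing_fun f.
  move=> x y xy; have /andP[c1 _] := clamp01 x; have /andP[_ c2] := clamp01 y.
  by apply: gm => //; exact: clamp_mono.
pose h : R := (k * n)%:R^-1.
have h0 : 0 < h by rewrite invr_gt0 ltr0n muln_gt0 k0.
have hE : h = k%:R^-1 * n%:R^-1 by rewrite /h natrM invfM.
have E1 : i%:R / k%:R + n%:R * h = i.+1%:R / k%:R.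
  rewrite hE -[i.+1]addn1 natrD; move: (n%:R : R) (k%:R : R) (i%:R : R) nR kR => u v w u0 v0.
  by field; rewrite !gt_eqF.
have E2 (l : 'I_n) : i%:R / k%:R + l.+1%:R * h = (i * n + l).+1%:R / (k * n)%:R.
  rewrite hE -addnS natrD !natrM.
  move: (n%:R : R) (k%:R : R) (i%:R : R) (l.+1%:R : R) nR kR => u v w z u0 v0.
  by field; rewrite !gt_eqF.
have in01 (x : R) : i%:R / k%:R <= x -> x <= i.+1%:R / k%:R -> 0 <= x <= 1.
  move=> x1 x2; rewrite (le_trans _ x1) ?divr_ge0//= (le_trans x2)// ler_pdivrMr// mul1r ler_nat//.
have := @monotone_riemann_error R f (i%:R / k%:R) h n nf h0.
rewrite E1; under eq_bigr => l _ do rewrite E2.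
have -> : \sum_(l < n) f ((i * n + l).+1%:R / (k * n)%:R) = \sum_(l < n) g ((i * n + l).+1%:R / (k * n)%:R).
  apply: eq_bigr => l _; rewrite /f clampE// -E2 in01//.
    by rewrite lerDl mulr_ge0// ltW.
  by rewrite -E1 lerD2l ler_pM2r// ler_nat.
have -> : Rintegral leb `[i%:R / k%:R, i.+1%:R / k%:R] f = Rintegral leb `[i%:R / k%:R, i.+1%:R / k%:R] g.
  apply: eq_Rintegral => x; rewrite inE/= in_itv/= => /andP[x1 x2].
  by rewrite /f clampE// in01.
move: (\sum_(l < n) _) (Rintegral _ _ _) => S I H.
have -> : n%:R^-1 * S - k%:R * I = k%:R * (h * S - I).
  by rewrite hE; field; rewrite !gt_eqF.
rewrite normrM ger0_norm ?(ltW kR)//.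
have : k%:R * `|h * S - I| <= k%:R * (h * 1).
  rewrite ler_pM2l//; apply: le_trans H _; rewrite ler_pM2l//.
  have /andP[c1 c2] := clamp01 (i.+1%:R / k%:R).
  have /andP[c3 c4] := clamp01 (i%:R / k%:R).
  have /andP[_ u1] : 0 <= f (i.+1%:R / k%:R) <= 1 by apply: g01; rewrite c1.
  have /andP[u2 _] : 0 <= f (i%:R / k%:R) <= 1 by apply: g01; rewrite c3.
  by rewrite lerBlDr (le_trans u1)// lerDl.
by rewrite mulr1 hE mulrA divff ?mul1r// gt_eqF.
Qed.

Lemma Jhat_ge0 k (g : R -> R) i : inG g -> 0 <= tnth (Jhat k g) i.
Proof.
move=> [_ g01 _ _]; rewrite tnth_mktuple mulr_ge0//.
apply: Rintegral_ge0 => x /=; rewrite in_itv/= => /andP[x1 x2].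
have k0 : (0 < k)%N by exact: leq_ltn_trans (ltn_ord i).
have kR : 0 < k%:R :> R by rewrite ltr0n.
have /g01/andP[]// : 0 <= x <= 1.
rewrite (le_trans _ x1) ?divr_ge0//= (le_trans x2)// ler_pdivrMr// mul1r ler_nat//.
Qed.

End block_means.

Lemma cvg_sum_ord (R : realType) k (f : 'I_k -> nat -> R) (l : 'I_k -> R) :
  (forall i, f i n @[n --> \oo] --> l i) ->
  (\sum_(i < k) f i n) @[n --> \oo] --> \sum_(i < k) l i.
Proof.
move=> fl; elim: (index_enum _) => [|i r IH].
  by rewrite big_nil; under eq_fun do rewrite big_nil; exact: cvg_cst.
by rewrite big_cons; under eq_fun do rewrite big_cons; exact: cvgD.
Qed.

Lemma cvg_prod_ord (R : realType) k (f : 'I_k -> nat -> R) (l : 'I_k -> R) :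
  (forall i, f i n @[n --> \oo] --> l i) ->
  (\prod_(i < k) f i n) @[n --> \oo] --> \prod_(i < k) l i.
Proof.
move=> fl; elim: (index_enum _) => [|i r IH].
  by rewrite big_nil; under eq_fun do rewrite big_nil; exact: cvg_cst.
by rewrite big_cons; under eq_fun do rewrite big_cons; exact: cvgM.
Qed.

(** * The transform of the averaged path *)

Section Jhat_transform.
Context {R : realType}.
Notation leb := (@lebesgue_measure R).

Variables (beta : R) (k : nat) (d : measure_display) (Omega : measurableType d).
Variables (P : probability Omega R) (X : Omega -> R -> R).
Hypothesis b0 : 0 < beta.
Hypothesis k0 : (0 < k)%N.
Hypothesis DF : DF_process beta P X.

Let XG w : inG (X w). Proof. by case: DF. Qed.

Lemma cvg_block_mean w (i : 'I_k) :
  block_mean k X n.+1 i w @[n --> \oo] --> tnth (Jhat k (X w)) i.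
Proof.
apply/subr_cvg0; apply: norm_cvg0.
have c1 : (0 : R) @[_ --> \oo] --> (0 : R) by exact: cvg_cst.
have c2 : (n.+1%:R^-1 : R) @[n --> \oo] --> (0 : R) by exact: cvg_harmonic.
apply: (squeeze_cvgr _ c1 c2); apply: nearW => n; rewrite normr_ge0/= tnth_mktuple.
exact: (inG_riemann (XG w) (ltn_ord i) (ltn0Sn n)).
Qed.

Lemma measurable_block_mean n i : measurable_fun setT (block_mean k X n i).
Proof.
apply: measurable_funM => //; apply: measurable_sum => l.
by case: DF => _ mX _; exact: mX.
Qed.

(** The process is measurable at each fixed time, hence so are the block means and their pointwise
    limit. *)
Lemma measurable_Jhat : measurable_fun setT (fun w => Jhat k (X w)).
Proof.
apply/measurable_fun_tnthP => i.
apply: (@measurable_fun_cvg _ _ _ _ (fun n => block_mean k X n.+1 i)) => //.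
- by move=> n; exact: measurable_block_mean.
- by move=> w _; exact: cvg_block_mean.
Qed.

Lemma block_mean_ge0 n (i : 'I_k) w : 0 <= block_mean k X n i w.
Proof.
rewrite /block_mean mulr_ge0 ?invr_ge0//; apply: sumr_ge0 => l _.
have ln := ltn_ord l; have n0 : (0 < n)%N by exact: leq_ltn_trans ln.
case: (XG w) => _ g01 _ _; have /g01/andP[]// : 0 <= ((i * n + l).+1%:R / (k * n)%:R : R) <= 1.
rewrite divr_ge0//= ler_pdivrMr ?ltr0n ?muln_gt0 ?k0// mul1r ler_nat.
by apply: leq_trans (_ : i.+1 * n <= _)%N; rewrite ?leq_mul2r ?ltn_ord ?orbT// mulSn addnC ltn_add2r.
Qed.

(** The base is at least [s >= 1], so the integrands are bounded by 1 and the mesh may go to 0 under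
    the integral. *)
Lemma Jhat_stieltjes (c : nat -> R) (s : R) : (forall i, 0 <= c i) -> 1 <= s ->
  (\int[P]_w ((s + \sum_(i < k) c i * tnth (Jhat k (X w)) i) `^ (- beta))%:E =
   (expR (- (beta / k%:R) * \sum_(i < k) mean_log (tail_weight k c s i) (c i)))%:E)%E.
Proof.
move=> c0 s1; have s0 : 0 < s by exact: lt_le_trans s1.
pose f (n : nat) w := ((s + \sum_(i < k) c i * block_mean k X n.+1 i w) `^ (- beta))%:E.
have ge1 (J : 'I_k -> R) : (forall i, 0 <= J i) -> 1 <= s + \sum_(i < k) c i * J i.
  move=> J0; rewrite (le_trans s1)// lerDl sumr_ge0// => i _; exact: mulr_ge0.
have c1 : (\int[P]_w f n w)%E @[n --> \oo] -->
    (\int[P]_w ((s + \sum_(i < k) c i * tnth (Jhat k (X w)) i) `^ (- beta))%:E)%E.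
  apply: (@dominated_cvg _ _ _ P setT measurableT _ _ (cst 1%E)) => //.
  - move=> n; apply/measurable_EFinP; apply: (measurableT_comp (measurable_powR _)).
    apply: measurable_funD => //; apply: measurable_sum => i; apply: measurable_funM => //.
    exact: measurable_block_mean.
  - move=> w _; apply: cvg_EFin; first by apply: nearW.
    set L := s + _.
    have L1 : 1 <= L by apply: ge1 => i; exact: Jhat_ge0 (XG w).
    have hL : 0 < 0 + 1 * L by rewrite add0r mul1r (lt_le_trans ltr01).
    have := @continuous_powR_affine R (- beta) 0 1 L hL.
    rewrite (_ : (fun x => _) = (fun x : R => x `^ (- beta))); last by apply/funext => x; rewrite add0r mul1r.
    move=> cL; apply: (@continuous_cvg _ _ _ _ _ (fun n => s + \sum_(i < k) c i * block_mean k X n.+1 i w) (fun x : R => x `^ (- beta))) => //.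
    apply: cvgD; first exact: cvg_cst.
    apply: cvg_sum_ord => i; apply: cvgM; first exact: cvg_cst.
    exact: cvg_block_mean.
  - exact: finite_measure_integrable_cst.
  - move=> n w _; rewrite /f /= lee_fin ger0_norm ?powR_ge0//.
    have h : 1 <= s + \sum_(i < k) c i * block_mean k X n.+1 i w by apply: ge1 => i; exact: block_mean_ge0.
    rewrite powRN invf_le1 ?powR_gt0 ?(lt_le_trans ltr01 h)//.
    by rewrite -[leLHS](powRr0 (s + \sum_(i < k) c i * block_mean k X n.+1 i w)) ler_powR// ltW.
have c2 : (\int[P]_w f n w)%E @[n --> \oo] -->
    (expR (- (beta / k%:R) * \sum_(i < k) mean_log (tail_weight k c s i) (c i)))%:E.
  under eq_fun do rewrite (discretized_stieltjes_exp b0 k0 DF (ltn0Sn _) c0 s0).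
  apply: cvg_EFin; first by apply: nearW.
  apply: continuous_cvg; first exact: continuous_expR.
  apply: cvgM; first exact: cvg_cst.
  apply: cvg_sum_ord => i; apply: cvg_mean_log => //.
  exact: tail_weight_gt0.
exact: cvg_unique c1 c2.
Qed.

End Jhat_transform.

(** * The density rho *)

Lemma measurable_invr (R : realType) : measurable_fun setT (fun x : R => x^-1).
Proof.
rewrite (_ : (fun x : R => x^-1) = (fun x : R => if 0 <= x then x `^ (-1) else - ((- x) `^ (-1)))).
  by mfun.
apply/funext => x; case: ifPn => [x0|]; first by rewrite powR_inv1.
by rewrite -ltNge => x0; rewrite powR_inv1 ?oppr_ge0 ?(ltW x0)// invrN opprK.
Qed.

Section rho_kernel.
Context {R : realType}.
Notation leb := (@lebesgue_measure R).
Notation mR := (measurableTypeR R).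

(* Since [theta01] vanishes outside ]0, 1[, no interlacing condition is needed. *)
Definition rho_kernel (al : R) m (x : m.+1.-tuple R) (y : m.-tuple R) : R :=
  if simplex y then
    \prod_(i < m.+1) (theta01 al ((ext x i.+1 - ext y i) / (ext y i.+1 - ext y i))
      * (ext y i.+1 - ext y i) `^ (al - 2))
  else 0.

Definition interlaced m (x : m.+1.-tuple R) (y : m.-tuple R) : bool :=
  [forall i : 'I_m, (ext x i.+1 < ext y i.+1) && (ext y i.+1 < ext x i.+2)].

Lemma ext0 (s : seq R) : ext s 0 = 0. Proof. by []. Qed.

Lemma theta01_neq0 (al z : R) : theta01 al z != 0 -> 0 < z < 1.
Proof. by rewrite /theta01; case: ifP => //; rewrite eqxx. Qed.

Lemma theta01E (al z : R) : 0 < z < 1 -> theta01 al z = theta al z.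
Proof. by rewrite /theta01 => ->. Qed.

Section one.
Variables (al : R) (m : nat) (x : m.+1.-tuple R) (y : m.-tuple R).

(** The support of the kernel as a single chain; the conventions of [ext] turn its two ends into
    inequalities with 0 and 1. *)
Definition nested := forall i, (i < m.+1)%N -> ext y i < ext x i.+1 < ext y i.+1.

Lemma nested_simplex : nested -> [/\ simplex x, interlaced x y & simplex y].
Proof.
move=> N; split.
- apply/forallP => -[[|j] /= jm]; first by have /andP[] := N 0%N (ltn0Sn m).
  have jm1 : (j < m.+1)%N by rewrite -ltnS.
  have /andP[_ h] := N j jm1; apply: lt_le_trans h _.
  have [jm2|mj] := ltnP j.+1 m.+1; first by have /andP[/ltW] := N _ jm2.
  have -> : j = m by apply/eqP; rewrite eqn_leq -ltnS jm1 -ltnS mj.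
  by rewrite !ext_last.
- apply/forallP => i.
  have /andP[_ ->] := N i (ltnW (ltn_ord i : (i.+1 < m.+1)%N)).
  by have /andP[->] := N i.+1 (ltn_ord i : (i.+1 < m.+1)%N).
- apply/forallP => i; have /andP[] := N i (ltn_ord i); exact: lt_trans.
Qed.

(** [interlaced] leaves out the inequalities at the two ends, [0 < x_1] and [x_(m+1) < 1]; they are
    supplied by [simplex x]. *)
Lemma interlaced_nested : simplex x -> interlaced x y -> nested.
Proof.
move=> /forallP sx /forallP ixy i im.
apply/andP; split.
  case: i im => [|i] im; first exact: (sx ord0).
  by have /andP[_] := ixy (Ordinal (im : (i < m)%N)).
have [im1|mi] := ltnP i m; first by have /andP[] := ixy (Ordinal im1).
have -> : i = m by apply/eqP; rewrite eqn_leq -ltnS im mi.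
by have := sx ord_max; rewrite /= !ext_last.
Qed.

Lemma nested_ratio i : nested -> (i < m.+1)%N ->
  0 < (ext x i.+1 - ext y i) / (ext y i.+1 - ext y i) < 1.
Proof.
move=> N im; have /andP[h1 h2] := N i im.
have w0 : 0 < ext y i.+1 - ext y i by rewrite subr_gt0 (lt_trans h1).
apply/andP; split; first by rewrite divr_gt0// subr_gt0.
by rewrite (ltr_pdivrMr _ _ w0) mul1r ltrD2r.
Qed.

Lemma rho_kernel_nested : rho_kernel al x y != 0 -> nested.
Proof.
rewrite /rho_kernel; case: ifP => sy; last by rewrite eqxx.
move=> /prodf_neq0 h i im.
have := h (Ordinal im) isT; rewrite mulf_eq0 negb_or => /andP[/theta01_neq0/= /andP[r0 r1] _].
have w0 : 0 < ext y i.+1 - ext y i by rewrite subr_gt0 simplex_ext_lt.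
move: r0 r1; rewrite pmulr_lgt0 ?invr_gt0// subr_gt0 => ->.
by rewrite ltr_pdivrMr// mul1r ltrD2r.
Qed.

Lemma rho_kernel_ge0 : 0 < al <= 1 -> 0 <= rho_kernel al x y.
Proof.
move=> al01; rewrite /rho_kernel; case: ifP => // _; apply: prodr_ge0 => i _.
by rewrite mulr_ge0 ?powR_ge0// theta01_ge0.
Qed.

End one.

Lemma rho_kernelE (beta : R) m (x : m.+1.-tuple R) (y : m.-tuple R) : simplex x ->
  rho_integrand beta x y = rho_kernel (beta / m.+1%:R) x y.
Proof.
move=> sx; rewrite /rho_integrand -/(interlaced x y); case: ifPn => [ixy|nixy].
  have N := interlaced_nested sx ixy; have [_ _ sy] := nested_simplex N.
  rewrite /rho_kernel sy; apply: eq_bigr => i _.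
  by rewrite theta01E// nested_ratio.
apply/esym/eqP; apply: contraNT nixy => /rho_kernel_nested N.
by have [_ ixy _] := nested_simplex N.
Qed.

Lemma rho_kernel_out (al : R) m (x : m.+1.-tuple R) (y : m.-tuple R) : ~~ simplex x ->
  rho_kernel al x y = 0.
Proof.
move=> nsx; apply/eqP; apply: contraNT nsx => /rho_kernel_nested N.
by have [] := nested_simplex N.
Qed.

Lemma measurable_rho_kernel (al : R) m : 0 < al <= 1 -> measurable_fun setT
  (fun p : (m.+1.-tuple R * m.-tuple R)%type => rho_kernel al p.1 p.2).
Proof.
move=> al01.
have m2 i : measurable_fun setT (fun p : (m.+1.-tuple R * m.-tuple R)%type => ext p.2 i : R).
  by apply: (measurableT_comp (@measurable_ext R m i)); exact: measurable_snd.
have m1 i : measurable_fun setT (fun p : (m.+1.-tuple R * m.-tuple R)%type => ext p.1 i : R).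
  by apply: (measurableT_comp (@measurable_ext R m.+1 i)); exact: measurable_fst.
apply: measurable_fun_ifT => //.
  by apply: (measurableT_comp (@measurable_simplex R m)); exact: measurable_snd.
apply: measurable_prod => i _; apply: measurable_funM.
  apply: (measurableT_comp (measurable_theta01 al01)).
  have -> : (fun p : (m.+1.-tuple R * m.-tuple R)%type => (ext p.1 i.+1 - ext p.2 i) / (ext p.2 i.+1 - ext p.2 i)) =
    (fun p => (ext p.1 i.+1 - ext p.2 i) * (ext p.2 i.+1 - ext p.2 i)^-1) by [].
  apply: measurable_funM; first exact: measurable_funB.
  by apply: (measurableT_comp (@measurable_invr R)); exact: measurable_funB.
by apply: (measurableT_comp (measurable_powR _)); exact: measurable_funB.
Qed.

End rho_kernel.

(** * The transform of the kernel *)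

Section kernel_transform.
Context {R : realType}.
Notation leb := (@lebesgue_measure R).
Notation mR := (measurableTypeR R).

Lemma ext_tnth n (x : n.-tuple R) (i : 'I_n) : ext x i.+1 = tnth x i.
Proof. by rewrite /ext/= size_tuple ltnNge (ltn_ord i : (i.+1 <= n)%N)/= (tnth_nth 0). Qed.

(** As in [abel_ext], but with the left end points of the gaps, which makes the tails strict. *)
Lemma abel_ext_tail m (y : m.-tuple R) (c : nat -> R) (s : R) :
  s + \sum_(j < m.+1) c j * ext y j =
  \sum_(i < m.+1) tail_weight m.+1 c s i * (ext y i.+1 - ext y i).
Proof.
rewrite /tail_weight; under [in RHS]eq_bigr do rewrite mulrDl.
rewrite big_split/= -mulr_sumr -ext_telescope ext_last mulr1; congr (_ + _).
under eq_bigr => j _.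
  rewrite ext_telescope (big_ord_widen m.+1 (fun i => ext y i.+1 - ext y i)) ?(ltnW (ltn_ord j))// mulr_sumr.
  over.
by rewrite (exchange_big_dep xpredT)//=; apply: eq_bigr => i _; rewrite mulr_suml.
Qed.

Variables (beta : R) (m : nat) (c : nat -> R) (s : R).
Let al : R := beta / m.+1%:R.
Hypothesis b0 : 0 < beta.
Hypothesis bm : beta <= m.+1%:R.
Hypothesis c0 : forall i, 0 <= c i.
Hypothesis s0 : 0 < s.

Let al01 : 0 < al <= 1.
Proof. by rewrite divr_gt0//= ler_pdivrMr// mul1r. Qed.

Let al0 : 0 < al. Proof. by case/andP: al01. Qed.

Let f (x : m.+1.-tuple R) : R := (s + \sum_(i < m.+1) c i * tnth x i) `^ (- beta).

Let mf : measurable_fun setT f.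
Proof.
apply: (measurableT_comp (measurable_powR _)); apply: measurable_funD => //.
by apply: measurable_sum => j; apply: measurable_funM => //; exact: measurable_tnth.
Qed.

Let D (y : m.-tuple R) (i : nat) : R := ext y i.+1 - ext y i.

Let mD i : measurable_fun setT (D ^~ i).
Proof. by apply: measurable_funB; exact: measurable_ext. Qed.

Let W (y : m.-tuple R) : R := if simplex y then \prod_(i < m.+1) D y i `^ (al - 1) else 0.

Let mW : measurable_fun setT W.
Proof.
apply: measurable_fun_ifT => //; first exact: measurable_simplex.
by apply: measurable_prod => i _; apply: (measurableT_comp (measurable_powR _)); exact: mD.
Qed.

Let W_ge0 y : 0 <= W y.
Proof. by rewrite /W; case: ifP => // _; apply: prodr_ge0 => i _; exact: powR_ge0. Qed.

Let S (z : m.+1.-tuple R) (y : m.-tuple R) : R :=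
  \sum_(i < m.+1) (tail_weight m.+1 c s i + c i * tnth z i) * D y i.

Let Th (z : m.+1.-tuple R) : R := \prod_(i < m.+1) theta01 al (tnth z i).

Let mTh : measurable_fun setT Th.
Proof.
apply: measurable_prod => i _; apply: (measurableT_comp (measurable_theta01 al01)).
exact: measurable_tnth.
Qed.

Let Th_ge0 z : 0 <= Th z.
Proof. by apply: prodr_ge0 => i _; exact: (theta01_ge0 al01). Qed.

Let G (p : (m.-tuple R * m.+1.-tuple R)%type) : R := Th p.2 * (W p.1 * S p.2 p.1 `^ (- beta)).

Let mG : measurable_fun setT G.
Proof.
have m1 i : measurable_fun setT (fun p : (m.-tuple R * m.+1.-tuple R)%type => D p.1 i : R).
  by apply: (measurableT_comp (mD i)); exact: measurable_fst.
have m2 i : measurable_fun setT (fun p : (m.-tuple R * m.+1.-tuple R)%type => tnth p.2 i : R).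
  by apply: (measurableT_comp (measurable_tnth i)); exact: measurable_snd.
apply: measurable_funM; first by apply: (measurableT_comp mTh); exact: measurable_snd.
apply: measurable_funM; first by apply: (measurableT_comp mW); exact: measurable_fst.
apply: (measurableT_comp (measurable_powR _)); apply: measurable_sum => i.
apply: measurable_funM; last exact: m1.
by apply: measurable_funD => //; apply: measurable_funM => //; exact: m2.
Qed.

Let G_ge0 p : 0 <= G p.
Proof. by rewrite /G !mulr_ge0 ?Th_ge0 ?W_ge0 ?powR_ge0. Qed.

(** For fixed [y] the substitution [x_i = y_i + D y i * z_i] separates the points; its Jacobian
    raises the exponent of each gap from [al - 2] to [al - 1], that of the Dirichlet weight. *)
Let kernel_slice y :
  (\int[lebn m.+1]_x (f x * rho_kernel al x y)%:E = \int[lebn m.+1]_z (G (y, z))%:E)%E.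
Proof.
have [sy|sy] := boolP (simplex y); last first.
  rewrite !integral0_eq// => x _; first by rewrite /G /W (negbTE sy) mul0r mulr0.
  by rewrite /rho_kernel (negbTE sy) mulr0.
have Dp (i : 'I_m.+1) : 0 < D y i by rewrite subr_gt0 simplex_ext_lt// -ltnS.
have mk : measurable_fun setT (fun x : m.+1.-tuple R => rho_kernel al x y).
  exact: (measurableT_comp (measurable_rho_kernel al01) (pair2_measurable y)).
rewrite (@lebn_affine R m.+1 (fun i => D y i) (fun i => ext y i))//; last 2 first.
- by apply/measurable_EFinP; apply: measurable_funM => //; exact: mf.
- by move=> x; rewrite lee_fin mulr_ge0 ?powR_ge0// (rho_kernel_ge0 _ _ al01).
rewrite -ge0_integralZl//; last 3 first.
- apply/measurable_EFinP; apply: (@measurableT_comp _ _ _ _ _ _ (fun x => f x * rho_kernel al x y) _ (fun z : m.+1.-tuple R => [tuple (ext y i + D y i * tnth z i) | i < m.+1])).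
    by apply: measurable_funM => //; exact: mf.
  apply/measurable_fun_tnthP => i.
  rewrite (_ : _ \o _ = (fun z => ext y i + D y i * tnth z i)).
    by apply: measurable_funD => //; apply: measurable_funM => //; exact: measurable_tnth.
  by apply/funext => z /=; rewrite tnth_mktuple.
- by move=> x _; rewrite lee_fin mulr_ge0 ?powR_ge0// (rho_kernel_ge0 _ _ al01).
- by rewrite lee_fin prodr_ge0// => i _; exact: ltW.
apply: eq_integral => z _; rewrite -EFinM; congr EFin.
set x := [tuple _ | i < _].
have fx : f x = S z y `^ (- beta).
  rewrite /f /S; congr (_ `^ _).
  under [RHS]eq_bigr do rewrite mulrDl.
  rewrite big_split/= -abel_ext_tail -addrA -big_split/=; congr (_ + _).
  by apply: eq_bigr => i _; rewrite tnth_mktuple mulrDr -/(D y i) mulrA (mulrAC _ (D y i)).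
have kx : \prod_(i < m.+1) D y i * rho_kernel al x y = W y * Th z.
  rewrite /rho_kernel /W sy /Th -!big_split/=; apply: eq_bigr => i _.
  have -> : ext x i.+1 - ext y i = D y i * tnth z i.
    by rewrite ext_tnth tnth_mktuple addrC addKr.
  have DE : D y i * D y i `^ (al - 2) = D y i `^ (al - 1).
    rewrite -{1}[D y i]powRr1 ?(ltW (Dp i))// -powRD ?(gt_eqF (Dp i)) ?implybT//.
    by congr (_ `^ _); ring.
  have Dz : D y i * tnth z i / D y i = tnth z i by rewrite mulrAC divff ?gt_eqF// mul1r.
  by rewrite -/(D y i) Dz mulrCA DE mulrC.
rewrite mulrCA kx fx /G /=; move: (S z y `^ _) (W y) (Th z) => u v w; ring.
Qed.

(** For fixed [z] the linear form in the gaps of [y] has the coefficients [tail_weight + c i * z_i],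
    and the Dirichlet formula turns it into a product over [i]. *)
Let W_integral z : (\int[lebn m]_y (G (y, z))%:E =
  (Gamma al ^+ m.+1 / Gamma beta * \prod_(i < m.+1)
    ((tail_weight m.+1 c s i + c i * tnth z i) `^ (- al) * theta01 al (tnth z i)))%:E)%E.
Proof.
have GB := Gamma_gt0 b0.
(* [dirichlet_stieltjes] asks for positive coefficients; where [Th z] is nonzero every [z_i] lies in
   []0, 1[]. *)
have [z0|Tz] := eqVneq (Th z) 0.
  rewrite integral0_eq => [|y _]; last by rewrite /G /= z0 mul0r.
  by rewrite big_split/= -/(Th z) z0 !mulr0.
have z01 i : 0 < tnth z i < 1.
  by move: Tz => /prodf_neq0/(_ i isT)/theta01_neq0.
pose b (i : 'I_m.+1) := tail_weight m.+1 c s i + c i * tnth z i.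
have bp i : 0 < b i.
  by rewrite ltr_wpDr ?tail_weight_gt0// mulr_ge0//; case/andP: (z01 i) => /ltW.
have := dirichlet_stieltjes (fun=> al0) bp; cbv zeta.
have -> : \sum_(i < m.+1) al = beta.
  by rewrite sumr_const card_ord -[LHS]mulr_natr divfK.
set I1 := (X in (X * _)%E = _) => E.
have I1E : I1 = ((\prod_(i < m.+1) (Gamma al * b i `^ (- al))) / Gamma beta)%:E.
  by rewrite EFinM -E -muleA -EFinM divff ?gt_eqF// mule1.
transitivity ((Th z)%:E * I1)%E.
  rewrite /I1 -ge0_integralZl//.
  - apply/measurable_EFinP; apply: measurable_funM; first exact: mW.
    apply: (measurableT_comp (measurable_powR _)); apply: measurable_sum => i.
    by apply: measurable_funM => //; exact: mD.
  - by move=> y _; rewrite lee_fin mulr_ge0 ?powR_ge0//; exact: W_ge0.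
  - by rewrite lee_fin Th_ge0.
rewrite I1E -EFinM; congr EFin; rewrite !big_split/= prodr_const card_ord -/(Th z).
rewrite -/b; move: (\prod_(i < m.+1) b i `^ _) (Th z) (Gamma al ^+ _) (Gamma beta)^-1 => B C A G'; ring.
Qed.

Lemma kernel_transform :
  (\int[lebn m.+1]_x (((s + \sum_(i < m.+1) c i * tnth x i) `^ (- beta))%:E *
      \int[lebn m]_y (rho_kernel al x y)%:E) =
   (Gamma al ^+ m.+1 / Gamma beta *
     expR (- al * \sum_(i < m.+1) mean_log (tail_weight m.+1 c s i) (c i)))%:E)%E.
Proof.
pose H (p : (m.+1.-tuple R * m.-tuple R)%type) : \bar R := (f p.1 * rho_kernel al p.1 p.2)%:E.
have mH : measurable_fun setT H.
  apply/measurable_EFinP; apply: measurable_funM; last exact: (measurable_rho_kernel al01).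
  by apply: (measurableT_comp mf); exact: measurable_fst.
have H0 p : (0 <= H p)%E by rewrite lee_fin mulr_ge0 ?powR_ge0// (rho_kernel_ge0 _ _ al01).
transitivity (\int[lebn m.+1]_x \int[lebn m]_y H (x, y))%E.
  apply: eq_integral => x _; rewrite -ge0_integralZl//.
  - by apply/measurable_EFinP; exact: (measurableT_comp (measurable_rho_kernel al01) (pair1_measurable x)).
  - by move=> y _; rewrite lee_fin (rho_kernel_ge0 _ _ al01).
  - by rewrite lee_fin powR_ge0.
rewrite (@fubini_tonelli _ _ _ _ R (lebn m.+1) (lebn m) H mH H0).
under eq_integral do rewrite kernel_slice.
have mGE : measurable_fun setT (EFin \o G) by apply/measurable_EFinP; exact: mG.
have GE0 p : (0 <= (EFin \o G) p)%E by rewrite lee_fin G_ge0.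
rewrite (@fubini_tonelli _ _ _ _ R (lebn m) (lebn m.+1) _ mGE GE0).
under eq_integral do rewrite W_integral EFinM.
have mt (i : 'I_m.+1) : measurable_fun setT (fun z : R => (tail_weight m.+1 c s i + c i * z) `^ (- al) * theta01 al z).
  by apply: measurable_funM; [mfun|exact: (measurable_theta01 al01)].
have t0 (i : 'I_m.+1) (z : R) : 0 <= (tail_weight m.+1 c s i + c i * z) `^ (- al) * theta01 al z.
  by rewrite mulr_ge0 ?powR_ge0// (theta01_ge0 al01).
rewrite ge0_integralZl//; last 3 first.
- apply/measurable_EFinP; apply: measurable_prod => i _.
  by apply: (measurableT_comp (mt i)); exact: measurable_tnth.
- by move=> z _; rewrite lee_fin prodr_ge0.
- by rewrite lee_fin divr_ge0 ?exprn_ge0 ?(ltW (Gamma_gt0 al0)) ?(ltW (Gamma_gt0 b0)).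
rewrite (lebn_prod mt t0) [RHS]EFinM; congr (_ * _)%E.
rewrite mulr_sumr expR_sum -prodEFin; apply: eq_bigr => i _.
by rewrite (theta_transform al01)// tail_weight_gt0.
Qed.

End kernel_transform.

(** * Change of variables to a fixed cube *)

Section pulled_kernel.
Context {R : realType}.
Notation leb := (@lebesgue_measure R).
Notation mR := (measurableTypeR R).
Variables (al : R) (m : nat).
Hypothesis al01 : 0 < al <= 1.

Let al0 : 0 < al. Proof. by case/andP: al01. Qed.

Definition gap (x : m.+1.-tuple R) (i : nat) : R := ext x i.+1 - ext x i.

Lemma gap_gt0 x i : simplex x -> (i < m.+2)%N -> 0 < gap x i.
Proof. by move=> sx im; rewrite subr_gt0 simplex_ext_lt. Qed.

Definition cube (s : m.-tuple R) : bool := [forall i : 'I_m, (0 < tnth s i) && (tnth s i < 1)].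

Lemma cube_ext s i : cube s -> (i < m.+1)%N -> 0 <= ext s i < 1.
Proof.
move=> /forallP cs; case: i => [|i] im; first by rewrite ext0 lexx ltr01.
by have := cs (Ordinal (im : (i < m)%N)); rewrite -ext_tnth/= => /andP[/ltW-> ->].
Qed.

Lemma cube_extS s i : cube s -> (i < m.+1)%N -> 0 < ext s i.+1 <= 1.
Proof.
move=> /forallP cs im; have [im1|mi] := ltnP i m.
  by have := cs (Ordinal im1); rewrite -ext_tnth/= => /andP[-> /ltW].
have -> : i = m by apply/eqP; rewrite eqn_leq -ltnS im mi.
by rewrite ext_last ltr01 lexx.
Qed.

(* With [y_i = x_i + s_i (x_(i+1) - x_i)], the points [y_i < x_(i+1) < y_(i+1)]
   are separated by [left_gap x s i] and [right_gap x s i]; the conventions of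
   [ext] make this hold for the extreme indices, where [s] is 0 or 1. *)
Definition left_gap (x : m.+1.-tuple R) (s : m.-tuple R) i : R := gap x i * (1 - ext s i).
Definition right_gap (x : m.+1.-tuple R) (s : m.-tuple R) i : R := gap x i.+1 * ext s i.+1.

Lemma left_gap_gt0 x s i : simplex x -> cube s -> (i < m.+1)%N -> 0 < left_gap x s i.
Proof.
move=> sx cs im; rewrite mulr_gt0 ?gap_gt0 ?(ltnW im)//; first exact: ltnW.
by rewrite subr_gt0; case/andP: (cube_ext cs im).
Qed.

Lemma right_gap_gt0 x s i : simplex x -> cube s -> (i < m.+1)%N -> 0 < right_gap x s i.
Proof.
move=> sx cs im; rewrite mulr_gt0 ?gap_gt0//.
by case/andP: (cube_extS cs im).
Qed.

Definition pulled_kernel (x : m.+1.-tuple R) (s : m.-tuple R) : R :=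
  if cube s then \prod_(i < m.+1)
    (theta01 al (left_gap x s i / (left_gap x s i + right_gap x s i))
      * (left_gap x s i + right_gap x s i) `^ (al - 2))
  else 0.

Definition pull (x : m.+1.-tuple R) (s : m.-tuple R) : m.-tuple R :=
  [tuple (ext x i.+1 + gap x i.+1 * tnth s i) | i < m].

Lemma ext_pull x s i : (i <= m.+1)%N -> ext (pull x s) i = ext x i + gap x i * ext s i.
Proof.
case: i => [|i] im; first by rewrite !ext0 mulr0 addr0.
have [im1|mi] := ltnP i m.
  by rewrite -[i]/(nat_of_ord (Ordinal im1)) !ext_tnth tnth_mktuple.
have -> : i = m by apply/eqP; rewrite eqn_leq -ltnS im mi.
by rewrite !ext_last /gap mulr1 addrC subrK ext_last.
Qed.

Lemma rho_kernel_pull x s : simplex x -> rho_kernel al x (pull x s) = pulled_kernel x s.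
Proof.
move=> sx; have L i : (i < m.+1)%N -> ext x i.+1 - ext (pull x s) i = left_gap x s i.
  move=> im; rewrite ext_pull 1?ltnW// /left_gap /gap.
  by move: (ext x _) (ext x _) (ext s _) => a b c; ring.
have LR i : (i < m.+1)%N -> ext (pull x s) i.+1 - ext (pull x s) i = left_gap x s i + right_gap x s i.
  move=> im; rewrite ext_pull// ext_pull 1?ltnW// /left_gap /right_gap /gap.
  by move: (ext x _) (ext x _) (ext x _) (ext s _) (ext s _) => a b c d e; ring.
rewrite /pulled_kernel; case: ifPn => [cs|ncs].
  have sy : simplex (pull x s).
    by apply/forallP => i; rewrite -subr_gt0 LR// addr_gt0 ?left_gap_gt0 ?right_gap_gt0.
  by rewrite /rho_kernel sy; apply: eq_bigr => i _; rewrite (LR _ (ltn_ord i)) (L _ (ltn_ord i)).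
apply/eqP; apply: contraNT ncs => /rho_kernel_nested/nested_simplex[_ /forallP h _].
apply/forallP => i; have := h i.
have i1 : (i < m.+1)%N by exact: ltnW (ltn_ord i : (i < m)%N).
rewrite (ext_pull x s (i1 : (i.+1 <= m.+1)%N)) ext_tnth.
have gp : 0 < gap x i.+1 by apply: gap_gt0.
have -> : ext x i.+2 = ext x i.+1 + gap x i.+1 by rewrite /gap addrC subrK.
by rewrite ltrDl ltrD2l pmulr_rgt0// gtr_pMr.
Qed.

Lemma measurable_pulled_kernel x : measurable_fun setT (pulled_kernel x).
Proof.
have mL i : measurable_fun setT (fun s : m.-tuple R => left_gap x s i).
  by apply: measurable_funM => //; apply: measurable_funB => //; exact: measurable_ext.
have mR' i : measurable_fun setT (fun s : m.-tuple R => right_gap x s i).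
  by apply: measurable_funM => //; exact: measurable_ext.
have mLR i : measurable_fun setT (fun s : m.-tuple R => left_gap x s i + right_gap x s i).
  exact: measurable_funD.
apply: measurable_fun_ifT => //.
  apply: measurable_forall => i; apply: measurable_and.
    by apply: measurable_fun_ltr => //; exact: measurable_tnth.
  by apply: measurable_fun_ltr => //; exact: measurable_tnth.
apply: measurable_prod => i _; apply: measurable_funM.
  apply: (measurableT_comp (measurable_theta01 al01)).
  apply: measurable_funM; first exact: mL.
  by apply: (measurableT_comp (@measurable_invr R)); exact: mLR.
by apply: (measurableT_comp (measurable_powR _)); exact: mLR.
Qed.

Lemma pulled_kernel_ge0 x s : 0 <= pulled_kernel x s.
Proof.
rewrite /pulled_kernel; case: ifP => // _; apply: prodr_ge0 => i _.
by rewrite mulr_ge0 ?powR_ge0// (theta01_ge0 al01).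
Qed.

Lemma pulled_kernel_gt0 x s : simplex x -> cube s -> 0 < pulled_kernel x s.
Proof.
move=> sx cs; rewrite /pulled_kernel cs; apply: prodr_gt0 => i _.
have l0 := left_gap_gt0 sx cs (ltn_ord i); have r0 := right_gap_gt0 sx cs (ltn_ord i).
have lr : 0 < left_gap x s i + right_gap x s i by rewrite addr_gt0.
have z01 : 0 < left_gap x s i / (left_gap x s i + right_gap x s i) < 1.
  by rewrite divr_gt0//= (ltr_pdivrMr _ _ lr) mul1r ltrDl.
by rewrite mulr_gt0 ?powR_gt0// theta01E// (theta_gt0 al01).
Qed.

Lemma integral_rho_kernel x : simplex x ->
  (\int[lebn m]_y (rho_kernel al x y)%:E =
   (\prod_(i < m) gap x i.+1)%:E * \int[lebn m]_s (pulled_kernel x s)%:E)%E.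
Proof.
move=> sx; rewrite (@lebn_affine R m (fun i => gap x i.+1) (fun i => ext x i.+1)).
- by congr (_ * _)%E; apply: eq_integral => s _; congr EFin; exact: rho_kernel_pull.
- by move=> i; apply: (gap_gt0 sx); rewrite !ltnS ltnW.
- by apply/measurable_EFinP; exact: (measurableT_comp (measurable_rho_kernel al01) (pair1_measurable x)).
- by move=> y; rewrite lee_fin (rho_kernel_ge0 _ _ al01).
Qed.

(** The singular factor of one coordinate: [s_i] enters one gap of [y] through [s_i] and the next
    one through [1 - s_i]. *)
Definition envelope1 (t : R) : R :=
  if (0 < t) && (t < 1) then t `^ (al / 2 - 1) * (1 - t) `^ (al / 2 - 1) else 0.

Lemma envelope1_ge0 t : 0 <= envelope1 t.
Proof. by rewrite /envelope1; case: ifP => // _; rewrite mulr_ge0 ?powR_ge0. Qed.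

Lemma measurable_envelope1 : measurable_fun setT envelope1.
Proof. by rewrite /envelope1; mfun. Qed.

Definition kernel_bound (del : R) : R :=
  \prod_(i < m.+1) (theta_max al * (del ^+ 2) `^ (al / 2 - 1)).

(** From [(l + r)^2 >= l r >= del^2 (1 - s_i) s_(i+1)] and [al / 2 - 1 <= 0]: the power [al - 2] of
    a gap splits into two powers [al / 2 - 1], one for each neighbouring coordinate, and these are
    integrable. *)
Lemma pulled_kernel_le x s del : 0 < del -> simplex x ->
  (forall i, (i < m.+2)%N -> del <= gap x i) ->
  pulled_kernel x s <= kernel_bound del * \prod_(i < m) envelope1 (tnth s i).
Proof.
move=> d0 sx dx; have M0 := theta_max_ge0 al01.
rewrite /pulled_kernel; case: ifPn => [cs|_]; last first.
  rewrite mulr_ge0//; first by apply: prodr_ge0 => i _; rewrite mulr_ge0 ?powR_ge0.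
  by apply: prodr_ge0 => i _; exact: envelope1_ge0.
(* The product is regrouped by the gaps of [y]; the additional factors at the two ends are powers of
   1. *)
have -> : \prod_(i < m) envelope1 (tnth s i) =
    \prod_(i < m.+1) ((1 - ext s i) `^ (al / 2 - 1) * ext s i.+1 `^ (al / 2 - 1)).
  rewrite [RHS]big_split/= big_ord_recl/= ext0 subr0 powR1 mul1r big_ord_recr/= ext_last powR1 mulr1.
  rewrite -big_split/=; apply: eq_bigr => i _; rewrite /bump/= add1n ext_tnth.
  by rewrite /envelope1 (forallP cs i) mulrC.
rewrite /kernel_bound -big_split/=; apply: ler_prod => i _.
have im := ltn_ord i.
have l0 := left_gap_gt0 sx cs im; have r0 := right_gap_gt0 sx cs im.
have /andP[_ p0] := cube_ext cs im; have /andP[q0 _] := cube_extS cs im.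
rewrite -subr_gt0 in p0.
have dL : del * (1 - ext s i) <= left_gap x s i by rewrite ler_pM2r// dx// ltnW.
have dR : del * ext s i.+1 <= right_gap x s i by rewrite ler_pM2r// dx.
move: (left_gap x s i) (right_gap x s i) (1 - ext s i) (ext s i.+1) l0 r0 p0 q0 dL dR => l r p q l0 r0 p0 q0 dL dR.
rewrite mulr_ge0 ?powR_ge0 ?(theta01_ge0 al01)//=.
rewrite -mulrA ler_pM ?powR_ge0 ?(theta01_ge0 al01)// ?(theta01_le_max al01)//.
have e2 : al / 2 - 1 <= 0 by case/andP: al01 => ? ?; lra.
have -> : (l + r) `^ (al - 2) = ((l + r) ^+ 2) `^ (al / 2 - 1).
  rewrite -powR_mulrn ?addr_ge0 ?ltW// -powRrM; congr (_ `^ _); lra.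
rewrite -powRM ?mulr_ge0 ?(ltW p0) ?(ltW q0)// -powRM ?sqr_ge0 ?mulr_ge0 ?(ltW p0) ?(ltW q0)//.
have h : del ^+ 2 * (p * q) <= (l + r) ^+ 2.
  have h1 : (del * p) * (del * q) <= l * r by rewrite ler_pM ?mulr_ge0 ?(ltW d0) ?(ltW p0) ?(ltW q0).
  have h2 := mulr_ge0 (ltW l0) (ltW l0); have h3 := mulr_ge0 (ltW r0) (ltW r0).
  have h4 := mulr_ge0 (ltW l0) (ltW r0).
  have -> : del ^+ 2 * (p * q) = (del * p) * (del * q) by ring.
  by apply: le_trans h1 _; rewrite sqrrD !expr2 mulr2n; lra.
have u0 : 0 < del ^+ 2 * (p * q) by rewrite !mulr_gt0 ?exprn_gt0.
have v0 := lt_le_trans u0 h.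
rewrite -[al / 2 - 1]opprK (powRN ((l + r) ^+ 2)) (powRN (del ^+ 2 * (p * q))) lef_pV2 ?posrE ?powR_gt0//.
by rewrite ge0_ler_powR ?nnegrE ?(ltW u0) ?(ltW v0)// oppr_ge0.
Qed.

End pulled_kernel.

(** * Finiteness and positivity of the inner integral *)

Section rho_analysis.
Context {R : realType}.
Notation leb := (@lebesgue_measure R).
Notation mR := (measurableTypeR R).
Variables (al : R) (m : nat).
Hypothesis al01 : 0 < al <= 1.

Let al0 : 0 < al. Proof. by case/andP: al01. Qed.

Lemma integral_lebn0 (g : 0.-tuple R -> \bar R) : (\int[lebn 0]_t g t = g [tuple])%E.
Proof.
transitivity (\int[lebn 0]_t (cst (g [tuple]) t))%E.
  by apply: eq_integral => t _; rewrite (tuple0 t).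
by rewrite /= integral_dirac// diracT mul1e.
Qed.

(* Up to a factor, this is the mass of the Dirichlet weight with two parameters
   [al / 2]. *)
Lemma integral_envelope1_lty : (\int[leb]_t (envelope1 al t)%:E < +oo)%E.
Proof.
have a0 : 0 < al / 2 by rewrite divr_gt0// al0.
have := @dirichlet_stieltjes R 1 (fun=> al / 2) (fun=> 1) (fun=> a0) (fun=> ltr01); cbv zeta.
set I1 := (X in (X * _)%E = _); set be := \sum_(i < 2) _ => E.
have be0 : 0 < be by rewrite /be big_ord_recl ltr_wpDr// sumr_ge0// => i _; rewrite ltW.
have GB := Gamma_gt0 be0.
suff -> : (\int[leb]_t (envelope1 al t)%:E = I1)%E.
  have I10 : (0 <= I1)%E.
    apply: integral_ge0 => y _; rewrite lee_fin mulr_ge0 ?powR_ge0//; case: ifP => // _.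
    by apply: prodr_ge0 => i _; exact: powR_ge0.
  move: E I10; case: I1 => [r| |]//=; first by rewrite ltry.
  by rewrite mulyr gtr0_sg// mul1e.
rewrite /I1 integral_lebnS_in; last 2 first.
- apply/measurable_EFinP; apply: measurable_funM.
    apply: measurable_fun_ifT => //; first exact: measurable_simplex.
    apply: measurable_prod => i _; apply: (measurableT_comp (measurable_powR _)).
    by apply: measurable_funB; exact: measurable_ext.
  apply: (measurableT_comp (measurable_powR _)); apply: measurable_sum => i.
  by apply: measurable_funM => //; apply: measurable_funB; exact: measurable_ext.
- move=> y; rewrite lee_fin mulr_ge0 ?powR_ge0//; case: ifP => // _.
  by apply: prodr_ge0 => i _; exact: powR_ge0.
apply: eq_integral => t _; rewrite integral_lebn0; congr EFin.
set y := [tuple of _].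
have y1 : ext y 1 = t by [].
have y2 : ext y 2 = 1 by [].
have -> : simplex y = (0 < t) && (t < 1).
  apply/forallP/andP => [h|[t0 t1] [[|[|//]] ?]] //.
  by split; [exact: (h ord0)|exact: (h ord_max)].
have -> : \sum_(i < 2) 1 * (ext y i.+1 - ext y i) = 1.
  transitivity (1 * (ext y 1 - ext y 0) + 1 * (ext y 2 - ext y 1)); first by rewrite big_ord_recl big_ord1.
  by rewrite y1 y2 ext0; ring.
have -> : \prod_(i < 2) (ext y i.+1 - ext y i) `^ (al / 2 - 1) = t `^ (al / 2 - 1) * (1 - t) `^ (al / 2 - 1).
  transitivity ((ext y 1 - ext y 0) `^ (al / 2 - 1) * (ext y 2 - ext y 1) `^ (al / 2 - 1)); first by rewrite big_ord_recl big_ord1.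
  by rewrite y1 y2 ext0 subr0.
by rewrite powR1 mulr1.
Qed.

Lemma integral_envelope_lty :
  (\int[lebn m]_s (\prod_(i < m) envelope1 al (tnth s i))%:E < +oo)%E.
Proof.
rewrite (@lebn_prod R m (fun=> envelope1 al)); last 2 first.
- by move=> i; exact: measurable_envelope1.
- by move=> i t; exact: envelope1_ge0.
have /fineK <- : (\int[leb]_t (envelope1 al t)%:E)%E \is a fin_num.
  rewrite ge0_fin_numE ?integral_envelope1_lty//.
  by apply: integral_ge0 => t _; rewrite lee_fin envelope1_ge0.
by rewrite prodEFin ltry.
Qed.

Lemma integrable_envelope del : 0 < del -> (lebn m).-integrable setT
  (fun s : m.-tuple R => (kernel_bound al m del * \prod_(i < m) envelope1 al (tnth s i))%:E).
Proof.
move=> d0; apply/integrableP.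
have mp : measurable_fun setT (fun s : m.-tuple R => \prod_(i < m) envelope1 al (tnth s i)).
  apply: measurable_prod => i _; apply: (measurableT_comp (@measurable_envelope1 R al)).
  exact: measurable_tnth.
have p0 (s : m.-tuple R) : 0 <= \prod_(i < m) envelope1 al (tnth s i).
  by apply: prodr_ge0 => i _; exact: envelope1_ge0.
have K0 : 0 <= kernel_bound al m del.
  by apply: prodr_ge0 => i _; rewrite mulr_ge0 ?powR_ge0// (theta_max_ge0 al01).
split; first by apply/measurable_EFinP; apply: measurable_funM.
under eq_integral => s _ do rewrite /= ger0_norm ?mulr_ge0// EFinM.
rewrite ge0_integralZl//; last 2 first.
- exact/measurable_EFinP.
- by move=> s _; rewrite lee_fin.
by rewrite lte_mul_pinfty// integral_envelope_lty.
Qed.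

Lemma simplex_gap_lb (x : m.+1.-tuple R) : simplex x ->
  exists2 del : R, 0 < del & forall i, (i < m.+2)%N -> del <= gap x i.
Proof.
(* The reciprocal of the sum of the reciprocals lies below every gap. *)
move=> sx; pose S := \sum_(i < m.+2) (gap x i)^-1.
have g0 (i : 'I_m.+2) : 0 < (gap x i)^-1 by rewrite invr_gt0 gap_gt0.
have S0 : 0 < S by rewrite /S big_ord_recl ltr_wpDr// sumr_ge0// => i _; rewrite ltW.
exists S^-1; first by rewrite invr_gt0.
move=> i im; rewrite -[leRHS]invrK lef_pV2 ?posrE ?invr_gt0 ?gap_gt0//.
by rewrite /S (bigD1 (Ordinal im))//= lerDl sumr_ge0// => j _; rewrite ltW.
Qed.

Lemma integral_pulled_lty x : simplex x ->
  (\int[lebn m]_s (pulled_kernel al x s)%:E < +oo)%E.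
Proof.
move=> sx; have [del d0 dx] := simplex_gap_lb sx.
have /integrableP[_] := integrable_envelope d0; apply: le_lt_trans.
apply: ge0_le_integral => //.
- by move=> s _; rewrite lee_fin (pulled_kernel_ge0 al01).
- by apply/measurable_EFinP; exact: (measurable_pulled_kernel al01).
- by have /integrableP[mb _] := integrable_envelope d0; apply: measurableT_comp.
- move=> s _; rewrite /= lee_fin; apply: le_trans (ler_norm _).
  exact: (pulled_kernel_le al01).
Qed.

Lemma integral_pulled_gt0 x : simplex x ->
  (0 < \int[lebn m]_s (pulled_kernel al x s)%:E)%E.
Proof.
move=> sx; have mc : measurable [set s : m.-tuple R | cube s].
  have mcb : measurable_fun setT (@cube R m).
    apply: measurable_forall => i; apply: measurable_and.
      by apply: measurable_fun_ltr => //; exact: measurable_tnth.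
    by apply: measurable_fun_ltr => //; exact: measurable_tnth.
  rewrite (_ : [set s | cube s] = setT `&` (@cube R m) @^-1` [set true]); first exact: mcb.
  by rewrite setTI; apply/seteqP; split => s.
have -> : (\int[lebn m]_s (pulled_kernel al x s)%:E =
    \int[lebn m]_(s in [set s | cube s]) (pulled_kernel al x s)%:E)%E.
  rewrite [RHS]integral_mkcond; apply: eq_integral => s _; rewrite patchE.
  by case: ifPn => //; rewrite notin_setE/= /pulled_kernel => /negP/negbTE ->.
apply: integral_gt0 => //.
- by apply: measurable_funTS; apply/measurable_EFinP; exact: (measurable_pulled_kernel al01).
(* The cube has mass 1, as a product of unit intervals. *)
- have : (\int[lebn m]_s (\prod_(i < m) (if (0 < tnth s i) && (tnth s i < 1) then 1 else 0 : R))%:E = 1)%E.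
    rewrite (@lebn_prod R m (fun _ t => if (0 < t) && (t < 1) then 1 else 0)); last 2 first.
    - by move=> i; mfun.
    - by move=> i t; case: ifP.
    rewrite big1// => i _.
    transitivity (leb `]0, 1[%classic); last by rewrite lebesgue_measure_itv/= lte_fin ltr01 oppr0 adde0.
    rewrite -[RHS]mul1e -integral_cst// integral_mkcond; apply: eq_integral => t _.
    by rewrite patchE mem_setE in_itv/=; case: ifP.
  suff E : (\int[lebn m]_s (\prod_(i < m) (if (0 < tnth s i) && (tnth s i < 1) then 1 else 0 : R))%:E = lebn m [set s | cube s])%E.
    move=> H; apply: (lt_le_trans lte01); rewrite le_eqVlt; apply/orP; left; apply/eqP.
    exact: etrans (esym H) E.
  rewrite -[RHS]mul1e -integral_cst// integral_mkcond; apply: eq_integral => s _; rewrite patchE.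
  case: ifPn => [|]; rewrite ?inE ?notin_setE/=.
    by move=> /forallP cs; rewrite big1// => i _; rewrite cs.
  move/negP; rewrite /cube negb_forall => /existsP[i ni].
  by rewrite (bigD1 i)//= (negbTE ni) mul0r.
- by move=> s /= cs; rewrite lte_fin (pulled_kernel_gt0 al01).
Qed.

End rho_analysis.

(** * Regularity and transform of rho *)

Section rho_regularity.
Context {R : realType}.
Notation leb := (@lebesgue_measure R).
Notation mR := (measurableTypeR R).
Variables (beta : R) (m : nat).
Hypothesis b0 : 0 < beta.
Hypothesis bm : beta <= m.+1%:R.
Let al : R := beta / m.+1%:R.

Let al01 : 0 < al <= 1.
Proof. by rewrite divr_gt0//= ler_pdivrMr// mul1r. Qed.

Let al0 : 0 < al. Proof. by case/andP: al01. Qed.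

(** A common lower bound [del] on the gaps provides one integrable envelope for the whole
    sequence. *)
Lemma integral_pulled_cvg (x : m.+1.-tuple R) (u : nat -> m.+1.-tuple R) (del : R) :
  simplex x -> (forall n, simplex (u n)) -> 0 < del ->
  (forall n i, (i < m.+2)%N -> del <= gap (u n) i) ->
  (forall i, ext (u n) i @[n --> \oo] --> ext x i) ->
  (\int[lebn m]_s (pulled_kernel al (u n) s)%:E)%E @[n --> \oo] -->
  (\int[lebn m]_s (pulled_kernel al x s)%:E)%E.
Proof.
move=> sx su d0 du cu.
apply: (@dominated_cvg _ _ _ (lebn m) setT measurableT _ _
  (fun s => (kernel_bound al m del * \prod_(i < m) envelope1 al (tnth s i))%:E)) => //.
- by move=> n; apply/measurable_EFinP; exact: (measurable_pulled_kernel al01).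
- move=> s _; apply: cvg_EFin; first by apply: nearW.
  rewrite /comp/= /pulled_kernel; case: ifPn => [cs|_]; last exact: cvg_cst.
  apply: cvg_prod_ord => i.
  have im := ltn_ord i.
  have l0 := left_gap_gt0 sx cs im; have r0 := right_gap_gt0 sx cs im.
  have cl : left_gap (u n) s i @[n --> \oo] --> left_gap x s i.
    by apply: cvgM; [apply: cvgB; exact: cu|exact: cvg_cst].
  have cr : right_gap (u n) s i @[n --> \oo] --> right_gap x s i.
    by apply: cvgM; [apply: cvgB; exact: cu|exact: cvg_cst].
  have clr : left_gap (u n) s i + right_gap (u n) s i @[n --> \oo] --> left_gap x s i + right_gap x s i.
    exact: cvgD.
  have z01 v : simplex v -> 0 < left_gap v s i / (left_gap v s i + right_gap v s i) < 1.
    move=> sv; have l1 := left_gap_gt0 sv cs im; have r1 := right_gap_gt0 sv cs im.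
    by rewrite divr_gt0 ?addr_gt0//= (ltr_pdivrMr _ _ (addr_gt0 l1 r1)) mul1r ltrDl.
  have lr0 : 0 < left_gap x s i + right_gap x s i by rewrite addr_gt0.
  apply: cvgM.
    rewrite (theta01E _ (z01 x sx)).
    under eq_fun => n do rewrite (theta01E _ (z01 (u n) (su n))).
    apply: (@continuous_cvg _ _ _ _ _ (fun n => left_gap (u n) s i / (left_gap (u n) s i + right_gap (u n) s i)) (theta al)).
      exact: (continuous_theta al01 (z01 x sx)).
    by apply: cvgM => //; apply: cvgV => //; rewrite gt_eqF.
  have h : 0 < 0 + 1 * (left_gap x s i + right_gap x s i) by rewrite add0r mul1r.
  have := @continuous_powR_affine R (al - 2) 0 1 _ h.
  rewrite (_ : (fun x => _) = (fun x : R => x `^ (al - 2))); last by apply/funext => t; rewrite add0r mul1r.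
  move=> cc; exact: (@continuous_cvg _ _ _ _ _ (fun n => left_gap (u n) s i + right_gap (u n) s i) (fun x : R => x `^ (al - 2)) _ cc clr).
- exact: (integrable_envelope m al01 d0).
- move=> n s _; rewrite lee_fin ger0_norm; last exact: (pulled_kernel_ge0 al01).
  exact: (pulled_kernel_le al01 s d0 (su n) (du n)).
Qed.

Lemma rhoE (x : m.+1.-tuple R) : simplex x -> rho beta x =
  Gamma beta / Gamma al ^+ m.+1 *
  (\prod_(i < m) gap x i.+1 * fine (\int[lebn m]_s (pulled_kernel al x s)%:E)%E).
Proof.
move=> sx; rewrite /rho sx; congr (_ * _).
have -> : (fun y : m.-tuple R => (rho_integrand beta x y)%:E) = (fun y => (rho_kernel al x y)%:E).
  by apply/funext => y; congr EFin; exact: rho_kernelE.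
rewrite iter_intE; last 2 first.
- by apply/measurable_EFinP; exact: (measurableT_comp (measurable_rho_kernel al01) (pair1_measurable x)).
- by move=> y; rewrite lee_fin (rho_kernel_ge0 _ _ al01).
rewrite (integral_rho_kernel al01 sx) fineM// ge0_fin_numE; first exact: (integral_pulled_lty al01 sx).
exact/ltW/(integral_pulled_gt0 al01 sx).
Qed.

(** [rho] takes [fine] of an integral; on the simplex this integral is finite, and elsewhere the
    kernel vanishes, so the extended-real identity holds everywhere and Tonelli can be applied to
    it. *)
Lemma EFin_rho (x : m.+1.-tuple R) :
  ((rho beta x)%:E = (Gamma beta / Gamma al ^+ m.+1)%:E * \int[lebn m]_y (rho_kernel al x y)%:E)%E.
Proof.
have [sx|nsx] := boolP (simplex x); last first.
  by rewrite /rho (negbTE nsx) integral0_eq ?mule0// => y _; rewrite rho_kernel_out.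
rewrite (rhoE sx) (integral_rho_kernel al01 sx) EFinM; congr (_ * _)%E.
rewrite EFinM fineK// ge0_fin_numE; first exact: (integral_pulled_lty al01 sx).
exact/ltW/(integral_pulled_gt0 al01 sx).
Qed.

Lemma rho_gt0 (x : m.+1.-tuple R) : simplex x -> 0 < rho beta x.
Proof.
move=> sx; rewrite (rhoE sx) !mulr_gt0 ?invr_gt0 ?exprn_gt0 ?(Gamma_gt0 b0) ?(Gamma_gt0 al0)//.
  by apply: prodr_gt0 => i _; apply: (gap_gt0 sx); rewrite !ltnS ltnW.
by rewrite fine_gt0// (integral_pulled_gt0 al01 sx) (integral_pulled_lty al01 sx).
Qed.

Lemma rho_ge0 (x : m.+1.-tuple R) : 0 <= rho beta x.
Proof.
have [/rho_gt0/ltW//|nsx] := boolP (simplex x).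
by rewrite /rho (negbTE nsx).
Qed.

Lemma rho_cvg (x : m.+1.-tuple R) (u : nat -> m.+1.-tuple R) (del : R) :
  simplex x -> (forall n, simplex (u n)) -> 0 < del ->
  (forall n i, (i < m.+2)%N -> del <= gap (u n) i) ->
  (forall i, ext (u n) i @[n --> \oo] --> ext x i) ->
  rho beta (u n) @[n --> \oo] --> rho beta x.
Proof.
move=> sx su d0 du cu; rewrite (rhoE sx).
under eq_fun => n do rewrite (rhoE (su n)).
apply: cvgM; first exact: cvg_cst.
apply: cvgM.
  by apply: cvg_prod_ord => i; apply: cvgB; exact: cu.
apply: fine_cvg; rewrite fineK; first exact: integral_pulled_cvg du cu.
rewrite ge0_fin_numE; first exact: (integral_pulled_lty al01 sx).
exact/ltW/(integral_pulled_gt0 al01 sx).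
Qed.

Lemma ext_dist (x y : m.+1.-tuple R) (e : R) i : 0 <= e ->
  (forall i : 'I_m.+1, `|tnth x i - tnth y i| <= e) -> `|ext x i - ext y i| <= e.
Proof.
move=> e0 h; case: i => [|i]; first by rewrite !ext0 subrr normr0.
have [im|mi] := ltnP i m.+1; first by rewrite -[i]/(nat_of_ord (Ordinal im)) !ext_tnth.
by rewrite /ext !size_tuple ltnS mi subrr normr0.
Qed.

(** By sequences: a failure at [e] yields points [u n] tending to [x] along which [rho] stays at
    distance [e], against [rho_cvg]. *)
Lemma rho_continuous (x : m.+1.-tuple R) : simplex x ->
  forall e : R, 0 < e -> exists2 del : R, 0 < del &
    forall y : m.+1.-tuple R, simplex y ->
      (forall i : 'I_m.+1, `|tnth x i - tnth y i| < del) ->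
      `|rho beta x - rho beta y| < e.
Proof.
move=> sx e e0; apply: contrapT => H.
have [del d0 dx] := simplex_gap_lb sx.
(* When both end points move by at most [del / 4], every gap of [u n] remains at least [del / 2]. *)
pose r (n : nat) : R := Num.min n.+1%:R^-1 (del / 4).
have r0 n : 0 < r n by rewrite lt_min invr_gt0 ltr0Sn divr_gt0.
have /choice[u Hu] : forall n, exists y : m.+1.-tuple R, [/\ simplex y,
    (forall i : 'I_m.+1, `|tnth x i - tnth y i| <= r n) & e <= `|rho beta x - rho beta y|].
  move=> n; apply: contrapT => H'; apply: H; exists (r n) => // y sy hy.
  rewrite ltNge; apply/negP => ey; apply: H'; exists y; split => // i.
  exact: ltW.
have su n : simplex (u n) by case: (Hu n).
have ed n i : `|ext x i - ext (u n) i| <= r n.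
  by apply: ext_dist; [exact: ltW|case: (Hu n)].
have cu i : ext (u n) i @[n --> \oo] --> ext x i.
  apply/subr_cvg0; apply: norm_cvg0.
  have c1 : (0 : R) @[_ --> \oo] --> (0 : R) by exact: cvg_cst.
  have c2 : (n.+1%:R^-1 : R) @[n --> \oo] --> (0 : R) by exact: cvg_harmonic.
  apply: (squeeze_cvgr _ c1 c2); apply: nearW => n; rewrite normr_ge0/= distrC.
  by apply: le_trans (ed n i) _; rewrite ge_min lexx.
have d2 : 0 < del / 2 by rewrite divr_gt0.
have du n i : (i < m.+2)%N -> del / 2 <= gap (u n) i.
  move=> im; have h1 := dx i im; have h2 := ed n i; have h3 := ed n i.+1.
  have h4 : r n <= del / 4 by rewrite ge_min lexx orbT.
  move: h1 (le_trans h2 h4) (le_trans h3 h4); rewrite /gap !ler_norml.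
  move: (ext x i.+1) (ext x i) (ext (u n) i.+1) (ext (u n) i) => p q v w h1 /andP[k1 k2] /andP[k3 k4].
  by lra.
have /cvgr_dist_lt/(_ e e0)[N _ /(_ N (leqnn N))] := rho_cvg sx su d2 du cu.
by rewrite /= ltNge => /negP; apply; case: (Hu N).
Qed.

Lemma measurable_integral_rho_kernel :
  measurable_fun setT (fun x : m.+1.-tuple R => (\int[lebn m]_y (rho_kernel al x y)%:E)%E).
Proof.
have mk : measurable_fun setT (fun p : (m.+1.-tuple R * m.-tuple R)%type => (rho_kernel al p.1 p.2)%:E).
  by apply/measurable_EFinP; exact: (measurable_rho_kernel al01).
have k0 (p : (m.+1.-tuple R * m.-tuple R)%type) : (0 <= (rho_kernel al p.1 p.2)%:E)%E.
  by rewrite lee_fin (rho_kernel_ge0 _ _ al01).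
exact: (@measurable_fun_fubini_tonelli_F _ _ _ _ R (lebn m) _ mk k0).
Qed.

Lemma measurable_rho : measurable_fun setT (@rho R beta m.+1).
Proof.
apply/measurable_EFinP; rewrite (_ : EFin \o _ = (fun x => ((Gamma beta / Gamma al ^+ m.+1)%:E * \int[lebn m]_y (rho_kernel al x y)%:E)%E)); last first.
  by apply/funext => x /=; exact: EFin_rho.
apply: measurable_funeM.
exact: measurable_integral_rho_kernel.
Qed.

(** The constant in [rho] cancels the one of [kernel_transform], which leaves the value found in
    [Jhat_stieltjes]. *)
Lemma rho_stieltjes (c : nat -> R) (s : R) : (forall i, 0 <= c i) -> 0 < s ->
  (\int[lebn m.+1]_x ((s + \sum_(i < m.+1) c i * tnth x i) `^ (- beta) * rho beta x)%:E =
   (expR (- al * \sum_(i < m.+1) mean_log (tail_weight m.+1 c s i) (c i)))%:E)%E.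
Proof.
move=> c0 s0; have Gb := Gamma_gt0 b0; have Ga := Gamma_gt0 al0.
have C0 : 0 < Gamma beta / Gamma al ^+ m.+1 by rewrite divr_gt0// exprn_gt0.
have K := kernel_transform b0 bm c0 s0.
under eq_integral => x _ do rewrite EFinM EFin_rho muleCA.
rewrite ge0_integralZl//; last 3 first.
- apply: emeasurable_funM.
    apply/measurable_EFinP; apply: (measurableT_comp (measurable_powR _)); apply: measurable_funD => //.
    by apply: measurable_sum => j; apply: measurable_funM => //; exact: measurable_tnth.
  exact: measurable_integral_rho_kernel.
- move=> x _; rewrite mule_ge0 ?lee_fin ?powR_ge0//; apply: integral_ge0 => y _.
  by rewrite lee_fin (rho_kernel_ge0 _ _ al01).
- by rewrite lee_fin ltW.
rewrite K -EFinM; congr EFin; rewrite mulrA -[RHS]mul1r; congr (_ * _).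
rewrite -/al; move: (Gamma beta) (Gamma al ^+ m.+1) Gb (exprn_gt0 m.+1 Ga) => p q p0 q0.
by field; rewrite !gt_eqF.
Qed.

End rho_regularity.

(** * Identification of the law *)

Section law_of_Jhat.
Context {R : realType}.
Notation leb := (@lebesgue_measure R).
Variables (beta : R) (m : nat).
Variables (d : measure_display) (Omega : measurableType d).
Variables (P : probability Omega R) (X : Omega -> R -> R).
Hypothesis b0 : 0 < beta.
Hypothesis bm : beta <= m.+1%:R.
Hypothesis DF : DF_process beta P X.

Let r : m.+1.-tuple R -> R := @rho R beta m.+1.

Let mr : measurable_fun setT r. Proof. exact: measurable_rho. Qed.
Let r0 x : 0 <= r x. Proof. exact: rho_ge0. Qed.

(** The total mass is the transform at [c = 0] and [s = 1]. *)
Let roo : (\int[lebn m.+1]_x (r x)%:E < +oo)%E.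
Proof.
have := rho_stieltjes b0 bm (fun=> lexx 0) ltr01.
under eq_integral => x _.
  rewrite (eq_bigr (fun=> 0)) => [|i _]; last by rewrite mul0r.
  rewrite big1// addr0 powR1 mul1r.
  over.
by rewrite -/r => ->; rewrite ltry.
Qed.

(* [stieltjes_uniqueness] asks for nonnegative coordinates everywhere; [absx] is
   the identity where [rho] does not vanish. *)
Let absx (x : m.+1.-tuple R) : m.+1.-tuple R := [tuple `|tnth x i| | i < m.+1].

Let mabsx : measurable_fun setT absx.
Proof.
apply/measurable_fun_tnthP => i.
rewrite (_ : _ \o _ = (fun x => `|tnth x i|)).
  by apply: (measurableT_comp (@normr_measurable R setT)); exact: measurable_tnth.
by apply/funext => x /=; rewrite tnth_mktuple.
Qed.

Let simplex_ge0 (x : m.+1.-tuple R) i : simplex x -> 0 <= ext x i.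
Proof.
move=> sx; have [im|mi] := leqP i m.+2; last by rewrite /ext; case: i mi => //= i mi; rewrite size_tuple (ltn_trans _ mi).
by rewrite ext_telescope sumr_ge0// => j _; rewrite subr_ge0 ltW// simplex_ext_lt// -ltnS (leq_trans (ltn_ord j)).
Qed.

Let absxE (x : m.+1.-tuple R) : simplex x -> absx x = x.
Proof.
move=> sx; apply: eq_from_tnth => i; rewrite tnth_mktuple ger0_norm//.
by rewrite -ext_tnth simplex_ge0.
Qed.

Lemma Jhat_law A : measurable A ->
  P ((fun w => Jhat m.+1 (X w)) @^-1` A) = iter_int (fun x => (\1_A x * r x)%:E).
Proof.
move=> mA.
have XG w : inG (X w) by case: DF.
have H1 w i : 0 <= tnth (Jhat m.+1 (X w)) i by exact: Jhat_ge0 (XG w).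
have H2 x i : 0 <= tnth (absx x) i by rewrite tnth_mktuple.
transitivity (mdens_fin mr r0 roo (absx @^-1` A)); last first.
  rewrite iter_intE; last 2 first.
  - by apply/measurable_EFinP; apply: measurable_funM; [exact: measurable_indic|exact: mr].
  - by move=> x; rewrite lee_fin mulr_ge0// r0.
  rewrite /mdens_fin /mdens/= [LHS]integral_mkcond; apply: eq_integral => x _.
  rewrite patchE; have [sx|nsx] := boolP (simplex x); last first.
    by rewrite /r /rho (negbTE nsx) mulr0; case: ifP.
  rewrite (_ : (x \in absx @^-1` A) = (x \in A)); last first.
    by apply/idP/idP; rewrite !inE/= absxE.
  by rewrite indicE; case: ifP => _; rewrite ?mul1r ?mul0r.
apply: (@stieltjes_uniqueness R beta m.+1 b0 _ _ P _ _ (mdens_fin mr r0 roo)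
  (fun w => Jhat m.+1 (X w)) absx (measurable_Jhat DF) mabsx H1 H2 _ A mA) => s c s1 c0.
- have s0 : 0 < s by exact: lt_le_trans s1.
  (* The transforms are stated for weights indexed by [nat]; [c] is extended by 0. *)
  pose c' (i : nat) : R := oapp c 0 (insub i).
  have c'E (i : 'I_m.+1) : c i = c' i by rewrite /c' valK.
  have c'0 i : 0 <= c' i by rewrite /c'; case: insub.
  under eq_integral => w _ do under eq_bigr => i _ do rewrite c'E.
  rewrite (Jhat_stieltjes b0 (ltn0Sn m) DF c'0 s1).
  rewrite [RHS](@integral_mdens _ _ _ (lebn m.+1) r mr r0
    (fun x => (s + \sum_(i < m.+1) c i * tnth (absx x) i) `^ (- beta))); last 2 first.
  + apply: (measurableT_comp (measurable_powR _)); apply: measurable_funD => //.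
    apply: measurable_sum => i; apply: measurable_funM => //.
    by apply: (measurableT_comp (measurable_tnth i)); exact: mabsx.
  + by move=> x; exact: powR_ge0.
  rewrite -(rho_stieltjes b0 bm c'0 s0); apply: eq_integral => x _; congr EFin.
  have [sx|nsx] := boolP (simplex x); last by rewrite /r /rho (negbTE nsx) !mulr0.
  congr (_ `^ _ * _); congr (_ + _); apply: eq_bigr => i _.
  by rewrite absxE// c'E.
Qed.

End law_of_Jhat.

Unset Implicit Arguments.
Set Strict Implicit.

Theorem theorem4p1 (R : realType) (beta : R) (k : nat)
    (d : measure_display) (Omega : measurableType d) (P : probability Omega R)
    (X : Omega -> R -> R) :
  0 < beta -> beta <= k%:R ->
  DF_process beta P X ->
  (* m^beta_k (law of Ĵ_k under Q^beta) is absolutely continuous w.r.t.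
     Lebesgue measure on R^k with density rho beta k *)
  (forall A : set (k.-tuple R), measurable A ->
     P ((fun w => Jhat k (X w)) @^-1` A) =
     iter_int (fun x => (\1_A x * rho beta x)%:E))
  (* the density is strictly positive on Σ_k *)
  /\ (forall x : k.-tuple R, simplex x -> 0 < rho beta x)
  (* the density is continuous on Σ_k *)
  /\ (forall x : k.-tuple R, simplex x ->
        forall e : R, 0 < e -> exists2 del : R, 0 < del &
          forall y : k.-tuple R, simplex y ->
            (forall i : 'I_k, `|tnth x i - tnth y i| < del) ->
            `|rho beta x - rho beta y| < e)
  (* the density vanishes outside Σ_k *)
  /\ (forall x : k.-tuple R, ~~ simplex x -> rho beta x = 0).
Proof.
case: k => [|m] b0 bm DF; first by have := lt_le_trans b0 bm; rewrite ltxx.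
split; [exact: Jhat_law|split; [exact: rho_gt0|split; [exact: rho_continuous|]]].
by move=> x nsx; rewrite /rho (negbTE nsx).
Qed.
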